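(* Let $n\ge 3$. Let $R>0$ and let $\mu\in C^\infty([0,\infty))$ be real-valued and decreasing (in the wide sense), with $\mu=1$ on $[0,R]$, $\mu>0$ on $(0,2R)$, $\mu<0$ on $(2R,\infty)$, and $\mu'(2R)<0$. Let \[ \Omega:=\left\{(x_1,x_2,x'')\in\mathbb{R}\times\mathbb{R}\times\mathbb{R}^{n-2}\,:\; x_1^2+x_2^2<\mu(|x''|^2)\right\}, \] and let $\zeta:\partial\Omega\to\mathbb{S}_{n-1}$ be the $C^\infty$-diffeomorphism $\zeta(x):=x/|x|$. Let $0\le\alpha<1$. Define $a_k:=0$ if $k\neq 2^j$ for all $j\in\mathbb{N}\setminus\{0\}$ and, if $k=2^j$ for some $j\in\mathbb{N}\setminus\{0\}$, define $a_k:=j^{-2}$ when $\alpha=0$ and $a_k:=2^{-j\alpha}$ when $0<\alpha<1$. Let \[ u(x):=\sum_{k=0}^\infty a_k\,\mathrm{Re}\bigl((x_1+ix_2)^k\bigr)\quad\text{for all }x=(x_1,x_2,\dots,x_n)\in\overline{\Omega}. \] Then there exists a unique function $w\in C^{0,\alpha}(\overline{\mathbb{B}_n})$ that is harmonic in $\mathbb{B}_n$ and such that \[ w(\xi)=u\circ\zeta^{-1}(\xi)\quad\text{for all }\xi\in\mathbb{S}_{n-1}. \] Moreover, $w$ does not belong to $C^{0,\alpha+\epsilon}(\overline{\mathbb{B}_n})$ for any $\epsilon>0$ and does not belong to $H^{\sigma+1/2}(\mathbb{B}_n)$ for any $\sigma>0$ if $\alpha=0$, and for any $\sigma\ge\alpha$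 if $0<\alpha<1$.
   Context: $\mathbb{N}$ includes $0$. $\mathbb{B}_n$ is the open unit ball of $\mathbb{R}^n$ centered at the origin and $\mathbb{S}_{n-1}:=\partial\mathbb{B}_n$. $C^{0,\alpha}$ denotes the space of H\''older continuous functions with exponent $\alpha$, with the convention that $C^{0,0}$ is the space of continuous functions. $H^s$ denotes the usual $L^2$-based Sobolev space of (possibly fractional) order $s$. The set $\Omega$ is open, bounded, of class $C^\infty$ and, since $\mu$ is decreasing, star-convex with respect to the origin. *)

(* Defs.v *)
From HB Require Import structures.
From mathcomp Require Import all_boot all_order all_algebra complex.
From mathcomp Require Import all_classical all_reals all_analysis.

Set Implicit Arguments.
Unset Strict Implicit.
Unset Printing Implicit Defensive.

Import Order.TTheory GRing.Theory Num.Theory.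
Import numFieldNormedType.Exports.

Local Open Scope classical_set_scope.
Local Open Scope ring_scope.

(* Points of R^n are row vectors. The norm carried by 'rV[R]_n in the library
   is the sup norm; it is used here only through the topology it induces. *)

Section euclidean_space.
Context {R : realType}.

Definition enorm n (x : 'rV[R]_n) : R := Num.sqrt (\sum_i x ord0 i ^+ 2).

Definition eball n : set 'rV[R]_n := [set x | enorm x < 1].


Definition boundary (T : topologicalType) (A : set T) : set T :=
  closure A `\` interior A.

(* The coordinate of index k, counted from 0; it is 0 if n <= k. *)
Definition coord_nat n (k : nat) (x : 'rV[R]_n) : R :=
  oapp (x ord0) 0 (insub k).

(* Holder space C^{0,alpha}(A), with C^{0,0}(A) the continuous functions.
   For bounded A, the only case of interest, the functions are automatically
   bounded. *)
Definition holder_space n (alpha : R) (A : set 'rV[R]_n) (f : 'rV[R]_n -> R) :=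
  if alpha == 0 then {within A, continuous f}
  else exists C : R, forall x y, A x -> A y ->
    `|f x - f y| <= C * enorm (x - y) `^ alpha.

(* dpart [:: i1; ..; ik] f is the iterated partial derivative d_i1 .. d_ik f. *)
Definition dpart n (s : seq 'I_n) (f : 'rV[R]_n -> R) : 'rV[R]_n -> R :=
  foldr (fun i (g : 'rV[R]_n -> R) x => 'D_(delta_mx ord0 i) g x) f s.

(* C^k on an open set A *)
Definition Cn_on n (k : nat) (A : set 'rV[R]_n) (f : 'rV[R]_n -> R) :=
  forall s : seq 'I_n, (size s <= k)%N -> forall x, A x ->
    {for x, continuous (dpart s f)} /\
    ((size s < k)%N -> forall i, derivable (dpart s f) x (delta_mx ord0 i)).

Definition harmonic_on n (A : set 'rV[R]_n) (f : 'rV[R]_n -> R) :=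
  Cn_on 2 A f /\ forall x, A x -> \sum_i dpart [:: i; i] f x = 0.

(* C^oo([0, +oo[): D k is the k-th derivative, extended continuously to 0. *)
Definition smooth_halfline (f : R -> R) :=
  exists D : nat -> R -> R,
    (forall x, 0 <= x -> D 0%N x = f x) /\
    forall k, {within `[0, +oo[, continuous (D k)} /\
              forall x : R, 0 < x -> is_derive x 1 (D k) (D k.+1 x).

End euclidean_space.

Arguments eball {R} n _.

(* The Lebesgue measure on the Borel sets of R^n, the sigma-algebra being
   generated by the coordinate functions. *)

Section rV_measurable.
Context d (T : sigmaRingType d) (n : nat).

Let coords : 'I_n -> 'rV[T]_n -> T := fun i x => x ord0 i.

Let rV_set0 : g_sigma_preimage coords set0.
Proof. exact: sigma_algebra0. Qed.

Let rV_setC A : g_sigma_preimage coords A -> g_sigma_preimage coords (~` A).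
Proof. exact: sigma_algebraC. Qed.

Let rV_bigcup (F : (set 'rV[T]_n)^nat) :
  (forall i, g_sigma_preimage coords (F i)) ->
  g_sigma_preimage coords (\bigcup_i (F i)).
Proof. exact: sigma_algebra_bigcup. Qed.

HB.instance Definition _ := @isMeasurable.Build (measure_tuple_display d)
  'rV[T]_n (g_sigma_preimage coords) rV_set0 rV_setC rV_bigcup.

End rV_measurable.

Lemma measurable_fun_to_rV d1 (T1 : measurableType d1) d (T : measurableType d)
    n (f : T1 -> 'rV[T]_n) :
  (forall i, measurable_fun [set: T1] (fun t => f t ord0 i)) ->
  measurable_fun [set: T1] f.
Proof.
move=> mf; apply: (@measurability _ _ _ _ setT f
  (\big[setU/set0]_(i < n)
     preimage_set_system setT (fun x : 'rV[T]_n => x ord0 i) measurable)) => //.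
move=> _ [B + <-]; rewrite -bigcup_seq => -[/= i _ [C mC <-]].
by rewrite setTI; exact: mf.
Qed.

Lemma measurable_rV_coord d (T : sigmaRingType d) n (i : 'I_n) :
  measurable_fun [set: 'rV[T]_n] (fun x : 'rV[T]_n => x ord0 i).
Proof.
move=> _ Y mY; rewrite setTI; apply: sub_sigma_algebra => /=.
rewrite -bigcup_seq/=; exists i => /=; first by rewrite mem_index_enum.
by exists Y => //; rewrite setTI.
Qed.

Section lebesgue_rV_step.
Context (R : realType) (n : nat).

Definition rV_cons (p : measurableTypeR R * 'rV[R]_n) : 'rV[R]_n.+1 :=
  \row_i oapp (p.2 ord0) p.1 (unlift ord0 i).

Definition rV_uncons (x : 'rV[R]_n.+1) : measurableTypeR R * 'rV[R]_n :=
  (x ord0 ord0, \row_i x ord0 (lift ord0 i)).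

Lemma rV_consK : cancel rV_cons rV_uncons.
Proof.
move=> [a v]; rewrite /rV_uncons /rV_cons !mxE unlift_none; congr pair.
by apply/rowP => i; rewrite !mxE liftK.
Qed.

Lemma rV_unconsK : cancel rV_uncons rV_cons.
Proof.
move=> x; apply/rowP => i; rewrite mxE /=.
by case: unliftP => [j ->|->] //=; rewrite mxE.
Qed.

Lemma measurable_rV_cons : measurable_fun setT rV_cons.
Proof.
apply: measurable_fun_to_rV => i.
case: (unliftP ord0 i) => [j ij|i0].
  rewrite (_ : (fun _ => _) =
    (fun x : 'rV[R]_n => x ord0 j) \o (@snd (measurableTypeR R) _)).
    apply: measurableT_comp; [exact: measurable_rV_coord|exact: measurable_snd].
  by apply/funext => p; rewrite /rV_cons mxE ij liftK.
rewrite (_ : (fun _ => _) = (@fst (measurableTypeR R) _)).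
  exact: measurable_fst.
by apply/funext => p; rewrite /rV_cons mxE i0 unlift_none.
Qed.

Lemma measurable_rV_uncons : measurable_fun setT rV_uncons.
Proof.
apply/measurable_fun_pair; first exact: (@measurable_rV_coord _ R).
apply: measurable_fun_to_rV => i.
under eq_fun do rewrite mxE.
exact: measurable_rV_coord.
Qed.

Variable mu : {sigma_finite_measure set 'rV[R]_n -> \bar R}.

Definition lebesgue_rV_step : set 'rV[R]_n.+1 -> \bar R :=
  pushforward (@lebesgue_measure R \x mu)%E rV_cons.

Let step0 : lebesgue_rV_step set0 = 0%E.
Proof. by rewrite /lebesgue_rV_step /pushforward preimage_set0 measure0. Qed.

Let step_ge0 A : (0 <= lebesgue_rV_step A)%E.
Proof. exact: (measure_ge0 (@lebesgue_measure R \x mu)%E). Qed.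

Let step_sigma_additive : semi_sigma_additive lebesgue_rV_step.
Proof.
move=> F mF tF mUF; rewrite /lebesgue_rV_step /pushforward preimage_bigcup.
apply: measure_semi_sigma_additive.
- by move=> k; rewrite -[X in measurable X]setTI; exact: measurable_rV_cons.
- apply/trivIsetP => /= i j _ _ ij; rewrite -preimage_setI.
  by move/trivIsetP : tF => /(_ _ _ _ _ ij) ->//; rewrite preimage_set0.
- by rewrite -preimage_bigcup -[X in measurable X]setTI;
    exact: measurable_rV_cons.
Qed.

HB.instance Definition _ := isMeasure.Build _ _ _ lebesgue_rV_step
  step0 step_ge0 step_sigma_additive.

Let step_sigma_finite : sigma_finite setT lebesgue_rV_step.
Proof.
have /sigma_finiteP[F [TF ndF Foo]] := sigma_finiteT (@lebesgue_measure R).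
have /sigma_finiteP[G [TG ndG Goo]] := sigma_finiteT mu.
exists (fun k => rV_uncons @^-1` (F k `*` G k)).
  rewrite -preimage_bigcup (_ : \bigcup_k _ = setT) ?preimage_setT//.
  rewrite -subTset -setXTT TF TG => -[x y] [/= [k _ Fkx] [l _ Gly]].
  exists (maxn k l) => //; split.
    by move: x Fkx; exact/subsetPset/ndF/leq_maxl.
  by move: y Gly; exact/subsetPset/ndG/leq_maxr.
move=> k; have [mF Fk] := Foo k; have [mG Gk] := Goo k; split.
  rewrite -[X in measurable X]setTI; apply: measurable_rV_uncons => //.
  exact: measurableX.
rewrite /lebesgue_rV_step /pushforward -comp_preimage.
rewrite (_ : rV_uncons \o rV_cons = id); last exact/funext/rV_consK.
by rewrite preimage_id product_measure1E// lte_mul_pinfty// ge0_fin_numE.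
Qed.

HB.instance Definition _ := Measure_isSigmaFinite.Build _ _ _ lebesgue_rV_step
  step_sigma_finite.

End lebesgue_rV_step.

Fixpoint lebesgue_rV (R : realType) (n : nat) :
    {sigma_finite_measure set 'rV[R]_n -> \bar R} :=
  match n with
  | 0 => @dirac _ 'rV[R]_0 0 R
  | m.+1 => lebesgue_rV_step (lebesgue_rV R m)
  end.

Section sobolev.
Context {R : realType} {n : nat}.
Implicit Types (A : set 'rV[R]_n) (f g phi : 'rV[R]_n -> R).
Local Notation leb := (lebesgue_rV R n).

Definition L2_on A f :=
  measurable_fun A f /\ (\int[leb]_(x in A) ((f x) ^+ 2)%:E < +oo)%E.

(* C^oo_c(A) *)
Definition test_function A phi :=
  (forall k, Cn_on k setT phi) /\
  exists2 K : set 'rV[R]_n, compact K /\ K `<=` A &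
    forall x, ~ K x -> phi x = 0.

(* g is the distributional derivative d_i1 .. d_ik f on A, s = [:: i1; ..; ik] *)
Definition weak_derivative A (s : seq 'I_n) f g :=
  forall phi, test_function A phi ->
    \int[leb]_(x in A) (f x * dpart s phi x) =
    (-1) ^+ size s * \int[leb]_(x in A) (g x * phi x).

(* square of the Gagliardo seminorm of order theta *)
Definition gagliardo A (theta : R) g : \bar R :=
  (\int[leb]_(x in A) \int[leb]_(y in A)
    ((g x - g y) ^+ 2 / enorm (x - y) `^ (n%:R + 2 * theta))%:E)%E.

(* H^s(A) for s >= 0, with the Sobolev-Slobodeckij definition: writing
   s = k + theta with k a natural number and 0 <= theta < 1, the weak
   derivatives of order at most k are in L^2(A) and, if theta > 0, those of
   order k have finite Gagliardo seminorm of order theta. *)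
Definition sobolev_space (s : R) A f :=
  L2_on A f /\
  let k := Num.truncn s in
  let theta := s - k%:R in
  forall w : seq 'I_n, (size w <= k)%N ->
    exists g, [/\ L2_on A g, weak_derivative A w f g &
      size w = k -> 0 < theta -> (gagliardo A theta g < +oo)%E].

End sobolev.

Section setting.
Context {R : realType} {n : nat}.
Implicit Types (mu : R -> R) (x : 'rV[R]_n) (alpha : R).

Definition Omega mu : set 'rV[R]_n :=
  [set x | coord_nat 0 x ^+ 2 + coord_nat 1 x ^+ 2
           < mu (\sum_(i < n | (2 <= i)%N) x ord0 i ^+ 2)].

Definition zeta x : 'rV[R]_n := (enorm x)^-1 *: x.

(* The inverse of zeta : boundary (Omega mu) -> boundary (eball n). *)
Definition zeta_inv mu : 'rV[R]_n -> 'rV[R]_n :=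
  'pinv_(fun=> 0) (boundary (Omega mu)) zeta.

(* trunc_log 2 k is the only j for which k = 2 ^ j is possible. *)
Definition lacunary_coef alpha (k : nat) : R :=
  let j := trunc_log 2 k in
  if (0 < j)%N && (k == 2 ^ j)%N then
    if alpha == 0 then j%:R ^- 2 else 2 `^ (- (j%:R * alpha))
  else 0.

Definition lacunary_sum alpha x : R :=
  limn (series (fun k =>
    lacunary_coef alpha k * complex.Re ((coord_nat 0 x +i* coord_nat 1 x)%C ^+ k))).

(* The solutions in C^{0,alpha} of the Dirichlet problem with datum
   u o zeta^{-1}, u = lacunary_sum alpha. *)
Definition dirichlet_solution mu alpha (w : 'rV[R]_n -> R) :=
  [/\ holder_space alpha (closure (eball n)) w,
      harmonic_on (eball n) w &
      forall xi, boundary (eball n) xi ->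
        w xi = lacunary_sum alpha (zeta_inv mu xi)].

End setting.

(* Main.v *)
(* On the sphere, the projection [zeta_inv] is [xi |-> rho(|z|^2) xi], where [z] is the
   complex number of the first two coordinates and [rho] is Lipschitz, by the implicit
   equation of the boundary and [mu'(2R) < 0]. Hence [Re (z^k)] composed with it is
   [Re (z^k) rho(|z|^2)^k]. For a polynomial [P], the boundary datum [Re (z^k) P(|z|^2)] is
   the restriction of a harmonic polynomial, so by the Weierstrass theorem every term has a
   harmonic extension [Re (z^k) W_k] that is a uniform limit of harmonic polynomials, with
   [W_k] invariant under rotations of [z]. The solution [w] is the lacunary sum of these
   waves; a barrier carries the Hoelder continuity from the sphere to the ball.

   The coefficient [a_J] is read off from [w] by rotations of the [z]-plane: the rotation of
   angle [pi / 2^i] changes the sign of the wave of frequency [2^i] and fixes those of higher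
   frequency. On two points of the sphere this excludes the larger Hoelder exponents.

   For the Sobolev norms let [k = 2^J], and let the energy of a function be the integral of
   [(f x - l f y)^2], [l] in [{0, 1}], over the pairs with [1 - c / k <= |x| < 1] and [y] at
   distance of order [1 / k] from [x] but deeper. The averages and differences under rotations
   do not increase the energy, so the energy of the angular derivative of order [m] of [w] is
   at least that of its wave of frequency [k], which is of order [a_J^2 k^(2m - n - 1)]: the
   wave is of order one near the sphere and small at [y], since it is half its increment under
   the rotation of angle [pi / k]. If [w] were in [H^(m + theta)], the energy would be
   [o(k^(-n - 2 theta))], because the integral of an integrable function over a thin shell
   tends to zero, and [a_J k^(m + theta - 1/2)] would tend to zero. *)

Require Import Defs.
From HB Require Import structures.
From mathcomp Require Import all_boot all_order all_algebra complex.
From mathcomp Require Import all_classical all_reals all_analysis measurable_realfun.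
From mathcomp Require Import ring lra zify.

Set Implicit Arguments.
Unset Strict Implicit.
Unset Printing Implicit Defensive.

Import Order.TTheory GRing.Theory Num.Theory.
Import numFieldNormedType.Exports.

Local Open Scope classical_set_scope.
Local Open Scope ring_scope.

(** * The Euclidean norm and the maximum principle *)

(** The theory on the ball rests on the maximum principle alone. Bernstein's auxiliary function
    turns it into an interior gradient bound for harmonic polynomials, and that bound carries every
    derivative to uniform limits; hence [harm_lim], a class in which interior estimates come with
    the approximating sequence. Each wave is extended separately, so the Lipschitz constant of
    [rho^k] may depend on [k] without control. What is uniform is that [xi |-> rho z] is Lipschitz
    with values in the unit disc: on the sphere the wave of frequency [k] is bounded by a constant
    and has a Lipschitz constant of order [k], which fixes the scale [1 / k]. The lower bounds live
    where [|z|^2 >= 1 / (1 + r)]. There the boundary of the domain is the cylinder [|z| = 1], and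
    the squares of the waves with phases [Re] and [Im] add up to 1. The parameter [l] separates two
    parts of the Sobolev norm: [l = 0] measures a derivative in [L^2], [l = 1] its Gagliardo
    seminorm. Angular derivatives of order at most 2 suffice: an order [t > 2] is replaced by 2, and
    [2 - 1/2 > alpha]. *)

Lemma continuous_sumr {R : realType} (T : topologicalType) (I : Type) (r : seq I)
    (f : I -> T -> R) (x : T) :
  (forall i, {for x, continuous (f i)}) ->
  {for x, continuous (fun y => \sum_(i <- r) f i y)}.
Proof.
move=> cf; elim: r => [|i r ih].
  rewrite (_ : (fun y => _) = cst 0); first exact: cvg_cst.
  by apply/funext => y; rewrite big_nil.
rewrite (_ : (fun y => _) = (fun y => f i y + \sum_(j <- r) f j y)).
  by apply: cvgD; [exact: cf|exact: ih].
by apply/funext => y; rewrite big_cons.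
Qed.

Section euclidean_norm.
Context {R : realType} {n : nat}.
Implicit Types x y z : 'rV[R]_n.

Definition dotp x y : R := \sum_i x ord0 i * y ord0 i.

Lemma dotpC x y : dotp x y = dotp y x.
Proof. by apply: eq_bigr => i _; rewrite mulrC. Qed.

Lemma dotpDl x y z : dotp (x + y) z = dotp x z + dotp y z.
Proof. by rewrite -big_split; apply: eq_bigr => i _; rewrite mxE mulrDl. Qed.

Lemma dotpZl a x y : dotp (a *: x) y = a * dotp x y.
Proof. by rewrite big_distrr; apply: eq_bigr => i _ /=; rewrite mxE mulrA. Qed.

Lemma dotpNl x y : dotp (- x) y = - dotp x y.
Proof. by rewrite -scaleN1r dotpZl mulN1r. Qed.

Lemma dotp0l y : dotp 0 y = 0.
Proof. by apply: big1 => i _; rewrite mxE mul0r. Qed.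

Lemma enorm_ge0 x : 0 <= enorm x.
Proof. exact: sqrtr_ge0. Qed.

Lemma dotpxx_ge0 x : 0 <= dotp x x.
Proof. by apply: sumr_ge0 => i _; rewrite -expr2 sqr_ge0. Qed.

Lemma enormE x : enorm x ^+ 2 = dotp x x.
Proof.
rewrite sqr_sqrtr; last by apply: sumr_ge0 => i _; rewrite sqr_ge0.
by apply: eq_bigr => i _; rewrite expr2.
Qed.

Lemma enormZ a x : enorm (a *: x) = `|a| * enorm x.
Proof.
apply/eqP; rewrite -(@eqrXn2 _ 2)// ?mulr_ge0 ?enorm_ge0//.
by rewrite exprMn real_normK ?num_real// !enormE dotpZl dotpC dotpZl; apply/eqP; ring.
Qed.

Lemma enormN x : enorm (- x) = enorm x.
Proof. by rewrite -scaleN1r enormZ normrN1 mul1r. Qed.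

Lemma enormB x y : enorm (x - y) = enorm (y - x).
Proof. by rewrite -enormN opprB. Qed.

Lemma enorm_eq0 x : enorm x = 0 -> x = 0.
Proof.
move=> x0; have /eqP : dotp x x = 0 by rewrite -enormE x0 expr0n.
rewrite psumr_eq0; last by move=> i _; rewrite -expr2 sqr_ge0.
move/allP => h; apply/rowP => i; rewrite mxE.
by have /(_ (mem_index_enum i)) := h i; rewrite mulf_eq0 orbb => /eqP.
Qed.

Lemma enorm0 : enorm (0 : 'rV[R]_n) = 0.
Proof. by rewrite -(scale0r (0 : 'rV[R]_n)) enormZ normr0 mul0r. Qed.

Lemma coord_le_enorm x i : `|x ord0 i| <= enorm x.
Proof.
rewrite -(@ler_pXn2r _ 2) ?nnegrE ?enorm_ge0// real_normK ?num_real// enormE.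
rewrite /dotp (bigD1 i)//= -expr2 lerDl.
by apply: sumr_ge0 => j _; rewrite -expr2 sqr_ge0.
Qed.

(** Cauchy-Schwarz, by expanding the square of [|y| x - |x| y], which equals
    [2 |x| |y| (|x| |y| - <x, y>)]. *)
Lemma dotp_le x y : dotp x y <= enorm x * enorm y.
Proof.
have [y0|yn0] := eqVneq (enorm y) 0.
  by rewrite y0 (enorm_eq0 y0) mulr0 dotpC dotp0l.
have y_gt0 : 0 < enorm y by rewrite lt_neqAle eq_sym yn0 enorm_ge0.
have [x0|xn0] := eqVneq (enorm x) 0.
  by rewrite x0 (enorm_eq0 x0) mul0r dotp0l.
have x_gt0 : 0 < enorm x by rewrite lt_neqAle eq_sym xn0 enorm_ge0.
have := dotpxx_ge0 (enorm y *: x - enorm x *: y).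
rewrite -scaleNr !dotpDl !(dotpC _ (_ + _)) !dotpDl !dotpZl !(dotpC _ (_ *: _)) !dotpZl.
rewrite (dotpC y x) -!enormE => h.
have : 0 <= 2 * (enorm x * enorm y) * (enorm x * enorm y - dotp x y).
  by apply: le_trans h _; rewrite le_eqVlt; apply/orP; left; apply/eqP; ring.
by rewrite pmulr_rge0 ?subr_ge0// mulr_gt0// mulr_gt0.
Qed.

Lemma enorm_triangle x y : enorm (x + y) <= enorm x + enorm y.
Proof.
rewrite -(@ler_pXn2r _ 2) ?nnegrE ?addr_ge0 ?enorm_ge0//.
rewrite enormE dotpDl !(dotpC _ (_ + _)) !dotpDl (dotpC y x) -!enormE.
have := dotp_le x y; nra.
Qed.

Lemma enorm_sub x y : `|enorm x - enorm y| <= enorm (x - y).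
Proof.
have h1 := enorm_triangle (x - y) y; have h2 := enorm_triangle (y - x) x.
rewrite !subrK in h1 h2; rewrite (enormB y x) in h2.
by rewrite ler_norml; apply/andP; split; lra.
Qed.

Lemma enorm_le_sum x : enorm x <= \sum_i `|x ord0 i|.
Proof.
have s0 : 0 <= \sum_i `|x ord0 i| by apply: sumr_ge0.
rewrite -(@ler_pXn2r _ 2) ?nnegrE ?enorm_ge0// enormE expr2 big_distrl/=.
apply: ler_sum => i _; apply: le_trans (ler_norm _) _; rewrite normrM.
rewrite ler_wpM2l// (bigD1 i)//= lerDl; exact: sumr_ge0.
Qed.

Lemma enorm_delta i : enorm (delta_mx ord0 i : 'rV[R]_n) = 1.
Proof.
apply/eqP; rewrite -(@eqrXn2 _ 2)// ?enorm_ge0// enormE /dotp (bigD1 i)//=.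
rewrite big1 ?addr0; last by move=> j ji; rewrite mxE (negPf ji) andbF mul0r.
by rewrite !mxE !eqxx.
Qed.

Lemma le_enorm_mx_norm x : `|x| <= enorm x.
Proof.
rewrite [leLHS]/Num.norm /= mx_normrE; apply/bigmax_leP; split; first exact: enorm_ge0.
by move=> [i j] _ /=; rewrite ord1 coord_le_enorm.
Qed.

Lemma enorm_le_mx_norm x : enorm x <= n%:R * `|x|.
Proof.
apply: le_trans (enorm_le_sum x) _.
rewrite -[X in X%:R]card_ord -sum1_card natr_sum mulr_suml; apply: ler_sum => i _.
rewrite mul1r [leRHS]/Num.norm /= mx_normrE.
by apply: (le_bigmax _ (fun ij : 'I_1 * 'I_n => `|x ij.1 ij.2|) (ord0, i)).
Qed.

Lemma enorm_continuous : continuous (@enorm R n).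
Proof.
move=> x; apply: (@continuous_comp _ _ _ _ (@Num.sqrt R)); last exact: sqrt_continuous.
apply: continuous_sumr => i; rewrite /=.
apply: (@continuous_comp _ _ _ _ (fun u : R => u ^+ 2)).
  exact: coord_continuous.
exact: exprn_continuous.
Qed.

Lemma enormB_continuous (a : 'rV[R]_n) : continuous (fun x => enorm (x - a)).
Proof.
move=> x A /nbhs_ballP[e /= e0 eA]; apply/nbhs_ballP; exists (e / (n%:R + 1)) => /=.
  by rewrite divr_gt0// ltr_wpDl.
move=> y; rewrite -ball_normE /ball_ /= => xy; apply: eA.
rewrite -ball_normE /ball_ /=.
apply: le_lt_trans (enorm_sub _ _) _; rewrite opprB addrA subrK.
apply: le_lt_trans (enorm_le_mx_norm _) _.
rewrite ltr_pdivlMr ?ltr_wpDl// in xy; apply: le_lt_trans xy.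
by rewrite mulrC ler_wpM2l// lerDl.
Qed.

Lemma open_enorm_lt (c : R) (a : 'rV[R]_n) : open [set x | enorm (x - a) < c].
Proof.
apply: (@open_comp _ _ (fun x => enorm (x - a)) [set u | u < c]).
  by move=> x _; exact: enormB_continuous.
exact: open_lt.
Qed.

Lemma closed_enorm_le (c : R) (a : 'rV[R]_n) : closed [set x | enorm (x - a) <= c].
Proof.
apply: (@closed_comp _ _ (fun x => enorm (x - a)) [set u | u <= c]).
  by move=> x _; exact: enormB_continuous.
exact: closed_le.
Qed.

Lemma compact_enorm_le (c : R) (a : 'rV[R]_n) : compact [set x | enorm (x - a) <= c].
Proof.
apply: bounded_closed_compact; last exact: closed_enorm_le.
exists (`|c| + enorm a); split; first exact: num_real.
move=> M cM x /= xa; apply: le_trans (le_enorm_mx_norm _) _.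
have := enorm_triangle (x - a) a; rewrite subrK => h.
apply: le_trans h _; apply: le_trans (ltW cM); rewrite lerD2r.
exact: le_trans xa (ler_norm _).
Qed.

(** The topology on row vectors comes from the sup norm; by the two comparisons of norms,
    neighbourhoods can be described by Euclidean balls throughout. *)
Lemma nbhs_enormP (x : 'rV[R]_n) (A : set 'rV[R]_n) :
  nbhs x A <-> exists2 e : R, 0 < e & forall y, enorm (y - x) < e -> A y.
Proof.
split.
  move=> /nbhs_ballP[e /= e0 h]; exists e => // y yx; apply: h.
  rewrite -ball_normE /ball_ /= -normrN opprB.
  exact: le_lt_trans (le_enorm_mx_norm _) yx.
move=> [e e0 h]; apply: filterS h _.
have : open [set y | enorm (y - x) < e] by exact: open_enorm_lt.
by move/(_ x); apply; rewrite /= subrr enorm0.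
Qed.

Definition cball : set 'rV[R]_n := [set x | enorm x <= 1].

Lemma open_eball : open (eball n : set 'rV[R]_n).
Proof.
have := @open_enorm_lt 1 0.
by rewrite (_ : [set x | _] = eball n)//; apply/funext => x; rewrite /= subr0.
Qed.

Lemma closed_cball : closed cball.
Proof.
have := @closed_enorm_le 1 0.
by rewrite (_ : [set x | _] = cball)//; apply/funext => x; rewrite /= subr0.
Qed.

Lemma compact_cball : compact cball.
Proof.
have := @compact_enorm_le 1 0.
by rewrite (_ : [set x | _] = cball)//; apply/funext => x; rewrite /= subr0.
Qed.

Lemma closure_eball : closure (eball n) = cball.
Proof.
apply/seteqP; split => [x|x /= x1].
  have /closure_id -> := closed_cball.
  by apply: closureS => y /= /ltW.
move=> A /nbhs_enormP[e e0 eA].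
(* The point [t x] lies in the open ball, at distance at most [1 - t <= e / 2] from [x]; the minimum
   with 1 keeps [t] nonnegative. *)
pose t : R := 1 - Num.min 1 (e / 2).
have t0 : 0 <= t by rewrite subr_ge0 ge_min lexx.
have t1 : t < 1 by rewrite ltrBlDr ltrDl lt_min ltr01 divr_gt0.
exists (t *: x); split.
  rewrite /eball /= enormZ ger0_norm//.
  apply: le_lt_trans t1; exact: ler_piMr.
apply: eA; rewrite -{2}(scale1r x) -scalerBl enormZ.
apply: (@le_lt_trans _ _ `|t - 1|); first exact: ler_piMr.
rewrite /t addrC addrA addNr add0r normrN.
rewrite ger0_norm; last by rewrite le_min ler01 divr_ge0// ltW.
by rewrite gt_min; apply/orP; right; lra.
Qed.

Lemma boundary_eball : boundary (eball n) = [set x : 'rV[R]_n | enorm x = 1].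
Proof.
rewrite /boundary closure_eball.
have /interior_id -> := open_eball.
apply/seteqP; split => x /=.
  by move=> [h1 /negP]; rewrite -leNgt => h2; apply/le_anti; rewrite h1 h2.
by move=> x1; rewrite /cball/eball /= x1; split; rewrite ?lexx ?ltxx.
Qed.

End euclidean_norm.
Section maximum_principle.
Context {R : realType}.

(** Were [q] positive, [dg], which vanishes at the maximum, would be positive just to the right of
    0, and the mean value theorem would make [g] exceed [g 0]. *)
Lemma second_derivative_at_max (g dg : R -> R) (q e : R) : 0 < e ->
  (forall t : R, `|t| < e -> is_derive t 1 g (dg t)) -> is_derive (0 : R) 1 dg q ->
  (forall t : R, `|t| < e -> g t <= g 0) -> q <= 0.
Proof.
move=> e0 dgE ddg gmax; rewrite leNgt; apply/negP => q0.
have dg0 : dg 0 = 0.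
  have zin : (0 : R) \in `](- e), e[%R by rewrite in_itv /= oppr_lt0 e0.
  have h : is_derive (0 : R) 1 g 0.
    apply: (@derive1_at_max _ g (- e) e 0) => //.
    - by lra.
    - by move=> t; rewrite in_itv /= -ltr_norml => te; have [] := dgE t te.
    - by move=> t; rewrite in_itv /= -ltr_norml => te; exact: gmax.
  have h0 : is_derive (0 : R) 1 g (dg 0) by apply: dgE; rewrite normr0.
  by rewrite -(@derive_val _ _ _ _ _ _ _ h0) (@derive_val _ _ _ _ _ _ _ h).
have : \forall t \near (0 : R), t != 0 -> 0 < t^-1 * dg t.
  have [dd dv] := ddg.
  have : (fun h : R => h^-1 *: ((dg \o shift 0) (h *: 1) - dg 0)) @ 0^' --> q.
    by rewrite -dv; exact: dd.
  move/cvgr_gt => /(_ _ q0); rewrite near_withinE; apply: filterS => t h tn0.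
  have := h tn0; rewrite /= dg0 subr0 addr0.
  by rewrite [_ *: 1]mulr1.
move=> /nbhs_ballP[d /= d0 hd].
pose t := Num.min (d / 2) (e / 2).
have t0 : 0 < t by rewrite lt_min !divr_gt0.
have td : t < d by rewrite gt_min; apply/orP; left; lra.
have te : t < e by rewrite gt_min; apply/orP; right; lra.
have [||c] := @MVT _ g dg 0 t t0.
- by move=> x; rewrite in_itv /= => /andP[x0 xt]; apply: dgE; rewrite gtr0_norm//; lra.
- apply: derivable_within_continuous => x; rewrite in_itv /= => /andP[x0 xt].
  by have [] := dgE x _ => //; rewrite ger0_norm//; lra.
rewrite in_itv /= => /andP[c0 ct] gt.
have dgc : 0 < dg c.
  have := hd c; rewrite /ball /= sub0r normrN gtr0_norm// => h.
  have := h (lt_trans ct td) (lt0r_neq0 c0).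
  by rewrite pmulr_rgt0 // invr_gt0.
have : g t <= g 0 by apply: gmax; rewrite gtr0_norm.
by rewrite -subr_le0 gt subr0 leNgt mulr_gt0.
Qed.

Context {n : nat}.
Implicit Types (x y : 'rV[R]_n).
Local Notation "'e_ i" := (delta_mx ord0 i : 'rV[R]_n) (at level 8, i at level 2).

Lemma is_derive_line (f : 'rV[R]_n -> R) x v (df t : R) :
  is_derive (t *: v + x) v f df -> is_derive t 1 (fun h : R => f (h *: v + x)) df.
Proof.
move=> [d1 d2].
have E : (fun h : R => h^-1 *: ((f \o shift (t *: v + x)) (h *: v) - f (t *: v + x)))
   = (fun h : R => h^-1 *: (((fun h : R => f (h *: v + x)) \o shift t) (h *: 1) -
      f (t *: v + x))).
  by apply/funext => h /=; rewrite [h *: 1]mulr1 scalerDl addrA.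
by split; [move: d1; rewrite /derivable E | move: d2; rewrite /derive E].
Qed.

Lemma is_derive_line0 (f : 'rV[R]_n -> R) x v (df : R) :
  is_derive x v f df <-> is_derive (0 : R) 1 (fun h : R => f (h *: v + x)) df.
Proof.
split=> [h|[d1 d2]]; first by apply: is_derive_line; rewrite scale0r add0r.
have E : (fun h : R => h^-1 *: ((f \o shift x) (h *: v) - f x))
   = (fun h : R => h^-1 *: (((fun h : R => f (h *: v + x)) \o shift 0) (h *: 1) -
      f (0 *: v + x))).
  by apply/funext => h /=; rewrite [h *: 1]mulr1 addr0 scale0r add0r.
by split; [rewrite /derivable E | rewrite /derive E].
Qed.

Lemma is_derive_coord i j x : is_derive x 'e_i (fun y => y ord0 j) (i == j)%:R.
Proof.
apply/is_derive_line0.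
have -> : (fun h : R => (h *: 'e_i + x) ord0 j) = (fun h => h * (i == j)%:R + x ord0 j).
  by apply/funext => h; rewrite !mxE /= [j == i]eq_sym.
have := is_deriveD (is_deriveZ (i == j)%:R (is_derive_id (0 : R) 1))
  (is_derive_cst (x ord0 j) (0 : R) 1).
 rewrite addr0 [_ *: 1]mulr1.
rewrite (_ : _ \*: id + _ = (fun h => h * (i == j)%:R + x ord0 j))//.
by apply/funext => h /=; rewrite mulrC.
Qed.

Lemma is_derive_enorm2 i x :
  is_derive x 'e_i (fun y => enorm y ^+ 2) (2 * x ord0 i).
Proof.
have h j : is_derive x 'e_i (fun y => y ord0 j ^+ 2) ((2 * x ord0 j) * (i == j)%:R).
  have hc := is_derive_coord i j x.
  have := @is_deriveX _ _ (fun y : 'rV[R]_n => y ord0 j) 2 x 'e_i _ hc.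
  by rewrite expr1.
have E : (fun y : 'rV[R]_n => enorm y ^+ 2) = \sum_j (fun y : 'rV[R]_n => y ord0 j ^+ 2).
  apply/funext => y; rewrite enormE fct_sumE; apply: eq_bigr => j _.
  by rewrite expr2.
rewrite E; apply: is_derive_eq.
rewrite (bigD1 i)//= eqxx mulr1 big1 ?addr0// => j ji.
by rewrite eq_sym (negPf ji) mulr0.
Qed.

(** Adding [eps |x|^2] makes the Laplacian strictly positive, which excludes an interior maximum.
    First and second derivatives are data [p] and [q], so that the principle applies to polynomials,
    limits, barriers and translates alike. *)
Lemma maximum_principle (K U : set 'rV[R]_n) (v : 'rV[R]_n -> R)
    (p q : 'I_n -> 'rV[R]_n -> R) (c : R) : (0 < n)%N ->
  compact K -> open U -> U `<=` K -> {within K, continuous v} ->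
  (forall x i, U x -> is_derive x 'e_i v (p i x)) ->
  (forall x i, U x -> is_derive x 'e_i (p i) (q i x)) ->
  (forall x, U x -> 0 <= \sum_i q i x) ->
  (forall x, K x -> ~ U x -> v x <= c) ->
  forall x, K x -> v x <= c.
Proof.
move=> n0 cK oU UK cv dv ddv lap vc x Kx.
rewrite leNgt; apply/negP => cvx.
have [M KM] : exists M, forall y, K y -> enorm y ^+ 2 <= M.
  have [||y _ ymax] := @EVT_max_rV R n (fun y => enorm y ^+ 2) K _ cK.
  - by exists x.
  - apply: continuous_subspaceT => y.
    apply: (@continuous_comp _ _ _ _ (fun u : R => u ^+ 2)).
      exact: enorm_continuous.
    exact: exprn_continuous.
  by exists (enorm y ^+ 2) => z Kz; apply: ymax; rewrite inE.
have M0 : 0 <= M by apply: le_trans (KM _ Kx); rewrite sqr_ge0.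
(* Small enough that [eps M < v x - c]: a maximum outside [U] would give [v x <= c + eps M], a
   contradiction. *)
pose eps := (v x - c) / (M + 1).
have eps0 : 0 < eps by rewrite divr_gt0 ?subr_gt0// ltr_wpDl.
pose u y := v y + eps * enorm y ^+ 2.
have [||y yK ymax] := @EVT_max_rV R n u K _ cK.
- by exists x.
- move=> z; apply: cvgD; first exact: cv.
  apply: cvgM; first exact: cvg_cst.
  have : {within K, continuous (fun y : 'rV[R]_n => enorm y ^+ 2)}.
    apply: continuous_subspaceT => w.
    apply: (@continuous_comp _ _ _ _ (fun u : R => u ^+ 2)).
      exact: enorm_continuous.
    exact: exprn_continuous.
  exact.
have {}yK : K y by rewrite inE in yK.
have xy : u x <= u y by apply: ymax; rewrite inE.
have [Uy|Uy] := pselect (U y); last first.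
  have h1 := vc _ yK Uy; have h2 := KM _ yK.
  have : v x <= c + eps * M.
    apply: (@le_trans _ _ (u x)); first by rewrite /u lerDl mulr_ge0 ?sqr_ge0// ltW.
    by apply: le_trans xy _; rewrite lerD// ler_pM2l.
  rewrite -lerBlDl /eps mulrAC -mulrA leNgt => /negP; apply.
  rewrite gtr_pMr ?subr_gt0//.
  by rewrite ltr_pdivrMr ?mul1r ?ltrDl// ltr_wpDl.
have qi i : q i y + eps * 2 <= 0.
  have /nbhs_enormP[e e0 hU] : nbhs y U by exact: open_nbhs_nbhs.
  apply: (@second_derivative_at_max (fun t => u (t *: 'e_i + y))
     (fun t => p i (t *: 'e_i + y) + eps * (2 * (t *: 'e_i + y) ord0 i)) _ e) => //.
  - move=> t te.
    have Ut : U (t *: 'e_i + y) by apply: hU; rewrite addrK enormZ enorm_delta mulr1.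
    apply: is_derive_line.
    have h1 := dv _ i Ut.
    have h2 := is_derive_enorm2 i (t *: 'e_i + y).
    exact: (@is_deriveD _ _ _ v (eps \*: (fun y : 'rV[R]_n => enorm y ^+ 2))).
  - apply/(is_derive_line0 (fun z => p i z + eps * (2 * z ord0 i)) y).
    have h1 := ddv _ i Uy.
    have h2 := is_derive_coord i i y; rewrite eqxx in h2.
    have := @is_deriveD _ _ _ (p i) (eps \*: (2 \*: (fun y : 'rV[R]_n => y ord0 i))) _ _ _ _ h1 _.
    move=> /(_ _ (@is_deriveZ _ _ _ _ _ _ _ _ (@is_deriveZ _ _ _ _ _ _ _ _ h2))).
    by rewrite [2 *: 1]mulr1.
  - move=> t te; apply: (@le_trans _ _ (u y)).
      apply: ymax; rewrite inE; apply: UK; apply: hU.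
      by rewrite addrK enormZ enorm_delta mulr1.
    by rewrite scale0r add0r.
have : \sum_i (q i y + eps * 2) <= 0 by exact: sumr_le0.
rewrite big_split /= sumr_const card_ord leNgt => /negP; apply.
by rewrite ltr_wpDl ?lap// pmulrn_lgt0// mulr_gt0.
Qed.

End maximum_principle.

(** * Smooth functions and harmonic polynomials *)

Lemma scale_regE {R : realType} (a b : R) : a *: (b : R^o) = a * b.
Proof. by []. Qed.

Section flat_function.
Context {R : realType}.

(** The functions [t^-k exp (-1/t)], cut off at 0, form a family closed under derivation up to
    linear combinations; products of them are the test functions. *)
Definition flat (k : nat) (t : R) : R :=
  if 0 < t then t^-1 ^+ k * expR (- t^-1) else 0.

Lemma flat_ge0 k t : 0 <= flat k t.
Proof.
rewrite /flat; case: ifPn => // t0.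
by rewrite mulr_ge0 ?expR_ge0// exprn_ge0// invr_ge0 ltW.
Qed.

(** From [exp u >= u^(k+2) / (k+2)!] at [u = 1/t]. The quadratic bound makes the derivative at 0
    vanish. *)
Lemma flat_le_sqr k t : flat k t <= (k.+2)`!%:R * t ^+ 2.
Proof.
rewrite /flat; case: ifPn => t0; last by rewrite mulr_ge0 ?sqr_ge0.
have u0 : 0 < t^-1 by rewrite invr_gt0.
have := expR_ge1Dxn k.+1 (ltW u0).
move=> h; have {}h : t^-1 ^+ k.+2 / k.+2`!%:R <= expR t^-1.
  by apply: le_trans h; rewrite lerDr.
have F0 : 0 < k.+2`!%:R :> R by rewrite ltr0n fact_gt0.
rewrite expRN ler_pdivrMr ?expR_gt0//.
rewrite ler_pdivrMr// in h.
have -> : t^-1 ^+ k = t ^+ 2 * t^-1 ^+ k.+2.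
  by rewrite !exprS; field; rewrite gt_eqF.
rewrite [leRHS](_ : _ = t ^+ 2 * (expR t^-1 * k.+2`!%:R)); last by ring.
by rewrite ler_pM2l ?exprn_gt0.
Qed.

Lemma flat_is_derive k (t : R) :
  is_derive t 1 (flat k) (flat k.+2 t - k%:R * flat k.+1 t).
Proof.
have [t0|t0|->] := ltgtP t 0.
- apply: (@near_eq_is_derive _ _ _ (cst 0)).
    near=> u; rewrite /flat ltNge; suff -> : u <= 0 by [].
    by apply: ltW; near: u; exact: lt_nbhsl.
  apply: is_derive_eq; rewrite /flat !ltNge (ltW t0) /=.
  by rewrite mulr0 subr0.
- apply: (@near_eq_is_derive _ _ _ (fun u : R => u^-1 ^+ k * expR (- u^-1))).
    near=> u; rewrite /flat; suff -> : 0 < u by [].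
    by near: u; exact: lt_nbhsr.
  have hV : is_derive t 1 (fun u : R => u^-1) (- t^-1 ^+ 2).
    have tn0 : t != 0 by rewrite gt_eqF.
    have := @is_deriveV R id t 1 1 tn0 (is_derive_id _ _).
    by rewrite /= exprVn [_ *: 1]mulr1.
  have hX := @is_deriveX _ _ _ k t 1 _ hV.
  have hE : is_derive t 1 (fun u : R => expR (- u^-1)) (expR (- t^-1) * t^-1 ^+ 2).
    have h := @is_derive1_comp R expR _ t _ _ (is_derive_expR (- t^-1)) (is_deriveN hV).
    by apply: (is_derive_eq h); rewrite opprK.
  have := @is_deriveM _ _ _ _ t 1 _ _ hX hE.
  rewrite exprfctE => h; apply: (is_derive_eq h).
  rewrite /flat t0 /= !scale_regE /=.
  case: k {hX h} => [|k]; rewrite /= ?mul0r ?exprS; ring.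
- have z j : flat j 0 = 0 by rewrite /flat ltxx.
  rewrite !z mulr0 subr0.
  have C0 : 0 < k.+2`!%:R :> R by rewrite ltr0n fact_gt0.
  have lim0 : (fun h : R => h^-1 *: ((flat k \o shift 0) (h *: 1) - flat k 0)) @ 0^' --> (0 : R).
    apply/cvgr0Pnorm_lt => e e0.
    rewrite near_withinE; apply/nbhs_ballP; exists (e / k.+2`!%:R) => /=.
      by rewrite divr_gt0.
    move=> h; rewrite /ball /= sub0r normrN => hlt hn0.
    rewrite z subr0 /= addr0 [h *: 1]mulr1 normrM normfV.
    rewrite (ger0_norm (flat_ge0 _ _)).
    rewrite ltr_pdivrMl ?normr_gt0//.
    apply: le_lt_trans (flat_le_sqr _ _) _.
    rewrite -real_normK ?num_real// expr2 mulrCA ltr_pM2l ?normr_gt0//.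
    rewrite mulrC -ltr_pdivlMr//.
  split; first by apply/cvg_ex; exists 0.
  exact/cvg_lim.
Unshelve. all: by end_near. Qed.

End flat_function.

(* A syntax for functions stable under partial derivatives: it contains both
   the polynomials and products of one-dimensional smooth bumps. *)
Inductive pexpr (R : realType) (n : nat) : Type :=
| PCst of R
| PVar of 'I_n
| PFlat of nat & R & R & 'I_n
| PAdd of pexpr R n & pexpr R n
| PMul of pexpr R n & pexpr R n.
Arguments PCst {R n}.
Arguments PVar {R n}.
Arguments PFlat {R n}.

Section pexpr.
Context {R : realType} {n : nat}.
Local Notation "'e_ i" := (delta_mx ord0 i : 'rV[R]_n) (at level 8, i at level 2).
Implicit Types (e : pexpr R n) (x : 'rV[R]_n).

Fixpoint peval e x : R :=
  match e with
  | PCst c => c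
  | PVar i => x ord0 i
  | PFlat k a b i => flat k (a * x ord0 i + b)
  | PAdd e1 e2 => peval e1 x + peval e2 x
  | PMul e1 e2 => peval e1 x * peval e2 x
  end.

Fixpoint pderiv (i : 'I_n) e : pexpr R n :=
  match e with
  | PCst c => PCst 0
  | PVar j => PCst (i == j)%:R
  | PFlat k a b j =>
      PMul (PCst (a * (i == j)%:R))
        (PAdd (PFlat k.+2 a b j) (PMul (PCst (- k%:R)) (PFlat k.+1 a b j)))
  | PAdd e1 e2 => PAdd (pderiv i e1) (pderiv i e2)
  | PMul e1 e2 => PAdd (PMul (pderiv i e1) e2) (PMul e1 (pderiv i e2))
  end.

Lemma peval_continuous e : continuous (peval e).
Proof.
elim: e => [c|j|k a b j|e1 h1 e2 h2|e1 h1 e2 h2] x /=.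
- exact: cst_continuous.
- exact: coord_continuous.
- apply: (@continuous_comp _ _ _ (fun x : 'rV[R]_n => a * x ord0 j + b)).
    apply: (@continuousD _ _ _ (fun x : 'rV[R]_n => a * x ord0 j) (cst b)).
      apply: (@continuousM _ _ (cst a) (fun x : 'rV[R]_n => x ord0 j)).
        exact: cst_continuous.
      exact: coord_continuous.
    exact: cst_continuous.
  apply/differentiable_continuous/derivable1_diffP.
  by have [] := flat_is_derive k (a * x ord0 j + b).
- by apply: (@continuousD _ _ _ (peval e1) (peval e2)); [exact: h1|exact: h2].
- by apply: (@continuousM _ _ (peval e1) (peval e2)); [exact: h1|exact: h2].
Qed.

Lemma peval_is_derive e i x : is_derive x 'e_i (peval e) (peval (pderiv i e) x).
Proof.
elim: e => [c|j|k a b j|e1 h1 e2 h2|e1 h1 e2 h2] /=.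
- exact: is_derive_cst.
- exact: is_derive_coord.
- apply/is_derive_line0.
  have := is_derive_line0 (fun y => y ord0 j) x 'e_i (i == j)%:R.
  move=> [+ _] => /(_ (is_derive_coord i j x)) h.
  have hL := is_deriveD (is_deriveZ a h) (is_derive_cst b (0 : R) 1).
  have := @is_derive1_comp R (flat k) _ 0 _ _ (flat_is_derive _ _) hL.
  move=> h'; apply: (is_derive_eq h').
  have -> : (a \*: (fun h0 : R => (h0 *: 'e_i + x) ord0 j) + cst b) 0 = a * x ord0 j + b.
    by rewrite -[LHS]/(a * (0 *: 'e_i + x) ord0 j + b) scale0r add0r.
  by rewrite addr0 scale_regE mulNr mulrC.
- exact: (@is_deriveD _ _ _ (peval e1) (peval e2)).
- have := @is_deriveM _ _ (peval e1) (peval e2) _ _ _ _ h1 h2.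
  move=> h; apply: (is_derive_eq h).
  by rewrite !scale_regE addrC; congr (_ + _); rewrite mulrC.
Qed.

Lemma peval_dpart e s : dpart s (peval e) = peval (foldr pderiv e s).
Proof.
elim: s => //= i s ->; apply/funext => x.
exact: (@derive_val _ _ _ _ _ _ _ (peval_is_derive _ _ _)).
Qed.

Lemma peval_Cn e k (A : set 'rV[R]_n) : Cn_on k A (peval e).
Proof.
move=> s _ x _; rewrite peval_dpart; split; first exact: peval_continuous.
by move=> _ i; have [] := peval_is_derive (foldr pderiv e s) i x.
Qed.

End pexpr.

Section harmonic_polynomials.
Context {R : realType} {n : nat}.
Local Notation "'e_ i" := (delta_mx ord0 i : 'rV[R]_n) (at level 8, i at level 2).
Implicit Types (e : pexpr R n) (x y v : 'rV[R]_n) (f : 'rV[R]_n -> R).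

Lemma compact_enorm_ball (c : R) : compact [set x : 'rV[R]_n | enorm x <= c].
Proof.
have := @compact_enorm_le R n c 0.
by rewrite (_ : [set x | _] = [set x | enorm x <= c])//; apply/funext => x; rewrite /= subr0.
Qed.

Lemma open_enorm_ball (c : R) : open [set x : 'rV[R]_n | enorm x < c].
Proof.
have := @open_enorm_lt R n c 0.
by rewrite (_ : [set x | _] = [set x | enorm x < c])//; apply/funext => x; rewrite /= subr0.
Qed.

Definition psum (F : 'I_n -> pexpr R n) : pexpr R n :=
  foldr (fun i a => PAdd (F i) a) (PCst 0) (enum 'I_n).

Lemma peval_psum F x : peval (psum F) x = \sum_i peval (F i) x.
Proof.
rewrite -big_enum /psum; elim: (enum _) => [|i r ih] /=; first by rewrite big_nil.
by rewrite big_cons ih.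
Qed.

Lemma peval_pderiv_psum F i x :
  peval (pderiv i (psum F)) x = \sum_j peval (pderiv i (F j)) x.
Proof.
rewrite -big_enum /psum; elim: (enum _) => [|j r ih] /=; first by rewrite big_nil.
by rewrite big_cons ih.
Qed.

Lemma peval_pderiv2_psum F i x :
  peval (pderiv i (pderiv i (psum F))) x = \sum_j peval (pderiv i (pderiv i (F j))) x.
Proof.
rewrite -big_enum /psum; elim: (enum _) => [|j r ih] /=; first by rewrite big_nil.
by rewrite big_cons ih.
Qed.

(** Both sides are the true partial derivative of the same function. The lemma allows replacing an
    expression by an equivalent one before a second derivation. *)
Lemma peval_pderiv_ext e1 e2 i : peval e1 =1 peval e2 ->
  peval (pderiv i e1) =1 peval (pderiv i e2).
Proof.
move=> /funext E x; have h1 := peval_is_derive e1 i x.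
have h2 := peval_is_derive e2 i x.
rewrite -(@derive_val _ _ _ _ _ _ _ h1) -(@derive_val _ _ _ _ _ _ _ h2).
by rewrite E.
Qed.

Lemma peval_pderivC e i j x :
  peval (pderiv i (pderiv j e)) x = peval (pderiv j (pderiv i e)) x.
Proof.
elim: e => [c|k|k a b l|e1 h1 e2 h2|e1 h1 e2 h2] //=; first by ring.
  by rewrite h1 h2.
by rewrite h1 h2; ring.
Qed.

Lemma peval_is_derive_dir e v x :
  is_derive x v (peval e) (\sum_i v ord0 i * peval (pderiv i e) x).
Proof.
elim: e => [c|j|k a b j|e1 h1 e2 h2|e1 h1 e2 h2] /=.
- rewrite big1; first exact: is_derive_cst.
  by move=> i _; rewrite mulr0.
- rewrite (bigD1 j)//= eqxx mulr1 big1 ?addr0; last first.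
    by move=> i ij; rewrite (negPf ij) mulr0.
  apply/is_derive_line0.
  have := is_deriveD (is_deriveZ (v ord0 j) (is_derive_id (0 : R) 1))
    (is_derive_cst (x ord0 j) (0 : R) 1).
  rewrite addr0 [_ *: 1]mulr1.
  rewrite (_ : _ \*: id + _ = (fun h => (h *: v + x) ord0 j))//.
  by apply/funext => h /=; rewrite !mxE mulrC.
- rewrite (bigD1 j)//= eqxx mulr1 big1 ?addr0; last first.
    by move=> i ij; rewrite (negPf ij) mulr0 mul0r mulr0.
  apply/is_derive_line0.
  have hL := is_deriveD (is_deriveZ (a * v ord0 j) (is_derive_id (0 : R) 1))
    (is_derive_cst (a * x ord0 j + b) (0 : R) 1).
  have := @is_derive1_comp R (flat k) _ 0 _ _ (flat_is_derive _ _) hL.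
  rewrite (_ : flat k \o _ = (fun h : R => flat k (a * (h *: v + x) ord0 j + b))); last first.
    apply/funext => h /=; congr (flat k _).
    rewrite -[LHS]/(a * v ord0 j * h + (a * x ord0 j + b)) !mxE; ring.
  move=> h'; apply: (is_derive_eq h').
  have -> : (a * v ord0 j \*: id + cst (a * x ord0 j + b)) 0 = a * x ord0 j + b.
    by rewrite -[LHS]/(a * v ord0 j * 0 + (a * x ord0 j + b)) mulr0 add0r.
  rewrite addr0 scale_regE; ring.
- under eq_bigr do rewrite mulrDr.
  by rewrite big_split /=; apply: (@is_deriveD _ _ _ (peval e1) (peval e2)).
- have := @is_deriveM _ _ (peval e1) (peval e2) _ _ _ _ h1 h2.
  move=> h; apply: (is_derive_eq h).
  rewrite !scale_regE !big_distrr -big_split /=; apply: eq_bigr => i _; ring.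
Qed.

Lemma peval_mvt e x y : exists t : R, 0 <= t <= 1 /\
  peval e y - peval e x =
  \sum_i (y - x) ord0 i * peval (pderiv i e) (t *: (y - x) + x).
Proof.
have h (t : R) : is_derive t 1 (fun h : R => peval e (h *: (y - x) + x))
   (\sum_i (y - x) ord0 i * peval (pderiv i e) (t *: (y - x) + x)).
  exact/is_derive_line/peval_is_derive_dir.
have [|c] := @MVT _ (fun h : R => peval e (h *: (y - x) + x)) _ 0 1 ltr01 (fun t _ => h t).
  by apply: derivable_within_continuous => t _; have [] := h t.
rewrite in_itv /= => /andP[c0 c1]; rewrite scale1r subrK scale0r add0r subr0 mulr1 => ->.
by exists c; rewrite !ltW.
Qed.

Definition pharm e := forall x, \sum_i peval (pderiv i (pderiv i e)) x = 0.

Lemma pharm_pderiv e j : pharm e -> pharm (pderiv j e).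
Proof.
move=> he x.
rewrite (eq_bigr (fun i => peval (pderiv j (pderiv i (pderiv i e))) x)); last first.
  move=> i _; rewrite -peval_pderivC; apply: peval_pderiv_ext => y.
  exact: peval_pderivC.
rewrite -(peval_pderiv_psum (fun i => pderiv i (pderiv i e))).
rewrite (@peval_pderiv_ext _ (PCst 0))// => y.
by rewrite peval_psum he.
Qed.

Definition pscale (c : R) e := PMul (PCst c) e.

Lemma pharm_lin c e1 e2 : pharm e1 -> pharm e2 -> pharm (PAdd e1 (pscale c e2)).
Proof.
move=> h1 h2 x /=; under eq_bigr do rewrite !mul0r !add0r.
by rewrite big_split /= -big_distrr /= h1 h2 mulr0 addr0.
Qed.

Hypothesis n0 : (0 < n)%N.

Lemma psub_max e (rho c : R) :
  (forall x, enorm x < rho -> 0 <= \sum_i peval (pderiv i (pderiv i e)) x) ->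
  (forall x, enorm x = rho -> peval e x <= c) ->
  forall x, enorm x <= rho -> peval e x <= c.
Proof.
move=> he hc x xr.
apply: (@maximum_principle R n [set x | enorm x <= rho] [set x | enorm x < rho]
  (peval e) (fun i => peval (pderiv i e)) (fun i => peval (pderiv i (pderiv i e)))) => //.
- exact: compact_enorm_ball.
- exact: open_enorm_ball.
- by move=> y /= /ltW.
- by apply: continuous_subspaceT; exact: peval_continuous.
- by move=> y i _; exact: peval_is_derive.
- by move=> y i _; exact: peval_is_derive.
- move=> y /= y1 /negP; rewrite -leNgt => y2; apply: hc.
  by apply/le_anti; rewrite y1 y2.
Qed.

Lemma pharm_max e (rho c : R) : pharm e ->
  (forall x, enorm x = rho -> `|peval e x| <= c) ->
  forall x, enorm x <= rho -> `|peval e x| <= c.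
Proof.
move=> he hc x xr; rewrite ler_norml; apply/andP; split.
  rewrite lerNl -mulN1r.
  apply: (@psub_max (pscale (-1) e) rho) => //.
    by move=> y _ /=; under eq_bigr do rewrite !mul0r !add0r;
      rewrite -big_distrr /= he mulr0.
  by move=> y /hc; rewrite ler_norml /= mulN1r lerNl => /andP[].
apply: (@psub_max e rho) => // [y _|y /hc]; first by rewrite he.
by rewrite ler_norml => /andP[].
Qed.

Let psq : pexpr R n := psum (fun i => PMul (PVar i) (PVar i)).

Let peval_psq x : peval psq x = enorm x ^+ 2.
Proof. by rewrite peval_psum enormE; apply: eq_bigr. Qed.

Let peval_psq1 i x : peval (pderiv i psq) x = 2 * x ord0 i.
Proof.
rewrite peval_pderiv_psum (bigD1 i)//= eqxx mulr1n big1; first by ring.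
by move=> j ji; rewrite eq_sym (negPf ji) mulr0n; ring.
Qed.

Let peval_psq2 i x : peval (pderiv i (pderiv i psq)) x = 2.
Proof.
rewrite peval_pderiv2_psum (bigD1 i)//= eqxx mulr1n big1; first by ring.
by move=> j ji; rewrite eq_sym (negPf ji) mulr0n; ring.
Qed.

(** Twice this constant is [24 + 4 n], a bound in the unit ball for the negative terms that the
    cut-off produces in Bernstein's computation. *)
Definition grad_cst : R := (12 + 2 * n%:R).

(* Bernstein's method: [(rho^2 - |x|^2)^2 (D_j h)^2 + (12 + 2n) h^2] is
   subharmonic when [h] is harmonic and [rho <= 1]. *)
Lemma pharm_gradient e (rho M : R) j : 0 < rho <= 1 -> pharm e ->
  (forall x, enorm x = rho -> `|peval e x| <= M) ->
  forall x, enorm x <= rho ->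
    (rho ^+ 2 - enorm x ^+ 2) ^+ 2 * peval (pderiv j e) x ^+ 2 <= grad_cst * M ^+ 2.
Proof.
move=> /andP[r0 r1] he hM x xr.
pose eta := PAdd (PCst (rho ^+ 2)) (pscale (-1) psq).
pose g := pderiv j e.
have hg : pharm g by exact: pharm_pderiv.
have L0 : 0 <= grad_cst by rewrite addr_ge0// mulr_ge0.
pose E := PAdd (PMul (PMul eta eta) (PMul g g)) (pscale grad_cst (PMul e e)).
have etaE y : peval eta y = rho ^+ 2 - enorm y ^+ 2 by rewrite /= peval_psq mulN1r.
have etaE1 i y : peval (pderiv i eta) y = - 2 * y ord0 i by rewrite /= peval_psq1; ring.
have etaE2 i y : peval (pderiv i (pderiv i eta)) y = - 2 by rewrite /= peval_psq2; ring.
have EE y : peval E y = (rho ^+ 2 - enorm y ^+ 2) ^+ 2 * peval g y ^+ 2 +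
    grad_cst * peval e y ^+ 2.
  by rewrite [LHS]/= -/(peval eta y) peval_psq; ring.
apply: (@le_trans _ _ (peval E x)).
  by rewrite EE lerDl mulr_ge0// sqr_ge0.
apply: (@psub_max E rho) => //; last first.
  move=> y yr; rewrite EE yr subrr expr0n mul0r add0r ler_wpM2l//.
  by rewrite -real_normK ?num_real// lerXn2r ?nnegrE// ?hM// (le_trans _ (hM _ yr)).
move=> y yr.
(* The cross term [-16 eta y_i g D_i g] is completed to a square at the cost of [32 y_i^2 g^2],
   which turns the coefficient 8 into -24. The term [2 grad_cst (D_j e)^2], contained in the sum
   over [i], compensates for it. *)
have dE i : peval (pderiv i (pderiv i E)) y =
   2 * (peval eta y * peval (pderiv i g) y - 4 * y ord0 i * peval g y) ^+ 2
   + (- 24 * y ord0 i ^+ 2 - 4 * peval eta y) * peval g y ^+ 2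
   + 2 * peval eta y ^+ 2 * peval g y * peval (pderiv i (pderiv i g)) y
   + 2 * grad_cst * peval (pderiv i e) y ^+ 2
   + 2 * grad_cst * peval e y * peval (pderiv i (pderiv i e)) y.
  rewrite /E; move: (etaE1 i y) (etaE2 i y).
  move: eta g {etaE etaE1 etaE2 EE hg E} => eta g E1 E2 /=.
  by rewrite E1 E2; ring.
rewrite (eq_bigr _ (fun i _ => dE i)).
have e1 : peval eta y <= 1.
  rewrite etaE lerBlDr (@le_trans _ _ 1)//; first by rewrite expr_le1// ltW.
  by rewrite lerDl sqr_ge0.
move: (peval eta y) e1 => h e1; clear dE.
rewrite !big_split /=.
rewrite -!big_distrr /= he hg !mulr0 !addr0 -big_distrl /=.
have S1 : 0 <= \sum_i (h * peval (pderiv i g) y - 4 * y ord0 i * peval g y) ^+ 2.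
  by apply: sumr_ge0 => i _; exact: sqr_ge0.
have S2 : peval g y ^+ 2 <= \sum_i peval (pderiv i e) y ^+ 2.
  by rewrite (bigD1 j)//= lerDl; apply: sumr_ge0 => i _; exact: sqr_ge0.
have S3 : - 2 * grad_cst <= \sum_i (- 24 * y ord0 i ^+ 2 - 4 * h).
  rewrite big_split /= -big_distrr /= sumr_const card_ord -mulr_natr.
  have -> : \sum_i y ord0 i ^+ 2 = enorm y ^+ 2.
    by rewrite enormE; apply: eq_bigr => i _; rewrite expr2.
  have y0 := enorm_ge0 y.
  have y1 : enorm y ^+ 2 <= 1 by rewrite expr_le1//; lra.
  have : h * n%:R <= n%:R by rewrite ler_piMl.
  rewrite /grad_cst; lra.
have := sqr_ge0 (peval g y).
set S := \sum_i _ in S1 *; set S' := \sum_i _ in S2 *; set T := \sum_i _ in S3 *.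
move=> gg.
have : - 2 * grad_cst * peval g y ^+ 2 <= T * peval g y ^+ 2 by exact: ler_wpM2r.
have : grad_cst * peval g y ^+ 2 <= grad_cst * S' by exact: ler_wpM2l.
lra.
Qed.

End harmonic_polynomials.

(** * Uniform limits of harmonic polynomials *)

Section epsilon_delta.
Context {R : realType} {n : nat}.
Implicit Types (A : set 'rV[R]_n) (f : 'rV[R]_n -> R).

Lemma continuous_enormP f x : {for x, continuous f} <->
  forall e : R, 0 < e -> exists2 d : R, 0 < d &
    forall y, enorm (y - x) < d -> `|f y - f x| < e.
Proof.
split=> [cf e e0|h].
  have : nbhs (f x) [set u | `|u - f x| < e].
    apply/nbhs_ballP; exists e => // u.
    by rewrite -ball_normE /ball_ /= distrC.
  by move/cf => /nbhs_enormP[d d0 hd]; exists d.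
move=> A /nbhs_ballP[e /= e0 eA]; apply/nbhs_enormP.
have [d d0 hd] := h _ e0; exists d => // y /hd fy; apply: eA.
by rewrite -ball_normE /ball_ /= distrC.
Qed.

Lemma continuous_within_enormP A f : {within A, continuous f} <->
  forall x, A x -> forall e : R, 0 < e -> exists2 d : R, 0 < d &
    forall y, A y -> enorm (y - x) < d -> `|f y - f x| < e.
Proof.
split=> [/subspace_continuousP cf x Ax e e0|h].
  have : nbhs (f x) [set u | `|u - f x| < e].
    apply/nbhs_ballP; exists e => // u.
    by rewrite -ball_normE /ball_ /= distrC.
  by move/(cf _ Ax) => /nbhs_enormP[d d0 hd]; exists d => // y Ay /hd; apply.
apply/subspace_continuousP => x Ax B /nbhs_ballP[e /= e0 eB]; apply/nbhs_enormP.
have [d d0 hd] := h _ Ax _ e0; exists d => // y yx Ay; apply: eB.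
by rewrite -ball_normE /ball_ /= distrC; apply: hd.
Qed.

End epsilon_delta.

Section real_sequences.
Context {R : realType}.

Lemma cauchy_cvgn (u : nat -> R) :
  (forall e : R, 0 < e -> exists N : nat, forall k l, (N <= k)%N -> (N <= l)%N ->
    `|u k - u l| <= e) -> cvgn u.
Proof.
move=> h; apply/cauchy_cvgP/cauchy_exP => e e0.
have [N hN] := h _ (divr_gt0 e0 (ltr0n _ 2)).
exists (u N); exists N => // k /= Nk; rewrite -ball_normE /ball_ /=.
by apply: le_lt_trans (hN _ _ _ _) _ => //; lra.
Qed.

Lemma cvgn_dist_le (u : nat -> R) (l c e : R) (N : nat) : u @ \oo --> l ->
  (forall k, (N <= k)%N -> `|u k - c| <= e) -> `|l - c| <= e.
Proof.
move=> ul h.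
have : (fun k => `|u k - c|) @ \oo --> `|l - c|.
  by apply: cvg_norm; apply: cvgB => //; exact: cvg_cst.
by move/cvgr_to_le; apply; exists N => // k /= /h.
Qed.

Lemma cvgn_le (u : nat -> R) (l c : R) (N : nat) : u @ \oo --> l ->
  (forall k, (N <= k)%N -> u k <= c) -> l <= c.
Proof. by move=> /cvgr_to_le ul h; apply: ul; exists N => // k /= /h. Qed.

Lemma is_derive_eps {V : normedModType R} (f : V -> R) x v (d : R) :
  (forall e : R, 0 < e -> exists2 del : R, 0 < del & forall h : R, `|h| < del ->
     `|f (h *: v + x) - f x - h * d| <= e * `|h|) -> is_derive x v f d.
Proof.
move=> H.
have lim0 : (fun h : R => h^-1 *: ((f \o shift x) (h *: v) - f x)) @ 0^' --> d.
  apply/cvgrPdist_le => e e0; have [del del0 Hd] := H _ e0.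
  rewrite near_withinE; apply/nbhs_ballP; exists del => //= h.
  rewrite /ball /= sub0r normrN => hd hn0.
  have := Hd _ hd; rewrite -ler_pdivrMr ?normr_gt0// -normfV -normrM.
  rewrite distrC scale_regE mulrBl mulrAC divff// mul1r.
  by rewrite [_ * h^-1]mulrC.
by split; [apply/cvg_ex; exists d|exact/cvg_lim].
Qed.

End real_sequences.

Section uniform_limits.
Context {R : realType} {n : nat}.
Local Notation "'e_ i" := (delta_mx ord0 i : 'rV[R]_n) (at level 8, i at level 2).
Implicit Types (e : pexpr R n) (x y v : 'rV[R]_n) (f g : 'rV[R]_n -> R)
  (B : set 'rV[R]_n) (F : nat -> pexpr R n).

Definition ulim B F f := forall eps : R, 0 < eps ->
  exists N : nat, forall k, (N <= k)%N -> forall x, B x ->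
    `|peval (F k) x - f x| <= eps.

Definition ucauchy B F := forall eps : R, 0 < eps ->
  exists N : nat, forall k l, (N <= k)%N -> (N <= l)%N -> forall x, B x ->
    `|peval (F k) x - peval (F l) x| <= eps.

Lemma ulim_cvg B F f x : ulim B F f -> B x -> peval (F k) x @[k --> \oo] --> f x.
Proof.
move=> h Bx; apply/cvgrPdist_le => e e0.
have [N hN] := h _ e0; near=> k; rewrite distrC; apply: hN => //.
by near: k; exists N.
Unshelve. all: by end_near. Qed.

Lemma ulim_ucauchy B F f : ulim B F f -> ucauchy B F.
Proof.
move=> h e e0; have [N hN] := h (e / 2) (divr_gt0 e0 (ltr0n _ 2)).
exists N => k l kN lN x Bx.
rewrite (splitr e) (_ : _ - _ = (peval (F k) x - f x) - (peval (F l) x - f x)); last by ring.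
by apply: le_trans (ler_normB _ _) _; apply: lerD; apply: hN.
Qed.

Lemma ucauchy_ulim B F : ucauchy B F -> ulim B F (fun x => limn (fun k => peval (F k) x)).
Proof.
move=> h e e0; have [N hN] := h _ e0; exists N => k kN x Bx.
rewrite distrC; apply: (@cvgn_dist_le _ (fun k => peval (F k) x) _ _ _ N).
  apply: cauchy_cvgn => e' e'0; have [N' hN'] := h _ e'0.
  by exists N' => l l' h1 h2; exact: hN'.
by move=> l lN; exact: hN.
Qed.

Lemma ulim_sub B B' F f : B' `<=` B -> ulim B F f -> ulim B' F f.
Proof.
by move=> BB h e /h[N hN]; exists N => k kN x /BB; exact: hN.
Qed.

Lemma ulim_ext B F f g : (forall x, B x -> f x = g x) -> ulim B F f -> ulim B F g.
Proof.
by move=> fg h e /h[N hN]; exists N => k kN x Bx; rewrite -fg//; exact: hN.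
Qed.

Lemma ulim_within B F f : ulim B F f -> {within B, continuous f}.
Proof.
move=> h; apply/continuous_within_enormP => x Bx e e0.
have [N hN] := h (e / 4) (divr_gt0 e0 (ltr0n _ 4)).
have /continuous_enormP/(_ (e / 4)) := @peval_continuous _ _ (F N) x.
rewrite divr_gt0// => /(_ isT)[d d0 hd]; exists d => // y By yx.
have h1 := hN N (leqnn _) _ Bx; have h2 := hN N (leqnn _) _ By.
have h3 := hd _ yx.
rewrite (_ : f y - f x = - (peval (F N) y - f y) + (peval (F N) x - f x) +
  (peval (F N) y - peval (F N) x)); last by ring.
apply: le_lt_trans (ler_normD _ _) _; apply: le_lt_trans (lerD (ler_normD _ _) (lexx _)) _.
rewrite normrN; lra.
Qed.

Lemma ulim_continuous B F f x : open B -> ulim B F f -> B x -> {for x, continuous f}.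
Proof.
move=> oB /ulim_within /continuous_within_enormP h Bx.
apply/continuous_enormP => e e0; have [d d0 hd] := h _ Bx _ e0.
have /nbhs_enormP[d' d'0 hd'] : nbhs x B by exact: open_nbhs_nbhs.
exists (Num.min d d'); first by rewrite lt_min d0.
by move=> y; rewrite lt_min => /andP[y1 y2]; apply: hd => //; exact: hd'.
Qed.

(** By the mean value theorem the difference quotient of [F k] is a value of its derivative, which
    is close to [g] and hence to [g x], uniformly in [k]; the bound passes to the limit. *)
Lemma ulim_is_derive B F f g i x : open B -> ulim B F f ->
  ulim B (fun k => pderiv i (F k)) g -> B x -> is_derive x 'e_i f (g x).
Proof.
move=> oB Ff Fg Bx; apply: is_derive_eps => e e0.
have /continuous_enormP/(_ (e / 2)) := ulim_continuous oB Fg Bx.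
rewrite divr_gt0// => /(_ isT)[d d0 hd].
have /nbhs_enormP[d' d'0 hd'] : nbhs x B by exact: open_nbhs_nbhs.
have [N hN] := Fg _ (divr_gt0 e0 (ltr0n _ 2)).
exists (Num.min d d'); first by rewrite lt_min d0.
move=> h; rewrite lt_min => /andP[h1 h2].
have nh t : 0 <= t <= 1 -> enorm (t *: (h *: 'e_i) + x - x) <= `|h|.
  move=> /andP[t0 t1]; rewrite addrK scalerA enormZ enorm_delta mulr1 normrM.
  by rewrite ler_piMl// ger0_norm.
have Bh t : 0 <= t <= 1 -> B (t *: (h *: 'e_i) + x).
  by move=> tt; apply: hd'; apply: le_lt_trans (nh _ tt) _.
have Bh1 : B (h *: 'e_i + x) by have := Bh 1; rewrite scale1r ler01 lexx; exact.
have cv : (fun k => peval (F k) (h *: 'e_i + x) - peval (F k) x) @ \oo -->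
    f (h *: 'e_i + x) - f x.
  by apply: cvgB; apply: ulim_cvg Ff _.
apply: (cvgn_dist_le (N := N) cv) => k kN.
have [t [tt ->]] := peval_mvt (F k) x (h *: 'e_i + x).
rewrite addrK (bigD1 i)//= big1 ?addr0; last first.
  by move=> j ji; rewrite !mxE (negPf ji) andbF mulr0 mul0r.
rewrite !mxE !eqxx mulr1 -mulrBr normrM mulrC ler_wpM2r//.
rewrite (splitr e) (_ : _ - _ = (peval (pderiv i (F k)) (t *: (h *: 'e_i) + x)
  - g (t *: (h *: 'e_i) + x)) + (g (t *: (h *: 'e_i) + x) - g x)); last by ring.
apply: le_trans (ler_normD _ _) _; apply: lerD; first by apply: hN => //; exact: Bh.
by apply: ltW; apply: hd; apply: le_lt_trans (nh _ tt) _.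
Qed.

(** Stands for the harmonic functions continuous on the closed ball: the class is closed under
    linear combinations and uniform limits, and estimates proved for polynomials pass to it. *)
Definition harm_lim f := exists2 F, (forall k, pharm (F k)) & ulim cball F f.

Lemma harm_lim_eps f : (forall eps : R, 0 < eps -> exists2 e, pharm e &
  forall x, cball x -> `|peval e x - f x| <= eps) -> harm_lim f.
Proof.
move=> h.
have /choice[F hF] : forall k : nat, exists e, pharm e /\
    forall x, cball x -> `|peval e x - f x| <= (k.+1%:R)^-1.
  by move=> k; have [|e e1 e2] := h (k.+1%:R)^-1; [rewrite invr_gt0|exists e].
exists F => [k|e e0]; first by have [] := hF k.
exists (Num.truncn e^-1) => k kN x Bx; have [_ /(_ _ Bx)] := hF k.
move=> /le_trans; apply; rewrite invf_ple ?posrE//.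
apply: ltW; apply: lt_le_trans (truncnS_gt _) _; rewrite ler_nat.
by [].
Qed.

Lemma harm_lim_lin (c : R) f g : harm_lim f -> harm_lim g ->
  harm_lim (fun x => f x + c * g x).
Proof.
move=> [F hF Ff] [G hG Gg]; exists (fun k => PAdd (F k) (pscale c (G k))).
  by move=> k; exact: pharm_lin.
move=> e e0.
have [N hN] := Ff _ (divr_gt0 e0 (ltr0n _ 2)).
have c0 : 0 < 2 * (`|c| + 1) :> R by rewrite mulr_gt0// ltr_wpDl.
have [M hM] := Gg _ (divr_gt0 e0 c0).
exists (maxn N M) => k; rewrite geq_max => /andP[kN kM] x Bx /=.
rewrite (splitr e) (_ : _ - _ = (peval (F k) x - f x) + c * (peval (G k) x - g x)); last by ring.
apply: le_trans (ler_normD _ _) _; apply: lerD; first exact: hN.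
rewrite normrM; apply: le_trans (ler_wpM2l (normr_ge0 _) (hM _ kM _ Bx)) _.
rewrite mulrA ler_pdivrMr//.
rewrite [leRHS](_ : _ = e * (`|c| + 1)); last by field.
by rewrite mulrC ler_pM2l// lerDl.
Qed.

Lemma harm_lim_ext f g : (forall x, cball x -> f x = g x) -> harm_lim f -> harm_lim g.
Proof. by move=> fg [F hF Ff]; exists F => //; exact: ulim_ext Ff. Qed.

Lemma harm_lim0 : harm_lim (fun=> 0).
Proof.
apply: harm_lim_eps => e e0; exists (PCst 0); first by move=> x /=; rewrite big1.
by move=> x _ /=; rewrite subrr normr0 ltW.
Qed.

Lemma harm_lim_within f : harm_lim f -> {within cball, continuous f}.
Proof. by move=> [F _]; exact: ulim_within. Qed.

Lemma harm_lim_closed f : (forall eps : R, 0 < eps -> exists2 g, harm_lim g &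
  forall x, cball x -> `|g x - f x| <= eps) -> harm_lim f.
Proof.
move=> h; apply: harm_lim_eps => e e0.
have [g [F hF Fg] gf] := h _ (divr_gt0 e0 (ltr0n _ 2)).
have [N hN] := Fg _ (divr_gt0 e0 (ltr0n _ 2)).
exists (F N) => // x Bx; rewrite (splitr e) (_ : _ - _ = (peval (F N) x - g x) + (g x - f x)); last by ring.
by apply: le_trans (ler_normD _ _) _; apply: lerD; [exact: hN|exact: gf].
Qed.

End uniform_limits.

Section harmonic_limits.
Context {R : realType} {n : nat}.
Local Notation "'e_ i" := (delta_mx ord0 i : 'rV[R]_n) (at level 8, i at level 2).
Hypothesis n0 : (0 < n)%N.
Variables (F : nat -> pexpr R n) (f : 'rV[R]_n -> R).
Hypotheses (hF : forall k, pharm (F k)) (Ff : ulim cball F f).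

Lemma pharm_pderivs e s : pharm e -> pharm (foldr pderiv e s : pexpr R n).
Proof. by move=> he; elim: s => //= i s; exact: pharm_pderiv. Qed.

Lemma grad_cst_ge1 : 1 <= @grad_cst R n.
Proof. by rewrite /grad_cst; have := ler0n R n; lra. Qed.

(** Each derivative costs a passage from [rho] to the larger radius [(1 + rho) / 2], on whose ball
    the gradient estimate is applied to the differences of two members of the sequence. *)
Lemma ucauchy_pderivs s (rho : R) : 0 < rho < 1 ->
  ucauchy [set x | enorm x <= rho] (fun k => foldr pderiv (F k) s).
Proof.
elim: s rho => [rho /andP[r0 r1]|i s ih rho /andP[r0 r1]].
  apply: (@ulim_ucauchy _ _ _ F f); apply: ulim_sub Ff => x /= xr.
  exact: le_trans xr (ltW r1).
pose rho' := (1 + rho) / 2.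
have r'0 : 0 < rho' by rewrite /rho'; lra.
have r'1 : rho' < 1 by rewrite /rho'; lra.
have rr : 0 < rho' ^+ 2 - rho ^+ 2.
  by rewrite subr_gt0 ltrXn2r ?nnegrE ?ltW//; rewrite /rho'; lra.
have C1 := grad_cst_ge1.
have C0 : 0 < @grad_cst R n by apply: lt_le_trans C1.
move=> e e0.
have rr1 : 0 < rho' < 1 by rewrite r'0.
have ed0 : 0 < e * (rho' ^+ 2 - rho ^+ 2) / @grad_cst R n by rewrite divr_gt0// mulr_gt0.
have [N hN] := ih rho' rr1 _ ed0.
exists N => k l kN lN x /= xr.
pose E := PAdd (foldr pderiv (F k) s) (pscale (-1) (foldr pderiv (F l) s)).
have EE y : peval E y = peval (foldr pderiv (F k) s) y - peval (foldr pderiv (F l) s) y.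
  by rewrite /= mulN1r.
have DE y : peval (pderiv i E) y = peval (pderiv i (foldr pderiv (F k) s)) y -
    peval (pderiv i (foldr pderiv (F l) s)) y.
  by rewrite /=; ring.
have hE : pharm E by apply: pharm_lin; exact: pharm_pderivs.
have := @pharm_gradient R n n0 E rho' (e * (rho' ^+ 2 - rho ^+ 2) / @grad_cst R n) i.
rewrite r'0 (ltW r'1) => /(_ isT hE) h.
rewrite -DE -(@ler_pXn2r _ 2)// ?nnegrE ?(ltW e0)// real_normK ?num_real//.
have xr' : enorm x <= rho' by rewrite (le_trans xr)// /rho'; lra.
have {}h : (rho' ^+ 2 - enorm x ^+ 2) ^+ 2 * peval (pderiv i E) x ^+ 2 <=
    @grad_cst R n * (e * (rho' ^+ 2 - rho ^+ 2) / @grad_cst R n) ^+ 2.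
  by apply: h => // y yr; rewrite EE; apply: hN => //=; rewrite yr.
have h2 : (rho' ^+ 2 - rho ^+ 2) ^+ 2 * peval (pderiv i E) x ^+ 2 <=
    (rho' ^+ 2 - enorm x ^+ 2) ^+ 2 * peval (pderiv i E) x ^+ 2.
  rewrite ler_wpM2r ?sqr_ge0// lerXn2r ?nnegrE ?(ltW rr)//.
    by rewrite subr_ge0 lerXn2r ?nnegrE ?enorm_ge0// ltW.
  by rewrite lerD2l lerN2 lerXn2r ?nnegrE ?enorm_ge0// ltW.
have h3 : @grad_cst R n * (e * (rho' ^+ 2 - rho ^+ 2) / @grad_cst R n) ^+ 2 <=
    (rho' ^+ 2 - rho ^+ 2) ^+ 2 * e ^+ 2.
  have -> : @grad_cst R n * (e * (rho' ^+ 2 - rho ^+ 2) / @grad_cst R n) ^+ 2 =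
      ((rho' ^+ 2 - rho ^+ 2) ^+ 2 * e ^+ 2) / @grad_cst R n.
    by field; rewrite gt_eqF.
  by rewrite ler_pdivrMr// ler_peMr// mulr_ge0 ?sqr_ge0.
by have := le_trans h2 (le_trans h h3); rewrite ler_pM2l// exprn_gt0.
Qed.

Let G s x := limn (fun k => peval (foldr pderiv (F k) s) x).

Let ulim_G s (rho : R) : 0 < rho < 1 ->
  ulim [set x | enorm x < rho] (fun k => foldr pderiv (F k) s) (G s).
Proof.
move=> rr; apply: (@ulim_sub _ _ [set x | enorm x <= rho]); first by move=> x /= /ltW.
exact/ucauchy_ulim/ucauchy_pderivs.
Qed.

Let between (x : 'rV[R]_n) : enorm x < 1 -> exists2 rho : R, 0 < rho < 1 & enorm x < rho.
Proof. by move=> x1; exists ((1 + enorm x) / 2); have := enorm_ge0 x; lra. Qed.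

Let G_is_derive s i x : enorm x < 1 -> is_derive x 'e_i (G s) (G (i :: s) x).
Proof.
move=> /between[rho rr xr].
exact: (@ulim_is_derive _ _ _ _ _ _ _ _ (@open_enorm_ball _ _ rho) (ulim_G s rr) (ulim_G (i :: s) rr)).
Qed.

Let near_ball1 (x : 'rV[R]_n) : enorm x < 1 -> \forall y \near x, enorm y < 1.
Proof.
by move=> x1; have := @open_enorm_ball R n 1; rewrite openE => /(_ _ x1).
Qed.

Let dpart_G s x : enorm x < 1 -> dpart s f x = G s x.
Proof.
elim: s x => [x x1|i s ih x x1].
  apply/esym/cvg_lim => //; apply: ulim_cvg Ff _; exact: ltW.
have h := G_is_derive s i x1.
rewrite -(@derive_val _ _ _ _ _ _ _ h) /=; apply: near_eq_derive.
by have := near_ball1 x1; apply: filterS => y; exact: ih.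
Qed.

Let near_dpart_G s x : enorm x < 1 -> \forall y \near x, G s y = dpart s f y.
Proof.
by move=> /near_ball1; apply: filterS => y /dpart_G.
Qed.

Lemma dpart_cvg s x : enorm x < 1 ->
  peval (foldr pderiv (F k) s) x @[k --> \oo] --> dpart s f x.
Proof.
move=> x1; rewrite dpart_G//; have [rho rr xr] := between x1.
exact: ulim_cvg (ulim_G s rr) _.
Qed.

Lemma dpart_is_derive s i x : enorm x < 1 ->
  is_derive x 'e_i (dpart s f) (dpart (i :: s) f x).
Proof.
move=> x1; rewrite (dpart_G (i :: s))//.
exact: near_eq_is_derive (near_dpart_G s x1) (G_is_derive s i x1).
Qed.

Lemma dpart_continuous s x : enorm x < 1 -> {for x, continuous (dpart s f)}.
Proof.
move=> x1; have [rho rr xr] := between x1.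
have := ulim_continuous (@open_enorm_ball _ _ rho) (ulim_G s rr) xr.
move=> /continuous_enormP h; apply/continuous_enormP => e /h[d d0 hd].
exists (Num.min d (rho - enorm x)); first by rewrite lt_min d0 subr_gt0.
move=> y; rewrite lt_min => /andP[/hd y1 y2].
rewrite !dpart_G//.
have := enorm_triangle (y - x) x; rewrite subrK.
by move/andP: rr => [r0 r1]; lra.
Qed.

Lemma ulim_harmonic : harmonic_on (eball n) f.
Proof.
split=> [s _ x x1|x x1].
  split; first exact: dpart_continuous.
  by move=> _ i; have [] := dpart_is_derive s i x1.
have c1 : (fun k => \sum_i peval (foldr pderiv (F k) [:: i; i]) x) @ \oo -->
    \sum_i dpart [:: i; i] f x.
  elim: (index_enum _) => [|i r ih].
    by under eq_cvg do rewrite big_nil; rewrite big_nil; exact: cvg_cst.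
  under eq_cvg do rewrite big_cons; rewrite big_cons.
  by apply: cvgD => //; exact: dpart_cvg.
apply: (cvg_unique _ c1) => //.
rewrite (_ : (fun k => _) = cst 0); first exact: cvg_cst.
by apply/funext => k; exact: hF.
Qed.

End harmonic_limits.

(** * Barriers, uniqueness and Hoelder estimates in the ball *)

Section power_functions.
Context {R : realType}.

(** For [0 <= z <= x + y] one has [z / (x + y) <= (z / (x + y))^b] as [b <= 1]; add this for [z = x]
    and [z = y]. *)
Lemma powR_subadd (b x y : R) : 0 < b <= 1 -> 0 <= x -> 0 <= y ->
  (x + y) `^ b <= x `^ b + y `^ b.
Proof.
move=> /andP[b0 b1] x0 y0.
have [/eqP|xyn0] := eqVneq (x + y) 0.
  rewrite paddr_eq0// => /andP[/eqP-> /eqP->].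
  by rewrite addr0 powR0 ?gt_eqF// addr0.
have xy0 : 0 < x + y by rewrite lt_neqAle eq_sym xyn0 addr_ge0.
have h z : 0 <= z -> z <= x + y -> z / (x + y) * (x + y) `^ b <= z `^ b.
  move=> z0 zxy; have [->|zn0] := eqVneq z 0; first by rewrite mul0r mul0r powR_ge0.
  have zgt0 : 0 < z by rewrite lt_neqAle eq_sym zn0.
  have -> : z `^ b = (z / (x + y)) `^ b * (x + y) `^ b.
    by rewrite -powRM ?divfK// ?divr_ge0// ltW.
  rewrite ler_pM2r ?powR_gt0//.
  by apply: ger1_powR; rewrite // divr_gt0//= ler_pdivrMr// mul1r.
have := lerD (h x x0 _) (h y y0 _).
rewrite lerDl lerDr -mulrDl -mulrDl divff// mul1r.
by apply.
Qed.

Lemma powR_dist (b x y : R) : 0 < b <= 1 -> 0 <= x -> 0 <= y ->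
  `|x `^ b - y `^ b| <= `|x - y| `^ b.
Proof.
move=> b01; have b0 : 0 <= b by case/andP: b01 => /ltW.
wlog xy : x y / y <= x.
  move=> H x0 y0; have [/H|/ltW/H] := leP y x; first exact.
  by rewrite distrC (distrC x); apply.
move=> x0 y0; rewrite !ger0_norm ?subr_ge0 ?ge0_ler_powR ?nnegrE//.
by rewrite lerBlDr -{1}(subrK y x) powR_subadd// subr_ge0.
Qed.

Context {n : nat}.
Local Notation "'e_ i" := (delta_mx ord0 i : 'rV[R]_n) (at level 8, i at level 2).

Lemma within_powR (A : set 'rV[R]_n) (g : 'rV[R]_n -> R) (b : R) : 0 < b <= 1 ->
  {within A, continuous g} -> (forall x, A x -> 0 <= g x) ->
  {within A, continuous (fun x => g x `^ b)}.
Proof.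
move=> b01 /continuous_within_enormP cg g0.
have b0 : 0 < b by case/andP: b01.
apply/continuous_within_enormP => x Ax e e0.
have [|d d0 hd] := cg _ Ax (e `^ b^-1); first by rewrite powR_gt0.
exists d => // y Ay /(hd _ Ay) yx.
apply: le_lt_trans (powR_dist b01 (g0 _ Ay) (g0 _ Ax)) _.
have -> : e = (e `^ b^-1) `^ b by rewrite -powRrM mulVf ?gt_eqF// powRr1// ltW.
by apply: gt0_ltr_powR => //; rewrite nnegrE ?powR_ge0.
Qed.

Lemma is_derive_powR_peval (E : pexpr R n) (a : R) i x : 0 < peval E x ->
  is_derive x 'e_i (fun y => peval E y `^ a)
    (a * peval E x `^ (a - 1) * peval (pderiv i E) x).
Proof.
move=> Ex; apply/is_derive_line0.
have h := (is_derive_line0 (peval E) x 'e_i _).1 (peval_is_derive E i x).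
have Ex' : 0 < peval E (0 *: 'e_i + x) by rewrite scale0r add0r.
have := @is_derive1_comp R (fun y => y `^ a) _ 0 _ _ (is_derive1_powR a Ex') h.
by rewrite scale0r add0r.
Qed.

Lemma is_derive2_powR_peval (E : pexpr R n) (a : R) i x : 0 < peval E x ->
  is_derive x 'e_i (fun y => a * peval E y `^ (a - 1) * peval (pderiv i E) y)
    (a * (a - 1) * peval E x `^ (a - 2) * peval (pderiv i E) x ^+ 2 +
     a * peval E x `^ (a - 1) * peval (pderiv i (pderiv i E)) x).
Proof.
move=> Ex.
have h1 := is_derive_powR_peval (a - 1) i Ex.
have h2 := peval_is_derive (pderiv i E) i x.
have h := is_deriveM (is_deriveZ a h1) h2.
apply: (is_derive_eq h); rewrite !scale_regE.
rewrite (_ : a - 1 - 1 = a - 2); last by ring.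
rewrite -[(a \*: _) x]/(a * peval E x `^ (a - 1)); ring.
Qed.

End power_functions.

Section barrier.
Context {R : realType} {n : nat}.
Local Notation "'e_ i" := (delta_mx ord0 i : 'rV[R]_n) (at level 8, i at level 2).
Variables (xi : 'rV[R]_n) (a : R).
Hypotheses (xi1 : enorm xi = 1) (a01 : 0 < a < 1).

(** [U] is [1 - <x, xi>] and [S] is [|x - xi|^2]. The power [S^(a/2)] has the required size but a
    Laplacian that may be positive; [U^a] is concave, and the weight [M = n / (1 - a)] makes it
    absorb that Laplacian. *)
Let U := PAdd (PCst 1) (pscale (-1) (psum (fun i => PMul (PVar i) (PCst (xi ord0 i))))) : pexpr R n.
Let S := psum (fun i => PMul (PAdd (PVar i) (PCst (- xi ord0 i))) (PAdd (PVar i) (PCst (- xi ord0 i)))) : pexpr R n.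
Let M := n%:R / (1 - a).

Let UE x : peval U x = 1 - dotp x xi.
Proof. by rewrite /= mulN1r peval_psum. Qed.

Let SE x : peval S x = enorm (x - xi) ^+ 2.
Proof. by rewrite peval_psum enormE; apply: eq_bigr => i _ /=; rewrite !mxE. Qed.

Let U1 i x : peval (pderiv i U) x = - xi ord0 i.
Proof.
rewrite /= peval_pderiv_psum (bigD1 i)//= eqxx mulr1n big1; first by ring.
by move=> j ji; rewrite eq_sym (negPf ji) mulr0n; ring.
Qed.

Let U2 i x : peval (pderiv i (pderiv i U)) x = 0.
Proof.
rewrite /= peval_pderiv2_psum big1; first by ring.
by move=> j _ /=; ring.
Qed.

Let S1 i x : peval (pderiv i S) x = 2 * (x ord0 i - xi ord0 i).
Proof.
rewrite /= peval_pderiv_psum (bigD1 i)//= eqxx mulr1n big1; first by ring.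
by move=> j ji; rewrite eq_sym (negPf ji) mulr0n; ring.
Qed.

Let S2 i x : peval (pderiv i (pderiv i S)) x = 2.
Proof.
rewrite /= peval_pderiv2_psum (bigD1 i)//= eqxx mulr1n big1; first by ring.
by move=> j ji; rewrite eq_sym (negPf ji) mulr0n; ring.
Qed.

Let b1 : 1 - dotp xi xi = 0. Proof. by rewrite -enormE xi1 expr1n subrr. Qed.

Let U_le x : peval U x <= enorm (x - xi).
Proof.
have -> : peval U x = dotp (xi - x) xi.
  by rewrite UE dotpDl dotpNl -enormE xi1 expr1n.
by apply: le_trans (dotp_le _ _) _; rewrite xi1 mulr1 enormB.
Qed.

Let U_gt0 x : enorm x < 1 -> 0 < peval U x.
Proof.
move=> x1; rewrite UE subr_gt0; apply: le_lt_trans (dotp_le _ _) _.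
by rewrite xi1 mulr1.
Qed.

Let U_ge0 x : enorm x <= 1 -> 0 <= peval U x.
Proof.
move=> x1; rewrite UE subr_ge0; apply: le_trans (dotp_le _ _) _.
by rewrite xi1 mulr1.
Qed.

Definition barrier (x : 'rV[R]_n) : R := M * peval U x `^ a + peval S x `^ (a / 2).

Let M0 : 0 <= M. Proof. by rewrite divr_ge0// subr_ge0; case/andP: a01 => _ /ltW. Qed.
Let a0 : 0 < a. Proof. by case/andP: a01. Qed.
Let a1 : a < 1. Proof. by case/andP: a01. Qed.

Let Spow x : peval S x `^ (a / 2) = enorm (x - xi) `^ a.
Proof.
by rewrite SE -powR_mulrn ?enorm_ge0// -powRrM mulrCA divff// mulr1.
Qed.

Lemma barrier_ge x : enorm (x - xi) `^ a <= barrier x.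
Proof. by rewrite /barrier Spow lerDr mulr_ge0// powR_ge0. Qed.

Lemma barrier_le x : enorm x <= 1 -> barrier x <= (n%:R / (1 - a) + 1) * enorm (x - xi) `^ a.
Proof.
move=> x1; rewrite /barrier Spow mulrDl mul1r lerD2r ler_wpM2l//.
by apply: ge0_ler_powR; rewrite ?nnegrE ?enorm_ge0 ?U_ge0 ?U_le// ltW.
Qed.

Lemma barrier_within : {within cball, continuous barrier}.
Proof.
move=> x; apply: cvgD.
  apply: cvgM; first exact: cvg_cst.
  have : {within cball, continuous (fun x => peval U x `^ a)}.
    apply: within_powR; first by rewrite a0 ltW.
      by apply: continuous_subspaceT; exact: peval_continuous.
    by move=> y; exact: U_ge0.
  exact.
have : {within cball, continuous (fun x => peval S x `^ (a / 2))}.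
  apply: within_powR; first by apply/andP; split; [have := a0|have := a1]; lra.
    by apply: continuous_subspaceT; exact: peval_continuous.
  by move=> y _; rewrite SE sqr_ge0.
exact.
Qed.

Definition barrier1 i (x : 'rV[R]_n) : R :=
  M * (a * peval U x `^ (a - 1) * peval (pderiv i U) x) +
  (a / 2) * peval S x `^ (a / 2 - 1) * peval (pderiv i S) x.

Definition barrier2 i (x : 'rV[R]_n) : R :=
  M * (a * (a - 1) * peval U x `^ (a - 2) * peval (pderiv i U) x ^+ 2 +
     a * peval U x `^ (a - 1) * peval (pderiv i (pderiv i U)) x) +
  ((a / 2) * (a / 2 - 1) * peval S x `^ (a / 2 - 2) * peval (pderiv i S) x ^+ 2 +
     (a / 2) * peval S x `^ (a / 2 - 1) * peval (pderiv i (pderiv i S)) x).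

Let S_gt0 x : enorm x < 1 -> 0 < peval S x.
Proof.
move=> x1; rewrite SE exprn_gt0//; apply: lt_le_trans (U_le x).
exact: U_gt0.
Qed.

Lemma barrier_is_derive i x : enorm x < 1 -> is_derive x 'e_i barrier (barrier1 i x).
Proof.
move=> x1.
exact: (is_deriveD (is_deriveZ M (is_derive_powR_peval a i (U_gt0 x1)))
  (is_derive_powR_peval (a / 2) i (S_gt0 x1))).
Qed.

Lemma barrier1_is_derive i x : enorm x < 1 ->
  is_derive x 'e_i (barrier1 i) (barrier2 i x).
Proof.
move=> x1.
exact: (is_deriveD (is_deriveZ M (is_derive2_powR_peval a i (U_gt0 x1)))
  (is_derive2_powR_peval (a / 2) i (S_gt0 x1))).
Qed.

(** With [u = U^(a-2)] and [s = S^(a/2-1)] the sum is [- a n u + a n s - a (2 - a) s], and [s <= u]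
    because [U <= |x - xi|] and the exponents are negative. *)
Lemma barrier_superharmonic x : enorm x < 1 -> \sum_i barrier2 i x <= 0.
Proof.
move=> x1; have u0 := U_gt0 x1; have s0 := S_gt0 x1.
have sxi : \sum_i xi ord0 i ^+ 2 = 1.
  transitivity (enorm xi ^+ 2); last by rewrite xi1 expr1n.
  by rewrite enormE; apply: eq_bigr => i _; rewrite expr2.
have sx : \sum_i (x ord0 i - xi ord0 i) ^+ 2 = peval S x.
  by rewrite SE enormE; apply: eq_bigr => i _; rewrite expr2 !mxE.
have ES : peval S x `^ (a / 2 - 2) * peval S x = peval S x `^ (a / 2 - 1).
  rewrite -[X in _ * X]powRr1 ?ltW// -powRD; last by rewrite (gt_eqF s0) implybT.
  by congr (_ `^ _); ring.
have E2 : peval S x `^ (a / 2 - 1) <= peval U x `^ (a - 2).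
  have -> : peval U x `^ (a - 2) = (peval U x ^+ 2) `^ (a / 2 - 1).
    by rewrite -powR_mulrn ?ltW// -powRrM; congr (_ `^ _); field.
  rewrite -(opprB 1 (a / 2)) !powRN lef_pV2 ?posrE ?powR_gt0 ?exprn_gt0//.
  apply: ge0_ler_powR; rewrite ?nnegrE ?sqr_ge0 ?(ltW s0)//; first by have := a1; lra.
  by rewrite SE lerXn2r ?nnegrE ?enorm_ge0 ?(ltW u0).
have E3 : \sum_i barrier2 i x = \sum_i ((M * (a * (a - 1) * peval U x `^ (a - 2))) * xi ord0 i ^+ 2 +
  ((a / 2) * (a / 2 - 1) * peval S x `^ (a / 2 - 2) * 4) * (x ord0 i - xi ord0 i) ^+ 2 +
  a * peval S x `^ (a / 2 - 1)).
  by apply: eq_bigr => i _; rewrite /barrier2 U1 U2 S1 S2; field.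
rewrite {}E3; move: (peval U x) (peval S x) u0 s0 sx ES E2 => pu ps u0 s0 sx ES E2.
have lin (A B C : R) (f g : 'I_n -> R) : \sum_i (A * f i + B * g i + C) =
    A * (\sum_i f i) + B * (\sum_i g i) + n%:R * C.
  by rewrite !big_split /= -!mulr_sumr sumr_const card_ord mulr_natl.
rewrite lin sxi sx mulr1.
have -> : a / 2 * (a / 2 - 1) * ps `^ (a / 2 - 2) * 4 * ps =
   a * (a - 2) * ps `^ (a / 2 - 1).
  by rewrite -ES; field.
set u := pu `^ _ in E2 *; set s := ps `^ _ in E2 *.
have s_ge0 : 0 <= s by exact: powR_ge0.
have -> : M * (a * (a - 1) * u) = - (a * n%:R * u).
  by rewrite /M; field; rewrite gt_eqF// subr_gt0.
have : n%:R * s <= n%:R * u by rewrite ler_wpM2l.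
have a1' := a1; have a0' := a0.
have : 0 <= (2 - a) * s by rewrite mulr_ge0//; lra.
move=> h1 h2.
have : 0 <= a * (n%:R * u - n%:R * s + (2 - a) * s).
  by apply: mulr_ge0; [exact: ltW|lra].
lra.
Qed.

End barrier.

Section harmonic_functions.
Context {R : realType} {n : nat}.
Local Notation "'e_ i" := (delta_mx ord0 i : 'rV[R]_n) (at level 8, i at level 2).
Implicit Types (f g w : 'rV[R]_n -> R) (x y xi : 'rV[R]_n).
Hypothesis n0 : (0 < n)%N.

Lemma is_derive_translate f x v h (d : R) :
  is_derive (x + h) v f d -> is_derive x v (fun y => f (y + h)) d.
Proof.
move=> [d1 d2].
have E : (fun t : R => t^-1 *: ((f \o shift (x + h)) (t *: v) - f (x + h)))
   = (fun t : R => t^-1 *: (((fun y => f (y + h)) \o shift x) (t *: v) - f (x + h))).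
  by apply/funext => t /=; rewrite addrA.
by split; [move: d1; rewrite /derivable E | move: d2; rewrite /derive E].
Qed.

Lemma harm_lim_harmonic f : harm_lim f -> harmonic_on (eball n) f.
Proof. by move=> [F hF Ff]; exact: ulim_harmonic Ff. Qed.

Lemma harm_lim_max f (c : R) : harm_lim f ->
  (forall x, enorm x = 1 -> `|f x| <= c) -> forall x, enorm x <= 1 -> `|f x| <= c.
Proof.
move=> [F hF Ff] fc x x1; apply/ler_addgt0Pr => e e0.
have [N hN] := Ff _ (divr_gt0 e0 (ltr0n _ 2)).
have h : `|peval (F N) x| <= c + e / 2.
  apply: (@pharm_max R n n0 (F N) 1) => // y y1.
  rewrite -(subrK (f y) (peval (F N) y)); apply: le_trans (ler_normD _ _) _.
  rewrite addrC lerD//; first exact: fc.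
  by apply: hN => //; rewrite /cball /= y1.
rewrite -(subrK (peval (F N) x) (f x)); apply: le_trans (ler_normD _ _) _.
have := hN N (leqnn _) x x1; rewrite distrC; lra.
Qed.

(** [pharm_gradient] bounds each partial derivative by [sqrt grad_cst * M / (1 - rho^2)]; the root
    is dropped as [grad_cst >= 1], and [n] counts the coordinates. The slack [e / (K + 1)] pays for
    the approximation on the sphere. *)
Lemma harm_lim_lipschitz f (M rho : R) x y : harm_lim f ->
  (forall z, enorm z = 1 -> `|f z| <= M) -> 0 < rho < 1 ->
  enorm x <= rho -> enorm y <= rho ->
  `|f y - f x| <= n%:R * @grad_cst R n * M / (1 - rho ^+ 2) * enorm (y - x).
Proof.
move=> [F hF Ff] fM /andP[r0 r1] xr yr.
have rho2 : 0 < 1 - rho ^+ 2 by rewrite subr_gt0 expr_lt1// ltW.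
have C1 := @grad_cst_ge1 R n.
have M0 : 0 <= M by apply: le_trans (fM 'e_(Ordinal n0) (enorm_delta _)).
have xb : cball x by apply: le_trans xr _; exact: ltW.
have yb : cball y by apply: le_trans yr _; exact: ltW.
pose K := n%:R * @grad_cst R n / (1 - rho ^+ 2) * enorm (y - x).
have K0 : 0 <= K.
  apply: mulr_ge0; last exact: enorm_ge0.
  by apply: divr_ge0; [apply: mulr_ge0 => //; exact: le_trans C1|exact: ltW].
rewrite (_ : _ * enorm (y - x) = K * M); last by rewrite /K; ring.
apply/ler_addgt0Pr => e e0.
have e'0 : 0 < e / (K + 1) by rewrite divr_gt0// ltr_wpDl.
have [N hN] := Ff _ e'0.
have FN (k : nat) : (N <= k)%N -> `|peval (F k) y - peval (F k) x| <= K * (M + e / (K + 1)).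
  move=> kN; have [t [/andP[t0 t1] ->]] := peval_mvt (F k) x y.
  set z := t *: (y - x) + x.
  have zr : enorm z <= rho.
    have -> : z = t *: y + (1 - t) *: x by rewrite /z scalerBl scale1r scalerBr addrAC addrA.
    apply: le_trans (enorm_triangle _ _) _; rewrite !enormZ !ger0_norm ?subr_ge0//.
    have : t * enorm y <= t * rho by rewrite ler_wpM2l.
    have : (1 - t) * enorm x <= (1 - t) * rho by rewrite ler_wpM2l// subr_ge0.
    lra.
  have FM u : enorm u = 1 -> `|peval (F k) u| <= M + e / (K + 1).
    move=> u1; rewrite -(subrK (f u) (peval (F k) u)); apply: le_trans (ler_normD _ _) _.
    by rewrite addrC lerD//; [exact: fM|apply: hN => //; rewrite /cball /= u1].
  have M'0 : 0 <= M + e / (K + 1) by rewrite addr_ge0// ltW.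
  have dz j : `|peval (pderiv j (F k)) z| <= @grad_cst R n * (M + e / (K + 1)) / (1 - rho ^+ 2).
    have := @pharm_gradient R n n0 (F k) 1 (M + e / (K + 1)) j _ (hF k) FM z _.
    rewrite expr1n ltr01 lexx => /(_ isT (le_trans zr (ltW r1))) h.
    rewrite ler_pdivlMr// -(@ler_pXn2r _ 2)// ?nnegrE ?mulr_ge0 ?(ltW rho2)//; last exact: le_trans C1.
    rewrite exprMn real_normK ?num_real// mulrC.
    apply: (@le_trans _ _ ((1 - enorm z ^+ 2) ^+ 2 * peval (pderiv j (F k)) z ^+ 2)).
      rewrite ler_wpM2r ?sqr_ge0// lerXn2r ?nnegrE ?(ltW rho2)//.
        by rewrite subr_ge0 expr_le1 ?enorm_ge0// (le_trans zr)// ltW.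
      by rewrite lerD2l lerN2 lerXn2r ?nnegrE ?enorm_ge0// ltW.
    apply: le_trans h _; rewrite exprMn ler_wpM2r ?sqr_ge0// expr2.
    by rewrite ler_peMr// (le_trans _ C1).
  apply: le_trans (ler_norm_sum _ _ _) _.
  apply: (@le_trans _ _ (\sum_(j < n) enorm (y - x) *
      (@grad_cst R n * (M + e / (K + 1)) / (1 - rho ^+ 2)))).
    apply: ler_sum => j _; rewrite normrM ler_pM ?coord_le_enorm//.
  rewrite sumr_const card_ord -mulr_natl /K.
  by rewrite le_eqVlt; apply/orP; left; apply/eqP; ring.
have cv : (fun k => peval (F k) y - peval (F k) x) @ \oo --> f y - f x.
  by apply: cvgB; exact: ulim_cvg Ff _.
apply: (@le_trans _ _ (K * (M + e / (K + 1)))).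
  rewrite -[leLHS](subr0) -[f y - f x]subr0.
  have := @cvgn_dist_le R _ _ 0 (K * (M + e / (K + 1))) N cv.
  by rewrite !subr0; apply => k /FN; rewrite subr0.
rewrite mulrDr lerD2l mulrCA ler_piMr ?ltW//.
by rewrite ltr_pdivrMr ?ltr_wpDl// mul1r ltrDl.
Qed.

Lemma harmonic_on_is_derive f i x : harmonic_on (eball n) f -> enorm x < 1 ->
  is_derive x 'e_i f (dpart [:: i] f x) /\
  is_derive x 'e_i (dpart [:: i] f) (dpart [:: i; i] f x).
Proof.
move=> [cf _] x1; split; apply: DeriveDef => //.
- by have [_ /(_ isT i)] := cf [::] isT x x1.
- by have [_ /(_ isT i)] := cf [:: i] isT x x1.
Qed.

Lemma superharmonic_comparison f (B : 'rV[R]_n -> R) (p q : 'I_n -> 'rV[R]_n -> R) :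
  {within cball, continuous f} -> harmonic_on (eball n) f ->
  {within cball, continuous B} ->
  (forall i x, enorm x < 1 -> is_derive x 'e_i B (p i x)) ->
  (forall i x, enorm x < 1 -> is_derive x 'e_i (p i) (q i x)) ->
  (forall x, enorm x < 1 -> \sum_i q i x <= 0) ->
  (forall x, enorm x = 1 -> f x <= B x) ->
  forall x, enorm x <= 1 -> f x <= B x.
Proof.
move=> cf hf cB dB ddB lB fB x x1; rewrite -subr_le0.
apply: (@maximum_principle R n cball (eball n) (f - B)
  (fun i => dpart [:: i] f - p i) (fun i x => dpart [:: i; i] f x - q i x)) => //.
- exact: compact_cball.
- exact: open_eball.
- by move=> y /= /ltW.
- by move=> y; apply: cvgB; [exact: cf|exact: cB].
- move=> y i y1; have [h _] := harmonic_on_is_derive i hf y1.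
  exact: (is_deriveB h (dB i y y1)).
- move=> y i y1; have [_ h] := harmonic_on_is_derive i hf y1.
  exact: (is_deriveB h (ddB i y y1)).
- move=> y y1; rewrite big_split /= sumrN; have [_ ->] := hf => //.
  by rewrite sub0r oppr_ge0 lB.
- move=> y y1 y2; rewrite -[_ y]/(f y - B y) subr_le0; apply: fB.
  apply/le_anti; rewrite y1 /= leNgt; exact/negP.
Qed.

(** Derivation commutes with the sign only where derivatives exist, so the identity for [dpart] is
    proved on the open ball and used through its validity near each point. *)
Lemma harmonic_onN f : harmonic_on (eball n) f -> harmonic_on (eball n) (fun x => - f x).
Proof.
move=> [cf lf].
have E (s : seq 'I_n) : (size s <= 2)%N -> forall x, enorm x < 1 ->
    dpart s (fun x => - f x) x = - dpart s f x.
  elim: s => [//|i s ih] /= si x x1.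
  rewrite -deriveN; last by have [_ /(_ si)] := cf s (ltnW si) x x1.
  apply: near_eq_derive.
  have : \forall y \near x, enorm y < 1.
    by have := @open_enorm_ball R n 1; rewrite openE => /(_ _ x1).
  by apply: filterS => y y1; rewrite ih// ltnW.
have nE (s : seq 'I_n) x : (size s <= 2)%N -> enorm x < 1 ->
    \forall y \near x, (- dpart s f) y = dpart s (fun x => - f x) y.
  move=> s2 x1; have : \forall y \near x, enorm y < 1.
    by have := @open_enorm_ball R n 1; rewrite openE => /(_ _ x1).
  by apply: filterS => y y1; rewrite E.
split=> [s s2 x x1|x x1].
  have [c1 d1] := cf s s2 x x1; split.
    move: c1 => /continuous_enormP c1; apply/continuous_enormP => e /c1[d d0 hd].
    exists (Num.min d (1 - enorm x)); first by rewrite lt_min d0 subr_gt0.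
    move=> y; rewrite lt_min => /andP[/hd yx y1].
    have := enorm_triangle (y - x) x; rewrite subrK => yy.
    have y1' : enorm y < 1 by lra.
    by rewrite (E _ s2 _ y1') (E _ s2 _ x1) -opprD normrN.
  move=> h i; apply: near_eq_derivable (nE s x s2 x1) _.
  exact/derivableN/d1.
rewrite (eq_bigr (fun i => - dpart [:: i; i] f x)) => [|i _]; last by rewrite E.
by rewrite sumrN lf ?oppr0.
Qed.

Lemma harmonic_unique f g : {within cball, continuous f} -> {within cball, continuous g} ->
  harmonic_on (eball n) f -> harmonic_on (eball n) g ->
  (forall x, enorm x = 1 -> f x = g x) -> forall x, enorm x <= 1 -> f x = g x.
Proof.
move=> cf cg hf hg fg x x1.
have H f1 g1 : {within cball, continuous f1} -> {within cball, continuous g1} ->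
  harmonic_on (eball n) f1 -> harmonic_on (eball n) g1 ->
  (forall x, enorm x = 1 -> f1 x = g1 x) -> f1 x <= g1 x.
  move=> cf1 cg1 hf1 hg1 fg1.
  apply: (@superharmonic_comparison f1 g1 (fun i => dpart [:: i] g1) (fun i => dpart [:: i; i] g1)) => //.
  - by move=> i y y1; have [] := harmonic_on_is_derive i hg1 y1.
  - by move=> i y y1; have [] := harmonic_on_is_derive i hg1 y1.
  - by move=> y y1; have [_ ->] := hg1.
  - by move=> y /fg1 ->.
by apply/le_anti; rewrite !H// => y /fg ->.
Qed.

(** On the sphere [C * barrier + f xi] dominates [f], since the barrier is at least [|x - xi|^a];
    comparison carries this inside, and likewise for [- f]. *)
Lemma holder_from_sphere f (C a : R) xi : {within cball, continuous f} ->
  harmonic_on (eball n) f -> 0 < a < 1 -> enorm xi = 1 -> 0 <= C ->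
  (forall x, enorm x = 1 -> `|f x - f xi| <= C * enorm (x - xi) `^ a) ->
  forall x, enorm x <= 1 ->
    `|f x - f xi| <= C * (n%:R / (1 - a) + 1) * enorm (x - xi) `^ a.
Proof.
move=> cf hf a01 xi1 C0 fC x x1.
have H f1 : {within cball, continuous f1} -> harmonic_on (eball n) f1 ->
   (forall x, enorm x = 1 -> f1 x - f1 xi <= C * enorm (x - xi) `^ a) ->
   f1 x - f1 xi <= C * (n%:R / (1 - a) + 1) * enorm (x - xi) `^ a.
  move=> cf1 hf1 fC1.
  have : f1 x <= (C \*: barrier xi a + cst (f1 xi)) x.
    apply: (@superharmonic_comparison f1 _ (fun i => C \*: barrier1 xi a i) (fun i x => C * barrier2 xi a i x)) => //.
    - move=> y; apply: cvgD; last exact: cvg_cst.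
      by apply: cvgM; [exact: cvg_cst|exact: barrier_within].
    - move=> i y y1.
      have := is_deriveD (is_deriveZ C (@barrier_is_derive R n xi a xi1 i y y1)) (is_derive_cst (f1 xi) y 'e_i).
      by rewrite addr0.
    - move=> i y y1; exact: (is_deriveZ C (@barrier1_is_derive R n xi a xi1 i y y1)).
    - move=> y y1; rewrite -mulr_sumr mulr_ge0_le0//; exact: barrier_superharmonic.
    - move=> y y1; rewrite -[leRHS]/(C * barrier xi a y + f1 xi) -lerBlDr.
      apply: le_trans (fC1 _ y1) _; rewrite ler_wpM2l//; exact: barrier_ge.
  rewrite -[leRHS]/(C * barrier xi a x + f1 xi) -lerBlDr => /le_trans; apply.
  by rewrite -mulrA ler_wpM2l// barrier_le.
rewrite ler_norml; apply/andP; split; last first.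
  by apply: H => // y y1; apply: le_trans (ler_norm _) (fC _ y1).
rewrite lerNl opprB addrC -[f xi]opprK.
apply: (H (fun x => - f x)); [|exact: harmonic_onN|].
  by move=> y; apply: cvgN; exact: cf.
move=> y y1; rewrite opprK addrC; apply: le_trans (ler_norm _) _.
by rewrite distrC fC.
Qed.

(** The increment [f (z + h) - f z] is harmonic on the intersection of the ball with its translate.
    At a boundary point of this lens [z] or [z + h] is on the sphere, where the hypothesis bounds
    the increment. *)
Lemma holder_in_ball f (C a : R) : {within cball, continuous f} ->
  harmonic_on (eball n) f -> 0 <= a -> 0 <= C ->
  (forall xi x, enorm xi = 1 -> enorm x <= 1 -> `|f x - f xi| <= C * enorm (x - xi) `^ a) ->
  forall x y, enorm x <= 1 -> enorm y <= 1 -> `|f x - f y| <= C * enorm (x - y) `^ a.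
Proof.
move=> cf hf a0 C0 fC.
suff H x y : enorm x <= 1 -> enorm y <= 1 -> f x - f y <= C * enorm (x - y) `^ a.
  move=> x y x1 y1; rewrite ler_norml lerNl opprB; apply/andP; split; last exact: H.
  by rewrite enormB; exact: H.
move=> x1 y1; pose h : 'rV[R]_n := x - y.
have -> : x = y + h by rewrite /h addrC subrK.
rewrite [y + h - y]addrC addKr.
have yh1 : enorm (y + h) <= 1 by rewrite /h addrC subrK.
pose K := [set z : 'rV[R]_n | enorm z <= 1 /\ enorm (z - (- h)) <= 1].
pose U := [set z : 'rV[R]_n | enorm z < 1 /\ enorm (z - (- h)) < 1].
apply: (@maximum_principle R n K U (fun z => f (z + h) - f z)
  (fun i z => dpart [:: i] f (z + h) - dpart [:: i] f z)
  (fun i z => dpart [:: i; i] f (z + h) - dpart [:: i; i] f z)) => //.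
- have -> : K = cball `&` [set z | enorm (z - (- h)) <= 1] by [].
  apply: compact_closedI; [exact: compact_cball|exact: closed_enorm_le].
- have -> : U = [set z | enorm z < 1] `&` [set z | enorm (z - (- h)) < 1] by [].
  by apply: openI; [exact: open_enorm_ball|exact: open_enorm_lt].
- by move=> z [/ltW z1 /ltW z2].
- apply/continuous_within_enormP => z [z1 z2] e e0.
  move/continuous_within_enormP : cf => cf; rewrite opprK in z2.
  have [d d0 hd] := cf _ z1 _ (divr_gt0 e0 (ltr0n _ 2)).
  have [d' d'0 hd'] := cf _ z2 _ (divr_gt0 e0 (ltr0n _ 2)).
  exists (Num.min d d'); first by rewrite lt_min d0.
  move=> u [u1 u2]; rewrite opprK in u2; rewrite lt_min => /andP[uz uz'].
  have h1 := hd _ u1 uz; have h2 := hd' _ u2.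
  rewrite (_ : u + h - (z + h) = u - z) in h2; last by rewrite opprD addrACA subrr addr0.
  rewrite (_ : _ - _ = (f (u + h) - f (z + h)) - (f u - f z)); last by ring.
  by apply: le_lt_trans (ler_normB _ _) _; have := h2 uz'; lra.
- move=> z i [z1 z2]; rewrite opprK in z2.
  have [h1 _] := harmonic_on_is_derive i hf z1.
  have [h2 _] := harmonic_on_is_derive i hf z2.
  exact: (is_deriveB (is_derive_translate h2) h1).
- move=> z i [z1 z2]; rewrite opprK in z2.
  have [_ h1] := harmonic_on_is_derive i hf z1.
  have [_ h2] := harmonic_on_is_derive i hf z2.
  exact: (is_deriveB (is_derive_translate h2) h1).
- move=> z [z1 z2]; rewrite opprK in z2; have [_ lf] := hf.
  have aux (G1 G2 : 'I_n -> R) : \sum_i G1 i = 0 -> \sum_i G2 i = 0 ->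
      0 <= \sum_i (G1 i - G2 i).
    by move=> e1 e2; rewrite sumrB e1 e2 subrr.
  exact: aux (lf _ z2) (lf _ z1).
- move=> z [z1 z2] nU; rewrite opprK in z2.
  have [z1'|z1'] := eqVneq (enorm z) 1.
    apply: le_trans (ler_norm _) _.
    by have := fC z (z + h) z1' z2; rewrite [z + h - z]addrC addKr.
  have [z2'|z2'] := eqVneq (enorm (z + h)) 1.
    apply: le_trans (ler_norm _) _; rewrite distrC.
    by have := fC (z + h) z z2' z1; rewrite enormB [z + h - z]addrC addKr.
  exfalso; apply: nU; rewrite /U /= opprK !lt_neqAle z1' z2'; split => //.
- by split; rewrite ?opprK.
Qed.

End harmonic_functions.

(** * Harmonic extension of angular data *)

Section weierstrass.
Context {R : realType}.

(* The Bernstein polynomial of order [N], defined by the recursion satisfied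
   by the expectation of [g (X_1 + .. + X_N)], the [X_i] being independent
   Bernoulli variables of parameter ['X]. *)
Fixpoint bernstein (N : nat) (g : nat -> R) : {poly R} :=
  if N is N'.+1 then (1 - 'X) * bernstein N' g + 'X * bernstein N' (g \o S)
  else (g 0)%:P.

Lemma bernstein_le N g1 g2 (x : R) : 0 <= x <= 1 ->
  (forall i, (i <= N)%N -> g1 i <= g2 i) ->
  (bernstein N g1).[x] <= (bernstein N g2).[x].
Proof.
move=> /andP[x0 x1]; elim: N g1 g2 => [|N ih] g1 g2 h /=; first by rewrite !hornerE h.
rewrite !hornerE lerD// ler_wpM2l ?subr_ge0//; apply: ih => i iN; apply: h => //.
exact: leqW.
Qed.

Lemma bernstein_lin N g1 g2 (a b x : R) :
  (bernstein N (fun i => a * g1 i + b * g2 i)).[x] =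
  a * (bernstein N g1).[x] + b * (bernstein N g2).[x].
Proof.
elim: N g1 g2 => [|N ih] g1 g2 /=; first by rewrite !hornerE.
rewrite !hornerE ih; have := ih (g1 \o S) (g2 \o S) => /= ->; ring.
Qed.

Lemma bernstein1 N (x : R) : (bernstein N (fun=> 1)).[x] = 1.
Proof.
elim: N => [|N ih] /=; first by rewrite !hornerE.
by rewrite !hornerE !ih; ring.
Qed.

(** The second moment about [c] of the binomial law with parameters [N] and [x]: variance plus
    squared bias. *)
Lemma bernstein_sqr N (c x : R) : (bernstein N (fun i => (i%:R - c) ^+ 2)).[x] =
  N%:R * x * (1 - x) + (N%:R * x - c) ^+ 2.
Proof.
elim: N c => [|N ih] c /=; first by rewrite !hornerE; ring.
rewrite !hornerE ih (_ : _ \o S = fun i => (i%:R - (c - 1)) ^+ 2).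
  by rewrite ih -[N.+1%:R]natr1; ring.
by apply/funext => i /=; rewrite -natr1; congr (_ ^+ 2); ring.
Qed.

(** By [L d <= L^2 d^2 / eps + eps / 4], the error [|f (i/N) - f x|] is at most a quadratic
    polynomial in [i], whose Bernstein polynomial is known exactly; [N >= L^2 / eps^2] makes the
    result at most [eps]. *)
Lemma weierstrass_lipschitz (f : R -> R) (L eps : R) : 0 < eps -> 0 < L ->
  (forall x y, 0 <= x <= 1 -> 0 <= y <= 1 -> `|f x - f y| <= L * `|x - y|) ->
  exists q : {poly R}, forall x, 0 <= x <= 1 -> `|q.[x] - f x| <= eps.
Proof.
move=> eps0 L0 fL; pose N := (Num.truncn (L ^+ 2 / eps ^+ 2)).+1.
have N0 : 0 < N%:R :> R by rewrite ltr0n.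
have NL : L ^+ 2 / eps ^+ 2 <= N%:R by apply: ltW; exact: truncnS_gt.
exists (bernstein N (fun i => f (i%:R / N%:R))) => x x01.
have /andP[x0 x1] := x01.
have key (c : R) : `|c| = 1 -> c * ((bernstein N (fun i => f (i%:R / N%:R))).[x] - f x) <= eps.
  move=> c1.
  pose g (i : nat) := (L ^+ 2 / (eps * N%:R ^+ 2)) * (i%:R - N%:R * x) ^+ 2 + (eps / 4) * 1.
  have -> : c * ((bernstein N (fun i => f (i%:R / N%:R))).[x] - f x) =
     (bernstein N (fun i => c * f (i%:R / N%:R) + (- c * f x) * 1)).[x].
    by rewrite (bernstein_lin _ _ (fun=> 1)) bernstein1; ring.
  apply: (@le_trans _ _ (bernstein N g).[x]).
    apply: bernstein_le => // i iN.
    have iN01 : 0 <= (i%:R / N%:R : R) <= 1.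
      by rewrite divr_ge0//= ler_pdivrMr// mul1r ler_nat.
    rewrite mulr1 mulNr -mulrBr.
    apply: le_trans (ler_norm _) _; rewrite normrM c1 mul1r.
    apply: le_trans (fL _ _ iN01 x01) _; rewrite /g.
    set d := `|_|.
    have -> : (i%:R - N%:R * x) ^+ 2 = N%:R ^+ 2 * d ^+ 2.
      by rewrite /d real_normK ?num_real//; field; rewrite gt_eqF.
    have -> : L ^+ 2 / (eps * N%:R ^+ 2) * (N%:R ^+ 2 * d ^+ 2) + eps / 4 * 1 =
       L * d + (L * d - eps / 2) ^+ 2 / eps by field; rewrite !gt_eqF.
    by rewrite lerDl divr_ge0 ?sqr_ge0// ltW.
  rewrite (bernstein_lin _ _ (fun=> 1)) bernstein1 bernstein_sqr subrr expr0n addr0.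
  have xx : x * (1 - x) <= 4^-1 by have := sqr_ge0 (x - 2^-1); rewrite expr2; lra.
  have h : L ^+ 2 <= eps ^+ 2 * N%:R.
    by rewrite mulrC -ler_pdivrMr ?exprn_gt0.
  have -> : L ^+ 2 / (eps * N%:R ^+ 2) * (N%:R * x * (1 - x)) =
    (L ^+ 2 / (eps * N%:R)) * (x * (1 - x)) by field; rewrite !gt_eqF.
  have h2 : L ^+ 2 / (eps * N%:R) <= eps.
    by rewrite ler_pdivrMr ?mulr_gt0// mulrA -expr2.
  have : L ^+ 2 / (eps * N%:R) * (x * (1 - x)) <= eps * 4^-1.
    by apply: ler_pM => //; [rewrite divr_ge0 ?sqr_ge0// mulr_ge0// ltW|
      rewrite mulr_ge0// subr_ge0].
  lra.
rewrite ler_norml; apply/andP; split.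
  by rewrite lerNl -mulN1r key// normrN1.
by have := key 1 (normr1 _); rewrite mul1r.
Qed.

End weierstrass.

Section angular_polynomials.
Context {R : realType} {n : nat}.
Variables (i0 i1 : 'I_n).
Hypothesis i01 : i0 != i1.
Implicit Types (x y : 'rV[R]_n) (e : pexpr R n).

Fixpoint zpow (k : nat) : pexpr R n * pexpr R n :=
  if k is k'.+1 then
    (PAdd (PMul (PVar i0) (zpow k').1) (pscale (-1) (PMul (PVar i1) (zpow k').2)),
     PAdd (PMul (PVar i0) (zpow k').2) (PMul (PVar i1) (zpow k').1))
  else (PCst 1, PCst 0).

Definition zre k x := peval (zpow k).1 x.
Definition zim k x := peval (zpow k).2 x.

Lemma zreS k x : zre k.+1 x = x ord0 i0 * zre k x - x ord0 i1 * zim k x.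
Proof. by rewrite /zre /= mulN1r. Qed.

Lemma zimS k x : zim k.+1 x = x ord0 i0 * zim k x + x ord0 i1 * zre k x.
Proof. by []. Qed.

Lemma zpowE k x : ((x ord0 i0 +i* x ord0 i1)%C ^+ k = (zre k x +i* zim k x)%C)%R.
Proof.
elim: k => [|k ih]; first by rewrite expr0.
rewrite exprS ih zreS zimS; apply/eqP; rewrite eq_complex /=.
by rewrite eqxx /= addrC eqxx.
Qed.

Definition ssq x := x ord0 i0 ^+ 2 + x ord0 i1 ^+ 2.

Lemma zre_zim k x : zre k x ^+ 2 + zim k x ^+ 2 = ssq x ^+ k.
Proof.
elim: k => [|k ih]; first by rewrite expr0 /zre /zim /=; ring.
rewrite zreS zimS [ssq x ^+ k.+1]exprS -ih /ssq; ring.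
Qed.

(** This is [Re ((c + i d) z^k)]. Carrying the phase [(c, d)] keeps the class stable under
    derivation and under rotations of [z]. *)
Definition zang (c d : R) k := PAdd (pscale c (zpow k).1) (pscale (- d) (zpow k).2).

Lemma zangE c d k x : peval (zang c d k) x = c * zre k x - d * zim k x.
Proof. by rewrite /= mulNr. Qed.

Lemma zpow_deriv k i x :
  peval (pderiv i (zpow k).1) x =
    (i == i0)%:R * (k%:R * zre k.-1 x) - (i == i1)%:R * (k%:R * zim k.-1 x) /\
  peval (pderiv i (zpow k).2) x =
    (i == i0)%:R * (k%:R * zim k.-1 x) + (i == i1)%:R * (k%:R * zre k.-1 x).
Proof.
elim: k => [|k [ih1 ih2]]; first by split; rewrite /=; ring.
rewrite /= ih1 ih2 -/(zre k x) -/(zim k x).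
case: k {ih1 ih2} => [|k]; first by split; rewrite /zre /zim /=; ring.
have [->|h0] := eqVneq i i0; have [E|h1] := eqVneq _ i1.
- by move/eqP: i01; rewrite E.
- by rewrite zreS zimS -[k.+2%:R]natr1; split; ring.
- by rewrite zreS zimS -[k.+2%:R]natr1; split; ring.
- by rewrite ?mulr0n; split; ring.
Qed.

Lemma zang_deriv c d k i x : peval (pderiv i (zang c d k)) x =
  k%:R * ((i == i0)%:R * peval (zang c d k.-1) x + (i == i1)%:R * peval (zang (- d) c k.-1) x).
Proof.
have [h1 h2] := zpow_deriv k i x.
rewrite !zangE /zang /= h1 h2; ring.
Qed.

Lemma zang_deriv_out c d k i x : i != i0 -> i != i1 -> peval (pderiv i (zang c d k)) x = 0.
Proof. by move=> h0 h1; rewrite zang_deriv (negPf h0) (negPf h1) !mul0r addr0 mulr0. Qed.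

Lemma zang_euler c d k x :
  x ord0 i0 * peval (pderiv i0 (zang c d k)) x + x ord0 i1 * peval (pderiv i1 (zang c d k)) x =
  k%:R * peval (zang c d k) x.
Proof.
rewrite !zang_deriv !eqxx (negPf i01) eq_sym (negPf i01).
case: k => [|k]; first by ring.
rewrite !zangE zreS zimS /=; ring.
Qed.

(* The second derivatives of a function determined by first derivatives of the
   form [a * zang] are again of that form. *)
Lemma zang_deriv2 c d k i x : peval (pderiv i (pderiv i (zang c d k))) x =
  k%:R * ((i == i0)%:R * peval (pderiv i (zang c d k.-1)) x +
          (i == i1)%:R * peval (pderiv i (zang (- d) c k.-1)) x).
Proof.
rewrite (@peval_pderiv_ext _ _ _ (pscale k%:R (PAdd (pscale (i == i0)%:R (zang c d k.-1))
  (pscale (i == i1)%:R (zang (- d) c k.-1)))) i (zang_deriv c d k i)).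
move: (zang c d k.-1) (zang (- d) c k.-1) => e1 e2 /=; ring.
Qed.

Lemma zang_deriv2_out c d k i x : i != i0 -> i != i1 ->
  peval (pderiv i (pderiv i (zang c d k))) x = 0.
Proof. by move=> h0 h1; rewrite zang_deriv2 (negPf h0) (negPf h1) !mul0r addr0 mulr0. Qed.

Lemma zang_harmonic c d k x :
  peval (pderiv i0 (pderiv i0 (zang c d k))) x +
  peval (pderiv i1 (pderiv i1 (zang c d k))) x = 0.
Proof.
have i10 : i1 != i0 by rewrite eq_sym.
rewrite !zang_deriv2 !eqxx !zang_deriv !eqxx !(negPf i01) !(negPf i10) ?mulr0n ?mulr1n.
rewrite !zangE; ring.
Qed.

Fixpoint ppow e m := if m is m'.+1 then PMul e (ppow e m') else PCst 1.

Lemma peval_ppow e m x : peval (ppow e m) x = peval e x ^+ m.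
Proof. by elim: m => //= m ->; rewrite exprS. Qed.

Lemma ppow_deriv e m i x : peval (pderiv i (ppow e m)) x =
  m%:R * peval e x ^+ m.-1 * peval (pderiv i e) x.
Proof.
elim: m => [|m ih] /=; first by ring.
rewrite ih peval_ppow; case: m {ih} => [|m]; first by rewrite expr0; ring.
by rewrite -[m.+2%:R]natr1 exprS /=; ring.
Qed.

Lemma ppow_deriv2 e m i x : peval (pderiv i (pderiv i (ppow e m))) x =
  m%:R * m.-1%:R * peval e x ^+ m.-2 * peval (pderiv i e) x ^+ 2 +
  m%:R * peval e x ^+ m.-1 * peval (pderiv i (pderiv i e)) x.
Proof.
rewrite (@peval_pderiv_ext _ _ _ (PMul (pscale m%:R (ppow e m.-1)) (pderiv i e))); last first.
  by move=> y; rewrite ppow_deriv /= peval_ppow.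
rewrite /= ppow_deriv peval_ppow; ring.
Qed.

Lemma pmul_deriv2 e1 e2 i x : peval (pderiv i (pderiv i (PMul e1 e2))) x =
  peval (pderiv i (pderiv i e1)) x * peval e2 x +
  2 * peval (pderiv i e1) x * peval (pderiv i e2) x +
  peval e1 x * peval (pderiv i (pderiv i e2)) x.
Proof. by rewrite /=; ring. Qed.

Definition outer (i : 'I_n) := (i != i0) && (i != i1).

Definition pss := PAdd (PMul (PVar i0) (PVar i0)) (PMul (PVar i1) (PVar i1)) : pexpr R n.
Definition ptt := psum (fun i => PMul (PCst (outer i)%:R) (PMul (PVar i) (PVar i))) : pexpr R n.
Definition tsq x := peval ptt x.

Lemma pssE x : peval pss x = ssq x.
Proof. by rewrite /= -!expr2. Qed.

Lemma tsqE x : tsq x = \sum_(i | outer i) x ord0 i ^+ 2.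
Proof.
rewrite /tsq peval_psum [RHS]big_mkcond; apply: eq_bigr => i _ /=.
by case: outer; rewrite ?mul1r ?mul0r ?expr2.
Qed.

Lemma sum_outer (F : 'I_n -> R) : \sum_i F i = F i0 + F i1 + \sum_(i | outer i) F i.
Proof.
rewrite (bigD1 i0)//= (bigD1 i1) ?(eq_sym i1)//= addrA; congr (_ + _).
Qed.

Lemma enorm_ssq_tsq x : enorm x ^+ 2 = ssq x + tsq x.
Proof.
rewrite enormE /dotp (sum_outer (fun i => x ord0 i * x ord0 i)) tsqE /ssq.
by rewrite !expr2; congr (_ + _); apply: eq_bigr => i _; rewrite expr2.
Qed.

Lemma ptt_deriv i x : peval (pderiv i ptt) x = (outer i)%:R * (2 * x ord0 i).
Proof.
rewrite peval_pderiv_psum (bigD1 i)//= eqxx mulr1n big1; first by ring.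
by move=> j ji; rewrite eq_sym (negPf ji) mulr0n; ring.
Qed.

Lemma ptt_deriv2 i x : peval (pderiv i (pderiv i ptt)) x = (outer i)%:R * 2.
Proof.
rewrite peval_pderiv2_psum (bigD1 i)//= eqxx mulr1n big1; first by ring.
by move=> j ji; rewrite eq_sym (negPf ji) mulr0n; ring.
Qed.

Lemma pss_deriv i x : peval (pderiv i pss) x = (~~ outer i)%:R * (2 * x ord0 i).
Proof.
rewrite /= /outer; have [->|h0] := eqVneq i i0; first by rewrite (negPf i01) mulr1n mulr0n /=; ring.
by have [->|h1] := eqVneq i i1; rewrite /= ?mulr1n ?mulr0n; ring.
Qed.

Lemma pss_deriv2 i x : peval (pderiv i (pderiv i pss)) x = (~~ outer i)%:R * 2.
Proof.
rewrite /= /outer; have [->|h0] := eqVneq i i0; first by rewrite (negPf i01) mulr1n mulr0n /=; ring.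
by have [_|h1] := eqVneq i i1; rewrite /= ?mulr1n ?mulr0n; ring.
Qed.

Let card_setC2 : (2 + #|~: [set i0; i1]| = n)%N.
Proof. by rewrite -[RHS]card_ord -(cardsC [set i0; i1]) cards2 i01. Qed.

Lemma card_outer : #|[pred i | outer i]| = (n - 2)%N.
Proof.
have -> : #|[pred i | outer i]| = #|~: [set i0; i1]|.
  by apply: eq_card => i; rewrite !inE negb_or.
by have := card_setC2; lia.
Qed.

(** [zang] is harmonic and homogeneous of degree [k] in the plane, hence the factor [4 a (a + k)];
    in the other [n - 2] variables the Laplacian of [t^b] is [2 b (2 b + n - 4) t^(b-1)]. *)
Lemma laplacian_angular c d k a b x :
  \sum_i peval (pderiv i (pderiv i (PMul (zang c d k) (PMul (ppow pss a) (ppow ptt b))))) x =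
  peval (zang c d k) x * (4 * a%:R * (a + k)%:R * ssq x ^+ a.-1 * tsq x ^+ b +
    2 * b%:R * (2 * b%:R + (n%:R - 4)) * ssq x ^+ a * tsq x ^+ b.-1).
Proof.
have oi0 : outer i0 = false by rewrite /outer eqxx.
have oi1 : outer i1 = false by rewrite /outer eqxx andbF.
have n2 : (2 <= n)%N.
  by have := card_setC2; lia.
have DI i : i \in [:: i0; i1] -> outer i = false ->
    peval (pderiv i (pderiv i (PMul (zang c d k) (PMul (ppow pss a) (ppow ptt b))))) x =
    tsq x ^+ b * (peval (pderiv i (pderiv i (zang c d k))) x * ssq x ^+ a +
      4 * a%:R * ssq x ^+ a.-1 * (x ord0 i * peval (pderiv i (zang c d k)) x) +
      peval (zang c d k) x * (4 * a%:R * a.-1%:R * ssq x ^+ a.-2 * x ord0 i ^+ 2 +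
        2 * a%:R * ssq x ^+ a.-1)).
  move=> _ oi; rewrite !pmul_deriv2.
  move: (zang c d k) => e.
  have -> : peval (pderiv i (PMul (ppow pss a) (ppow ptt b))) x =
    peval (pderiv i (ppow pss a)) x * peval (ppow ptt b) x +
    peval (ppow pss a) x * peval (pderiv i (ppow ptt b)) x by [].
  rewrite -[peval (PMul _ _) x]/(peval (ppow pss a) x * peval (ppow ptt b) x).
  rewrite !ppow_deriv2 !ppow_deriv !peval_ppow ptt_deriv ptt_deriv2 pss_deriv pss_deriv2 oi pssE -/(tsq x) /=.
  by rewrite mulr0n mulr1n; ring.
have DO i : outer i ->
    peval (pderiv i (pderiv i (PMul (zang c d k) (PMul (ppow pss a) (ppow ptt b))))) x =
    (peval (zang c d k) x * ssq x ^+ a * (4 * b%:R * b.-1%:R * tsq x ^+ b.-2)) * x ord0 i ^+ 2 +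
     peval (zang c d k) x * ssq x ^+ a * (2 * b%:R * tsq x ^+ b.-1).
  move=> oi; have /andP[h0 h1] := oi.
  rewrite !pmul_deriv2 zang_deriv_out// zang_deriv2_out//.
  move: (zang c d k) => e.
  have -> : peval (pderiv i (PMul (ppow pss a) (ppow ptt b))) x =
    peval (pderiv i (ppow pss a)) x * peval (ppow ptt b) x +
    peval (ppow pss a) x * peval (pderiv i (ppow ptt b)) x by [].
  rewrite -[peval (PMul _ _) x]/(peval (ppow pss a) x * peval (ppow ptt b) x).
  rewrite !ppow_deriv2 !ppow_deriv !peval_ppow ptt_deriv ptt_deriv2 pss_deriv pss_deriv2 oi pssE -/(tsq x) /=.
  by rewrite mulr0n mulr1n; ring.
rewrite sum_outer (DI i0) ?inE ?eqxx// (DI i1) ?inE ?eqxx ?orbT//.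
have SO (A B : R) : \sum_(i | outer i) (A * x ord0 i ^+ 2 + B) =
    A * tsq x + B * (n%:R - 2).
  by rewrite big_split /= -mulr_sumr -tsqE sumr_const card_outer -[B *+ _]mulr_natr natrB.
rewrite (eq_bigr _ DO) SO.
have E1 := zang_euler c d k x; have E2 := zang_harmonic c d k x.
have a1 : a%:R * a.-1%:R * ssq x ^+ a.-2 * ssq x = a%:R * a.-1%:R * ssq x ^+ a.-1 :> R.
  by case: (a) => [|[|m]] /=; rewrite ?mul0r ?mulr0 ?mul0r// -mulrA -exprSr.
have a2 : a%:R * a.-1%:R = a%:R * a%:R - a%:R :> R.
  by case: (a) => [|m] /=; rewrite ?mul0r ?subrr// -[m.+1%:R]natr1; ring.
have b1 : b%:R * b.-1%:R * tsq x ^+ b.-2 * tsq x = b%:R * b.-1%:R * tsq x ^+ b.-1 :> R.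
  by case: (b) => [|[|m]] /=; rewrite ?mul0r ?mulr0 ?mul0r// -mulrA -exprSr.
have b2 : b%:R * b.-1%:R = b%:R * b%:R - b%:R :> R.
  by case: (b) => [|m] /=; rewrite ?mul0r ?subrr// -[m.+1%:R]natr1; ring.
move: E1 E2 a1 b1; rewrite a2 b2 natrD.
move: (peval (zang c d k) x) (peval (pderiv i0 (pderiv i0 (zang c d k))) x)
  (peval (pderiv i1 (pderiv i1 (zang c d k))) x) (peval (pderiv i0 (zang c d k)) x)
  (peval (pderiv i1 (zang c d k)) x) => u u00 u11 u0 u1.
move=> E1 E2 a1 b1.
transitivity (tsq x ^+ b * ((u00 + u11) * ssq x ^+ a + 4 * a%:R * ssq x ^+ a.-1 *
     (x ord0 i0 * u0 + x ord0 i1 * u1) +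
   u * (4 * (a%:R * a.-1%:R * ssq x ^+ a.-2 * ssq x) + 4 * a%:R * ssq x ^+ a.-1)) +
   u * ssq x ^+ a * (4 * (b%:R * b.-1%:R * tsq x ^+ b.-2 * tsq x) + 2 * b%:R * tsq x ^+ b.-1 * (n%:R - 2))).
  have sE : x ord0 i0 ^+ 2 = ssq x - x ord0 i1 ^+ 2 by rewrite /ssq addrK.
  by rewrite sE; ring.
rewrite E1 E2 a2 b2 a1 b1; ring.
Qed.

End angular_polynomials.

Section angular_extension.
Context {R : realType} {n : nat}.
Variables (i0 i1 : 'I_n).
Hypothesis i01 : i0 != i1.
Hypothesis n3 : (3 <= n)%N.
Implicit Types (x y : 'rV[R]_n) (e : pexpr R n).
Local Notation ssq := (ssq i0 i1).
Local Notation tsq := (tsq i0 i1).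
Local Notation zang := (zang i0 i1).
Local Notation pss := (pss i0 i1).
Local Notation ptt := (ptt i0 i1).

Let n0 : (0 < n)%N. Proof. by apply: leq_trans n3. Qed.

Fixpoint psumn (N : nat) (F : nat -> pexpr R n) :=
  if N is N'.+1 then PAdd (psumn N' F) (F N') else PCst 0.

Lemma peval_psumn N F x : peval (psumn N F) x = \sum_(j < N) peval (F j) x.
Proof. by elim: N => [|N ih] /=; rewrite ?big_ord0// big_ord_recr ih. Qed.

Definition plap e x := \sum_i peval (pderiv i (pderiv i e)) x.

Lemma plap_scale e (c : R) F x : plap (PMul e (pscale c F)) x = c * plap (PMul e F) x.
Proof. by rewrite /plap mulr_sumr; apply: eq_bigr => i _ /=; ring. Qed.

Lemma plap_add e F1 F2 x : plap (PMul e (PAdd F1 F2)) x =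
  plap (PMul e F1) x + plap (PMul e F2) x.
Proof. by rewrite /plap -big_split; apply: eq_bigr => i _ /=; ring. Qed.

Lemma plap_psumn e N F x : plap (PMul e (psumn N F)) x =
  \sum_(j < N) plap (PMul e (F j)) x.
Proof.
elim: N => [|N ih]; last by rewrite big_ord_recr /= -ih; exact: plap_add.
by rewrite big_ord0 /plap big1// => i _ /=; ring.
Qed.

(* The coefficients of the polynomials [sum_j hcoef j * s^(m-j) * t^j] whose
   products with [Re (om * z^k)] are harmonic, [s = |z|^2], [t = |x''|^2]. *)
Fixpoint hcoef (m k j : nat) : R :=
  if j is j'.+1 then
    - hcoef m k j' * (4 * (m - j')%:R * (m - j' + k)%:R) /
      (2 * j%:R * (2 * j%:R + (n%:R - 4)))
  else 1.

Definition hpoly m k :=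
  psumn m.+1 (fun j => pscale (hcoef m k j) (PMul (ppow pss (m - j)) (ppow ptt j))).

(** At [j = 0] the quantity is [n - 2]: this is how [n >= 3] enters the recursion. *)
Lemma hcoef_den_gt0 (j : nat) : 0 < 2 * j.+1%:R + (n%:R - 4) :> R.
Proof.
have : 3 <= n%:R :> R by rewrite (ler_nat _ 3).
have : 0 <= j%:R :> R by [].
by rewrite -[j.+1%:R]natr1; lra.
Qed.

Lemma hpoly_pharm m k c d : pharm (PMul (zang c d k) (hpoly m k)).
Proof.
move=> x; rewrite -/(plap _ x) plap_psumn.
rewrite (eq_bigr (fun j : 'I_m.+1 => peval (zang c d k) x *
  (hcoef m k j * (4 * (m - j)%:R * (m - j + k)%:R) * ssq x ^+ (m - j).-1 * tsq x ^+ j +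
   hcoef m k j * (2 * j%:R * (2 * j%:R + (n%:R - 4))) * ssq x ^+ (m - j) * tsq x ^+ j.-1))); last first.
  by move=> j _; rewrite plap_scale /plap (laplacian_angular i01); ring.
rewrite -mulr_sumr.
(* [P j] comes from lowering the power of [s], [Q j] from lowering that of [t]; the recursion for
   [hcoef] makes [P j] cancel against [Q (j + 1)]. *)
have tele (P Q : nat -> R) : P m = 0 -> Q 0%N = 0 ->
    (forall j, (j < m)%N -> P j + Q j.+1 = 0) -> \sum_(j < m.+1) (P j + Q j) = 0.
  move=> Pm Q0 PQ; rewrite big_split /= big_ord_recr /= Pm addr0 big_ord_recl Q0 add0r.
  by rewrite -big_split big1// => j _; apply: PQ.
rewrite (tele (fun j => hcoef m k j * (4 * (m - j)%:R * (m - j + k)%:R) * ssq x ^+ (m - j).-1 * tsq x ^+ j)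
  (fun j => hcoef m k j * (2 * j%:R * (2 * j%:R + (n%:R - 4))) * ssq x ^+ (m - j) * tsq x ^+ j.-1)) ?mulr0//.
- by rewrite subnn; ring.
- by ring.
move=> j jm; have h := hcoef_den_gt0 j.
have -> : hcoef m k j.+1 * (2 * j.+1%:R * (2 * j.+1%:R + (n%:R - 4))) =
   - hcoef m k j * (4 * (m - j)%:R * (m - j + k)%:R).
  rewrite -[hcoef m k j.+1]/(- hcoef m k j * (4 * (m - j)%:R * (m - j + k)%:R) /
      (2 * j.+1%:R * (2 * j.+1%:R + (n%:R - 4)))).
  by rewrite divfK// mulf_neq0 ?mulf_neq0 ?(gt_eqF h)// pnatr_eq0.
by rewrite -subnS; ring.
Qed.

Definition hpol m k : {poly R} :=
  \sum_(j < m.+1) hcoef m k j *: ('X^(m - j) * (1 - 'X) ^+ j).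

Lemma hpolyE m k x : enorm x = 1 -> peval (hpoly m k) x = (hpol m k).[ssq x].
Proof.
move=> x1; have tE : tsq x = 1 - ssq x.
  by have := enorm_ssq_tsq i01 x; rewrite x1 expr1n => ->; ring.
rewrite peval_psumn horner_sum; apply: eq_bigr => j _.
rewrite -[LHS]/(hcoef m k j * (peval (ppow pss (m - j)) x * peval (ppow ptt j) x)).
by rewrite !peval_ppow pssE -/(tsq x) tE !hornerE.
Qed.

Lemma sub1X_exp j : (1 - 'X) ^+ j = (-1) ^+ j *: ('X - 1%:P) ^+ j :> {poly R}.
Proof.
rewrite -exprZn; congr (_ ^+ _); by rewrite scaleN1r opprB.
Qed.

Lemma hcoef_sign m k j : (j <= m)%N -> 0 <= hcoef m k j * (-1) ^+ j.
Proof.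
elim: j => [_|j ih jm]; first by rewrite /= mul1r.
have h := hcoef_den_gt0 j.
rewrite exprS (_ : _ * _ = hcoef m k j * (-1) ^+ j *
  ((4 * (m - j)%:R * (m - j + k)%:R) / (2 * j.+1%:R * (2 * j.+1%:R + (n%:R - 4))))); last first.
  by rewrite /=; ring.
by rewrite mulr_ge0 ?ih ?(ltnW jm)// divr_ge0 ?mulr_ge0// ltW.
Qed.

(** The signs of [hcoef] alternate like the leading coefficients of [(1 - 'X)^j], so every summand
    contributes a nonnegative amount and the first one contributes 1. Hence [hpol m k] has degree
    exactly [m]. *)
Lemma hpol_coef m k : 0 < (hpol m k)`_m.
Proof.
have T (j : 'I_m.+1) : 0 <= (hcoef m k j *: ('X^(m - j) * (1 - 'X) ^+ j))`_m.
  rewrite coefZ coefXnM ltnNge leq_subr.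
  rewrite subKn -1?ltnS ?ltn_ord// sub1X_exp coefZ.
  have -> : (('X - 1%:P : {poly R}) ^+ j)`_j = 1.
    have := size_exp_XsubC j (1 : R).
    have /monicP := monic_exp j (monicXsubC (1 : R)).
    by rewrite lead_coefE => + sE; rewrite sE.
  by rewrite mulr1; apply: hcoef_sign; rewrite -ltnS ltn_ord.
rewrite coef_sum big_ord_recl; apply: ltr_pwDl; last by apply: sumr_ge0 => j _; exact: T.
by rewrite subn0 expr0 mulr1 scale1r coefXn eqxx.
Qed.

Lemma hpol_size m k : (size (hpol m k) <= m.+1)%N.
Proof.
apply: (leq_trans (size_sum _ _ _)); apply/bigmax_leqP => j _.
apply: (leq_trans (size_scale_leq _ _)).
apply: (leq_trans (size_polyMleq _ _)).
rewrite size_polyXn /= sub1X_exp; apply: (@leq_trans (m - j + j.+1)).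
  rewrite leq_add2l; apply: (leq_trans (size_scale_leq _ _)).
  by rewrite size_exp_XsubC.
by rewrite addnS subnK// -ltnS.
Qed.

Definition rotation_invariant (f : 'rV[R]_n -> R) :=
  forall x y, ssq x = ssq y -> tsq x = tsq y -> f x = f y.

Lemma hpoly_invariant m k : rotation_invariant (peval (hpoly m k)).
Proof.
move=> x y sxy txy; rewrite !peval_psumn; apply: eq_bigr => j _.
rewrite /= !peval_ppow !pssE -[peval ptt x]/(tsq x) -[peval ptt y]/(tsq y).
by rewrite sxy txy.
Qed.

(** Induction on the size of [q]: a multiple of [hpol m k] removes the leading coefficient. One
    expression [G] serves all phases [(c, d)]. *)
Lemma polynomial_extension k (q : {poly R}) : exists G : pexpr R n,
  [/\ rotation_invariant (peval G), (forall c d, pharm (PMul (zang c d k) G)) &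
      forall x, enorm x = 1 -> peval G x = q.[ssq x]].
Proof.
have [N] := ubnP (size q); elim: N q => // N ih q; rewrite ltnS.
case: N ih => [_|m ih qm].
  rewrite leqn0 size_poly_eq0 => /eqP ->; exists (PCst 0); split => //.
    by move=> c d x; rewrite big1// => i _ /=; ring.
  by move=> x _; rewrite horner0.
have h0 := hpol_coef m k.
pose a := q`_m / (hpol m k)`_m.
have [|G [G1 G2 G3]] := ih (q - a *: hpol m k).
  rewrite ltnS; apply/leq_sizeP => j; rewrite leq_eqVlt => /orP[/eqP <-|mj].
    by rewrite coefB coefZ /a divfK ?subrr// gt_eqF.
  rewrite coefB coefZ [q`_j]nth_default ?(leq_trans qm)//.
  by rewrite nth_default ?mulr0 ?subr0// (leq_trans (hpol_size m k)).
exists (PAdd G (pscale a (hpoly m k))); split.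
- move=> x y sxy txy; rewrite -[LHS]/(peval G x + a * peval (hpoly m k) x).
  by rewrite (G1 x y)// (hpoly_invariant m k sxy txy).
- move=> c d x; rewrite -/(plap _ x) plap_add plap_scale /plap.
  by rewrite (G2 c d x) (hpoly_pharm m k c d x) mulr0 addr0.
- move=> x x1; rewrite -[LHS]/(peval G x + a * peval (hpoly m k) x).
  by rewrite G3// hpolyE// !hornerE subrK.
Qed.

Lemma ssq_sphere x : enorm x = 1 -> 0 <= ssq x <= 1.
Proof.
move=> x1; have := enorm_ssq_tsq i01 x; rewrite x1 expr1n => h.
have : 0 <= tsq x by rewrite (tsqE i0 i1); apply: sumr_ge0 => i _; exact: sqr_ge0.
have : 0 <= ssq x by rewrite addr_ge0 ?sqr_ge0.
by lra.
Qed.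

Lemma zang_bound c d k x : enorm x <= 1 -> `|peval (zang c d k) x| <= `|c| + `|d|.
Proof.
move=> x1; rewrite zangE.
have s1 : ssq x <= 1.
  have := enorm_ssq_tsq i01 x.
  have : 0 <= tsq x by rewrite (tsqE i0 i1); apply: sumr_ge0 => i _; exact: sqr_ge0.
  have : enorm x ^+ 2 <= 1 by rewrite expr_le1// enorm_ge0.
  lra.
have s0 : 0 <= ssq x by rewrite addr_ge0 ?sqr_ge0.
have := zre_zim i0 i1 k x.
have sk : ssq x ^+ k <= 1 by rewrite exprn_ile1.
move=> E; apply: le_trans (ler_normB _ _) _; rewrite !normrM.
apply: lerD; apply: ler_piMr => //; rewrite -sqrtr1 -sqrtr_sqr ler_sqrt//.
  by have := sqr_ge0 (zim i0 i1 k x); lra.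
by have := sqr_ge0 (zre i0 i1 k x); lra.
Qed.

(** Weierstrass on the sphere, the maximum principle inside. A single factor [W] must serve all
    phases, so the limit is taken of the factors [G N] rather than of the products. *)
Lemma angular_extension k (f : R -> R) (L : R) : (0 < k)%N ->
  (forall s s', 0 <= s <= 1 -> 0 <= s' <= 1 -> `|f s - f s'| <= L * `|s - s'|) ->
  exists W : 'rV[R]_n -> R, rotation_invariant W /\ forall c d : R,
    harm_lim (fun x => peval (zang c d k) x * W x) /\
    forall x, enorm x = 1 -> peval (zang c d k) x * W x = peval (zang c d k) x * f (ssq x).
Proof.
move=> k0 fL.
have {}fL s s' : 0 <= s <= 1 -> 0 <= s' <= 1 -> `|f s - f s'| <= (`|L| + 1) * `|s - s'|.
  move=> h1 h2; apply: le_trans (fL _ _ h1 h2) _; rewrite ler_wpM2r//.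
  by apply: le_trans (ler_norm _) _; rewrite lerDl.
have L0 : 0 < `|L| + 1 by rewrite ltr_wpDl.
have /choice[G hG] : forall N : nat, exists G : pexpr R n,
    [/\ rotation_invariant (peval G), (forall c d, pharm (PMul (zang c d k) G)) &
      forall x, enorm x = 1 -> `|peval G x - f (ssq x)| <= N.+1%:R^-1].
  move=> N; have N0 : 0 < N.+1%:R^-1 :> R by rewrite invr_gt0.
  have [q hq] := weierstrass_lipschitz N0 L0 fL.
  have [G [G1 G2 G3]] := polynomial_extension k q; exists G; split => // x x1.
  by rewrite G3//; apply: hq; exact: ssq_sphere.
have small (e : R) j : 0 < e -> (Num.truncn e^-1 <= j)%N -> j.+1%:R^-1 <= e.
  move=> e0 jN; rewrite invf_ple ?posrE//.
  by apply: ltW; apply: lt_le_trans (truncnS_gt _) _; rewrite ler_nat.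
(* The difference of two products is a harmonic polynomial, so closeness on the sphere, where both
   factors approximate [f], extends to the ball. *)
have diff c d N N' (e : R) : 0 < e -> (Num.truncn e^-1 <= N)%N -> (Num.truncn e^-1 <= N')%N ->
    forall x, enorm x <= 1 -> `|peval (PMul (zang c d k) (G N)) x - peval (PMul (zang c d k) (G N')) x| <=
    (`|c| + `|d|) * (e + e).
  move=> e0 NN NN' x x1.
  pose E := PAdd (PMul (zang c d k) (G N)) (pscale (-1) (PMul (zang c d k) (G N'))).
  have EE y : peval (PMul (zang c d k) (G N)) y - peval (PMul (zang c d k) (G N')) y = peval E y.
    by rewrite /E; move: (zang c d k) => e1 /=; ring.
  have EE2 y : peval E y = peval (zang c d k) y * (peval (G N) y - peval (G N') y).
    by rewrite /E; move: (zang c d k) => e1 /=; ring.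
  rewrite EE; apply: (@pharm_max R n n0 E 1) => //.
    by apply: pharm_lin; [have [_ h _] := hG N|have [_ h _] := hG N']; exact: h.
  move=> y y1; rewrite EE2 normrM ler_pM ?zang_bound ?y1//.
  rewrite (_ : _ - _ = (peval (G N) y - f (ssq y)) - (peval (G N') y - f (ssq y))); last by ring.
  apply: le_trans (ler_normB _ _) _; apply: lerD.
    by apply: le_trans (small _ _ e0 NN); have [_ _] := hG N; apply.
  by apply: le_trans (small _ _ e0 NN'); have [_ _] := hG N'; apply.
have uc c d : ucauchy cball (fun N => PMul (zang c d k) (G N)).
  move=> e e0; have A0 : 0 < 2 * (`|c| + `|d| + 1) by rewrite mulr_gt0// ltr_wpDl// addr_ge0.
  exists (Num.truncn (e / (2 * (`|c| + `|d| + 1)))^-1) => N N' NN NN' x x1.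
  apply: le_trans (diff c d N N' _ _ NN NN' x x1) _; first by rewrite divr_gt0.
  rewrite [leLHS](_ : _ = e * ((`|c| + `|d|) / (`|c| + `|d| + 1))); last first.
    by field; rewrite gt_eqF// ltr_wpDl// addr_ge0.
  have cd0 : 0 < `|c| + `|d| + 1 by rewrite ltr_wpDl// addr_ge0.
  by apply: ler_piMr; [exact: ltW|rewrite ler_pdivrMr// mul1r lerDl].
have ul c d := ucauchy_ulim (uc c d).
pose W x := limn (fun N => peval (G N) x).
have Wcv c d x : enorm x <= 1 ->
    (fun N => peval (PMul (zang c d k) (G N)) x) @ \oo --> peval (zang c d k) x * W x.
  (* On the axis [z = 0] the values [peval (G N) x] need not converge, and [W x] may be a default
     value; since [0 < k] the angular factor vanishes there and the products still converge. *)
  move=> x1; have [s0|sn0] := eqVneq (ssq x) 0.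
    have := zre_zim i0 i1 k x; rewrite s0 expr0n gtn_eqF// => /eqP.
    rewrite paddr_eq0 ?sqr_ge0// !sqrf_eq0 => /andP[/eqP a1 /eqP a2].
    have z0 : peval (zang c d k) x = 0 by rewrite zangE a1 a2; ring.
    rewrite z0 mul0r (_ : (fun N => _) = cst 0); first exact: cvg_cst.
    by apply/funext => N; rewrite -[LHS]/(peval (zang c d k) x * peval (G N) x) z0 mul0r.
  (* With the phase [(u, -v)] the angular factor at [x] is [|z|^(2k)], which is not zero, so
     convergence of this product gives convergence of [G N] at [x]. *)
  pose u := zre i0 i1 k x; pose v := zim i0 i1 k x.
  have uv : u ^+ 2 + v ^+ 2 != 0 by rewrite zre_zim expf_neq0.
  have h1 := ulim_cvg (ul u (- v)) x1.
  have zuv : peval (zang u (- v) k) x = u ^+ 2 + v ^+ 2 by rewrite zangE -/u -/v; ring.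
  have cG : cvgn (fun N => peval (G N) x).
    apply/cvg_ex; eexists.
    have -> : (fun N => peval (G N) x) = (fun N => (u ^+ 2 + v ^+ 2)^-1 * peval (PMul (zang u (- v) k) (G N)) x).
      apply/funext => N; rewrite -[peval (PMul _ _) x]/(peval (zang u (- v) k) x * peval (G N) x).
      by rewrite zuv mulKf.
    by apply: cvgM; [exact: cvg_cst|exact: h1].
  rewrite -[(fun N => _)]/(fun N => peval (zang c d k) x * peval (G N) x).
  by apply: cvgM; [exact: cvg_cst|exact: cG].
exists W; split.
  move=> x y sxy txy; rewrite /W; congr (limn _); apply/funext => N.
  by have [h _ _] := hG N; apply: h.
move=> c d; split.
  exists (fun N => PMul (zang c d k) (G N)); first by move=> N; have [_ h _] := hG N.
  apply: ulim_ext (ul c d) => x x1; apply/cvg_lim => //; exact: Wcv.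
move=> x x1; apply: (cvg_unique _ (Wcv c d x _)) => //; first by rewrite x1.
change ((fun N => peval (zang c d k) x * peval (G N) x) @ \oo --> peval (zang c d k) x * f (ssq x)).
apply: cvgM; first exact: cvg_cst.
apply/cvgrPdist_le => e e0; near=> N; rewrite distrC.
have [_ _ /(_ _ x1) /le_trans] := hG N; apply; apply: small => //.
by near: N; exists (Num.truncn e^-1).
Unshelve. all: by end_near. Qed.

End angular_extension.

(** * The boundary of the domain *)

Section radial_profile.
Context {R : realType}.
Variables (r : R) (mu : R -> R).
Hypotheses (hr : 0 < r) (mu_smooth : smooth_halfline mu)
  (mu_decr : forall s t : R, 0 <= s -> s <= t -> mu t <= mu s)
  (mu_one : forall t : R, 0 <= t <= r -> mu t = 1)
  (mu_pos : forall t : R, 0 < t < 2 * r -> 0 < mu t)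
  (mu_neg : forall t : R, 2 * r < t -> mu t < 0)
  (mu_deriv : derive1 mu (2 * r) < 0).

Lemma mu0 : mu 0 = 1.
Proof. by apply: mu_one; rewrite lexx ltW. Qed.

Lemma mu_le1 (t : R) : 0 <= t -> mu t <= 1.
Proof. by move=> t0; rewrite -mu0; exact: mu_decr. Qed.

Lemma mu_within : {within `[0, +oo[, continuous mu}.
Proof.
have [D [D0 DS]] := mu_smooth; have [c0 _] := DS 0%N.
apply: subspace_eq_continuous c0 => x; rewrite inE /= in_itv /= andbT.
exact: D0.
Qed.

(** [smooth_halfline] says nothing about negative arguments; composing with the absolute value gives
    a function continuous on the whole line. *)
Lemma mu_abs_continuous : continuous (fun t : R => mu `|t|).
Proof.
move=> x; have /subspace_continuousP c := mu_within.
have h : `[0, +oo[%classic `|x| by rewrite /= in_itv /= normr_ge0.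
move=> A HA.
have hc : nbhs `|x| (fun y => `[0, +oo[%classic y -> A (mu y)) := c _ h A HA.
have nx : (fun t : R => `|t|) @ x --> `|x| by exact: norm_continuous.
have hx : nbhs x (fun t : R => `[0, +oo[%classic `|t| -> A (mu `|t|)) := nx _ hc.
apply: (@filterS _ _ _ (fun t : R => `[0, +oo[%classic `|t| -> A (mu `|t|))) hx => y; apply.
by rewrite /= in_itv /= normr_ge0.
Qed.

Lemma mu_eq0 (t : R) : 0 <= t -> mu t = 0 -> t = 2 * r.
Proof.
move=> t0 mt; have [h|h|//] := ltgtP t (2 * r); last first.
  by have := mu_neg h; rewrite mt ltxx.
have [E|tn0] := eqVneq t 0; first by move: mt; rewrite E mu0 => /eqP; rewrite oner_eq0.
by have := @mu_pos t; rewrite h lt_neqAle eq_sym tn0 t0 mt ltxx => /(_ isT).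
Qed.

Lemma mu_ge0_le (t : R) : 0 <= mu t -> t <= 2 * r.
Proof. by move=> h; rewrite leNgt; apply/negP => /mu_neg; rewrite ltNge h. Qed.

Lemma mu_mvt (a b : R) : 0 <= a -> a < b -> forall D : nat -> R -> R,
  (forall x, 0 <= x -> D 0%N x = mu x) ->
  (forall k, {within `[0, +oo[, continuous (D k)} /\
              forall x : R, 0 < x -> is_derive x 1 (D k) (D k.+1 x)) ->
  exists2 c, a < c < b & mu b - mu a = D 1%N c * (b - a).
Proof.
move=> a0 ab D D0 DS.
have [||c] := @MVT R (D 0%N) (D 1%N) a b ab.
- move=> x; rewrite in_itv /= => /andP[ax _]; have [_ h] := DS 0%N.
  by apply: h; exact: le_lt_trans ax.
- have [c _] := DS 0%N; apply: continuous_subspaceW c => x /=.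
  by rewrite !in_itv /= andbT => /andP[ax _]; exact: le_trans ax.
rewrite in_itv /= => cab; rewrite !D0 ?(ltW (le_lt_trans a0 ab))// => E.
by exists c.
Qed.

Lemma mu_lipschitz (T : R) : exists2 L, 0 <= L & forall s t : R, 0 <= s <= T -> 0 <= t <= T ->
  `|mu s - mu t| <= L * `|s - t|.
Proof.
have [T0|T0] := ltP T 0; first by exists 0 => // s t; lra.
have [D [D0 DS]] := mu_smooth.
have cD : {within `[0, T], continuous (fun x => `|D 1%N x|)}.
  have [c _] := DS 1%N.
  have : {within `[0, T], continuous (D 1%N)}.
    apply: continuous_subspaceW c => x /=.
    by rewrite !in_itv /= andbT => /andP[].
  by move=> h x; apply: cvg_norm; exact: h.
have [c cT hc] := EVT_max T0 cD.
exists `|D 1%N c| => // s t.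
wlog st : s t / s < t => [H hs ht|/andP[s0 sT] /andP[t0 tT]].
  have [h|h|->] := ltgtP s t; [exact: H|rewrite distrC (distrC s); exact: H|].
  by rewrite !subrr !normr0 mulr0.
have [d /andP[sd dt] E] := mu_mvt s0 st D0 DS.
rewrite distrC E normrM (distrC s) ler_wpM2r// hc// in_itv /=; lra.
Qed.

(** The slope [c] is half of [- mu' (2 r)], by continuity of the derivative: the quantitative form
    of [mu_deriv]. *)
Lemma mu_slope : exists c eta : R, [/\ 0 < c, 0 < eta, eta < r &
  forall t t' : R, 2 * r - eta <= t -> t <= t' -> t' <= 2 * r -> c * (t' - t) <= mu t - mu t'].
Proof.
have [D [D0 DS]] := mu_smooth.
have r2 : 0 < 2 * r by rewrite mulr_gt0.
have dE : derive1 mu (2 * r) = D 1%N (2 * r).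
  have [_ h] := DS 0%N; have h1 := h _ r2.
  rewrite derive1E -(@derive_val _ _ _ _ _ _ _ h1); apply: near_eq_derive.
  near=> t; rewrite D0// ltW//; near: t; exact: lt_nbhsr.
pose c := - D 1%N (2 * r) / 2.
have c0 : 0 < c by rewrite divr_gt0// oppr_gt0 -dE.
have [c1 _] := DS 1%N.
have c2 : D 1%N x @[x --> 2 * r] --> D 1%N (2 * r).
  have [_ h] := DS 1%N; have [h1 _] := h _ r2.
  by apply/differentiable_continuous/derivable1_diffP.
have : \forall t \near 2 * r, D 1%N t < - c.
  by apply: (cvgr_lt _ c2); rewrite /c; have := c0; rewrite /c; lra.
move=> /nbhs_ballP[e /= e0 he].
pose eta := Num.min (e / 2) (r / 2).
have eta0 : 0 < eta by rewrite lt_min !divr_gt0.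
have etae : eta < e by rewrite gt_min; apply/orP; left; lra.
have etar : eta < r by rewrite gt_min; apply/orP; right; lra.
exists c, eta; split => // t t' t1 tt' t2.
have [->|tn] := eqVneq t t'; first by rewrite !subrr mulr0.
have {}tt' : t < t' by rewrite lt_neqAle tn.
have t0 : 0 <= t by lra.
have [d /andP[td dt] E] := mu_mvt t0 tt' D0 DS.
have : D 1%N d < - c by apply: he; rewrite /ball /= ger0_norm; lra.
move=> h; have : (D 1%N d + c) * (t' - t) <= 0.
  by rewrite mulr_le0_ge0//; lra.
lra.
Unshelve. all: by end_near. Qed.

(** [tau] is the squared length of the boundary point in a direction with [|z|^2 = p]. The condition
    on [p] stays inside the existential so that [choice] yields a function on all reals. *)
Lemma tau_exists (p : R) : exists tau : R, 0 <= p <= 1 -> 0 < tau /\ p * tau = mu ((1 - p) * tau).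
Proof.
have [|pn] := boolP (0 <= p <= 1); last by exists 0.
move=> /andP[p0 p1].
(* If [H T <= 0], then [p T <= 1] and [(1 - p) T <= 2 r], so that [T <= 1 + 2 r]; hence a value
   above [1 + 2 r]. *)
pose T := 2 + 2 * r.
have hr0 : 0 < r by exact: hr.
have T0 : 0 <= T by rewrite /T; lra.
pose H t := p * t - mu `|(1 - p) * t|.
have cH : {within `[0, T], continuous H}.
  apply: continuous_subspaceT => x; apply: cvgB.
    by apply: cvgM; [exact: cvg_cst|exact: cvg_id].
  apply: (@continuous_comp _ _ _ (fun t => (1 - p) * t) (fun t => mu `|t|)).
    by apply: cvgM; [exact: cvg_cst|exact: cvg_id].
  exact: mu_abs_continuous.
have H0 : H 0 = - 1 by rewrite /H !mulr0 normr0 mu0 sub0r.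
have HT : 0 < H T.
  rewrite ltNge; apply/negP => h.
  have qT : 0 <= (1 - p) * T by rewrite mulr_ge0// subr_ge0.
  have pT : 0 <= p * T by rewrite mulr_ge0.
  rewrite /H ger0_norm// in h.
  have h1 : mu ((1 - p) * T) <= 1 by exact: mu_le1.
  have h2 : (1 - p) * T <= 2 * r by apply: mu_ge0_le; lra.
  by move: h2 h h1; rewrite /T; nra.
have [|t] := @IVT R H 0 T 0 T0 cH.
  rewrite H0 ge_min le_max lerN10 /=; apply/orP; right; exact: ltW.
rewrite in_itv /= => /andP[t0 tT] Ht.
have tn0 : t != 0 by apply/eqP => E; move: Ht; rewrite E H0; lra.
exists t => _; split; first by rewrite lt_neqAle eq_sym tn0.
move: Ht => /eqP; rewrite subr_eq0 => /eqP ->; rewrite ger0_norm// mulr_ge0// subr_ge0//.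
Qed.

Definition tau : R -> R := projT1 (choice tau_exists).

Section tau_at.
Variable p : R.
Hypothesis p01 : 0 <= p <= 1.
Let p0 : 0 <= p. Proof. by case/andP: p01. Qed.
Let q0 : 0 <= 1 - p. Proof. by rewrite subr_ge0; case/andP: p01. Qed.

Lemma tau_gt0 : 0 < tau p.
Proof. by rewrite /tau; case: choice => t /= /(_ p p01) []. Qed.

Lemma tauE : p * tau p = mu ((1 - p) * tau p).
Proof. by rewrite /tau; case: choice => t /= /(_ p p01) []. Qed.

Let qt0 : 0 <= (1 - p) * tau p. Proof. by rewrite mulr_ge0// ltW// tau_gt0. Qed.

Lemma tau_p_le1 : p * tau p <= 1.
Proof. by rewrite tauE mu_le1. Qed.

Lemma tau_q_le : (1 - p) * tau p <= 2 * r.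
Proof. by apply: mu_ge0_le; rewrite -tauE mulr_ge0// ltW// tau_gt0. Qed.

Lemma tau_le : tau p <= 1 + 2 * r.
Proof. by have := tau_p_le1; have := tau_q_le; lra. Qed.

(** Either [(1 - p) tau <= r], where [mu = 1] and [p tau = 1], or [tau >= (1 - p) tau > r]. The
    lower bound keeps the square root Lipschitz. *)
Lemma tau_ge : Num.min 1 r <= tau p.
Proof.
have t0 := tau_gt0.
have [h|h] := leP ((1 - p) * tau p) r.
  have E : p * tau p = 1 by rewrite tauE mu_one// qt0.
  rewrite ge_min; apply/orP; left; rewrite -E ler_piMl ?(ltW t0)//.
  by case/andP: p01.
rewrite ge_min; apply/orP; right; apply/ltW/(lt_le_trans h).
by rewrite ler_piMl ?(ltW t0)//; have := p0; lra.
Qed.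

(** In [t] the left side does not decrease and the right side does not increase, so two distinct
    solutions force [p = 0]; then [mu] has to vanish, which happens only at [2 r]. *)
Lemma tau_unique (t : R) : 0 < t -> p * t = mu ((1 - p) * t) -> t = tau p.
Proof.
move=> t0 Et; have T0 := tau_gt0; have ET := tauE.
have key (u v : R) : 0 < u -> 0 < v -> p * u = mu ((1 - p) * u) ->
    p * v = mu ((1 - p) * v) -> ~ u < v.
  move=> u0 v0 Eu Ev uv.
  have m : mu ((1 - p) * v) <= mu ((1 - p) * u).
    by apply: mu_decr; [rewrite mulr_ge0// ltW|rewrite ler_wpM2l// ltW].
  have pz : p = 0.
    apply/eqP; rewrite eq_le p0 andbT leNgt; apply/negP => pp.
    by move: m; rewrite -Eu -Ev leNgt ltr_pM2l// uv.
  have hu : u = 2 * r by apply: mu_eq0; [exact: ltW|move: Eu; rewrite pz mul0r subr0 mul1r => <-].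
  have hv : v = 2 * r by apply: mu_eq0; [exact: ltW|move: Ev; rewrite pz mul0r subr0 mul1r => <-].
  by move: uv; rewrite hu hv ltxx.
by have [/(key _ _ t0 T0 Et ET)|/(key _ _ T0 t0 ET Et)|] := ltgtP t (tau p).
Qed.

End tau_at.

(** Two regimes. For [p >= p0] the left side of the equation grows in [tau] at rate at least [p0].
    For smaller [p] the boundary point has [|x''|^2] in [[2 r - eta, 2 r]], and the slope of [mu]
    there takes over. *)
Lemma tau_lipschitz : exists2 L, 0 <= L & forall p p' : R, 0 <= p <= 1 -> 0 <= p' <= 1 ->
  `|tau p - tau p'| <= L * `|p - p'|.
Proof.
have [c [eta [c0 eta0 etar slope]]] := mu_slope.
pose T := 1 + 2 * r; have T0 : 0 < T by rewrite /T; lra.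
have [Lm Lm0 mL] := mu_lipschitz T.
have m0 : 0 < mu (2 * r - eta) by apply: mu_pos; lra.
(* As [tau <= T], a value [p < p0] gives [p tau < mu (2 r - eta)], which forces
   [(1 - p) tau >= 2 r - eta]; the bound 1/2 keeps [1 - p] away from 0. *)
pose p0 := Num.min 2^-1 (mu (2 * r - eta) / (2 * T)).
have p00 : 0 < p0 by rewrite lt_min invr_gt0 ltr0n divr_gt0// mulr_gt0.
have p0T : p0 * T < mu (2 * r - eta).
  have : p0 * T <= mu (2 * r - eta) / (2 * T) * T.
    by rewrite ler_wpM2r ?(ltW T0)// ge_min lexx orbT.
  rewrite [leRHS](_ : _ = mu (2 * r - eta) / 2); first by lra.
  by field; rewrite gt_eqF.
have p0h : p0 <= 2^-1 by rewrite ge_min lexx.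
pose L1 := (T + Lm * T) / p0.
pose L2 := 2 * (2 * r / c * 4) + 2 * r * 4.
have L10 : 0 <= L1.
  by apply: divr_ge0; [apply: addr_ge0; [|apply: mulr_ge0 => //]|]; exact: ltW.
have L20 : 0 <= L2.
  have : 0 <= 2 * r / c by rewrite divr_ge0 ?(ltW c0)// mulr_ge0// ltW.
  have hr0 : 0 < r by exact: hr.
  by rewrite /L2; lra.
exists (L1 + L2); first exact: addr_ge0.
have big (p p' : R) : 0 <= p <= 1 -> 0 <= p' <= 1 -> p0 <= p -> `|tau p - tau p'| <= L1 * `|p - p'|.
  move=> hp hp' pp.
  have t0 := tau_gt0 hp; have t0' := tau_gt0 hp'.
  have E := tauE hp; have E' := tauE hp'.
  have tT := tau_le hp; have tT' := tau_le hp'.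
  have /andP[pa pb] := hp; have /andP[pa' pb'] := hp'.
  rewrite /L1 mulrAC ler_pdivlMr//.
  (* The two differences on the right have opposite signs since [mu] decreases, so subtracting them
     loses nothing. *)
  have H1 : `|tau p - tau p'| * p0 <= `|p * (tau p - tau p') - (mu ((1 - p) * tau p) - mu ((1 - p) * tau p'))|.
    have [h|h] := leP (tau p') (tau p).
      have m : mu ((1 - p) * tau p) <= mu ((1 - p) * tau p').
        by apply: mu_decr; [rewrite mulr_ge0 ?(ltW t0')// subr_ge0|rewrite ler_wpM2l// subr_ge0].
      rewrite ger0_norm ?subr_ge0// ger0_norm; last by rewrite subr_ge0 (le_trans _ (mulr_ge0 pa _)) ?subr_ge0// subr_le0.
      have : p0 * (tau p - tau p') <= p * (tau p - tau p') by rewrite ler_wpM2r// subr_ge0.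
      lra.
    have m : mu ((1 - p) * tau p') <= mu ((1 - p) * tau p).
      by apply: mu_decr; [rewrite mulr_ge0 ?(ltW t0)// subr_ge0|rewrite ler_wpM2l ?(ltW h)// subr_ge0].
    have : p0 * (tau p' - tau p) <= p * (tau p' - tau p) by rewrite ler_wpM2r// subr_ge0 ltW.
    rewrite distrC ger0_norm; last by rewrite subr_ge0 ltW.
    move=> h1; rewrite -normrN; apply: le_trans (ler_norm _); lra.
  apply: le_trans H1 _.
  rewrite (_ : _ - _ = - ((p - p') * tau p' - (mu ((1 - p) * tau p') - mu ((1 - p') * tau p')))); last first.
    by rewrite -E -E'; ring.
  rewrite normrN; apply: le_trans (ler_normB _ _) _; rewrite [leRHS]mulrDl; apply: lerD.
    by rewrite normrM mulrC ler_wpM2r// ger0_norm// ltW.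
  have q1 : 0 <= (1 - p) * tau p' <= T.
    rewrite mulr_ge0 ?(ltW t0') ?subr_ge0//=; apply: le_trans tT'.
    by rewrite ler_piMl ?(ltW t0')//; lra.
  have q2 : 0 <= (1 - p') * tau p' <= T.
    rewrite mulr_ge0 ?(ltW t0') ?subr_ge0//=; apply: le_trans tT'.
    by rewrite ler_piMl ?(ltW t0')//; lra.
  apply: le_trans (mL _ _ q1 q2) _; rewrite -mulrA ler_wpM2l//.
  rewrite (_ : _ - _ = - ((p - p') * tau p')); last by ring.
  by rewrite normrN normrM mulrC ler_wpM2r// ger0_norm// ltW.
have small (p p' : R) : 0 <= p <= 1 -> 0 <= p' <= 1 -> p < p0 -> p' < p0 ->
    (1 - p) * tau p <= (1 - p') * tau p' -> `|tau p - tau p'| <= L2 * `|p - p'|.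
  move=> hp hp' pp pp' tt'.
  have t0 := tau_gt0 hp; have t0' := tau_gt0 hp'.
  have E := tauE hp; have E' := tauE hp'.
  have tT := tau_le hp; have tT' := tau_le hp'.
  have q2r := tau_q_le hp; have q2r' := tau_q_le hp'.
  have /andP[pa pb] := hp; have /andP[pa' pb'] := hp'.
  have lowt : 2 * r - eta <= (1 - p) * tau p.
    rewrite leNgt; apply/negP => h.
    have : mu (2 * r - eta) <= mu ((1 - p) * tau p).
      by apply: mu_decr; [rewrite mulr_ge0 ?(ltW t0)// subr_ge0|exact: ltW].
    rewrite -E leNgt => /negP; apply; apply: le_lt_trans p0T.
    by apply: ler_pM => //; exact: ltW.
  have h1 := slope _ _ lowt tt' q2r'.
  rewrite -E -E' in h1.
  (* The estimate is made in [t = (1 - p) tau], the squared length of [x''], and is brought back to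
     [tau = t / (1 - p)] at the end. *)
  set t := (1 - p) * tau p in tt' lowt q2r h1 *; set t' := (1 - p') * tau p' in tt' q2r' h1 *.
  have q : 2^-1 <= 1 - p by lra.
  have q' : 2^-1 <= 1 - p' by lra.
  have qn : 0 < 1 - p by lra.
  have qn' : 0 < 1 - p' by lra.
  have tauq : tau p = t / (1 - p) by rewrite /t; field; rewrite gt_eqF.
  have tauq' : tau p' = t' / (1 - p') by rewrite /t'; field; rewrite gt_eqF.
  clearbody t t'.
  have t_ge0 : 0 <= t by lra.
  have t_ge0' : 0 <= t' by lra.
  have invb : (1 - p)^-1 <= 2 by rewrite invf_ple ?posrE.
  have invb' : (1 - p')^-1 <= 2 by rewrite invf_ple ?posrE.
  have dg : `|(1 - p)^-1 - (1 - p')^-1| <= 4 * `|p - p'|.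
    have -> : (1 - p)^-1 - (1 - p')^-1 = (1 - p)^-1 * (1 - p')^-1 * (p - p').
      by field; rewrite !gt_eqF.
    rewrite normrM ler_wpM2r// ger0_norm ?mulr_ge0 ?invr_ge0 ?(ltW qn) ?(ltW qn')//.
    have i0 : 0 <= (1 - p)^-1 by rewrite invr_ge0 ltW.
    have i0' : 0 <= (1 - p')^-1 by rewrite invr_ge0 ltW.
    by apply: le_trans (ler_pM i0 i0' invb invb') _; rewrite -natrM.
  have dg2 : `|p / (1 - p) - p' / (1 - p')| <= 4 * `|p - p'|.
    by rewrite (_ : _ - _ = (1 - p)^-1 - (1 - p')^-1)//; field; rewrite !gt_eqF.
  have h2 : c * (t' - t) <= 2 * r * (4 * `|p - p'|).
    apply: le_trans h1 _; rewrite tauq tauq'.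
    have -> : p * (t / (1 - p)) - p' * (t' / (1 - p')) =
       t * (p / (1 - p) - p' / (1 - p')) - (t' - t) * (p' / (1 - p')) by ring.
    have : 0 <= (t' - t) * (p' / (1 - p')) by rewrite mulr_ge0 ?subr_ge0// divr_ge0 ?subr_ge0.
    have : t * (p / (1 - p) - p' / (1 - p')) <= 2 * r * (4 * `|p - p'|).
      apply: le_trans (ler_norm _) _; rewrite normrM ger0_norm//.
      exact: ler_pM.
    lra.
  have h3 : t' - t <= 2 * r / c * 4 * `|p - p'|.
    have -> : 2 * r / c * 4 * `|p - p'| = (2 * r * (4 * `|p - p'|)) / c by ring.
    by rewrite ler_pdivlMr// mulrC.
  rewrite tauq tauq' (_ : _ - _ = - ((t' - t) / (1 - p)) + t' * ((1 - p)^-1 - (1 - p')^-1)); last by ring.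
  apply: le_trans (ler_normD _ _) _; rewrite normrN !normrM /L2 mulrDl.
  rewrite (ger0_norm t_ge0') (ger0_norm (_ : 0 <= t' - t)) ?subr_ge0//.
  rewrite (ger0_norm (_ : 0 <= (1 - p)^-1)) ?invr_ge0 ?(ltW qn)//.
  apply: lerD.
    rewrite -mulrA [2 * _]mulrC; apply: ler_pM; rewrite ?subr_ge0 ?invr_ge0 ?(ltW qn)//.
  by rewrite -mulrA; exact: ler_pM.
move=> p p' hp hp'; rewrite mulrDl.
have n1 : 0 <= L1 * `|p - p'| by rewrite mulr_ge0.
have n2 : 0 <= L2 * `|p - p'| by rewrite mulr_ge0.
have [h|h] := leP p0 p; first by apply: le_trans (big _ _ hp hp' h) _; rewrite lerDl.
have [h'|h'] := leP p0 p'.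
  rewrite distrC; apply: le_trans (big _ _ hp' hp h') _.
  by rewrite (distrC p') lerDl.
have [tt|/ltW tt] := leP ((1 - p) * tau p) ((1 - p') * tau p').
  by apply: le_trans (small _ _ hp hp' h h' tt) _; rewrite lerDr.
rewrite distrC; apply: le_trans (small _ _ hp' hp h' h tt) _.
by rewrite (distrC p') lerDr.
Qed.

Definition rho (p : R) := Num.sqrt (tau p).

Lemma rho_gt0 (p : R) : 0 <= p <= 1 -> 0 < rho p.
Proof. by move=> p01; rewrite sqrtr_gt0 tau_gt0. Qed.

Lemma rho_sqr (p : R) : 0 <= p <= 1 -> rho p ^+ 2 = tau p.
Proof. by move=> p01; rewrite sqr_sqrtr// ltW// tau_gt0. Qed.

Lemma rho_lipschitz : exists2 L, 0 <= L & forall p p' : R, 0 <= p <= 1 -> 0 <= p' <= 1 ->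
  `|rho p - rho p'| <= L * `|p - p'|.
Proof.
have [L L0 hL] := tau_lipschitz.
pose m := Num.sqrt (Num.min 1 r).
have m0 : 0 < m by rewrite sqrtr_gt0 lt_min ltr01.
exists (L / m); first by rewrite divr_ge0// ltW.
move=> p p' hp hp'.
have rm (q : R) : 0 <= q <= 1 -> m <= rho q.
  by move=> hq; rewrite ler_sqrt ?tau_ge// ltW// tau_gt0.
rewrite mulrAC ler_pdivlMr//; apply: le_trans (hL p p' hp hp').
rewrite -!rho_sqr// subr_sqr normrM ler_wpM2l//.
have := rm _ hp; have := rm _ hp' => h h'.
by apply: le_trans (ler_norm _); lra.
Qed.

(** The constant grows with [k]; it serves only to apply the Weierstrass theorem to [rho^k]. *)
Lemma rho_pow_lipschitz k : exists L, forall p p' : R, 0 <= p <= 1 -> 0 <= p' <= 1 ->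
  `|rho p ^+ k - rho p' ^+ k| <= L * `|p - p'|.
Proof.
have [L L0 hL] := rho_lipschitz.
pose B := 1 + (1 + 2 * r).
have hr0 : 0 < r by exact: hr.
have B0 : 0 <= B by rewrite /B; lra.
have rB (q : R) : 0 <= q <= 1 -> 0 <= rho q <= B.
  move=> hq; rewrite (ltW (rho_gt0 hq)) /=.
  have : rho q ^+ 2 <= 1 + 2 * r by rewrite rho_sqr// tau_le.
  have := sqr_ge0 (rho q - 1); rewrite /B !expr2; lra.
elim: k => [|k [K hK]]; first by exists 0 => p p' _ _; rewrite !expr0 subrr normr0 mul0r.
exists (B * K + L * B ^+ k) => p p' hp hp'.
have /andP[a1 a2] := rB _ hp; have /andP[b1 b2] := rB _ hp'.
rewrite !exprS (_ : _ - _ = rho p * (rho p ^+ k - rho p' ^+ k) + (rho p - rho p') * rho p' ^+ k); last by ring.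
apply: le_trans (ler_normD _ _) _; rewrite !normrM mulrDl; apply: lerD.
  rewrite -mulrA; apply: ler_pM => //; first by rewrite ger0_norm.
  exact: hK.
rewrite mulrAC; apply: ler_pM => //; first exact: hL.
by rewrite ger0_norm ?exprn_ge0// lerXn2r ?nnegrE.
Qed.

End radial_profile.

Section star_domain.
Context {R : realType} {n : nat}.
Hypothesis hn : (3 <= n)%N.
Variables (r : R) (mu : R -> R).
Hypotheses (hr : 0 < r) (mu_smooth : smooth_halfline mu)
  (mu_decr : forall s t : R, 0 <= s -> s <= t -> mu t <= mu s)
  (mu_one : forall t : R, 0 <= t <= r -> mu t = 1)
  (mu_pos : forall t : R, 0 < t < 2 * r -> 0 < mu t)
  (mu_neg : forall t : R, 2 * r < t -> mu t < 0)
  (mu_deriv : derive1 mu (2 * r) < 0).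
Variables (i0 i1 : 'I_n).
Hypotheses (i0E : i0 = 0%N :> nat) (i1E : i1 = 1%N :> nat).
Implicit Types (x y xi : 'rV[R]_n).
Local Notation ssq := (@ssq R n i0 i1).
Local Notation tsq := (@tsq R n i0 i1).

Lemma i01_neq : i0 != i1.
Proof. by rewrite -val_eqE /= i0E i1E. Qed.

Lemma coord_nat0 x : coord_nat 0 x = x ord0 i0.
Proof.
rewrite /coord_nat; case: insubP => [i _ iE|]; last by rewrite (leq_trans _ hn).
by congr (x ord0 _); apply: val_inj; rewrite /= iE i0E.
Qed.

Lemma coord_nat1 x : coord_nat 1 x = x ord0 i1.
Proof.
rewrite /coord_nat; case: insubP => [i _ iE|]; last by rewrite (leq_trans _ hn).
by congr (x ord0 _); apply: val_inj; rewrite /= iE i1E.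
Qed.

Lemma outer_ge2 i : outer i0 i1 i = (2 <= i)%N.
Proof. by rewrite /outer -!val_eqE /= i0E i1E; case: (nat_of_ord i) => [|[|]]. Qed.

Lemma OmegaE x : Omega mu x = (ssq x < mu (tsq x)).
Proof.
rewrite /Omega /= coord_nat0 coord_nat1 (tsqE i0 i1); congr (is_true (_ < mu _)).
by apply: eq_bigl => i; rewrite outer_ge2.
Qed.

Lemma tsq_ge0 x : 0 <= tsq x.
Proof. by rewrite (tsqE i0 i1); apply: sumr_ge0 => i _; exact: sqr_ge0. Qed.

Lemma ssqE x : ssq x = x ord0 i0 ^+ 2 + x ord0 i1 ^+ 2.
Proof. by []. Qed.

Lemma ssq_ge0 x : 0 <= ssq x.
Proof. by rewrite ssqE addr_ge0 ?sqr_ge0. Qed.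

Lemma ssqZ (a : R) x : ssq (a *: x) = a ^+ 2 * ssq x.
Proof. by rewrite !ssqE !mxE; ring. Qed.

Lemma tsqZ (a : R) x : tsq (a *: x) = a ^+ 2 * tsq x.
Proof.
rewrite !(tsqE i0 i1) mulr_sumr; apply: eq_bigr => i _.
by rewrite !mxE exprMn.
Qed.

Lemma gap_continuous : continuous (fun x => ssq x - mu (tsq x)).
Proof.
move=> x.
have -> : (fun x => ssq x - mu (tsq x)) = (fun x => peval (pss i0 i1) x - mu `|tsq x|).
  by apply/funext => y; rewrite pssE ger0_norm ?tsq_ge0.
apply: (@continuousB _ _ _ (peval (pss i0 i1)) (fun x => mu `|tsq x|)).
  exact: peval_continuous.
apply: (@continuous_comp _ _ _ (peval (ptt i0 i1)) (fun t : R => mu `|t|)).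
  exact: peval_continuous.
exact: (mu_abs_continuous mu_smooth).
Qed.

(** A point of the level set is the limit of [(1 - d) x]: shrinking lowers [ssq] strictly unless it
    is zero, and cannot lower [mu (tsq x)]. If [ssq x = 0] then [tsq x = 2 r], and [mu] is positive
    just below. *)
Lemma boundary_Omega x : boundary (Omega mu) x <-> ssq x = mu (tsq x).
Proof.
have oO : open (Omega mu : set 'rV[R]_n).
  rewrite (_ : Omega mu = (fun x => ssq x - mu (tsq x)) @^-1` [set u | u < 0]).
    apply: open_comp; last exact: open_lt.
    by move=> y _; exact: gap_continuous.
  by apply/funext => y; rewrite OmegaE /= subr_lt0.
have cO : closure (Omega mu) `<=` [set y | ssq y <= mu (tsq y)].
  have c : closed [set y | ssq y <= mu (tsq y)].
    rewrite (_ : [set y | _] = (fun x => ssq x - mu (tsq x)) @^-1` [set u | u <= 0]).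
      apply: closed_comp; last exact: closed_le.
      by move=> y _; exact: gap_continuous.
    by apply/funext => y; rewrite /= subr_le0.
  by move/closure_id : c => ->; apply: closureS => y; rewrite OmegaE => /ltW.
rewrite /boundary ((interior_id _).1 oO); split.
  move=> [/cO /= h]; rewrite OmegaE => /negP; rewrite -leNgt => h'.
  by apply/le_anti; rewrite h h'.
move=> E; split; last by rewrite OmegaE E ltxx.
move=> A /nbhs_enormP[e e0 eA].
pose d := Num.min 2^-1 (e / (enorm x + 1) / 2).
have x10 : 0 < enorm x + 1 by rewrite ltr_wpDl// enorm_ge0.
have d0 : 0 < d by rewrite lt_min invr_gt0 ltr0n /= !divr_gt0.
have d1 : d <= 2^-1 by rewrite ge_min lexx.
have de : d * (enorm x + 1) < e.
  have : d * (enorm x + 1) <= e / (enorm x + 1) / 2 * (enorm x + 1).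
    by rewrite ler_pM2r// ge_min lexx orbT.
  have -> : e / (enorm x + 1) / 2 * (enorm x + 1) = e / 2 by field; rewrite gt_eqF.
  by lra.
exists ((1 - d) *: x); split; last first.
  apply: eA; rewrite scalerBl scale1r addrC addKr enormN enormZ gtr0_norm//.
  by apply: le_lt_trans de; rewrite ler_pM2l// lerDl.
rewrite OmegaE ssqZ tsqZ.
have s1 : 0 < (1 - d) ^+ 2 < 1.
  have h1 : 0 < 1 - d by lra.
  by rewrite exprn_gt0//= expr_lt1//; lra.
have /andP[s0 s1'] := s1.
have tt : (1 - d) ^+ 2 * tsq x <= tsq x by rewrite ler_piMl ?tsq_ge0// ltW.
have m1 : mu (tsq x) <= mu ((1 - d) ^+ 2 * tsq x).
  by apply: mu_decr => //; rewrite mulr_ge0 ?tsq_ge0// ltW.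
have [x0|xn0] := eqVneq (ssq x) 0; last first.
  apply: (@lt_le_trans _ _ (ssq x)); last by rewrite E.
  by rewrite gtr_pMl// lt_neqAle eq_sym xn0 ssq_ge0.
have t2 : tsq x = 2 * r.
  by apply: (mu_eq0 hr mu_one mu_pos mu_neg); rewrite ?tsq_ge0// -E.
rewrite x0 mulr0 t2; apply: mu_pos; have hr0 : 0 < 2 * r by rewrite mulr_gt0.
by rewrite mulr_gt0//= gtr_pMl.
Qed.

Local Notation tau := (tau hr mu_smooth mu_decr mu_one mu_neg).
Local Notation rho := (rho hr mu_smooth mu_decr mu_one mu_neg).

Lemma rhoE p : rho p = Num.sqrt (tau p).
Proof. by []. Qed.

Lemma ssq_tsq_sphere xi : enorm xi = 1 -> tsq xi = 1 - ssq xi.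
Proof.
by have := enorm_ssq_tsq i01_neq xi => + x1; rewrite x1 expr1n => ->; ring.
Qed.

Lemma ssq01 xi : enorm xi = 1 -> 0 <= ssq xi <= 1.
Proof. exact: ssq_sphere i01_neq xi. Qed.

Lemma boundary_neq0 y : ssq y = mu (tsq y) -> enorm y != 0.
Proof.
move=> E; apply/eqP => /enorm_eq0 y0; move: E; rewrite y0.
rewrite -(scale0r (0 : 'rV[R]_n)) ssqZ tsqZ expr0n /= !mul0r (mu0 hr mu_one) => /eqP.
by rewrite eq_sym oner_eq0.
Qed.

Lemma boundary_enorm y : ssq y = mu (tsq y) ->
  enorm y = rho (ssq (zeta y)) /\ enorm (zeta y) = 1.
Proof.
move=> E; have yn0 := boundary_neq0 E.
have y0 : 0 < enorm y by rewrite lt_neqAle eq_sym yn0 enorm_ge0.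
have z1 : enorm (zeta y) = 1 by rewrite /zeta enormZ normfV gtr0_norm// mulVf.
split => //.
rewrite rhoE -(tau_unique hr mu_smooth mu_decr mu_one mu_pos mu_neg (ssq01 z1) (t := enorm y ^+ 2)).
- by rewrite sqrtr_sqr gtr0_norm.
- by rewrite exprn_gt0.
have e2 : ssq (zeta y) * enorm y ^+ 2 = ssq y.
  by rewrite /zeta ssqZ exprVn mulrAC mulVf ?mul1r// expf_neq0.
have e3 : (1 - ssq (zeta y)) * enorm y ^+ 2 = tsq y.
  by rewrite -(ssq_tsq_sphere z1) /zeta tsqZ exprVn mulrAC mulVf ?mul1r// expf_neq0.
by rewrite e2 e3.
Qed.

Lemma zeta_inj : {in boundary (Omega mu) &, injective (@zeta R n)}.
Proof.
move=> x y; rewrite !inE => /boundary_Omega bx /boundary_Omega by_ E.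
have [ex _] := boundary_enorm bx; have [ey _] := boundary_enorm by_.
have xn0 := boundary_neq0 bx; have yn0 := boundary_neq0 by_.
have {}ex : enorm x = enorm y by rewrite ex ey E.
by move: E; rewrite /zeta ex => /(can_inj (scalerK _)); apply; rewrite invr_eq0.
Qed.

(** [zeta_inv] is a partial inverse obtained by choice; injectivity of [zeta] on the boundary makes
    it equal to the explicit point, which lies on the boundary by the equation of [tau]. *)
Lemma zeta_invE xi : enorm xi = 1 -> zeta_inv mu xi = rho (ssq xi) *: xi.
Proof.
move=> xi1; have p01 := ssq01 xi1.
have r0 := rho_gt0 hr mu_smooth mu_decr mu_one mu_neg p01.
pose y := rho (ssq xi) *: xi.
have by_ : boundary (Omega mu) y.
  apply/boundary_Omega; rewrite /y ssqZ tsqZ rho_sqr// (ssq_tsq_sphere xi1).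
  by rewrite mulrC [X in mu X]mulrC; exact: tauE.
have -> : xi = zeta y.
  by rewrite /zeta /y enormZ xi1 mulr1 gtr0_norm// scalerA mulVf ?scale1r// gt_eqF.
have K : {in boundary (Omega mu), cancel (@zeta R n) (zeta_inv mu)}.
  by apply: pinvKV; exact: zeta_inj.
rewrite K ?inE//.
rewrite {1}/y; congr (rho (ssq _) *: _).
  by rewrite /zeta /y enormZ xi1 mulr1 gtr0_norm// scalerA mulVf ?scale1r// gt_eqF.
by rewrite /zeta /y enormZ xi1 mulr1 gtr0_norm// scalerA mulVf ?scale1r// gt_eqF.
Qed.

(** The [z]-part of the boundary point has modulus at most 1, which makes the lacunary series
    converge there. *)
Lemma rho_ssq_le1 xi : enorm xi = 1 -> rho (ssq xi) ^+ 2 * ssq xi <= 1.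
Proof.
move=> x1; rewrite rho_sqr ?ssq01// mulrC.
exact: tau_p_le1 (ssq01 x1).
Qed.

(** For [s = |z|^2 >= 1 / (1 + r)] the candidate [tau = 1 / s] gives [(1 - s) / s <= r], where
    [mu = 1]: the boundary point is on the cylinder [|z| = 1]. *)
Lemma rho_ssq_eq1 xi : enorm xi = 1 -> 1 <= (1 + r) * ssq xi ->
  rho (ssq xi) ^+ 2 * ssq xi = 1.
Proof.
move=> x1 h; have p01 := ssq01 x1; have /andP[p0 p1] := p01.
have r0 : 0 < r by exact: hr.
have pp : 0 < ssq xi.
  by rewrite lt_neqAle eq_sym p0 andbT; apply/eqP => E; move: h; rewrite E; lra.
rewrite rho_sqr// -(tau_unique hr mu_smooth mu_decr mu_one mu_pos mu_neg p01 (t := (ssq xi)^-1)).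
- by rewrite mulVf// gt_eqF.
- by rewrite invr_gt0.
rewrite divff ?gt_eqF// mu_one// divr_ge0 ?subr_ge0//=.
by rewrite ler_pdivrMr//; lra.
Qed.

End star_domain.

(** * The lacunary series *)

Section lacunary_series.
Context {R : realType}.
Variable alpha : R.
Hypothesis halpha : 0 <= alpha < 1.

Definition lcoef (j : nat) : R :=
  if (0 < j)%N then if alpha == 0 then j%:R ^- 2 else 2 `^ (- (j%:R * alpha)) else 0.

Lemma lcoef_ge0 j : 0 <= lcoef j.
Proof.
rewrite /lcoef; case: ifP => // _; case: ifP => _; last exact: powR_ge0.
by rewrite invr_ge0 exprn_ge0.
Qed.

Lemma lcoef_powE j : (0 < j)%N -> 0 < alpha -> lcoef j = (2 `^ (- alpha)) ^+ j.
Proof.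
move=> j0 a0; rewrite /lcoef j0 gt_eqF// -powR_mulrn ?powR_ge0// -powRrM.
by rewrite mulNr mulrC.
Qed.

Lemma pow2alpha_lt1 : 0 < alpha -> 0 < (2 : R) `^ (- alpha) < 1.
Proof.
move=> a0; rewrite powR_gt0//= powRN invf_lt1 ?powR_gt0//.
have : (1 : R) `^ alpha < 2 `^ alpha.
  by apply: gt0_ltr_powR; rewrite ?nnegrE ?ltr1n.
by rewrite powR1.
Qed.

Lemma lcoef_geometric_tail : 0 < alpha ->
  let T j := (2 `^ (- alpha)) ^+ j / (1 - 2 `^ (- alpha)) in
  [/\ forall j, lcoef j <= T j - T j.+1, forall j, 0 <= T j & T @ \oo --> (0 : R)].
Proof.
move=> a0 T; rewrite {}/T.
have /andP[q0 q1] := pow2alpha_lt1 a0; set q : R := 2 `^ (- alpha) in q0 q1.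
have q1' : 0 < 1 - q by lra.
split.
- move=> j.
  have -> : q ^+ j / (1 - q) - q ^+ j.+1 / (1 - q) = q ^+ j.
    by rewrite exprS; field; rewrite gt_eqF.
  case: j => [|j]; last by rewrite lcoef_powE.
  by rewrite /lcoef /= expr0.
- by move=> j; rewrite divr_ge0 ?exprn_ge0 ?ltW.
rewrite (_ : 0 = 0 / (1 - q)); last by rewrite mul0r.
by apply: cvgMl; apply: cvg_expr; rewrite gtr0_norm.
Qed.

(** A telescoping majorant: [T J] bounds the sum of all coefficients from index [J] on. *)
Lemma lcoef_tail : exists T : nat -> R, [/\ forall j, lcoef j <= T j - T j.+1,
  forall j, 0 <= T j & T @ \oo --> (0 : R)].
Proof.
have /andP[a0 a1] := halpha.
have [aE|aN] := eqVneq alpha 0.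
  (* Consecutive values differ by [6 / ((j + 1) (j + 2))], and [(j + 1) (j + 2) <= 6 j^2] for
     [j >= 1], with equality at 1. *)
  exists (fun j => 6 / j.+1%:R); split.
  - move=> j; rewrite /lcoef aE eqxx; case: j => [|j] /=; first by lra.
    have j0 : (0 : R) <= j%:R by [].
    have -> : j.+1%:R = j%:R + 1 :> R by rewrite natr1.
    have -> : j.+2%:R = j%:R + 1 + 1 :> R by rewrite !natr1.
    have -> : j.+3%:R = j%:R + 1 + 1 + 1 :> R by rewrite !natr1.
    move: (j%:R : R) j0 => t j0.
    have -> : 6 / (t + 1 + 1) - 6 / (t + 1 + 1 + 1) = 6 / ((t + 1 + 1) * (t + 1 + 1 + 1)).
      by field; apply/andP; split; rewrite gt_eqF//; lra.
    rewrite ler_pdivlMr; last by apply: mulr_gt0; lra.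
    rewrite mulrC ler_pdivrMr; last by apply: exprn_gt0; lra.
    by nra.
  - by move=> j; rewrite divr_ge0.
  rewrite (_ : 0 = 6 * 0 :> R); last by rewrite mulr0.
  by apply: cvgMr; exact: cvg_harmonic.
have {}a0 : 0 < alpha by rewrite lt_neqAle eq_sym aN.
by have := lcoef_geometric_tail a0; set T := (fun j => _) => hT; exists T.
Qed.

(** Only the powers of 2 contribute. The term [j = 0] on the right agrees with the exclusion of
    [k = 1] because [lcoef 0 = 0]. *)
Lemma lacunary_partial (v : nat -> R) N :
  \sum_(k < N.+1) lacunary_coef alpha k * v k =
  \sum_(j < (trunc_log 2 N).+1) lcoef j * v (2 ^ j)%N.
Proof.
elim: N => [|N IH].
  by rewrite trunc_log0 !big_ord1 /lacunary_coef /lcoef trunc_log0 /= !mul0r.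
rewrite big_ord_recr /= IH.
set t := trunc_log 2 N.+1.
have /andP[tl tu] : (2 ^ t <= N.+1 < 2 ^ t.+1)%N by exact: trunc_log_bounds.
have [E|NE] := eqVneq N.+1 (2 ^ t)%N; last first.
  have -> : trunc_log 2 N = t.
    by apply: trunc_log_eq => //; lia.
  by rewrite /lacunary_coef -/t (negbTE NE) andbF mul0r addr0.
case: t tl tu E => [|t] tl tu E.
  have N0 : N = 0%N by move: E; rewrite expn0; lia.
  rewrite N0 trunc_log0 /lacunary_coef.
  have -> : trunc_log 2 1 = 0%N by [].
  by rewrite /= mul0r addr0.
have tE : trunc_log 2 N.+1 = t.+1 by rewrite E trunc_expnK.
have -> : trunc_log 2 N = t.
  apply: trunc_log_eq => //.
  move: E; rewrite expnS => E.
  have := expn_gt0 2 t; rewrite /= => p0.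
  by apply/andP; split; rewrite ?expnS; lia.
by rewrite [RHS]big_ord_recr /=; congr (_ + _); rewrite /lacunary_coef /lcoef tE -E eqxx.
Qed.

Definition lsum (v : nat -> R) : R := limn (fun J => \sum_(j < J) lcoef j * v j).

Lemma lsum_block (T : nat -> R) (B : R) (v : nat -> R) (J K : nat) :
  (forall j, lcoef j <= T j - T j.+1) -> (forall j, 0 <= T j) -> 0 <= B ->
  (forall j, `|v j| <= B) -> (J <= K)%N ->
  `|\sum_(j < K) lcoef j * v j - \sum_(j < J) lcoef j * v j| <= B * T J.
Proof.
move=> hT T0 B0 vB /subnK <-.
suff : `|\sum_(j < (K - J) + J) lcoef j * v j - \sum_(j < J) lcoef j * v j| <=
    B * (T J - T ((K - J) + J)%N).
  move/le_trans; apply; apply: ler_wpM2l => //.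
  by rewrite lerBlDr lerDl.
elim: (K - J)%N => [|d IH]; first by rewrite add0n !subrr normr0 mulr0.
rewrite addSn big_ord_recr /= addrAC.
apply: le_trans (ler_normD _ _) _.
have h : `|lcoef (d + J) * v (d + J)%N| <= B * (T (d + J)%N - T (d + J).+1).
  rewrite normrM (ger0_norm (lcoef_ge0 _)) mulrC.
  by apply: ler_pM => //; exact: lcoef_ge0.
by apply: le_trans (lerD IH h) _; rewrite -mulrDr; apply: ler_wpM2l => //; lra.
Qed.

Section bounded_terms.
Variables (T : nat -> R).
Hypotheses (hT : forall j, lcoef j <= T j - T j.+1) (T0 : forall j, 0 <= T j)
  (Tcvg : T @ \oo --> (0 : R)).

Lemma tail_small (eps : R) : 0 < eps -> exists N, forall J, (N <= J)%N -> T J <= eps.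
Proof.
move=> e0; have /cvgrPdist_le/(_ eps e0)[N _ h] := Tcvg.
exists N => J NJ; have := h J NJ.
by rewrite sub0r normrN ger0_norm.
Qed.

Lemma lsum_cvg (B : R) (v : nat -> R) : (forall j, `|v j| <= B) ->
  \sum_(j < J) lcoef j * v j @[J --> \oo] --> lsum v.
Proof.
move=> vB; apply: cauchy_cvgn => e e0.
have B0 : 0 <= B by exact: le_trans (vB 0%N).
have B1 : 0 < 2 * (B + 1) by lra.
have [N hN] := tail_small (divr_gt0 e0 B1).
exists N.
have h : forall k, (N <= k)%N ->
    `|\sum_(j < k) lcoef j * v j - \sum_(j < N) lcoef j * v j| <= e / 2.
  move=> k Nk; apply: le_trans (lsum_block hT T0 B0 vB Nk) _.
  have := hN N (leqnn _); rewrite ler_pdivlMr// => hh.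
  have := T0 N; nra.
move=> k l /h hk /h hl.
move: hk hl; rewrite !ler_norml => /andP[? ?] /andP[? ?].
by apply/andP; split; lra.
Qed.

Lemma lsum_dist (B : R) (v : nat -> R) J : (forall j, `|v j| <= B) ->
  `|lsum v - \sum_(j < J) lcoef j * v j| <= B * T J.
Proof.
move=> vB; have B0 : 0 <= B by exact: le_trans (vB 0%N).
by apply: (cvgn_dist_le (lsum_cvg vB)) => K; exact: lsum_block.
Qed.

Lemma lsum_lin (B B' a b : R) (v v' : nat -> R) : (forall j, `|v j| <= B) -> (forall j, `|v' j| <= B') ->
  lsum (fun j => a * v j + b * v' j) = a * lsum v + b * lsum v'.
Proof.
move=> vB vB'; apply/cvg_lim => //.
have -> : (fun J => \sum_(j < J) lcoef j * (a * v j + b * v' j)) =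
   (fun J => a * (\sum_(j < J) lcoef j * v j) + b * (\sum_(j < J) lcoef j * v' j)).
  apply/funext => J; rewrite !mulr_sumr -big_split /=.
  by apply: eq_bigr => j _; ring.
by apply: cvgD; apply: cvgMr; [exact: lsum_cvg vB|exact: lsum_cvg vB'].
Qed.

Lemma lsum_split (B : R) (v : nat -> R) J : (forall j, `|v j| <= B) ->
  `|lsum v| <= \sum_(j < J) lcoef j * `|v j| + B * T J.
Proof.
move=> vB; have := lsum_dist J vB.
have h : `|\sum_(j < J) lcoef j * v j| <= \sum_(j < J) lcoef j * `|v j|.
  apply: le_trans (ler_norm_sum _ _ _) _; apply: ler_sum => j _.
  by rewrite normrM (ger0_norm (lcoef_ge0 _)).
move: h; rewrite !ler_norml => /andP[? ?] /andP[? ?].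
by apply/andP; split; lra.
Qed.

Lemma lsum_single J (t : R) : lsum (fun j => if j == J then t else 0) = lcoef J * t.
Proof.
apply/cvg_lim => //; apply: cvg_near_cst; exists J.+1 => // K /= JK.
rewrite (bigD1 (Ordinal JK)) //= eqxx big1 ?addr0// => i iJ.
by rewrite ifN ?mulr0//; apply: contraNneq iJ => E; apply/eqP/val_inj.
Qed.

Lemma lacunary_series_lsum (B : R) (v : nat -> R) : (forall k, `|v k| <= B) ->
  limn (series (fun k => lacunary_coef alpha k * v k)) = lsum (fun j => v (2 ^ j)%N).
Proof.
move=> vB; apply/cvg_lim => //.
have h := @lsum_cvg B (fun j => v (2 ^ j)%N) (fun j => vB _).
apply/cvgrPdist_le => e e0; have /cvgrPdist_le/(_ e e0)[N _ hN] := h.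
exists (2 ^ N).+1 => // -[|k] //= kN.
rewrite /series /= big_mkord lacunary_partial; apply: hN => /=.
by apply: leqW; rewrite -(trunc_expnK (p := 2) N) // leq_trunc_log.
Qed.

End bounded_terms.

End lacunary_series.

(** * Rotations of the plane of the first two coordinates *)

Section trigonometric_bounds.
Context {R : realType}.
Implicit Types t : R.

Lemma sin_le_id t : 0 <= t -> `|sin t| <= t.
Proof.
rewrite le_eqVlt => /predU1P[<-|t0]; first by rewrite sin0 normr0.
have [c _ E] := @MVT R sin cos 0 t t0 (fun x _ => is_derive_sin x)
  (continuous_subspaceT (@continuous_sin R)).
move: E; rewrite sin0 !subr0 => ->; rewrite normrM (gtr0_norm t0).
by rewrite ler_piMl ?cos_max// ltW.
Qed.

Lemma cos_sub1_le t : 0 <= t -> `|cos t - 1| <= t.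
Proof.
rewrite le_eqVlt => /predU1P[<-|t0]; first by rewrite cos0 subrr normr0.
have [c _ E] := @MVT R cos (fun x => - sin x) 0 t t0 (fun x _ => is_derive_cos x)
  (continuous_subspaceT (@continuous_cos R)).
move: E; rewrite cos0 subr0 => ->; rewrite normrM (gtr0_norm t0) normrN.
by rewrite ler_piMl ?sin_max// ltW.
Qed.

Lemma cos_pi_pow2 j : cos ((2 ^ j)%:R * (pi / (2 ^ j)%:R) : R) = -1 /\
  sin ((2 ^ j)%:R * (pi / (2 ^ j)%:R) : R) = 0.
Proof.
by rewrite mulrCA divff ?mulr1 ?cospi ?sinpi// pnatr_eq0 -lt0n expn_gt0.
Qed.

Lemma cos_sin_pi_pow2_lt i j : (i < j)%N ->
  cos ((2 ^ j)%:R * (pi / (2 ^ i)%:R) : R) = 1 /\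
  sin ((2 ^ j)%:R * (pi / (2 ^ i)%:R) : R) = 0.
Proof.
move=> ij.
have -> : (2 ^ j)%:R * (pi / (2 ^ i)%:R) = (pi *+ 2) *+ 2 ^ (j - i.+1) :> R.
  have -> : (2 ^ j)%:R = 2 * (2 ^ (j - i.+1))%:R * (2 ^ i)%:R :> R.
    by rewrite -!natrM -expnS -expnD; congr (2 ^ _)%:R; lia.
  have h : (2 ^ i)%:R != 0 :> R by rewrite pnatr_eq0 -lt0n expn_gt0.
  rewrite -(mulr_natr _ (2 ^ (j - i.+1))) -[pi *+ 2]mulr_natl.
  by field.
have := periodicn (@cosD2pi R) (2 ^ (j - i.+1)) 0.
have := periodicn (@sinD2pi R) (2 ^ (j - i.+1)) 0.
by rewrite !add0r cos0 sin0 => -> ->.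
Qed.

End trigonometric_bounds.

Section rotations.
Context {R : realType} {n : nat}.
Variables (i0 i1 : 'I_n).
Hypothesis i01 : i0 != i1.
Implicit Types (x y : 'rV[R]_n) (t : R).
Local Notation ssq := (@ssq R n i0 i1).
Local Notation tsq := (@tsq R n i0 i1).
Local Notation zang := (@zang R n i0 i1).

Definition rot t x : 'rV[R]_n := \row_i
  (if i == i0 then cos t * x ord0 i0 - sin t * x ord0 i1
   else if i == i1 then sin t * x ord0 i0 + cos t * x ord0 i1 else x ord0 i).

Lemma rot_0 t x : rot t x ord0 i0 = cos t * x ord0 i0 - sin t * x ord0 i1.
Proof. by rewrite mxE eqxx. Qed.

Lemma rot_1 t x : rot t x ord0 i1 = sin t * x ord0 i0 + cos t * x ord0 i1.
Proof. by rewrite mxE eq_sym (negbTE i01) eqxx. Qed.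

Lemma rot_out t x i : outer i0 i1 i -> rot t x ord0 i = x ord0 i.
Proof. by rewrite mxE => /andP[/negbTE -> /negbTE ->]. Qed.

Lemma rot_ssq t x : ssq (rot t x) = ssq x.
Proof.
rewrite !ssqE rot_0 rot_1.
transitivity ((cos t ^+ 2 + sin t ^+ 2) * (x ord0 i0 ^+ 2 + x ord0 i1 ^+ 2)); first by ring.
by rewrite cos2Dsin2 mul1r.
Qed.

Lemma rot_tsq t x : tsq (rot t x) = tsq x.
Proof. by rewrite !(tsqE i0 i1); apply: eq_bigr => i /(rot_out t x) ->. Qed.

Lemma rot_enorm t x : enorm (rot t x) = enorm x.
Proof.
apply/eqP; rewrite -(@eqrXn2 _ 2) ?enorm_ge0// !(enorm_ssq_tsq i01).
by rewrite rot_ssq rot_tsq.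
Qed.

Lemma rotB t x y : rot t (x - y) = rot t x - rot t y.
Proof. by apply/rowP => i; rewrite !mxE; do ![case: ifP => _] => //; ring. Qed.

Lemma rotD t s x : rot t (rot s x) = rot (t + s) x.
Proof.
apply/rowP => i; rewrite [LHS]mxE [RHS]mxE rot_0 rot_1 cosD sinD.
case: ifP => [_|n0]; first by ring.
case: ifP => [_|n1]; first by ring.
by rewrite mxE n0 n1.
Qed.

Lemma rot0 x : rot 0 x = x.
Proof.
apply/rowP => i; rewrite mxE cos0 sin0 !mul1r !mul0r subr0 add0r.
by do ![case: eqP => [->|_] //].
Qed.

Lemma rotK t x : rot (- t) (rot t x) = x.
Proof. by rewrite rotD addNr rot0. Qed.

(** A rotation by [t] multiplies [z^k] by [e^(i k t)], that is, it turns the phase [c + i d] by the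
    angle [k t]. *)
Lemma zang_rot c d k t x : peval (zang c d k) (rot t x) =
  peval (zang (c * cos (k%:R * t) - d * sin (k%:R * t))
              (c * sin (k%:R * t) + d * cos (k%:R * t)) k) x.
Proof.
have : zre i0 i1 k (rot t x) =
    cos (k%:R * t) * zre i0 i1 k x - sin (k%:R * t) * zim i0 i1 k x /\
  zim i0 i1 k (rot t x) = sin (k%:R * t) * zre i0 i1 k x + cos (k%:R * t) * zim i0 i1 k x.
  elim: k => [|k [IHr IHi]].
    rewrite mul0r cos0 sin0 /zre /zim /=; split; ring.
  rewrite !zreS !zimS IHr IHi rot_0 rot_1 -natr1 [(k%:R + 1) * t]mulrDl mul1r cosD sinD.
  by split; ring.
by rewrite !zangE => -[-> ->]; ring.
Qed.

Lemma enorm_rot_sub t x : 0 <= t -> enorm (rot t x - x) <= 4 * t * enorm x.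
Proof.
move=> t0; have h0 := sin_le_id t0; have h1 := cos_sub1_le t0.
apply: le_trans (enorm_le_sum _) _.
rewrite (sum_outer i01) [X in _ + X]big1 ?addr0; last first.
  move=> i /(rot_out t x) oi.
  have -> : (rot t x - x) ord0 i = rot t x ord0 i - x ord0 i by rewrite !mxE.
  by rewrite oi subrr normr0.
have h : forall a b : R, `|a| <= enorm x -> `|b| <= enorm x -> forall s s' : R,
    `|s| <= t -> `|s'| <= t -> `|s * a + s' * b| <= 2 * t * enorm x.
  move=> a b ha hb s s' hs hs'; apply: le_trans (ler_normD _ _) _.
  rewrite !normrM.
  have e1 : `|s| * `|a| <= t * enorm x by apply: ler_pM.
  have e2 : `|s'| * `|b| <= t * enorm x by apply: ler_pM.
  by lra.
have -> : 4 * t * enorm x = 2 * t * enorm x + 2 * t * enorm x by ring.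
apply: lerD.
  have -> : (rot t x - x) ord0 i0 = (cos t - 1) * x ord0 i0 + (- sin t) * x ord0 i1.
    by rewrite !mxE eqxx; ring.
  by apply: h; rewrite ?coord_le_enorm ?normrN.
have -> : (rot t x - x) ord0 i1 = sin t * x ord0 i0 + (cos t - 1) * x ord0 i1.
  by rewrite !mxE eqxx eq_sym (negbTE i01); ring.
by apply: h; rewrite ?coord_le_enorm.
Qed.

Lemma zang_le c d k x : ssq x <= 1 -> `|peval (zang c d k) x| <= `|c| + `|d|.
Proof.
move=> s1; rewrite zangE; apply: le_trans (ler_normB _ _) _.
have s0 : 0 <= ssq x by rewrite ssqE addr_ge0 ?sqr_ge0.
have h : zre i0 i1 k x ^+ 2 + zim i0 i1 k x ^+ 2 <= 1.
  by rewrite zre_zim exprn_ile1.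
have h1 : `|zre i0 i1 k x| <= 1.
  by rewrite -(@expr_le1 _ 2)// -normrX ger0_norm ?sqr_ge0//; have := sqr_ge0 (zim i0 i1 k x); lra.
have h2 : `|zim i0 i1 k x| <= 1.
  by rewrite -(@expr_le1 _ 2)// -normrX ger0_norm ?sqr_ge0//; have := sqr_ge0 (zre i0 i1 k x); lra.
by rewrite !normrM; apply: lerD; rewrite ler_piMr.
Qed.

(** On [|z| <= 1], a convex set that contains the segment, each partial derivative of [zang] is at
    most [k (|c| + |d|)]. *)
Lemma zang_lipschitz c d k x y : ssq x <= 1 -> ssq y <= 1 ->
  `|peval (zang c d k) y - peval (zang c d k) x| <=
  k%:R * (`|c| + `|d|) * (`|y ord0 i0 - x ord0 i0| + `|y ord0 i1 - x ord0 i1|).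
Proof.
move=> x1 y1; have [t [/andP[t0 t1] ->]] := peval_mvt (zang c d k) x y.
set z := t *: (y - x) + x.
have z1 : ssq z <= 1.
  have -> : ssq z = (1 - t) * ssq x + t * ssq y -
      t * (1 - t) * ((y ord0 i0 - x ord0 i0) ^+ 2 + (y ord0 i1 - x ord0 i1) ^+ 2).
    by rewrite !ssqE !mxE; ring.
  have : 0 <= t * (1 - t) * ((y ord0 i0 - x ord0 i0) ^+ 2 + (y ord0 i1 - x ord0 i1) ^+ 2).
    by rewrite mulr_ge0 ?addr_ge0 ?sqr_ge0 ?mulr_ge0// subr_ge0.
  have : (1 - t) * ssq x <= 1 - t by rewrite ler_piMr// subr_ge0.
  have : t * ssq y <= t by rewrite ler_piMr.
  by lra.
rewrite (sum_outer i01) [X in _ + X]big1 ?addr0; last first.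
  by move=> i /andP[a b]; rewrite zang_deriv_out ?mulr0.
rewrite !(zang_deriv i01) eqxx (negbTE i01) eq_sym (negbTE i01) eqxx.
rewrite !mul1r !mul0r addr0 add0r !mxE.
have b0 := zang_le c d k.-1 z1.
have b1 := zang_le (- d) c k.-1 z1; rewrite normrN in b1.
move: (peval _ z) (peval _ z) b0 b1 => p q b0 b1.
apply: le_trans (ler_normD _ _) _; rewrite !normrM normr_nat mulrDr.
apply: lerD; rewrite mulrC ?mulrA; apply: ler_wpM2r => //; apply: ler_wpM2l => //.
by rewrite addrC.
Qed.

End rotations.

Section lacunary_growth.
Context {R : realType}.
Variable alpha : R.

(** Write [2^(s/m) = 1 + x] with [x > 0]; Bernoulli's inequality gives [(1 + x)^j >= x j], to be
    raised to the power [m]. *)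
Lemma exp2_growth (s : R) m : 0 < s -> exists2 c : R, 0 < c &
  forall j : nat, c * j%:R ^+ m <= 2 `^ (s * j%:R).
Proof.
move=> s0.
have [->|m0] := posnP m.
  exists 1 => // j; rewrite expr0 mulr1 -[leLHS](powRr0 2).
  by apply: ler_powR; rewrite ?ler1n// mulr_ge0// ltW.
have sm : 0 < s / m%:R by rewrite divr_gt0// ltr0n.
have x0 : 0 < (2 : R) `^ (s / m%:R) - 1.
  have : (1 : R) `^ (s / m%:R) < 2 `^ (s / m%:R).
    by apply: gt0_ltr_powR; rewrite ?nnegrE ?ltr1n.
  by rewrite powR1 subr_gt0.
set x := _ - 1 in x0.
exists (x ^+ m) => [|j]; first exact: exprn_gt0.
have -> : (2 : R) `^ (s * j%:R) = ((1 + x) ^+ j) ^+ m.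
  rewrite /x addrC subrK -!powR_mulrn ?powR_ge0// -!powRrM.
  by congr (_ `^ _); field; rewrite pnatr_eq0 -lt0n.
have x0' : 0 <= x by exact: ltW.
clearbody x.
rewrite -exprMn; apply: lerXn2r; rewrite ?nnegrE ?mulr_ge0 ?exprn_ge0 ?addr_ge0//.
elim: j => [|j IH]; first by rewrite mulr0 expr0.
rewrite exprS -natr1.
have j0 : (0 : R) <= j%:R by [].
have h : 0 <= (1 + x) ^+ j by rewrite exprn_ge0// addr_ge0// ltW.
have h1 : 1 <= (1 + x) ^+ j by rewrite exprn_ege1// lerDl ltW.
by nra.
Qed.

Lemma powR_half_power (a : R) (J : nat) : (2 `^ (- a)) ^+ J = (2 ^- J) `^ a.
Proof.
have -> : 2 ^- J = 2 `^ (- J%:R) :> R by rewrite powR_invn.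
rewrite -powR_mulrn; last exact: powR_ge0.
by rewrite -!powRrM; congr (_ `^ _); ring.
Qed.

Lemma exp2_unbounded (s C : R) : 0 < s -> exists2 j : nat, (0 < j)%N & C < 2 `^ (s * j%:R).
Proof.
move=> s0; have [c c0 h] := exp2_growth 1 s0.
have [j hj] : exists j : nat, C / c < j%:R.
  exists (Num.truncn (C / c)).+1; exact: truncnS_gt.
exists j.+1 => //; apply: lt_le_trans (h j.+1).
rewrite expr1 -natr1 mulrDr mulr1.
by move: hj; rewrite ltr_pdivrMr// mulrC => hj; lra.
Qed.

(** For [alpha > 0] the exponent [(s - alpha) j] is nonnegative; for [alpha = 0] the exponential
    beats [j^2]. Both negative results confront this bound with a quantity that becomes small. *)
Lemma lcoef_lower (s : R) : 0 < s -> alpha <= s -> exists2 c : R, 0 < c &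
  forall j, (0 < j)%N -> c <= lcoef alpha j * 2 `^ (s * j%:R).
Proof.
move=> s0 as_; have [aE|aN] := eqVneq alpha 0.
  have [c c0 h] := exp2_growth 2 s0; exists c => // j j0.
  rewrite /lcoef j0 aE eqxx mulrC ler_pdivlMr ?exprn_gt0 ?ltr0n//.
exists 1 => // j j0; rewrite /lcoef j0 (negbTE aN) -powRD; last first.
  by apply/implyP => _; rewrite pnatr_eq0.
rewrite -[leLHS](powRr0 2); apply: ler_powR; first by rewrite ler1n.
have : (0 : R) <= j%:R by [].
by nra.
Qed.

Lemma holder_within n (A : set 'rV[R]_n) (f : 'rV[R]_n -> R) :
  0 <= alpha -> holder_space alpha A f -> {within A, continuous f}.
Proof.
move=> alpha0; rewrite /holder_space; have [//|aN] := eqVneq alpha 0.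
have a0 : 0 < alpha by rewrite lt_neqAle eq_sym aN.
move=> [C hC]; apply/continuous_within_enormP => x Ax e e0.
have C1 : 0 < `|C| + 1 by rewrite ltr_wpDl.
have q0 : 0 < e / (`|C| + 1) by rewrite divr_gt0.
exists ((e / (`|C| + 1)) `^ alpha^-1) => [|y Ay yx]; first by rewrite powR_gt0.
apply: le_lt_trans (hC _ _ Ay Ax) _.
have h : enorm (y - x) `^ alpha < e / (`|C| + 1).
  have -> : e / (`|C| + 1) = ((e / (`|C| + 1)) `^ alpha^-1) `^ alpha.
    by rewrite -powRrM mulVf// powRr1// ltW.
  by apply: gt0_ltr_powR; rewrite ?nnegrE ?enorm_ge0 ?powR_ge0.
move: h; rewrite ltr_pdivlMr// => h.
have := powR_ge0 (enorm (y - x)) alpha; have := ler_norm C; nra.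
Qed.

End lacunary_growth.

(** * Waves in the ball and their lacunary sum *)

Section waves.
Context {R : realType} {n : nat}.
Variables (i0 i1 : 'I_n).
Hypotheses (i01 : i0 != i1) (n3 : (3 <= n)%N).
Implicit Types (x y xi : 'rV[R]_n) (c d t : R).
Local Notation ssq := (@ssq R n i0 i1).
Local Notation tsq := (@tsq R n i0 i1).
Local Notation zang := (@zang R n i0 i1).
Local Notation rot := (@rot R n i0 i1).
Variables (g : R -> R) (Lam : R) (W : nat -> 'rV[R]_n -> R).

(** Here [g] is the profile [rho] and [W j] the factor of the extension of [Re (z^k) rho^k] for
    [k = 2^j], as specified by the hypotheses that follow. *)
Definition wave c d j x := peval (zang c d (2 ^ j)) x * W j x.

Hypotheses (Lam0 : 0 <= Lam)
  (g_le1 : forall xi, enorm xi = 1 -> g (ssq xi) ^+ 2 * ssq xi <= 1)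
  (g_lip : forall xi eta : 'rV[R]_n, enorm xi = 1 -> enorm eta = 1 ->
    `|g (ssq xi) * xi ord0 i0 - g (ssq eta) * eta ord0 i0| +
    `|g (ssq xi) * xi ord0 i1 - g (ssq eta) * eta ord0 i1| <= Lam * enorm (xi - eta))
  (W_inv : forall j, rotation_invariant i0 i1 (W j))
  (W_lim : forall j c d, harm_lim (wave c d j))
  (W_sphere : forall j c d xi, enorm xi = 1 ->
    wave c d j xi = peval (zang c d (2 ^ j)) xi * g (ssq xi) ^+ (2 ^ j)).

Let eqr_le_ (a b : R) : a = b -> a <= b. Proof. by move=> ->. Qed.

Let n0 : (0 < n)%N. Proof. exact: leq_trans n3. Qed.

Lemma zangZ (a c d : R) k x : peval (zang c d k) (a *: x) = a ^+ k * peval (zang c d k) x.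
Proof.
rewrite !zangE.
have [-> ->] : zre i0 i1 k (a *: x) = a ^+ k * zre i0 i1 k x /\
    zim i0 i1 k (a *: x) = a ^+ k * zim i0 i1 k x.
  elim: k => [|k [IHr IHi]]; first by rewrite expr0 !mul1r.
  by rewrite !zreS !zimS IHr IHi !mxE exprS; split; ring.
by ring.
Qed.

Lemma zang_lin c d k x : peval (zang c d k) x =
  c * peval (zang 1 0 k) x + d * peval (zang 0 1 k) x.
Proof. by rewrite !zangE; ring. Qed.

Lemma wave_lin c d j x : wave c d j x = c * wave 1 0 j x + d * wave 0 1 j x.
Proof. by rewrite /wave zang_lin; ring. Qed.

Lemma wave_sphereE c d j xi : enorm xi = 1 ->
  wave c d j xi = peval (zang c d (2 ^ j)) (g (ssq xi) *: xi).
Proof. by move=> x1; rewrite zangZ W_sphere// mulrC. Qed.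

Lemma ssq_profile_le1 xi : enorm xi = 1 -> ssq (g (ssq xi) *: xi) <= 1.
Proof.
move=> x1; apply: le_trans (g_le1 x1); rewrite le_eqVlt; apply/orP; left.
by apply/eqP; rewrite !ssqE !mxE; ring.
Qed.

Lemma wave_le c d j x : enorm x <= 1 -> `|wave c d j x| <= `|c| + `|d|.
Proof.
apply: (harm_lim_max n0 (W_lim j c d)) => xi x1.
by rewrite wave_sphereE// zang_le// ssq_profile_le1.
Qed.

Lemma wave_sphere_lipschitz c d j xi eta : enorm xi = 1 -> enorm eta = 1 ->
  `|wave c d j xi - wave c d j eta| <= (2 ^ j)%:R * (`|c| + `|d|) * (Lam * enorm (xi - eta)).
Proof.
move=> x1 e1; rewrite !wave_sphereE//.
apply: le_trans (zang_lipschitz i01 _ _ _ (ssq_profile_le1 e1) (ssq_profile_le1 x1)) _.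
rewrite ler_wpM2l ?mulr_ge0 ?addr_ge0// !mxE.
exact: g_lip.
Qed.

Lemma wave_rot c d j t x : wave c d j (rot t x) =
  wave (c * cos ((2 ^ j)%:R * t) - d * sin ((2 ^ j)%:R * t))
       (c * sin ((2 ^ j)%:R * t) + d * cos ((2 ^ j)%:R * t)) j x.
Proof.
rewrite /wave (zang_rot i01); congr (_ * _).
by apply: W_inv; rewrite ?rot_ssq ?rot_tsq.
Qed.

Lemma wave_antiperiodic c d j x : wave c d j (rot (pi / (2 ^ j)%:R) x) = - wave c d j x.
Proof.
rewrite wave_rot; have [-> ->] := @cos_pi_pow2 R j.
by rewrite [LHS]wave_lin [in RHS]wave_lin; ring.
Qed.

(* A function that changes sign under the rotation of angle [pi / 2 ^ j] is half its
   own increment between [x] and the rotated point, so the interior gradient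
   estimate makes it small. *)
Lemma wave_deep c d j x : enorm x < 1 ->
  `|wave c d j x| <=
  2 * n%:R * @grad_cst R n * pi * (`|c| + `|d|) / ((2 ^ j)%:R * (1 - enorm x ^+ 2)).
Proof.
move=> x1; set k : R := (2 ^ j)%:R.
have k0 : 0 < k by rewrite /k ltr0n expn_gt0.
have x2 : 0 < 1 - enorm x ^+ 2.
  by rewrite subr_gt0 expr_lt1 ?enorm_ge0.
set K : R := n%:R * @grad_cst R n.
have K0 : 0 <= K by rewrite mulr_ge0// (le_trans ler01)// grad_cst_ge1.
set N : R := `|c| + `|d|.
have N0 : 0 <= N by rewrite addr_ge0.
have -> : 2 * n%:R * @grad_cst R n * pi * N / (k * (1 - enorm x ^+ 2)) =
    2^-1 * (K * N / (1 - enorm x ^+ 2) * (4 * (pi / k))).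
  by rewrite /K; field; apply/andP; split; rewrite gt_eqF.
have pk : 0 <= pi / k by rewrite divr_ge0 ?pi_ge0// ltW.
have [xE|xN] := eqVneq (enorm x) 0.
  have -> : wave c d j x = 0.
    have := wave_antiperiodic c d j x; rewrite (enorm_eq0 xE).
    have -> : rot (pi / (2 ^ j)%:R) 0 = 0.
      by apply/rowP => i; rewrite !mxE !mulr0 subr0 addr0 !if_same.
    by move=> E; lra.
  have x2' : 0 <= 1 - enorm x ^+ 2 by exact: ltW.
  rewrite normr0; apply: mulr_ge0; first by rewrite invr_ge0.
  apply: mulr_ge0; last exact: mulr_ge0.
  by apply: divr_ge0 => //; exact: mulr_ge0.
have xp : 0 < enorm x by rewrite lt_neqAle eq_sym xN enorm_ge0.
have xr : 0 < enorm x < 1 by rewrite xp x1.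
have /= h := harm_lim_lipschitz (M := N) n0 (W_lim j c d)
  (fun z z1 => wave_le c d j (eqr_le_ z1)) xr (lexx _) (eqr_le_ (rot_enorm i01 (pi / k) x)).
have E : wave c d j x = 2^-1 * (wave c d j x - wave c d j (rot (pi / k) x)).
  by rewrite wave_antiperiodic; lra.
rewrite E normrM gtr0_norm// ler_wpM2l// distrC; apply: le_trans h _.
have KN : 0 <= K * N / (1 - enorm x ^+ 2).
  by apply: divr_ge0; [exact: mulr_ge0|exact: ltW].
apply: (ler_wpM2l KN).
apply: le_trans (enorm_rot_sub i01 _ pk) _.
by apply: ler_piMr; [rewrite mulr_ge0|exact: ltW].
Qed.

(** On the sphere, the geometric mean of the bound [2 N] and of the Lipschitz bound of order [k]
    gives exponent 1/2, which the barrier admits; there [n / (1 - 1/2) + 1 = 2 n + 1]. *)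
Lemma wave_near c d j x xi : enorm xi = 1 -> enorm x <= 1 ->
  `|wave c d j x - wave c d j xi| <=
  (`|c| + `|d|) * (2 * n%:R + 1) * Num.sqrt (2 * Lam * (2 ^ j)%:R * enorm (x - xi)).
Proof.
move=> x1 xle; set k : R := (2 ^ j)%:R; set N : R := `|c| + `|d|.
have k0 : 0 <= k by [].
have N0 : 0 <= N by rewrite addr_ge0.
have a01 : 0 < (2^-1 : R) < 1 by apply/andP; split; lra.
have C0 : 0 <= N * Num.sqrt (2 * Lam * k) by rewrite mulr_ge0 ?sqrtr_ge0.
have K0 : 0 <= 2 * Lam * k by rewrite !mulr_ge0.
have sph : forall y, enorm y = 1 -> `|wave c d j y - wave c d j xi| <=
    N * Num.sqrt (2 * Lam * k) * enorm (y - xi) `^ 2^-1.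
  move=> y y1; rewrite powR12_sqrt ?enorm_ge0// -mulrA -sqrtrM//.
  have h1 : `|wave c d j y - wave c d j xi| <= 2 * N.
    apply: le_trans (ler_normB _ _) _.
    have := wave_le c d j (eqr_le_ y1); have := wave_le c d j (eqr_le_ x1).
    by rewrite -/N; lra.
  have h2 := wave_sphere_lipschitz c d j y1 x1; rewrite -/k -/N in h2.
  rewrite -[X in X * _](ger0_norm N0) -(sqrtr_sqr N) -sqrtrM ?sqr_ge0//.
  rewrite -[leLHS]ger0_norm// -sqrtr_sqr.
  apply: ler_wsqrtr; rewrite [leLHS]expr2.
  apply: le_trans (ler_pM (normr_ge0 _) (normr_ge0 _) h1 h2) _.
  by rewrite le_eqVlt; apply/orP; left; apply/eqP; ring.
have := holder_from_sphere n0 (harm_lim_within (W_lim j c d))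
  (harm_lim_harmonic n0 (W_lim j c d)) a01 x1 C0 sph xle.
move/le_trans; apply; rewrite powR12_sqrt ?enorm_ge0// (sqrtrM _ K0) le_eqVlt.
by apply/orP; left; apply/eqP; field.
Qed.

Section phases.
Variable alpha : R.
Hypothesis halpha : 0 <= alpha < 1.
Implicit Types p : nat -> R * R.

(** The bound 2 accommodates [|cos| + |sin|], the size of a unit phase after a rotation. *)
Definition phase_le p := forall j, `|(p j).1| + `|(p j).2| <= 2.

Definition phased p x := lsum alpha (fun j => wave (p j).1 (p j).2 j x).

Lemma phased_term_le p x j : phase_le p -> enorm x <= 1 ->
  `|wave (p j).1 (p j).2 j x| <= 2.
Proof. by move=> hp x1; apply: le_trans (wave_le _ _ _ x1) (hp j). Qed.

Lemma phased_harm_lim p : phase_le p -> harm_lim (phased p).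
Proof.
move=> hp; have [T [hT T0 Tcvg]] := lcoef_tail halpha.
apply: harm_lim_closed => e e0.
have [J hJ] := tail_small T0 Tcvg (divr_gt0 e0 (ltr0n R 2)).
exists (fun x => \sum_(j < J) lcoef alpha j * wave (p j).1 (p j).2 j x).
  elim: J {hJ} => [|J IH].
    by apply: harm_lim_ext harm_lim0 => x _; rewrite big_ord0.
  apply: harm_lim_ext (harm_lim_lin (lcoef alpha J) IH (W_lim J (p J).1 (p J).2)) => x _.
  by rewrite [RHS]big_ord_recr.
move=> x x1; rewrite distrC.
apply: le_trans (lsum_dist hT T0 Tcvg J (fun j => phased_term_le j hp x1)) _.
by have := hJ J (leqnn _); rewrite ler_pdivlMr// mulrC.
Qed.

Lemma phased_single J c d x : phased (fun j => if j == J then (c, d) else (0, 0)) x =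
  lcoef alpha J * wave c d J x.
Proof.
rewrite -lsum_single; congr lsum; apply/funext => j; case: eqP => [->//|_].
by rewrite /wave zangE /=; ring.
Qed.

Lemma phased_rot p t x : phased p (rot t x) =
  phased (fun j => ((p j).1 * cos ((2 ^ j)%:R * t) - (p j).2 * sin ((2 ^ j)%:R * t),
                    (p j).1 * sin ((2 ^ j)%:R * t) + (p j).2 * cos ((2 ^ j)%:R * t))) x.
Proof. by congr lsum; apply/funext => j; rewrite wave_rot. Qed.

(** Phases matter only at indices [j > 0], because [lcoef 0 = 0]. *)
Lemma phased_lin p q r' (a b : R) x : phase_le p -> phase_le q -> enorm x <= 1 ->
  (forall j, (0 < j)%N -> (r' j).1 = a * (p j).1 + b * (q j).1 /\
                          (r' j).2 = a * (p j).2 + b * (q j).2) ->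
  phased r' x = a * phased p x + b * phased q x.
Proof.
move=> hp hq x1 hr; have [T [hT T0 Tcvg]] := lcoef_tail halpha.
rewrite -(lsum_lin hT T0 Tcvg a b (fun j => phased_term_le j hp x1)
  (fun j => phased_term_le j hq x1)).
congr (limn _); apply/funext => J; apply: eq_bigr => j _.
case: (posnP j) => [->|j0]; first by rewrite /lcoef /= !mul0r.
have [-> ->] := hr j j0; congr (_ * _).
by rewrite wave_lin [in RHS]wave_lin [X in _ = _ + _ * X]wave_lin; ring.
Qed.

Definition from (i : nat) : nat -> R * R := fun j => if (j < i)%N then (0, 0) else (1, 0).

Lemma from_le i : phase_le (from i).
Proof.
move=> j; rewrite /from; case: ifP => _ /=; rewrite ?normr0 ?normr1 ?addr0 //.
by rewrite ler1n.
Qed.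

Definition rotated p t : nat -> R * R :=
  fun j => ((p j).1 * cos ((2 ^ j)%:R * t) - (p j).2 * sin ((2 ^ j)%:R * t),
            (p j).1 * sin ((2 ^ j)%:R * t) + (p j).2 * cos ((2 ^ j)%:R * t)).

Lemma rotated_from_le i t : phase_le (rotated (from i) t).
Proof.
move=> j; rewrite /rotated /from; case: ifP => _ /=.
  by rewrite !mul0r subrr addr0 !normr0 addr0.
rewrite !mul1r !mul0r subr0 addr0.
by have := cos_max ((2 ^ j)%:R * t); have := sin_max ((2 ^ j)%:R * t); lra.
Qed.

Lemma rotated_from i j : rotated (from i) (pi / (2 ^ i)%:R) j =
  if j == i then (- 1, 0) else from i j.
Proof.
rewrite /rotated /from; case: (ltngtP j i) => [ji|ij|->] /=.
- by rewrite !mul0r subrr addr0.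
- by have [-> ->] := @cos_sin_pi_pow2_lt R _ _ ij; rewrite !mul1r !mul0r subr0 addr0.
- by have [-> ->] := @cos_pi_pow2 R i; rewrite !mul1r !mul0r subr0 addr0.
Qed.

(* The rotation of angle [pi / 2 ^ i] flips the sign of the wave of index [i] and fixes
   those of higher index, so averaging removes the waves one after the other. *)
Lemma phased_average i x : enorm x <= 1 ->
  phased (from i.+1) x = 2^-1 * phased (from i) x + 2^-1 * phased (from i) (rot (pi / (2 ^ i)%:R) x).
Proof.
move=> x1; rewrite phased_rot.
apply: (phased_lin (from_le i) (rotated_from_le i _) x1) => j _.
rewrite rotated_from /from ltnS; case: (ltngtP j i) => _ /=; split; lra.
Qed.

Lemma phased_difference i x : enorm x <= 1 ->
  lcoef alpha i * wave 1 0 i x =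
  2^-1 * phased (from i) x + (- 2^-1) * phased (from i) (rot (pi / (2 ^ i)%:R) x).
Proof.
move=> x1; rewrite phased_rot -phased_single.
apply: (phased_lin (from_le i) (rotated_from_le i _) x1) => j _.
rewrite rotated_from /from; case: (ltngtP j i) => _ /=; split; lra.
Qed.

Definition wave_sum := phased (fun=> (1, 0)).

Lemma phased_from1 : phased (from 1) = wave_sum.
Proof.
apply/funext => x; rewrite /wave_sum /phased; congr (limn _); apply/funext => J.
apply: eq_bigr => j _; case: (posnP j) => [->|j0]; first by rewrite /lcoef /= !mul0r.
by rewrite /from ltnS leqNgt j0.
Qed.

Lemma wave_sum_harm_lim : harm_lim wave_sum.
Proof.
by apply: phased_harm_lim => j; rewrite /= normr0 normr1 addr0 ler1n.
Qed.

(** [J] is the least exponent with [2^-J <= d]; minimality gives [2^J d <= 2], and for [J = 0] the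
    hypothesis [d <= 2] does. *)
Lemma dyadic_scale (d : R) : 0 < d <= 2 -> exists J : nat,
  2 ^- J <= d /\ (2 ^ J)%:R * d <= 2.
Proof.
move=> /andP[d0 d2].
have [J0 hJ0] : exists J : nat, 2 ^- J <= d.
  have [j _ hj] := exp2_unbounded d^-1 (ltr01 : 0 < (1 : R)).
  exists j; rewrite invf_ple ?posrE ?exprn_gt0//.
  by rewrite mul1r powR_mulrn// in hj; exact: ltW.
have ex0 : exists J : nat, 2 ^- J <= d by exists J0.
case: (ex_minnP ex0) => J hJ hmin.
exists J; split => //; case: J hJ hmin => [|J] hJ hmin; first by rewrite expn0 mul1r.
have : ~~ (2 ^- J <= d) by apply/negP => /hmin; rewrite ltnn.
rewrite -ltNge => /ltW h.
rewrite expnS natrM natrX -mulrA -[leRHS]mulr1 ler_wpM2l//.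
by rewrite mulrC -ler_pdivlMr ?exprn_gt0// mul1r.
Qed.

(** Split at the scale [2^-J] of the distance. Lower frequencies use the Lipschitz bound and form a
    geometric series of ratio [2 q > 1], as [alpha < 1]; higher ones use the bound 2 and the ratio
    [q < 1]. *)
Lemma wave_sum_sphere_holder : 0 < alpha -> exists2 C : R, 0 <= C &
  forall xi eta : 'rV[R]_n, enorm xi = 1 -> enorm eta = 1 ->
  `|wave_sum xi - wave_sum eta| <= C * enorm (xi - eta) `^ alpha.
Proof.
move=> a0; have /andP[_ a1] := halpha; have /andP[q0 q1] := pow2alpha_lt1 a0.
set q : R := 2 `^ (- alpha) in q0 q1.
have q2 : 1 < 2 * q.
  have : (1 : R) `^ (1 - alpha) < 2 `^ (1 - alpha).
    by apply: gt0_ltr_powR; rewrite ?nnegrE ?ltr1n ?subr_gt0.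
  rewrite powR1 powRB; last by apply/implyP => _; rewrite pnatr_eq0.
  by rewrite powRr1// /q powRN.
have [hT T0 Tcvg] := lcoef_geometric_tail a0.
rewrite -/q in hT T0 Tcvg.
have c1 : 0 < 1 - q by rewrite subr_gt0.
have c2 : 0 < 2 * q - 1 by rewrite subr_gt0.
exists (2 * Lam / (2 * q - 1) + 2 / (1 - q)).
  by apply: addr_ge0; apply: divr_ge0; rewrite ?mulr_ge0// ltW.
move=> xi eta x1 e1.
have [dE|dN] := eqVneq (enorm (xi - eta)) 0.
  rewrite (subr0_eq (enorm_eq0 dE)) subrr normr0.
  apply: mulr_ge0; last exact: powR_ge0.
  by apply: addr_ge0; apply: divr_ge0; rewrite ?mulr_ge0// ltW.
set d := enorm (xi - eta) in dN *.
have d0 : 0 < d by rewrite lt_neqAle eq_sym dN enorm_ge0.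
have d2 : 0 < d <= 2.
  rewrite d0 /=; apply: le_trans (enorm_triangle _ _) _; rewrite enormN x1 e1; lra.
have [J [J1 J2]] := dyadic_scale d2.
have w1 (z : 'rV[R]_n) : enorm z = 1 -> forall j, `|wave 1 0 j z| <= 1.
  by move=> z1 j; have := wave_le 1 0 j (eqr_le_ z1); rewrite normr1 normr0 addr0.
have -> : wave_sum xi - wave_sum eta = lsum alpha (fun j => 1 * wave 1 0 j xi + (- 1) * wave 1 0 j eta).
  rewrite (lsum_lin hT T0 Tcvg 1 (- 1) (w1 _ x1) (w1 _ e1)) /wave_sum /phased /=.
  by rewrite mul1r mulN1r.
have vB j : `|1 * wave 1 0 j xi + (- 1) * wave 1 0 j eta| <= 2.
  rewrite mul1r mulN1r; apply: le_trans (ler_normB _ _) _.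
  by have := w1 _ x1 j; have := w1 _ e1 j; lra.
apply: le_trans (lsum_split hT T0 Tcvg J vB) _.
have qJ : q ^+ J <= d `^ alpha.
  have -> : q ^+ J = (2 ^- J) `^ alpha.
    exact: powR_half_power.
  by rewrite ge0_ler_powR ?nnegrE ?invr_ge0 ?exprn_ge0// ltW.
apply: (@le_trans _ _ ((2 * Lam / (2 * q - 1) + 2 / (1 - q)) * q ^+ J)); last first.
  apply: ler_wpM2l => //.
  by apply: addr_ge0; apply: divr_ge0; rewrite ?mulr_ge0// ltW.
rewrite [leRHS]mulrDl; apply: lerD; last first.
  by rewrite le_eqVlt; apply/orP; left; apply/eqP; ring.
have h1 : \sum_(j < J) lcoef alpha j * `|1 * wave 1 0 j xi + (- 1) * wave 1 0 j eta| <=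
    \sum_(j < J) (2 * q) ^+ j * (Lam * d).
  apply: ler_sum => j _.
  have := wave_sphere_lipschitz 1 0 j x1 e1.
  rewrite normr1 normr0 addr0 mulr1 -/d natrX mul1r mulN1r => h.
  rewrite exprMn (mulrC (2 ^+ j)) -mulrA; apply: ler_pM => //; first exact: lcoef_ge0.
  have [->|j0] := posnP j; first by rewrite /lcoef.
  by rewrite lcoef_powE.
apply: le_trans h1 _; rewrite -mulr_suml.
have h2 : \sum_(j < J) (2 * q) ^+ j <= (2 * q) ^+ J / (2 * q - 1).
  elim: (J) => [|m IH]; first by rewrite big_ord0 expr0 divr_ge0// ltW.
  rewrite big_ord_recr /=; apply: le_trans (lerD IH (lexx _)) _.
  rewrite le_eqVlt; apply/orP; left; apply/eqP; rewrite exprS; field.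
  by rewrite gt_eqF.
have Ld : 0 <= Lam * d by rewrite mulr_ge0// ltW.
apply: le_trans (ler_wpM2r Ld h2) _.
have -> : (2 * q) ^+ J / (2 * q - 1) * (Lam * d) =
    (Lam / (2 * q - 1) * q ^+ J) * ((2 ^ J)%:R * d).
  by rewrite exprMn natrX; field; rewrite gt_eqF.
have -> : 2 * Lam / (2 * q - 1) * q ^+ J = (Lam / (2 * q - 1) * q ^+ J) * 2.
  by field; rewrite gt_eqF.
apply: ler_wpM2l => //; apply: mulr_ge0; last by rewrite exprn_ge0// ltW.
by apply: divr_ge0 => //; exact: ltW.
Qed.

Lemma wave_sum_holder : holder_space alpha cball wave_sum.
Proof.
have /andP[a0 a1] := halpha.
have hl := wave_sum_harm_lim.
rewrite /holder_space; case: eqVneq => [_|aN]; first exact: harm_lim_within.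
have a0' : 0 < alpha by rewrite lt_neqAle eq_sym aN.
have [C C0 hC] := wave_sum_sphere_holder a0'.
have a01 : 0 < alpha < 1 by rewrite a0' a1.
have C1 : 0 <= C * (n%:R / (1 - alpha) + 1).
  by apply: mulr_ge0 => //; apply: addr_ge0 => //; apply: divr_ge0 => //; rewrite subr_ge0 ltW.
exists (C * (n%:R / (1 - alpha) + 1)).
apply: (holder_in_ball n0 (harm_lim_within hl) (harm_lim_harmonic n0 hl) a0 C1) => xi x x1 xle.
apply: (holder_from_sphere n0 (harm_lim_within hl) (harm_lim_harmonic n0 hl) a01 x1 C0 _ xle).
by move=> y y1; apply: hC.
Qed.

Lemma lacunary_sum_zre x : coord_nat 0 x = x ord0 i0 -> coord_nat 1 x = x ord0 i1 ->
  ssq x <= 1 -> lacunary_sum alpha x = lsum alpha (fun j => peval (zang 1 0 (2 ^ j)) x).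
Proof.
move=> e0 e1 s1; have [T [hT T0 Tcvg]] := lcoef_tail halpha.
rewrite /lacunary_sum.
have -> : (fun k => lacunary_coef alpha k * complex.Re ((coord_nat 0 x +i* coord_nat 1 x)%C ^+ k)) =
    (fun k => lacunary_coef alpha k * peval (zang 1 0 k) x).
  by apply/funext => k; rewrite e0 e1 zpowE zangE mul1r mul0r subr0.
have vB k : `|peval (zang 1 0 k) x| <= 1.
  by have := zang_le 1 0 k s1; rewrite normr1 normr0 addr0.
exact: (lacunary_series_lsum halpha hT T0 Tcvg vB).
Qed.

Lemma wave_sum_boundary xi : coord_nat 0 xi = xi ord0 i0 -> coord_nat 1 xi = xi ord0 i1 ->
  enorm xi = 1 -> wave_sum xi = lacunary_sum alpha (g (ssq xi) *: xi).
Proof.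
move=> e0 e1 x1; rewrite lacunary_sum_zre ?ssq_profile_le1//.
- by congr lsum; apply/funext => j; rewrite wave_sphereE.
- rewrite mxE -e0 /coord_nat; case: insubP => /= [i _ _|_]; by rewrite ?mxE ?mulr0.
- rewrite mxE -e1 /coord_nat; case: insubP => /= [i _ _|_]; by rewrite ?mxE ?mulr0.
Qed.

(* The difference quotients between [e_0] and its rotation by [pi / 2 ^ J] only see
   nonnegative terms, and the term of index [J] is [2 * lcoef alpha J]. *)
Lemma wave_sum_not_holder (eps : R) : g 1 ^+ 2 = 1 -> 0 < eps ->
  ~ holder_space (alpha + eps) cball wave_sum.
Proof.
move=> g1 e0; have /andP[a0 a1] := halpha.
have ae0 : 0 < alpha + eps by rewrite ltr_wpDl.
rewrite /holder_space gt_eqF// => -[C hC].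
pose e : 'rV[R]_n := delta_mx ord0 i0.
have e1 : enorm e = 1 by exact: enorm_delta.
have es : ssq e = 1.
  rewrite ssqE !mxE /= !eqxx (negbTE (_ : i1 != i0)) ?andbF 1?eq_sym//.
  by rewrite mulr1n mulr0n; ring.
have [T [hT T0 Tcvg]] := lcoef_tail halpha.
have gk j : (0 < j)%N -> g 1 ^+ (2 ^ j) = 1.
  by case: j => // j _; rewrite expnS exprM g1 expr1n.
have wE j t : (0 < j)%N -> wave 1 0 j (rot t e) = cos ((2 ^ j)%:R * t).
  move=> j0; rewrite W_sphere; last by rewrite rot_enorm.
  rewrite (rot_ssq i01) es gk// mulr1 (zang_rot i01) zangE.
  have [-> ->] : zre i0 i1 (2 ^ j) e = 1 /\ zim i0 i1 (2 ^ j) e = 0.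
    elim: (2 ^ j)%N => [//|k [IHr IHi]].
    rewrite zreS zimS IHr IHi !mxE /= !eqxx (negbTE (_ : i1 != i0)) ?andbF 1?eq_sym//.
    by rewrite mulr1n mulr0n; split; ring.
  by ring.
have lower J : (0 < J)%N ->
    2 * lcoef alpha J <= wave_sum e - wave_sum (rot (pi / (2 ^ J)%:R) e).
  move=> J0; set t := pi / _.
  have w1 (z : 'rV[R]_n) : enorm z = 1 -> forall j, `|wave 1 0 j z| <= 1.
    by move=> z1 j; have := wave_le 1 0 j (eqr_le_ z1); rewrite normr1 normr0 addr0.
  have re1 : enorm (rot t e) = 1 by rewrite rot_enorm.
  have h1 := lsum_cvg hT T0 Tcvg (w1 _ e1).
  have h2 := lsum_cvg hT T0 Tcvg (w1 _ re1).
  have h3 : (\sum_(j < K) lcoef alpha j * wave 1 0 j (rot t e) -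
      \sum_(j < K) lcoef alpha j * wave 1 0 j e) @[K --> \oo] -->
      wave_sum (rot t e) - wave_sum e by exact: cvgB h2 h1.
  rewrite -lerN2 opprB; apply: (@cvgn_le R _ _ _ J.+1 h3) => K JK.
  rewrite -lerN2 opprB opprK -sumrB (bigD1 (Ordinal JK)) //= -[leLHS]addr0.
  have term (j : nat) : lcoef alpha j * wave 1 0 j e - lcoef alpha j * wave 1 0 j (rot t e) =
      lcoef alpha j * (1 - cos ((2 ^ j)%:R * t)).
    have [->|j0] := posnP j; first by rewrite /lcoef /= !mul0r subrr.
    by rewrite -mulrBr wE// -{1}(rot0 i0 i1 e) wE// mulr0 cos0.
  apply: lerD.
    rewrite term; have [-> _] := @cos_pi_pow2 R J.
    by rewrite opprK mulrC.
  apply: sumr_ge0 => j _; rewrite term mulr_ge0 ?lcoef_ge0// subr_ge0 cos_le1.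
(* The exponent [alpha + eps / 2] is positive even for [alpha = 0], and leaves a gap [eps / 2] whose
   exponential growth gives the contradiction. *)
have s0 : 0 < alpha + eps / 2 by lra.
have as_ : alpha <= alpha + eps / 2 by lra.
have [c c0 hc] := lcoef_lower s0 as_.
pose D := `|C| * (4 * pi) `^ (alpha + eps).
have [J J0 hJ] := exp2_unbounded (D / (2 * c)) (divr_gt0 e0 (ltr0n R 2)).
have k0 : 0 < (2 ^ J)%:R :> R by rewrite ltr0n expn_gt0.
have pk : 0 <= pi / (2 ^ J)%:R :> R by rewrite divr_ge0 ?pi_ge0// ltW.
have up : wave_sum e - wave_sum (rot (pi / (2 ^ J)%:R) e) <=
    D * 2 `^ (- (alpha + eps) * J%:R).
  apply: le_trans (ler_norm _) _.
  apply: le_trans (hC _ _ _ _) _; rewrite /cball /= ?rot_enorm ?e1//.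
  have h : enorm (e - rot (pi / (2 ^ J)%:R) e) <= 4 * pi / (2 ^ J)%:R.
    rewrite enormB; apply: le_trans (enorm_rot_sub i01 _ pk) _.
    by rewrite e1 mulr1 mulrA.
  have h' : enorm (e - rot (pi / (2 ^ J)%:R) e) `^ (alpha + eps) <=
      (4 * pi / (2 ^ J)%:R) `^ (alpha + eps).
    by rewrite ge0_ler_powR ?nnegrE ?enorm_ge0 ?divr_ge0 ?mulr_ge0 ?pi_ge0// ltW.
  have p4 : 0 <= 4 * pi :> R by rewrite mulr_ge0 ?pi_ge0.
  rewrite powRM ?invr_ge0 ?(ltW k0)// in h'.
  have e2 : (2 ^ J)%:R^-1 `^ (alpha + eps) = 2 `^ (- (alpha + eps) * J%:R) :> R.
    rewrite natrX -powR_half_power -powR_mulrn; last exact: powR_ge0.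
    by rewrite -powRrM.
  rewrite e2 in h'.
  apply: le_trans (_ : `|C| * enorm (e - rot (pi / (2 ^ J)%:R) e) `^ (alpha + eps) <= _).
    by rewrite ler_wpM2r ?powR_ge0// ler_norm.
  by rewrite /D -mulrA ler_wpM2l.
have lo := lower J J0; have hcJ := hc J J0.
have : 2 * c <= D * 2 `^ (- (eps / 2) * J%:R).
  have E : (2 : R) `^ (- (eps / 2) * J%:R) =
      2 `^ (- (alpha + eps) * J%:R) * 2 `^ ((alpha + eps / 2) * J%:R).
    rewrite -powRD; last by apply/implyP => _; rewrite pnatr_eq0.
    by congr (_ `^ _); field.
  rewrite E mulrA.
  have := le_trans lo up; have := powR_ge0 2 ((alpha + eps / 2) * J%:R).
  move: (2 `^ _) (2 `^ _) hcJ => p q hcJ q0 hh.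
  have h5 := ler_wpM2r q0 hh.
  by apply: le_trans h5; lra.
rewrite mulNr powRN ler_pdivlMr ?powR_gt0// leNgt => /negP; apply.
by move: hJ; rewrite ltr_pdivrMr ?mulr_gt0// => hJ; rewrite mulrC.
Qed.

End phases.

End waves.

(** * The angular derivative *)

Section quadratic_bounds.
Context {R : realType}.

Lemma abs_le_mvt (f df : R -> R) (t : R) : f 0 = 0 ->
  (forall x : R, is_derive x 1 f (df x)) -> (forall x : R, 0 <= x -> `|df x| <= x) ->
  0 <= t -> `|f t| <= t ^+ 2.
Proof.
move=> f0 hf hdf; rewrite le_eqVlt => /predU1P[<-|t0]; first by rewrite f0 normr0 sqr_ge0.
have cf : {within `[0, t], continuous f}.
  apply: continuous_subspaceT => x; apply: differentiable_continuous.
  by apply/derivable1_diffP; case: (hf x).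
have [c c0t E] := @MVT R f df 0 t t0 (fun x _ => hf x) cf.
move: c0t; rewrite in_itv /= => /andP[c0 ct].
move: E; rewrite f0 !subr0 => ->; rewrite normrM (gtr0_norm t0) expr2 ler_wpM2r//.
  exact: ltW.
by apply: le_trans (hdf _ (ltW c0)) _; exact: ltW.
Qed.

Lemma cos_sub1_sqr (t : R) : `|cos t - 1| <= t ^+ 2.
Proof.
wlog t0 : t / 0 <= t.
  move=> h; case: (leP 0 t) => [|/ltW t0]; first exact: h.
  by rewrite -cosN -sqrrN; apply: h; rewrite oppr_ge0.
apply: (@abs_le_mvt (fun t => cos t - 1) (fun x => - sin x)) => //.
- by rewrite cos0 subrr.
- move=> x; have h := is_deriveB (is_derive_cos x) (is_derive_cst (1 : R) x 1).
  by rewrite subr0 in h.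
- by move=> x x0; rewrite normrN sin_le_id.
Qed.

Lemma sin_subid_sqr (t : R) : `|sin t - t| <= t ^+ 2.
Proof.
wlog t0 : t / 0 <= t.
  move=> h; case: (leP 0 t) => [|/ltW t0]; first exact: h.
  by have := h (- t); rewrite oppr_ge0 sinN sqrrN -opprD normrN; exact.
apply: (@abs_le_mvt (fun t => sin t - t) (fun x => cos x - 1)) => //.
- by rewrite sin0 subrr.
- by move=> x; exact: cos_sub1_le.
Qed.

Lemma dist_aux (e h M : R) : 0 <= h -> h * (4 * M) < e -> 2 * (h * h) * M <= e / 2 * h.
Proof. by move=> h0 h1; nra. Qed.

End quadratic_bounds.

Section angular_derivative.
Context {R : realType} {n : nat}.
Variables (i0 i1 : 'I_n).
Hypothesis i01 : i0 != i1.
Implicit Types (x y : 'rV[R]_n) (t : R) (f G H : 'rV[R]_n -> R).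
Local Notation rot := (@rot R n i0 i1).

Let n0 : (0 < n)%N. Proof. by case: n i0 => [[]|]. Qed.

Lemma dpart_uniform (F : nat -> pexpr R n) f s (rho e : R) :
  (forall k, pharm (F k)) -> ulim cball F f -> 0 < rho < 1 -> 0 < e ->
  exists N, forall k, (N <= k)%N -> forall z, enorm z <= rho ->
    `|peval (foldr pderiv (F k) s) z - dpart s f z| <= e.
Proof.
move=> hF Ff rho1 e0; have [N hN] := ucauchy_pderivs n0 hF Ff s rho1 e0.
exists N => k Nk z zr; have z1 : enorm z < 1 by case/andP: rho1 => _ ?; exact: le_lt_trans zr _.
rewrite distrC; apply: (cvgn_dist_le (N := N) (dpart_cvg n0 hF Ff (s := s) z1)) => l Nl.
exact: hN.
Qed.

(** The mean value theorem for the approximating polynomials, whose partial derivatives are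
    uniformly close to those of [f] near [x]; [ep = e / (2 n)] shares the error between closeness
    and continuity over the [n] coordinates. *)
Lemma harm_lim_frechet f (s : seq 'I_n) x : harm_lim f -> enorm x < 1 ->
  forall e : R, 0 < e -> exists2 d : R, 0 < d & forall y, enorm (y - x) < d ->
    `|dpart s f y - dpart s f x - \sum_i (y - x) ord0 i * dpart (i :: s) f x| <=
    e * enorm (y - x).
Proof.
move=> [F hF Ff] x1 e e0.
pose rho := (1 + enorm x) / 2.
have rho1 : 0 < rho < 1.
  by have := enorm_ge0 x; rewrite /rho => h; apply/andP; split; lra.
have xr : enorm x < rho by rewrite /rho; lra.
have nn : 0 < n%:R :> R by rewrite ltr0n.
pose ep := e / n%:R / 2.
have ep0 : 0 < ep by rewrite !divr_gt0.
have cont i := dpart_continuous n0 hF Ff (s := i :: s) x1.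
have : \forall y \near x, enorm y < rho /\ forall i, `|dpart (i :: s) f y - dpart (i :: s) f x| < ep.
  have h1 : \forall y \near x, enorm y < rho.
    by apply: (@open_nbhs_nbhs); split => //; exact: open_enorm_ball.
  have h2 : \forall y \near x, forall i, `|dpart (i :: s) f y - dpart (i :: s) f x| < ep.
    have h i : nbhs x (fun y => `|dpart (i :: s) f y - dpart (i :: s) f x| < ep).
      have /continuous_enormP/(_ ep ep0)[d d0 hd] := cont i.
      by apply/nbhs_enormP; exists d.
    exact: (@filter_forall _ _ _ (nbhs x) (nbhs_filter x) h).
  by apply: filterS2 h1 h2 => y.
move=> /nbhs_enormP[d d0 hd]; exists d => // y yx.
have [N hN] : exists N, forall k, (N <= k)%N -> forall i z, enorm z <= rho ->
    `|peval (foldr pderiv (F k) (i :: s)) z - dpart (i :: s) f z| <= ep.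
  have /choice[N hN] : forall i, exists N : nat, forall k, (N <= k)%N -> forall z, enorm z <= rho ->
      `|peval (foldr pderiv (F k) (i :: s)) z - dpart (i :: s) f z| <= ep.
    by move=> i; exact: dpart_uniform hF Ff rho1 ep0.
  exists (\max_i N i) => k Nk i; apply: hN; apply: leq_trans Nk.
  exact: leq_bigmax.
have y1 : enorm y < 1.
  by have [yr _] := hd y yx; case/andP: rho1 => _; exact: lt_trans.
have cvy := dpart_cvg n0 hF Ff (s := s) y1; have cvx := dpart_cvg n0 hF Ff (s := s) x1.
have cv : peval (foldr pderiv (F k) s) y - peval (foldr pderiv (F k) s) x @[k --> \oo] -->
    dpart s f y - dpart s f x by exact: cvgB cvy cvx.
apply: (cvgn_dist_le (N := N) cv) => k Nk.
have [t [/andP[t0 t1] ->]] := peval_mvt (foldr pderiv (F k) s) x y.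
set z := t *: (y - x) + x.
have zx : enorm (z - x) < d.
  rewrite /z addrK enormZ ger0_norm//; apply: le_lt_trans yx.
  by rewrite ler_piMl ?enorm_ge0.
have [zr zd] := hd z zx.
rewrite -sumrB; apply: le_trans (ler_norm_sum _ _ _) _.
have -> : e * enorm (y - x) = \sum_(i < n) (enorm (y - x) * (ep + ep)).
  rewrite sumr_const card_ord -mulr_natr /ep; field; lra.
apply: ler_sum => i _; rewrite -mulrBr normrM.
apply: ler_pM => //; first exact: coord_le_enorm.
have a1 := hN k Nk i z (ltW zr); have a2 := ltW (zd i).
apply: le_trans (ler_distD (dpart (i :: s) f z) _ _) _.
exact: lerD.
Qed.

Lemma rot_sub_le t x : enorm (rot t x - x) <= 4 * `|t| * enorm x.
Proof.
case: (leP 0 t) => [t0|/ltW t0]; first by rewrite ger0_norm//; exact: enorm_rot_sub.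
have := enorm_rot_sub i01 (t := - t) (rot t x).
by rewrite oppr_ge0 (rotK i01) (rot_enorm i01) enormB ler0_norm//; exact.
Qed.

Lemma rot_sub_coord t x (D : 'I_n -> R) :
  \sum_i (rot t x - x) ord0 i * D i =
  ((cos t - 1) * x ord0 i0 - sin t * x ord0 i1) * D i0 +
  (sin t * x ord0 i0 + (cos t - 1) * x ord0 i1) * D i1.
Proof.
rewrite (sum_outer i01) [X in _ + X]big1 ?addr0; last first.
  move=> i /(rot_out t x) oi.
  have -> : (rot t x - x) ord0 i = rot t x ord0 i - x ord0 i by rewrite !mxE.
  by rewrite oi subrr mul0r.
have -> : (rot t x - x) ord0 i0 = rot t x ord0 i0 - x ord0 i0 by rewrite !mxE.
have -> : (rot t x - x) ord0 i1 = rot t x ord0 i1 - x ord0 i1 by rewrite !mxE.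
by rewrite rot_0 (rot_1 i01); ring.
Qed.

(** The orbit of [x] is a curve with velocity [(- x_1, x_0)] at time 0, so total differentiability
    is used; the deviation of the orbit from its tangent is of order [h^2]. *)
Lemma dpart_rot_is_derive f (s : seq 'I_n) x : harm_lim f -> enorm x < 1 ->
  is_derive (0 : R) 1 (fun t => dpart s f (rot t x))
    (x ord0 i0 * dpart (i1 :: s) f x - x ord0 i1 * dpart (i0 :: s) f x).
Proof.
move=> hf x1; apply: is_derive_eps => e e0.
set D0 := dpart (i0 :: s) f x; set D1 := dpart (i1 :: s) f x.
pose e' := e / (8 * (enorm x + 1)).
have x10 : 0 < enorm x + 1 by have := enorm_ge0 x; lra.
have e'0 : 0 < e' by rewrite divr_gt0// mulr_gt0.
have [d d0 hd] := harm_lim_frechet s hf x1 e'0.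
pose M := `|D0| + `|D1| + 1.
have M0 : 0 < M by rewrite /M ltr_wpDl// addr_ge0.
pose del := Num.min (d / (4 * (enorm x + 1))) (e / (4 * M)).
have del0 : 0 < del by rewrite lt_min !divr_gt0// mulr_gt0.
exists del => // h; rewrite lt_min => /andP[h1 h2].
have -> : h *: (1 : R^o) + (0 : R^o) = h by rewrite scale_regE mulr1 addr0.
rewrite (rot0 i0 i1) => {}; have hx : enorm (rot h x - x) <= 4 * `|h| * (enorm x + 1).
  apply: le_trans (rot_sub_le h x) _; rewrite ler_wpM2l ?mulr_ge0//; lra.
have hdd : enorm (rot h x - x) < d.
  apply: le_lt_trans hx _; move: h1; rewrite ltr_pdivlMr ?mulr_gt0//; lra.
have := hd _ hdd; rewrite rot_sub_coord -/D0 -/D1 => a1.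
have a2 : e' * enorm (rot h x - x) <= e / 2 * `|h|.
  apply: le_trans (ler_wpM2l (ltW e'0) hx) _.
  by rewrite le_eqVlt /e'; apply/orP; left; apply/eqP; field; rewrite gt_eqF.
have xc i : `|x ord0 i| <= 1 by apply: le_trans (coord_le_enorm _ _) _; exact: ltW.
have a3 : `|((cos h - 1) * x ord0 i0 - sin h * x ord0 i1) * D0 +
    (sin h * x ord0 i0 + (cos h - 1) * x ord0 i1) * D1 - h * (x ord0 i0 * D1 - x ord0 i1 * D0)| <=
    e / 2 * `|h|.
  have -> : ((cos h - 1) * x ord0 i0 - sin h * x ord0 i1) * D0 +
    (sin h * x ord0 i0 + (cos h - 1) * x ord0 i1) * D1 - h * (x ord0 i0 * D1 - x ord0 i1 * D0) =
    ((cos h - 1) * x ord0 i0 - (sin h - h) * x ord0 i1) * D0 +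
    ((sin h - h) * x ord0 i0 + (cos h - 1) * x ord0 i1) * D1 by ring.
  have c2 := cos_sub1_sqr h; have s2 := sin_subid_sqr h.
  have q2 : 0 <= h ^+ 2 by exact: sqr_ge0.
  have b (p q u v : R) : `|p| <= h ^+ 2 -> `|q| <= h ^+ 2 -> `|u| <= 1 -> `|v| <= 1 ->
      `|p * u + q * v| <= 2 * h ^+ 2.
    move=> hp hq hu hv; apply: le_trans (ler_normD _ _) _; rewrite !normrM.
    have k1 : `|p| * `|u| <= h ^+ 2 * 1 by apply: ler_pM.
    have k2 : `|q| * `|v| <= h ^+ 2 * 1 by apply: ler_pM.
    lra.
  have b0 := b (cos h - 1) (- (sin h - h)) (x ord0 i0) (x ord0 i1) c2.
  rewrite normrN mulNr in b0; have {}b0 := b0 s2 (xc _) (xc _).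
  have b1 := b (sin h - h) (cos h - 1) (x ord0 i0) (x ord0 i1) s2 c2 (xc _) (xc _).
  apply: le_trans (ler_normD _ _) _; rewrite !normrM.
  have k1 := ler_pM (normr_ge0 _) (normr_ge0 _) b0 (lexx `|D0|).
  have k2 := ler_pM (normr_ge0 _) (normr_ge0 _) b1 (lexx `|D1|).
  apply: le_trans (lerD k1 k2) _.
  have k3 : 2 * h ^+ 2 * M <= e / 2 * `|h|.
    move: h2; rewrite ltr_pdivlMr ?mulr_gt0// => h2.
    rewrite -[h ^+ 2]real_normK ?num_real// expr2.
    exact: dist_aux (normr_ge0 h) h2.
  apply: le_trans k3; rewrite -mulrDr; apply: ler_wpM2l.
    by apply: mulr_ge0.
  by rewrite /M lerDl.
set u := dpart s f (rot h x) in a1 *.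
have := ler_normD (u - dpart s f x - (((cos h - 1) * x ord0 i0 - sin h * x ord0 i1) * D0 +
    (sin h * x ord0 i0 + (cos h - 1) * x ord0 i1) * D1))
   (((cos h - 1) * x ord0 i0 - sin h * x ord0 i1) * D0 +
    (sin h * x ord0 i0 + (cos h - 1) * x ord0 i1) * D1 - h * (x ord0 i0 * D1 - x ord0 i1 * D0)).
rewrite addrA subrK => /le_trans; apply; lra.
Qed.

(** Defined along the orbit rather than as [x_0 D_1 - x_1 D_0]: it then commutes with rotations and
    makes sense for every function. *)
Definition aderiv G x : R := 'D_1 (fun t => G (rot t x)) 0.

Lemma aderiv_orbit G H x y : (forall t, G (rot t x) = H (rot t y)) -> aderiv G x = aderiv H y.
Proof.
move=> E; rewrite /aderiv.
by have -> : (fun t => G (rot t x)) = (fun t => H (rot t y)) by exact/funext.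
Qed.

Lemma aderiv_rot G (s : R) x : aderiv (fun y => G (rot s y)) x = aderiv G (rot s x).
Proof.
by apply: aderiv_orbit => t; rewrite !(rotD i01) addrC.
Qed.

Lemma aderiv_ext G H x : (forall y, enorm y = enorm x -> G y = H y) -> aderiv G x = aderiv H x.
Proof.
by move=> GH; apply: aderiv_orbit => t; apply: GH; rewrite (rot_enorm i01).
Qed.

Lemma aderivE f x : harm_lim f -> enorm x < 1 ->
  aderiv f x = x ord0 i0 * dpart [:: i1] f x - x ord0 i1 * dpart [:: i0] f x.
Proof. by move=> hf x1; have := dpart_rot_is_derive [::] hf x1; exact: @derive_val. Qed.

Lemma rot_coord_is_derive x : is_derive (0 : R) 1 (fun t => rot t x ord0 i0) (- x ord0 i1) /\
  is_derive (0 : R) 1 (fun t => rot t x ord0 i1) (x ord0 i0).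
Proof.
split.
  have -> : (fun t => rot t x ord0 i0) = (fun t => cos t * x ord0 i0 - sin t * x ord0 i1).
    by apply/funext => t; rewrite rot_0.
  apply: is_derive_eq.
  by rewrite sin0 cos0 !scale_regE; ring.
have -> : (fun t => rot t x ord0 i1) = (fun t => sin t * x ord0 i0 + cos t * x ord0 i1).
  by apply/funext => t; rewrite rot_1.
apply: is_derive_eq.
by rewrite sin0 cos0 !scale_regE; ring.
Qed.

Lemma aderiv2_is_derive f x : harm_lim f -> enorm x < 1 ->
  is_derive (0 : R) 1 (fun t => aderiv f (rot t x))
   (x ord0 i0 * (x ord0 i0 * dpart [:: i1; i1] f x - x ord0 i1 * dpart [:: i0; i1] f x)
    - x ord0 i1 * dpart [:: i1] f x
    - (x ord0 i1 * (x ord0 i0 * dpart [:: i1; i0] f x - x ord0 i1 * dpart [:: i0; i0] f x)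
       + x ord0 i0 * dpart [:: i0] f x)).
Proof.
move=> hf x1.
have -> : (fun t => aderiv f (rot t x)) = (fun t => rot t x ord0 i0 * dpart [:: i1] f (rot t x)
    - rot t x ord0 i1 * dpart [:: i0] f (rot t x)).
  by apply/funext => t; rewrite aderivE// (rot_enorm i01).
have [c0 c1] := rot_coord_is_derive x.
have d1 := dpart_rot_is_derive [:: i1] hf x1.
have d0 := dpart_rot_is_derive [:: i0] hf x1.
apply: is_derive_eq (is_deriveB (is_deriveM c0 d1) (is_deriveM c1 d0)) _.
have E (a b f1 f0 f11 f01 f10 f00 : R) :
    a *: (a * f11 - b * f01 : R^o) + f1 *: (- b : R^o) -
    (b *: (a * f10 - b * f00 : R^o) + f0 *: (a : R^o)) =
    a * (a * f11 - b * f01) - b * f1 - (b * (a * f10 - b * f00) + a * f0).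
  by rewrite !scale_regE; ring.
by rewrite !(rot0 i0 i1); exact: E.
Qed.

Lemma aderiv2E f x : harm_lim f -> enorm x < 1 ->
  aderiv (aderiv f) x =
   x ord0 i0 * (x ord0 i0 * dpart [:: i1; i1] f x - x ord0 i1 * dpart [:: i0; i1] f x)
    - x ord0 i1 * dpart [:: i1] f x
    - (x ord0 i1 * (x ord0 i0 * dpart [:: i1; i0] f x - x ord0 i1 * dpart [:: i0; i0] f x)
       + x ord0 i0 * dpart [:: i0] f x).
Proof. by move=> hf x1; have := aderiv2_is_derive hf x1; exact: @derive_val. Qed.

Lemma iter_aderiv_derivable f m x : harm_lim f -> enorm x < 1 -> (m <= 1)%N ->
  derivable (fun t => iter m aderiv f (rot t x)) (0 : R) 1.
Proof.
move=> hf x1; case: m => [|[|//]] _.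
  by case: (dpart_rot_is_derive [::] hf x1).
by case: (aderiv2_is_derive hf x1).
Qed.

Lemma iter_aderiv_rot f m (s : R) x : iter m aderiv (fun y => f (rot s y)) x = iter m aderiv f (rot s x).
Proof.
elim: m x => [//|m IH] x /=.
by rewrite -(aderiv_rot (iter m aderiv f)); apply: aderiv_ext => y _; exact: IH.
Qed.

(** Linearity needs derivability of each iterate along the orbit, which is known for iterates of
    order at most 1; hence at most two derivatives. *)
Lemma iter_aderiv_lin f1 f2 g m (a b : R) x : harm_lim f1 -> harm_lim f2 -> (m <= 2)%N ->
  enorm x < 1 -> (forall y, enorm y < 1 -> g y = a * f1 y + b * f2 y) ->
  iter m aderiv g x = a * iter m aderiv f1 x + b * iter m aderiv f2 x.
Proof.
move=> h1 h2 m2 x1 E; elim: m m2 x x1 => [_ x x1|m IH m2 x x1] /=; first exact: E.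
have {}IH := IH (ltnW m2).
transitivity (aderiv (fun y => a * iter m aderiv f1 y + b * iter m aderiv f2 y) x).
  by apply: aderiv_ext => y yx; apply: IH; rewrite yx.
have d1 := iter_aderiv_derivable h1 x1 m2.
have d2 := iter_aderiv_derivable h2 x1 m2.
rewrite /aderiv.
exact: (@derive_val _ _ _ _ _ _ _
  (is_deriveD (is_deriveZ a (DeriveDef d1 erefl)) (is_deriveZ b (DeriveDef d2 erefl)))).
Qed.

End angular_derivative.

(** * Lebesgue measure and rotations *)

Section measure_preserving.
Context {R : realType}.
Local Notation leb := (lebesgue_rV R).

Lemma measurable_preimage d1 d2 (T1 : measurableType d1) (T2 : measurableType d2)
    (f : T1 -> T2) (A : set T2) :
  measurable_fun setT f -> measurable A -> measurable (f @^-1` A).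
Proof. by move=> mf mA; rewrite -[X in measurable X]setTI; exact: mf. Qed.

Lemma measurable_coord n (i : 'I_n) : measurable_fun setT (fun x : 'rV[R]_n => x ord0 i : R).
Proof. exact: (@measurable_rV_coord _ R). Qed.

Definition preserving n (f : 'rV[R]_n -> 'rV[R]_n) := measurable_fun setT f /\
  forall A, measurable A -> leb n (f @^-1` A) = leb n A.

Lemma preserving_comp n (f g : 'rV[R]_n -> 'rV[R]_n) :
  preserving f -> preserving g -> preserving (f \o g).
Proof.
move=> [mf hf] [mg hg]; split; first exact: measurableT_comp.
by move=> A mA; rewrite comp_preimage hg ?hf//; exact: measurable_preimage.
Qed.

Lemma preserving_integral n (f : 'rV[R]_n -> 'rV[R]_n) (G : 'rV[R]_n -> \bar R) :
  preserving f -> measurable_fun [set: 'rV[R]_n] G -> (forall x, 0 <= G x)%E ->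
  (\int[leb n]_x G (f x) = \int[leb n]_x G x)%E.
Proof.
move=> [mf hf] mG G0.
have := @ge0_integral_pushforward _ _ _ _ R f mf (leb n) setT G measurableT mG (fun y _ => G0 y).
rewrite preimage_setT => <-.
by apply: eq_measure_integral => A mA _; exact: hf.
Qed.

Lemma lebesgue_measure_translate (c : R) (A : set R) : measurable A ->
  lebesgue_measure ((fun x : R => x + c) @^-1` A) = lebesgue_measure A.
Proof.
move=> mA.
have mf : measurable_fun setT ((fun x : R => x + c) : measurableTypeR R -> measurableTypeR R).
  by apply: measurable_funD => //; exact: measurable_id.
suff : pushforward lebesgue_measure ((fun x : R => x + c) : _ -> measurableTypeR R) A =
    lebesgue_measure A by [].
apply/esym/lebesgue_measure_unique => //= _ [[a b]] _ <-; rewrite /pushforward /=.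
have -> : (fun x : R => x + c) @^-1` `]a, b] = `](a - c), (b - c)]%classic.
  by apply/seteqP; split => x /=; rewrite !in_itv /= ltrBlDr lerBrDr.
rewrite !lebesgue_measure_itv /= !lte_fin ltrD2r.
by case: ifP => // _; rewrite -!EFinB; congr (_%:E); ring.
Qed.

Lemma lebesgue_rV_xsection n (A : set 'rV[R]_n.+1) :
  (leb n.+1 A = \int[lebesgue_measure]_a leb n [set v | A (rV_cons (a, v))])%E.
Proof.
apply: eq_integral => a _ /=; congr (leb n _).
by rewrite xsectionE.
Qed.

(** By definition the measure integrates the volumes of tail sections; uniqueness of the product
    measure also allows sections along the first coordinate. *)
Lemma lebesgue_rV_ysection n (A : set 'rV[R]_n.+1) : measurable A ->
  (leb n.+1 A = \int[leb n]_v lebesgue_measure [set a : R | A (rV_cons (a, v))])%E.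
Proof.
move=> mA.
have mA' : measurable ((@rV_cons R n) @^-1` A).
  by apply: measurable_preimage => //; exact: measurable_rV_cons.
transitivity ((@lebesgue_measure R \x^ leb n) ((@rV_cons R n) @^-1` A))%E.
  apply: (product_measure_unique (m' := (@lebesgue_measure R \x^ leb n)%E)) => //.
  by move=> B C mB mC; exact: product_measure2E.
apply: eq_integral => a _ /=; congr (lebesgue_measure _).
by rewrite ysectionE.
Qed.

Definition rV_tail n (x : 'rV[R]_n.+1) : 'rV[R]_n := \row_i x ord0 (lift ord0 i).

Lemma measurable_rV_tail n : measurable_fun setT (@rV_tail n).
Proof.
by apply: measurable_fun_to_rV => i; under eq_fun do rewrite mxE; exact: measurable_coord.
Qed.

Lemma rV_cons_tail n a (v : 'rV[R]_n) : rV_tail (rV_cons (a, v)) = v.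
Proof. by apply/rowP => i; rewrite !mxE liftK. Qed.

Lemma rV_cons_head n a (v : 'rV[R]_n) : rV_cons (a, v) ord0 ord0 = a.
Proof. by rewrite mxE unlift_none. Qed.

Lemma measurable_rV_cons2 d (T : measurableType d) n (a : T -> R) (v : T -> 'rV[R]_n) :
  measurable_fun setT a -> measurable_fun setT v ->
  measurable_fun setT (fun x => rV_cons (a x, v x)).
Proof.
move=> ma mv; apply: (measurableT_comp (@measurable_rV_cons R n)).
exact/measurable_fun_pair.
Qed.

(** On each line parallel to the first axis the map is a translation. *)
Lemma preserving_shear_head n (phi : 'rV[R]_n -> R) : measurable_fun setT phi ->
  preserving (fun x => rV_cons (x ord0 ord0 + phi (rV_tail x), rV_tail x)).
Proof.
move=> mphi; set f := (fun x => _).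
have mf : measurable_fun setT f.
  apply: measurable_rV_cons2; last exact: measurable_rV_tail.
  apply: measurable_funD; first exact: measurable_coord.
  exact: measurableT_comp mphi (@measurable_rV_tail n).
split=> // A mA; rewrite !lebesgue_rV_ysection//; last exact: measurable_preimage.
apply: eq_integral => v _.
have mAv : measurable [set a : R | A (rV_cons (a, v))].
  apply: (measurable_preimage (f := fun a : R => rV_cons (a, v))) mA.
  by apply: measurable_rV_cons2; [exact: measurable_id|exact: measurable_cst].
rewrite -(lebesgue_measure_translate (phi v) mAv); congr (lebesgue_measure _).
by apply/seteqP; split => a /=; rewrite /f rV_cons_head rV_cons_tail.
Qed.

Lemma preserving_shear_tail n (g : R -> 'rV[R]_n -> 'rV[R]_n) :
  (forall a, preserving (g a)) ->
  measurable_fun setT (fun x : 'rV[R]_n.+1 => g (x ord0 ord0) (rV_tail x)) ->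
  preserving (fun x => rV_cons (x ord0 ord0, g (x ord0 ord0) (rV_tail x))).
Proof.
move=> hg mg; set f := (fun x => _).
have mf : measurable_fun setT f.
  by apply: measurable_rV_cons2 mg; exact: measurable_coord.
split=> // A mA; rewrite !lebesgue_rV_xsection.
apply: eq_integral => a _.
have mAv : measurable [set v : 'rV[R]_n | A (rV_cons (a, v))].
  apply: (measurable_preimage (f := fun v : 'rV[R]_n => rV_cons (a, v))) mA.
  by apply: measurable_rV_cons2; [exact: measurable_cst|exact: measurable_id].
have [_ /(_ _ mAv) <-] := hg a; congr (leb n _).
by apply/seteqP; split => v /=; rewrite /f rV_cons_head rV_cons_tail.
Qed.

Lemma measurable_translate n (v : 'rV[R]_n) : measurable_fun setT (fun x : 'rV[R]_n => x + v).
Proof.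
apply: measurable_fun_to_rV => i; under eq_fun do rewrite mxE.
by apply: measurable_funD; [exact: measurable_coord|exact: measurable_cst].
Qed.

Lemma preserving_translate n (v : 'rV[R]_n) : preserving (fun x => x + v).
Proof.
elim: n v => [v|n IH v].
  split; first exact: measurable_translate.
  move=> A mA; congr (dirac _ _); apply/seteqP; split => x /=.
    by rewrite (_ : x + v = x)//; apply/rowP; case.
  by rewrite [x + v](_ : _ = x)//; apply/rowP; case.
have -> : (fun x : 'rV[R]_n.+1 => x + v) =
    (fun x : 'rV[R]_n.+1 => rV_cons (x ord0 ord0, rV_tail x + rV_tail v)) \o
    (fun x : 'rV[R]_n.+1 => rV_cons (x ord0 ord0 + v ord0 ord0, rV_tail x)).
  apply/funext => x /=; rewrite rV_cons_head rV_cons_tail; apply/rowP => i.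
  by rewrite !mxE; case: unliftP => [j ->|->] /=; rewrite ?mxE.
apply: preserving_comp; last first.
  by apply: (preserving_shear_head (phi := fun=> v ord0 ord0)); exact: measurable_cst.
apply: (preserving_shear_tail (g := fun _ w => w + rV_tail v)).
  by move=> a; exact: IH.
exact: measurableT_comp (measurable_translate _) (@measurable_rV_tail n).
Qed.

Lemma preserving_shear01 n (a : R) (i0 i1 : 'I_n) : i0 = 0%N :> nat -> i1 = 1%N :> nat ->
  preserving (fun x : 'rV[R]_n => x + (a * x ord0 i1) *: delta_mx ord0 i0) /\
  preserving (fun x : 'rV[R]_n => x + (a * x ord0 i0) *: delta_mx ord0 i1).
Proof.
case: n i0 i1 => [[]//|n] i0 i1 e0 e1.
have {e0} -> : i0 = ord0 by apply: val_inj.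
clear i0.
case: n i1 e1 => [|n] i1 e1; first by have := ltn_ord i1; rewrite e1.
have {e1} -> : i1 = lift ord0 ord0 by apply: val_inj; rewrite /= e1.
split.
  have -> : (fun x : 'rV[R]_n.+2 => x + (a * x ord0 (lift ord0 ord0)) *: delta_mx ord0 ord0) =
      (fun x => rV_cons (x ord0 ord0 + a * rV_tail x ord0 ord0, rV_tail x)).
    apply/funext => x; apply/rowP => i; rewrite !mxE.
    by case: unliftP => [j ->|->] /=; rewrite ?mxE /= ?mulr0 ?addr0 ?mulr1.
  apply: (preserving_shear_head (phi := fun v => a * v ord0 ord0)).
  by apply: measurable_funM; [exact: measurable_cst|exact: measurable_coord].
have -> : (fun x : 'rV[R]_n.+2 => x + (a * x ord0 ord0) *: delta_mx ord0 (lift ord0 ord0)) =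
    (fun x => rV_cons (x ord0 ord0, rV_tail x + (a * x ord0 ord0) *: delta_mx ord0 ord0)).
  apply/funext => x; apply/rowP => i; rewrite !mxE.
  case: unliftP => [j ->|->] /=; rewrite ?mxE /= ?mulr0 ?addr0//.
apply: (preserving_shear_tail (g := fun b v => v + (a * b) *: delta_mx ord0 ord0)).
  by move=> b; exact: preserving_translate.
apply: measurable_fun_to_rV => i; under eq_fun do rewrite !mxE.
apply: measurable_funD; first exact: measurable_coord.
apply: measurable_funM; last exact: measurable_cst.
by apply: measurable_funM; [exact: measurable_cst|exact: measurable_coord].
Qed.

(* A rotation of angle [t] is a product of three shears of slopes [(cos t - 1) / sin t],
   [sin t] and [(cos t - 1) / sin t]. *)
Lemma preserving_rot n (i0 i1 : 'I_n) (t : R) : i0 = 0%N :> nat -> i1 = 1%N :> nat ->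
  sin t != 0 -> preserving (rot i0 i1 t).
Proof.
move=> e0 e1 st; have i01 : i0 != i1 by rewrite -val_eqE /= e0 e1.
pose a := (cos t - 1) / sin t.
have [pa _] := preserving_shear01 a e0 e1; have [_ pb] := preserving_shear01 (sin t) e0 e1.
have := preserving_comp pa (preserving_comp pb pa); congr preserving.
apply/funext => x; apply/rowP => i; rewrite [RHS]mxE /= !mxE /= !eqxx.
rewrite [i1 == i0]eq_sym (negbTE i01) /= ?(mulr1n, mulr0n, mulr0, addr0, mulr1).
have as_ : a * sin t = cos t - 1 by rewrite /a mulfVK.
have [->|n0] := eqVneq i i0.
  rewrite (negbTE i01) ?(mulr1n, mulr0n, mulr0, addr0, mulr1).
  have e : a * (cos t + 1) = - sin t.
    apply: (mulIf st); rewrite mulrAC as_ mulNr -expr2 sin2cos2; ring.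
  have -> : x ord0 i0 + a * x ord0 i1 + a * (x ord0 i1 + sin t * (x ord0 i0 + a * x ord0 i1)) =
    x ord0 i0 * (1 + a * sin t) + x ord0 i1 * (a * (a * sin t + 2)) by ring.
  rewrite as_ (_ : cos t - 1 + 2 = cos t + 1); last by ring.
  by rewrite e; ring.
have [->|n1] := eqVneq i i1.
  rewrite ?(mulr1n, mulr0n, mulr0, addr0, mulr1).
  have -> : x ord0 i1 + sin t * (x ord0 i0 + a * x ord0 i1) =
    sin t * x ord0 i0 + (1 + a * sin t) * x ord0 i1 by ring.
  by rewrite as_; ring.
by rewrite ?(mulr1n, mulr0n, mulr0, addr0, mulr1).
Qed.

End measure_preserving.

Section measurable_functions.
Context {R : realType} {n : nat}.
Implicit Types (x : 'rV[R]_n) (e : pexpr R n).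

Lemma flat_continuous k : continuous (@flat R k).
Proof.
move=> t; apply: differentiable_continuous; apply/derivable1_diffP.
by case: (flat_is_derive k t).
Qed.

Lemma measurable_peval e : measurable_fun [set: 'rV[R]_n] (peval e).
Proof.
elim: e => [c|i|k a b i|e1 IH1 e2 IH2|e1 IH1 e2 IH2] /=.
- exact: measurable_cst.
- exact: measurable_coord.
- apply: (measurableT_comp (continuous_measurable_fun (@flat_continuous k))).
  apply: measurable_funD; last exact: measurable_cst.
  by apply: measurable_funM; [exact: measurable_cst|exact: measurable_coord].
- exact: measurable_funD.
- exact: measurable_funM.
Qed.

Lemma measurable_enorm : measurable_fun [set: 'rV[R]_n] (@enorm R n).
Proof.
apply: (measurableT_comp (continuous_measurable_fun (@sqrt_continuous R))).
have -> : (fun x : 'rV[R]_n => \sum_i x ord0 i ^+ 2) =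
    peval (psum (fun i => PMul (PVar i) (PVar i))).
  by apply/funext => x; rewrite peval_psum.
exact: measurable_peval.
Qed.

Lemma measurable_eball : measurable (eball n : set 'rV[R]_n).
Proof.
rewrite (_ : eball n = @enorm R n @^-1` `]-oo, 1[%classic).
  by apply: measurable_preimage => //; exact: measurable_enorm.
by apply/seteqP; split => x /=; rewrite in_itv.
Qed.

Lemma harm_lim_measurable (f : 'rV[R]_n -> R) : harm_lim f -> measurable_fun (eball n) f.
Proof.
move=> [F hF Ff]; apply: (measurable_fun_cvg (h := fun k => peval (F k))).
  by move=> k; apply: measurable_funTS; exact: measurable_peval.
by move=> x x1; apply: (ulim_cvg Ff); rewrite /cball /=; apply: ltW.
Qed.

Lemma dpart_measurable (n0 : (0 < n)%N) (f : 'rV[R]_n -> R) s : harm_lim f ->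
  measurable_fun (eball n) (dpart s f).
Proof.
move=> [F hF Ff].
apply: (measurable_fun_cvg (h := fun k => peval (foldr pderiv (F k) s))).
  by move=> k; apply: measurable_funTS; exact: measurable_peval.
by move=> x x1; exact: (dpart_cvg n0 hF Ff).
Qed.

End measurable_functions.

(** * Volumes of cubes and shells *)

Section cubes.
Context {R : realType}.
Local Notation leb := (lebesgue_rV R).

Definition cube n (c : R) : set 'rV[R]_n := [set x | forall i, `|x ord0 i| <= c].

Lemma cubeS n (c : R) : cube c = @rV_uncons R n @^-1` (`[- c, c]%classic `*` cube c).
Proof.
apply/seteqP; split => x /=.
  move=> h; split; first by rewrite in_itv /= -ler_norml.
  by move=> i; rewrite mxE.
rewrite in_itv /= -ler_norml => -[h0 h] i.
case: (unliftP ord0 i) => [j ->|->//].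
by have := h j; rewrite mxE.
Qed.

Lemma measurable_cube n (c : R) : measurable (cube c : set 'rV[R]_n).
Proof.
elim: n => [|n IH].
  by rewrite (_ : cube c = setT)//; apply/seteqP; split => // x _ [].
rewrite cubeS; apply: measurable_preimage; first exact: measurable_rV_uncons.
exact: measurableX.
Qed.

Lemma lebesgue_cube n (c : R) : 0 <= c -> leb n (cube c) = ((2 * c) ^+ n)%:E.
Proof.
move=> c0; elim: n => [|n IH].
  rewrite expr0 /= diracE (_ : _ \in _ = true)//.
  by apply/mem_set; case.
have -> : leb n.+1 (cube c) = (@lebesgue_measure R \x leb n)%E (`[- c, c]%classic `*` cube c).
  rewrite /= /lebesgue_rV_step /pushforward cubeS -comp_preimage.
  by rewrite (_ : _ \o _ = id) ?preimage_id//; exact/funext/rV_consK.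
rewrite product_measure1E//; last exact: measurable_cube.
rewrite -[X in (X * _)%E]/(lebesgue_measure `[- c, c]%classic) IH.
rewrite lebesgue_measure_itv /= lte_fin exprS.
have [c1|c1] := ltP (- c) c.
  rewrite -EFinB -EFinM; congr (_%:E); ring.
have -> : c = 0 by lra.
by rewrite mul0e mulr0 mul0r.
Qed.

Lemma lebesgue_cube_translate n (c : R) (z : 'rV[R]_n) : 0 <= c ->
  leb n [set x | cube c (x - z)] = ((2 * c) ^+ n)%:E.
Proof.
move=> c0; have [_ h] := preserving_translate (- z).
by rewrite -(lebesgue_cube n c0) -(h _ (@measurable_cube n c)).
Qed.

Lemma measurable_cube_translate n (c : R) (z : 'rV[R]_n) : measurable [set x | cube c (x - z)].
Proof.
have [mf _] := preserving_translate (- z).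
exact: (measurable_preimage mf (@measurable_cube n c)).
Qed.

Lemma lebesgue_near_le n (c : R) (z : 'rV[R]_n) (A : set 'rV[R]_n) : 0 <= c ->
  measurable A -> (forall x, A x -> enorm (x - z) <= c) -> (leb n A <= ((2 * c) ^+ n)%:E)%E.
Proof.
move=> c0 mA h; rewrite -(lebesgue_cube_translate z c0); apply: le_measure; rewrite ?inE//.
  exact: measurable_cube_translate.
by move=> x /h xz i; apply: le_trans xz; exact: coord_le_enorm.
Qed.

Lemma lebesgue_near_ge n (c : R) (z : 'rV[R]_n) (A : set 'rV[R]_n) : 0 <= c ->
  measurable A -> (forall x, enorm (x - z) <= n%:R * c -> A x) ->
  (((2 * c) ^+ n)%:E <= leb n A)%E.
Proof.
move=> c0 mA h; rewrite -(lebesgue_cube_translate z c0); apply: le_measure; rewrite ?inE//.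
  exact: measurable_cube_translate.
move=> x xz; apply: h; apply: le_trans (enorm_le_sum _) _.
rewrite -[X in X%:R](card_ord n) mulr_natl -sumr_const.
by apply: ler_sum => i _; exact: xz.
Qed.

Lemma lebesgue_rV_bounded_lty n (A : set 'rV[R]_n) (c : R) : measurable A ->
  (forall x, A x -> enorm x <= c) -> (leb n A < +oo)%E.
Proof.
move=> mA h; have [c0|c0] := leP 0 c.
  apply: le_lt_trans (lebesgue_near_le (z := 0) c0 mA _) _; last exact: ltry.
  by move=> x /h; rewrite subr0.
rewrite (_ : A = set0) ?measure0//; apply/seteqP; split => // x /h.
by move=> /(le_lt_trans)/(_ c0); rewrite ltNge enorm_ge0.
Qed.

(* Over each small value of the other coordinates, the shell [1 - e <= |x| < 1] contains
   an interval of first coordinates of length at least [e / 2]. *)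
Lemma shell_volume n (q : R) : 0 < q < 1 -> exists c e0 : R, [/\ 0 < c, 0 < e0 &
  forall (e : R) (E : set 'rV[R]_n.+1), 0 < e <= e0 -> measurable E ->
  (forall x, 1 - e <= enorm x -> enorm x < 1 -> q <= x ord0 ord0 ^+ 2 -> E x) ->
  ((c * e)%:E <= leb n.+1 E)%E].
Proof.
(* On the cube of half-side [d] one has [|v|^2 <= eta]. With [e <= eta] this gives
   [(1 - e)^2 - |v|^2 >= 1 - 3 eta >= q], so the whole interval of first coordinates satisfies
   [q <= a^2]. *)
move=> /andP[q0 q1]; pose eta : R := (1 - q) / 4.
have eta0 : 0 < eta by rewrite /eta; lra.
have eta1 : eta <= 4^-1 by rewrite /eta; lra.
pose d : R := eta / n.+1%:R.
have d0 : 0 < d by rewrite divr_gt0.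
exists ((2 * d) ^+ n / 2), eta; split => //.
  by rewrite divr_gt0// exprn_gt0// mulr_gt0.
move=> e E /andP[e0 e1] mE hE.
rewrite lebesgue_rV_ysection//.
have mEv v : measurable [set a : R | E (rV_cons (a, v))].
  apply: (measurable_preimage (f := fun a : R => rV_cons (a, v))) mE.
  by apply: measurable_rV_cons2; [exact: measurable_id|exact: measurable_cst].
have mG : measurable_fun setT (fun v : 'rV[R]_n => lebesgue_measure [set a : R | E (rV_cons (a, v))]).
  have mE' : measurable ((@rV_cons R n) @^-1` E).
    by apply: measurable_preimage => //; exact: measurable_rV_cons.
  have := measurable_fun_ysection (@lebesgue_measure R) mE'.
  by congr measurable_fun; apply/funext => v /=; rewrite ysectionE.
apply: (@le_trans _ _ (\int[leb n]_(v in cube d) (e / 2)%:E)%E).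
  have -> : (\int[leb n]_(v in cube d) (e / 2)%:E = (e / 2)%:E * ((2 * d) ^+ n)%:E)%E.
    rewrite integral_cst; last exact: measurable_cube.
    by congr (_ * _)%E; apply: lebesgue_cube; exact: ltW.
  rewrite -EFinM lee_fin le_eqVlt; apply/orP; left; apply/eqP.
  by field.
apply: (@le_trans _ _ (\int[leb n]_(v in cube d) lebesgue_measure [set a : R | E (rV_cons (a, v))])%E); last first.
  apply: ge0_subset_integral => //; exact: measurable_cube.
apply: ge0_le_integral => //.
- exact: measurable_cube.
- by move=> v _; rewrite lee_fin divr_ge0 ?ltW.
- by apply: measurable_funTS.
move=> v vd; pose t := enorm v ^+ 2.
have nn : 1 <= n.+1%:R :> R by rewrite ler1n.
have t1 : t <= eta.
  have h : enorm v <= eta.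
    apply: le_trans (enorm_le_sum _) _.
    apply: (@le_trans _ _ (\sum_(i < n) d)); first by apply: ler_sum => i _; exact: vd.
    rewrite sumr_const card_ord -mulr_natr /d mulrAC ler_pdivrMr ?ltr0n//.
    by rewrite ler_wpM2l ?ler_nat ?ltW.
  rewrite /t expr2; have := enorm_ge0 v; nra.
have t0 : 0 <= t by exact: sqr_ge0.
pose lo : R := Num.sqrt ((1 - e) ^+ 2 - t); pose hi : R := Num.sqrt (1 - t).
have A0 : q <= (1 - e) ^+ 2 - t.
  by move: e1 t1 eta1; rewrite /eta; move: e0 => *; nra.
have A1 : (1 - e) ^+ 2 - t <= 1 - t by nra.
have lo0 : 0 <= lo by exact: sqrtr_ge0.
have lo2 : lo ^+ 2 = (1 - e) ^+ 2 - t by rewrite sqr_sqrtr//; apply: le_trans A0; exact: ltW.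
have hi2 : hi ^+ 2 = 1 - t by rewrite sqr_sqrtr//; apply: le_trans A1; apply: le_trans A0; exact: ltW.
have hi0 : 0 <= hi by exact: sqrtr_ge0.
have lohi : lo <= hi by exact: ler_wsqrtr.
have hi1 : hi <= 1 by nra.
(* [(hi - lo) (hi + lo) = 2 e - e^2] with [hi + lo <= 2], whence a length of at least
   [e - e^2 / 2]. *)
have gap : e / 2 <= hi - lo.
  have : (hi - lo) * (hi + lo) = 2 * e - e ^+ 2.
    have -> : (hi - lo) * (hi + lo) = hi ^+ 2 - lo ^+ 2 by ring.
    by rewrite hi2 lo2; ring.
  have : hi + lo <= 2 by lra.
  by nra.
apply: (@le_trans _ _ (lebesgue_measure `[lo, hi[%classic)).
  rewrite lebesgue_measure_itv /= lte_fin; case: ltP => h; first by rewrite -EFinB lee_fin.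
  by rewrite lee_fin; lra.
apply: le_measure; rewrite ?inE//.
  exact: mEv.
move=> a /=; rewrite in_itv /= => /andP[a1 a2].
have en : enorm (rV_cons (a, v)) ^+ 2 = a ^+ 2 + t.
  rewrite !enormE /t enormE /dotp big_ord_recl rV_cons_head -expr2; congr (_ + _).
  by apply: eq_bigr => i _; rewrite !mxE liftK.
have a0 : 0 <= a by exact: le_trans a1.
have s1 : lo ^+ 2 <= a ^+ 2 by rewrite lerXn2r ?nnegrE.
have s2 : a ^+ 2 < hi ^+ 2 by rewrite ltrXn2r ?nnegrE.
apply: hE.
- have e1' : 0 <= 1 - e by lra.
  by rewrite -(@ler_pXn2r _ 2) ?nnegrE ?enorm_ge0// en; lra.
- by rewrite -(@expr_lt1 _ 2) ?enorm_ge0// en; lra.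
- by rewrite rV_cons_head; lra.
Qed.

End cubes.

(** * Weak and classical derivatives *)

Section compactly_supported.
Context {R : realType} {n : nat}.
Local Notation leb := (lebesgue_rV R n).
Local Notation "'e_ i" := (delta_mx ord0 i : 'rV[R]_n) (at level 8, i at level 2).
Implicit Types (x y : 'rV[R]_n) (e E phi : pexpr R n) (u v : 'rV[R]_n -> R).

Lemma peval_bounded e (c : R) : exists2 M : R, 0 <= M &
  forall x, enorm x <= c -> `|peval e x| <= M.
Proof.
elim: e => [a|i|k a b i|e1 [M1 p1 h1] e2 [M2 p2 h2]|e1 [M1 p1 h1] e2 [M2 p2 h2]] /=.
- by exists `|a|.
- by exists `|c| => // x xc; apply: le_trans (coord_le_enorm _ _) (le_trans xc (ler_norm _)).
- exists ((k.+2)`!%:R * (`|a| * `|c| + `|b|) ^+ 2).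
    by rewrite mulr_ge0// exprn_ge0// addr_ge0// mulr_ge0.
  move=> x xc; rewrite ger0_norm ?flat_ge0//; apply: le_trans (flat_le_sqr _ _) _.
  rewrite ler_wpM2l// -[leLHS]real_normK ?num_real// lerXn2r ?nnegrE ?addr_ge0 ?mulr_ge0//.
  apply: le_trans (ler_normD _ _) _; rewrite lerD2r normrM ler_wpM2l//.
  by apply: le_trans (coord_le_enorm _ _) (le_trans xc (ler_norm _)).
- exists (M1 + M2); first exact: addr_ge0.
  by move=> x xc; apply: le_trans (ler_normD _ _) _; apply: lerD; [exact: h1|exact: h2].
- exists (M1 * M2); first exact: mulr_ge0.
  by move=> x xc; rewrite normrM; apply: ler_pM => //; [exact: h1|exact: h2].
Qed.

Definition supported (c : R) u := forall x, c < enorm x -> u x = 0.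

Lemma measurable_enorm_le (c : R) : measurable [set x : 'rV[R]_n | enorm x <= c].
Proof.
rewrite (_ : [set x | _] = @enorm R n @^-1` `]-oo, c]%classic).
  by apply: measurable_preimage => //; exact: measurable_enorm.
by apply/seteqP; split => x /=; rewrite in_itv.
Qed.

(** The dominating function in the convergence arguments for compactly supported integrands. *)
Definition plateau (c M : R) : 'rV[R]_n -> R := (fun=> M) \_ [set x | enorm x <= c].

Lemma plateau_integrable (c M : R) : leb.-integrable setT (EFin \o plateau c M).
Proof.
rewrite /plateau; have mB := measurable_enorm_le c.
have -> : EFin \o ((fun=> M) \_ [set x : 'rV[R]_n | enorm x <= c]) =
    (EFin \o (fun=> M)) \_ [set x : 'rV[R]_n | enorm x <= c].
  by rewrite restrict_EFin.
apply: (iffLR (integrable_mkcond (EFin \o (fun=> M)) mB)).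
apply/integrableP; split; first exact: measurable_cst.
rewrite (eq_integral (cst `|M|%:E)); last by [].
rewrite integral_cst// lte_mul_pinfty//.
by apply: (lebesgue_rV_bounded_lty mB) => x; exact.
Qed.

Lemma bounded_supported_integrable (c M : R) u : measurable_fun setT u ->
  supported c u -> (forall x, enorm x <= c -> `|u x| <= M) ->
  leb.-integrable setT (EFin \o u).
Proof.
move=> mu su hM; apply: (le_integrable measurableT _ _ (plateau_integrable c M)) => //.
  exact/measurable_EFinP.
move=> x _ /=; rewrite lee_fin /plateau /patch; case: ifPn => [|/negP xc].
  by rewrite inE /= => xc; apply: le_trans (hM _ xc) (ler_norm _).
rewrite su ?normr0 // ltNge; apply/negP => h; apply: xc; exact/mem_set.
Qed.

Lemma peval_integrable (c : R) E : supported c (peval E) -> leb.-integrable setT (EFin \o peval E).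
Proof.
move=> sE; have [M _ hM] := peval_bounded E c.
exact: (bounded_supported_integrable (measurable_peval E) sE hM).
Qed.

Lemma supported_pderiv (c : R) E i : supported c (peval E) -> supported c (peval (pderiv i E)).
Proof.
move=> sE x cx; have h := peval_is_derive E i x.
rewrite -(@derive_val _ _ _ _ _ _ _ h); apply: derive_val; apply: is_derive_eps => e e0.
have d0 : 0 < enorm x - c by rewrite subr_gt0.
exists (enorm x - c) => // t ht; rewrite !sE//; first by rewrite subrr mulr0 subr0 normr0 mulr_ge0// ltW.
have := enorm_sub (t *: 'e_i + x) x; rewrite addrK enormZ enorm_delta mulr1 ler_norml.
by move=> /andP[h1 _]; lra.
Qed.

Lemma preserving_integral_signed (f : 'rV[R]_n -> 'rV[R]_n) (G : 'rV[R]_n -> \bar R) :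
  preserving f -> measurable_fun [set: 'rV[R]_n] G ->
  (\int[leb]_x G (f x) = \int[leb]_x G x)%E.
Proof.
move=> pf mG; rewrite integralE [in RHS]integralE; congr (_ - _)%E.
  transitivity (\int[leb]_x (G^\+ (f x)))%E; first by apply: eq_integral => x _; rewrite (funeposE, funenegE) (funeposE, funenegE).
  apply: (preserving_integral (G := G^\+%E) pf) => //.
  exact: measurable_funepos.
transitivity (\int[leb]_x (G^\- (f x)))%E; first by apply: eq_integral => x _; rewrite (funeposE, funenegE) (funeposE, funenegE).
apply: (preserving_integral (G := G^\-%E) pf) => //.
exact: measurable_funeneg.
Qed.

(* The difference quotients of a compactly supported function have zero integral by
   translation invariance, and they converge boundedly to the derivative. *)
Lemma integral_pderiv (c : R) E i : supported c (peval E) ->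
  (\int[leb]_x (peval (pderiv i E) x)%:E = 0)%E.
Proof.
move=> sE; have iE := peval_integrable sE.
pose h (k : nat) : R := k.+1%:R^-1.
have h0 k : 0 < h k by rewrite invr_gt0.
have h1 k : h k <= 1 by rewrite /h invf_le1 ?ltr0n// ler1n.
pose q k x : R := (h k)^-1 * (peval E (x + h k *: 'e_i) - peval E x).
have quot k x : exists2 t : R, 0 <= t <= h k & q k x = peval (pderiv i E) (x + t *: 'e_i).
  have [t [/andP[t0 t1] E1]] := peval_mvt E x (x + h k *: 'e_i).
  exists (t * h k).
    by rewrite mulr_ge0 ?(ltW (h0 k))//= ler_piMl// ltW.
  have e1 : x + h k *: 'e_i - x = h k *: 'e_i by rewrite addrC addKr.
  rewrite /q E1 (bigD1 i) //= big1 ?addr0; last first.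
    by move=> j ji; rewrite e1 !mxE eqxx (negbTE ji) mulr0 mul0r.
  rewrite e1 !mxE !eqxx mulr1 mulrA mulVf ?gt_eqF// mul1r scalerA.
  by congr (peval _ _); rewrite addrC.
have mq k : measurable_fun setT (q k).
  apply: measurable_funM; first exact: measurable_cst.
  apply: measurable_funB; last exact: measurable_peval.
  exact: measurableT_comp (measurable_peval E) (measurable_translate _).
have iT k : leb.-integrable setT (EFin \o (fun x => peval E (x + h k *: 'e_i))).
  apply/integrableP; split.
    apply/measurable_EFinP.
    exact: measurableT_comp (measurable_peval E) (measurable_translate _).
  have /integrableP[mE] := iE; congr (_ < _)%E; apply/esym.
  apply: (preserving_integral (G := fun x => `|(peval E x)%:E|%E) (preserving_translate _)) => //.
  by apply: measurableT_comp => //; apply/measurable_EFinP; exact: measurable_peval.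
have q0 k : (\int[leb]_x (q k x)%:E = 0)%E.
  have -> : (\int[leb]_x (q k x)%:E = \int[leb]_x
      ((h k)^-1%:E * ((peval E (x + h k *: 'e_i))%:E - (peval E x)%:E)))%E.
    by apply: eq_integral => x _; rewrite EFinM EFinB.
  rewrite integralZl//; last exact: (integrableB measurableT (iT k) iE).
  rewrite integralB_EFin//.
  rewrite (preserving_integral_signed (G := EFin \o peval E) (preserving_translate _)); last first.
    by apply/measurable_EFinP; exact: measurable_peval.
  by rewrite subee ?mule0// integrable_fin_num.
pose D x := peval (pderiv i E) x.
have sD := supported_pderiv i sE.
have near_supp x (t : R) : c + 1 < enorm x -> 0 <= t <= 1 -> c < enorm (x + t *: 'e_i).
  move=> cx /andP[t0 t1]; have := enorm_sub (x + t *: 'e_i) x.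
  rewrite [x + _]addrC addrK enormZ enorm_delta mulr1 (ger0_norm t0) ler_norml.
  by move=> /andP[? _]; lra.
have qs k : supported (c + 1) (q k).
  move=> x cx; have [t /andP[t0 t1] ->] := quot k x.
  by apply: sD; apply: near_supp => //; rewrite t0 (le_trans t1).
have [M' M'0 hM'] := peval_bounded (pderiv i E) (c + 2).
have qM k x : enorm x <= c + 1 -> `|q k x| <= M'.
  move=> xc; have [t /andP[t0 t1] ->] := quot k x; apply: hM'.
  apply: le_trans (enorm_triangle _ _) _; rewrite enormZ enorm_delta mulr1 ger0_norm//.
  have := h1 k; lra.
have qcvg x : (q k x)%:E @[k --> \oo] --> (D x)%:E.
  apply/fine_cvgP; split; first by near=> k.
  apply/cvgrPdist_lt => e e0 /=.
  have /continuous_enormP/(_ e e0)[d d0 hd] := @peval_continuous _ _ (pderiv i E) x.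
  have hh : h k @[k --> \oo] --> (0 : R) by exact: cvg_harmonic.
  have /cvgrPdist_lt/(_ d d0) := hh; apply: filterS => k.
  rewrite sub0r normrN gtr0_norm// => hk.
  have [t /andP[t0 t1] ->] := quot k x; rewrite distrC; apply: hd.
  rewrite [x + _]addrC addrK enormZ enorm_delta mulr1 ger0_norm//.
  exact: le_lt_trans hk.
have mqE k : measurable_fun setT (fun x => (q k x)%:E) by apply/measurable_EFinP.
have mDE : measurable_fun setT (fun x => (D x)%:E).
  by apply/measurable_EFinP; exact: measurable_peval.
have dom : {ae leb, forall x k, [set: 'rV[R]_n] x -> (`|(q k x)%:E| <=
    (EFin \o plateau (c + 1) M') x)%E}.
  apply: aeW => x k _ /=; rewrite lee_fin /plateau /patch; case: ifPn => [|/negP xc].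
    by rewrite inE /=; exact: qM.
  rewrite qs ?normr0 // ltNge; apply/negP => hx; apply: xc; exact/mem_set.
have ae_cvg : {ae leb, forall x, [set: 'rV[R]_n] x -> (q k x)%:E @[k --> \oo] --> (D x)%:E}.
  by apply: aeW => x _; exact: qcvg.
have [_ _ lim] := dominated_convergence measurableT mqE mDE ae_cvg
  (plateau_integrable (c + 1) M') dom.
have lim0 : ([sequence \int[leb]_x (q k x)%:E]_k @ \oo --> (0 : \bar R))%E.
  have -> : ([sequence \int[leb]_x (q k x)%:E]_k)%E = (fun=> 0%E) by apply/funext => k; exact: q0.
  exact: cvg_cst.
exact: (cvg_unique _ lim lim0).
Unshelve. all: by end_near.
Qed.

Lemma supportedM (c : R) u v : supported c v -> supported c (fun x => u x * v x).
Proof. by move=> sv x /sv ->; rewrite mulr0. Qed.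

Lemma supported_pderivs (c : R) phi s : supported c (peval phi) ->
  supported c (peval (foldr pderiv phi s)).
Proof. by move=> sp; elim: s => //= i s IH; exact: supported_pderiv. Qed.

Lemma pmul_integrable (c : R) E phi : supported c (peval phi) ->
  leb.-integrable setT (EFin \o (fun x => peval E x * peval phi x)).
Proof.
move=> sp; apply: (@peval_integrable c (PMul E phi)).
exact: (supportedM (peval E) sp).
Qed.

Lemma peval_by_parts (c : R) E phi i : supported c (peval phi) ->
  (\int[leb]_x (peval E x * peval (pderiv i phi) x)%:E =
   - \int[leb]_x (peval (pderiv i E) x * peval phi x)%:E)%E.
Proof.
move=> sp; have := @integral_pderiv c (PMul E phi) i (supportedM (peval E) sp).
have i1 := pmul_integrable (pderiv i E) sp.
have i2 := pmul_integrable E (supported_pderiv i sp).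
under eq_integral do rewrite /= EFinD.
rewrite (integralD_EFin measurableT i1 i2) => h.
have f1 := integrable_fin_num measurableT i1.
have f2 := integrable_fin_num measurableT i2.
move: h f1 f2; move: (integral _ _ _) (integral _ _ _) => [a| |] // [b| |] //=.
move=> /eqP; rewrite -EFinD eqe => /eqP h _ _.
by congr (_%:E); rewrite -(addKr b a) h addr0.
Qed.

(** Integration by parts strips the outermost derivative first, so the word is reversed on the other
    factor. *)
Lemma peval_by_parts_seq (c : R) E phi s : supported c (peval phi) ->
  (\int[leb]_x (peval E x * peval (foldr pderiv phi s) x)%:E =
   ((-1) ^+ size s)%:E * \int[leb]_x (peval (foldr pderiv E (rev s)) x * peval phi x)%:E)%E.
Proof.
move=> sp; elim: s E => [|i s IH] E /=; first by rewrite expr0 mul1e.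
rewrite (peval_by_parts E i (supported_pderivs s sp)) IH rev_cons foldr_rcons.
by rewrite exprS mulN1r EFinN mulNe.
Qed.

(** Nothing is known of [v] outside the ball of radius [rho], but there [phi] vanishes. The sequence
    is shifted by [N] to be bounded uniformly, as dominated convergence requires. *)
Lemma integral_uniform_limit (G : nat -> pexpr R n) v phi (rho : R) :
  (forall e : R, 0 < e -> exists N, forall k, (N <= k)%N -> forall x, enorm x <= rho ->
    `|peval (G k) x - v x| <= e) ->
  supported rho (peval phi) ->
  [/\ measurable_fun setT (fun x => v x * peval phi x),
      leb.-integrable setT (EFin \o (fun x => v x * peval phi x)) &
      (\int[leb]_x (peval (G k) x * peval phi x)%:E)%E @[k --> \oo] -->
      (\int[leb]_x (v x * peval phi x)%:E)%E].
Proof.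
move=> hG sp; have [N hN] := hG 1 ltr01.
have [M M0 hM] := peval_bounded (G N) rho; have [L L0 hL] := peval_bounded phi rho.
have vM x : enorm x <= rho -> `|v x| <= M + 1.
  move=> xr; have := hN N (leqnn _) x xr; have := hM x xr.
  by rewrite !ler_norml => /andP[? ?] /andP[? ?]; apply/andP; split; lra.
have sup x : ~~ (enorm x <= rho) -> peval phi x = 0 by rewrite -ltNge => /sp.
have pw x : peval (G (k + N)%N) x * peval phi x @[k --> \oo] --> v x * peval phi x.
  have [xr|/sup ->] := boolP (enorm x <= rho); last first.
    by under eq_fun do rewrite mulr0; rewrite mulr0; exact: cvg_cst.
  apply: cvgMl; apply/cvgrPdist_le => e e0; have [K hK] := hG e e0.
  exists K => // k /= Kk; rewrite distrC; apply: hK => //.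
  exact: leq_trans Kk (leq_addr _ _).
have mk k : measurable_fun setT (fun x => peval (G (k + N)%N) x * peval phi x).
  exact: (measurable_peval (PMul (G (k + N)%N) phi)).
have mv : measurable_fun setT (fun x => v x * peval phi x).
  by apply: (measurable_fun_cvg mk) => x _; exact: pw.
have bound (p : R) x : enorm x <= rho -> `|p| <= M + 2 ->
    `|p * peval phi x| <= (M + 2) * L.
  by move=> xr pM; rewrite normrM; apply: ler_pM => //; exact: hL.
have vi : leb.-integrable setT (EFin \o (fun x => v x * peval phi x)).
  apply: (bounded_supported_integrable mv (supportedM v sp)) => x xr.
  by apply: bound => //; have := vM x xr; lra.
split => //.
have mkE k : measurable_fun setT (fun x => (peval (G (k + N)%N) x * peval phi x)%:E).
  by apply/measurable_EFinP.
have mvE : measurable_fun setT (fun x => (v x * peval phi x)%:E) by apply/measurable_EFinP.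
have ae_cvg : {ae leb, forall x, [set: 'rV[R]_n] x ->
    (peval (G (k + N)%N) x * peval phi x)%:E @[k --> \oo] --> (v x * peval phi x)%:E}.
  by apply: aeW => x _; apply: cvg_EFin; [exact: nearW|exact: pw].
have dom : {ae leb, forall x k, [set: 'rV[R]_n] x ->
    (`|(peval (G (k + N)%N) x * peval phi x)%:E| <= (EFin \o plateau rho ((M + 2) * L)) x)%E}.
  apply: aeW => x k _ /=; rewrite lee_fin /plateau /patch.
  case: ifPn => [|/negP xc].
    rewrite inE /= => xr; apply: bound => //; have := hN (k + N)%N (leq_addl _ _) x xr.
    have := vM x xr; rewrite !ler_norml => /andP[? ?] /andP[? ?]; apply/andP; split; lra.
  by rewrite sup ?mulr0 ?normr0//; apply/negP => h; apply: xc; rewrite inE.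
have [_ _ lim] := dominated_convergence measurableT mkE mvE ae_cvg
  (plateau_integrable rho ((M + 2) * L)) dom.
by rewrite -(cvg_shiftn N).
Qed.

Lemma harm_lim_by_parts (f : 'rV[R]_n -> R) phi (rho : R) s : (0 < n)%N -> harm_lim f ->
  0 < rho < 1 -> supported rho (peval phi) ->
  [/\ leb.-integrable setT (EFin \o (fun x => f x * peval (foldr pderiv phi s) x)),
      leb.-integrable setT (EFin \o (fun x => dpart (rev s) f x * peval phi x)) &
   (\int[leb]_x (f x * peval (foldr pderiv phi s) x)%:E =
   ((-1) ^+ size s)%:E * \int[leb]_x (dpart (rev s) f x * peval phi x)%:E)%E].
Proof.
move=> n0 [F hF Ff] rho1 sp.
have h1 (e : R) : 0 < e -> exists N, forall k, (N <= k)%N -> forall x, enorm x <= rho ->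
    `|peval (F k) x - f x| <= e.
  move=> e0; have [N hN] := Ff e e0; exists N => k Nk x xr; apply: hN => //.
  by case/andP: rho1 => _ /ltW; exact: le_trans.
have h2 (e : R) : 0 < e -> exists N, forall k, (N <= k)%N -> forall x, enorm x <= rho ->
    `|peval (foldr pderiv (F k) (rev s)) x - dpart (rev s) f x| <= e.
  by move=> e0; exact: (dpart_uniform (Ordinal n0) (rev s) hF Ff rho1 e0).
have [_ i1 l1] := integral_uniform_limit h1 (supported_pderivs s sp).
have [_ i2 l2] := integral_uniform_limit h2 sp.
split => //; apply: (cvg_unique _ l1) => //.
have -> : (fun k => \int[leb]_x (peval (F k) x * peval (foldr pderiv phi s) x)%:E)%E =
   (fun k => ((-1) ^+ size s)%:E *
      \int[leb]_x (peval (foldr pderiv (F k) (rev s)) x * peval phi x)%:E)%E.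
  by apply/funext => k; exact: peval_by_parts_seq sp.
by apply: cvgeZl l2.
Qed.

End compactly_supported.

(** * Functions determined by their integrals over boxes *)

Section open_boxes.
Context {R : realType} {n : nat}.
Local Notation leb := (lebesgue_rV R n).
Implicit Types (x a b : 'rV[R]_n).

Definition obox a b : set 'rV[R]_n := [set x | forall i, a ord0 i < x ord0 i < b ord0 i].

Lemma measurable_obox a b : measurable (obox a b).
Proof.
have -> : obox a b = \bigcap_(i in [set: 'I_n])
    ((fun x : 'rV[R]_n => x ord0 i) @^-1` `]a ord0 i, b ord0 i[%classic).
  apply/seteqP; split => x /= h i; first by move=> _; rewrite /= in_itv /=; exact: h.
  by have := h i I; rewrite /= in_itv.
apply: fin_bigcap_measurable => // i _.
by apply: measurable_preimage => //; exact: measurable_coord.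
Qed.

Definition oboxes : set (set 'rV[R]_n) := [set A | exists a b, A = obox a b].

Lemma oboxes_setI : setI_closed oboxes.
Proof.
move=> _ _ [a [b ->]] [a' [b' ->]].
exists (\row_i Num.max (a ord0 i) (a' ord0 i)), (\row_i Num.min (b ord0 i) (b' ord0 i)).
apply/seteqP; split => x /=.
  move=> [h h'] i; rewrite !mxE gt_max lt_min.
  by have /andP[-> ->] := h i; have /andP[-> ->] := h' i.
move=> h; split => i; have := h i; rewrite !mxE gt_max lt_min.
  by move=> /andP[/andP[-> _] /andP[-> _]].
by move=> /andP[/andP[_ ->] /andP[_ ->]].
Qed.

Lemma norm_lt_nat x : exists k : nat, forall i, `|x ord0 i| < k%:R.
Proof.
exists (Num.truncn (enorm x)).+1 => i.
by apply: le_lt_trans (coord_le_enorm _ _) _; exact: truncnS_gt.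
Qed.

(** The half-space where coordinate [i] exceeds [c] is a countable union of boxes, and half-lines
    generate the Borel sets of the line. *)
Lemma measurable_oboxes : measurable = <<s oboxes >>.
Proof.
apply/seteqP; split; last first.
  apply: smallest_sub; first exact: sigma_algebra_measurable.
  by move=> _ [a [b ->]]; exact: measurable_obox.
apply: smallest_sub; first exact: smallest_sigma_algebra.
move=> A /=; rewrite -bigcup_seq => -[i _ [C mC <-]]; rewrite setTI.
suff : measurable_fun [set: g_sigma_algebraType oboxes]
    ((fun x : 'rV[R]_n => x ord0 i) : g_sigma_algebraType oboxes -> R).
  by move=> h; have := h measurableT C mC; rewrite setTI.
apply: (measurability _ (RGenOInfty.measurableE R)) => // _ [_ [c ->] <-].
rewrite setTI.
have -> : (fun x : 'rV[R]_n => x ord0 i) @^-1` `]c, +oo[%classic =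
    \bigcup_k obox (\row_j if j == i then Num.max c (- k%:R) else - k%:R) (const_mx k%:R).
  apply/seteqP; split => x /=.
    rewrite in_itv /= andbT => cx; have [k hk] := norm_lt_nat x.
    exists k => // j; rewrite !mxE; have := hk j; rewrite ltr_norml => /andP[h1 ->].
    by case: eqP => [->|_]; rewrite ?gt_max ?cx /= andbT//; have := hk i; rewrite ltr_norml => /andP[].
  by move=> [k _ h]; have := h i; rewrite !mxE eqxx gt_max in_itv /= andbT => /andP[/andP[]].
apply: bigcupT_measurable => k; apply: sub_sigma_algebra.
by exists (\row_j if j == i then Num.max c (- k%:R) else - k%:R), (const_mx k%:R).
Qed.

End open_boxes.

Section density.
Context d (T : measurableType d) {R : realType} (mu : {measure set T -> \bar R})
  (f : T -> \bar R).
Hypotheses (mf : measurable_fun setT f) (f0 : forall x, (0 <= f x)%E).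

Definition density (A : set T) : \bar R := (\int[mu]_(x in A) f x)%E.

Let density0 : density set0 = 0%E. Proof. exact: integral_set0. Qed.

Let density_ge0 A : (0 <= density A)%E. Proof. exact: integral_ge0. Qed.

Let density_sigma_additive : semi_sigma_additive density.
Proof. exact: semi_sigma_additive_nng_induced. Qed.

HB.instance Definition _ := isMeasure.Build _ _ _ density
  density0 density_ge0 density_sigma_additive.

End density.

Section vanishing_on_boxes.
Context {R : realType} {n : nat}.
Local Notation leb := (lebesgue_rV R n).

(** The positive and the negative part of [h] are densities of two measures that agree on boxes, a
    generating class stable under intersection; they then agree on all measurable sets. *)
Lemma zero_on_boxes (h : 'rV[R]_n -> R) : leb.-integrable setT (EFin \o h) ->
  (forall a b, \int[leb]_(x in obox a b) (h x)%:E = 0)%E ->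
  ae_eq leb setT (EFin \o h) (cst 0%E).
Proof.
move=> ih hz; have mh : measurable_fun setT (EFin \o h) := measurable_int _ ih.
have int_split A : measurable A -> (\int[leb]_(x in A) (h x)%:E =
    \int[leb]_(x in A) (EFin \o h)^\+ x - \int[leb]_(x in A) (EFin \o h)^\- x)%E.
  by move=> mA; rewrite integralE.
have fin_pos A : measurable A -> (\int[leb]_(x in A) (EFin \o h)^\+ x < +oo)%E.
  move=> mA; have iA : leb.-integrable A (EFin \o h) by apply: integrableS ih.
  exact: integral_funepos_lt_pinfty iA.
have fin_neg A : measurable A -> (\int[leb]_(x in A) (EFin \o h)^\- x < +oo)%E.
  move=> mA; have iA : leb.-integrable A (EFin \o h) by apply: integrableS ih.
  exact: integral_funeneg_lt_pinfty iA.
have eq0 A : measurable A -> (\int[leb]_(x in A) (EFin \o h)^\+ x =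
    \int[leb]_(x in A) (EFin \o h)^\- x)%E -> (\int[leb]_(x in A) (h x)%:E = 0)%E.
  move=> mA E; rewrite int_split// E subee// ge0_fin_numE ?fin_neg//.
  exact: integral_ge0.
have main A : measurable A -> (\int[leb]_(x in A) (EFin \o h)^\+ x =
    \int[leb]_(x in A) (EFin \o h)^\- x)%E.
  move=> mA.
  have mp : measurable_fun setT ((EFin \o h)^\+)%E by exact: measurable_funepos.
  have mn : measurable_fun setT ((EFin \o h)^\-)%E by exact: measurable_funeneg.
  suff : density leb ((EFin \o h)^\+)%E A = density leb ((EFin \o h)^\-)%E A by [].
  pose g (k : nat) : set 'rV[R]_n := obox (const_mx (- k%:R)) (const_mx k%:R).
  apply: (measure_unique oboxes g (@measurable_oboxes R n) (@oboxes_setI R n)) => //.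
  - by move=> k; exists (const_mx (- k%:R)), (const_mx k%:R).
  - apply/seteqP; split => // x _; have [k hk] := norm_lt_nat x.
    by exists k => // i; rewrite !mxE -ltr_norml.
  - move=> _ [a [b ->]].
    suff E : (\int[leb]_(x in obox a b) (EFin \o h)^\+ x =
      \int[leb]_(x in obox a b) (EFin \o h)^\- x)%E by exact: E.
    have := hz a b; rewrite int_split; last exact: measurable_obox.
    have := fin_pos _ (measurable_obox a b); have := fin_neg _ (measurable_obox a b).
    have p0 : (0 <= \int[leb]_(x in obox a b) (EFin \o h)^\+ x)%E by exact: integral_ge0.
    have n0 : (0 <= \int[leb]_(x in obox a b) (EFin \o h)^\- x)%E by exact: integral_ge0.
    move: p0 n0.
    move: (integral _ _ _) (integral _ _ _) => [u| |] // [v| |] //= _ _ _ _.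
    by move=> /eqP; rewrite -EFinB eqe subr_eq0 => /eqP ->.
  - by move=> k; apply: fin_pos; exact: measurable_obox.
apply: (@integral_ae_eq _ _ _ leb setT measurableT (cst 0%E) (EFin \o h)) => //.
by move=> E _ mE; rewrite integral0; apply: eq0 => //; exact: main.
Qed.

End vanishing_on_boxes.

Section bumps.
Context {R : realType} {n : nat}.
Implicit Types (x a b : 'rV[R]_n).

Definition pprod (F : 'I_n -> pexpr R n) : pexpr R n :=
  foldr (fun i e => PMul (F i) e) (PCst 1) (enum 'I_n).

Lemma peval_pprod F x : peval (pprod F) x = \prod_i peval (F i) x.
Proof.
rewrite /pprod -big_enum /=; elim: (enum _) => [|i s IH] /=; first by rewrite big_nil.
by rewrite big_cons IH.
Qed.

(** Each one-dimensional factor is [exp (- 1 / (k t))] for [k t > 0] and zero otherwise, so the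
    product vanishes off the box and tends to its indicator as [k] grows. *)
Definition bump a b (k : nat) : pexpr R n := pprod (fun i =>
  PMul (PFlat 0 k%:R (- (k%:R * a ord0 i)) i) (PFlat 0 (- k%:R) (k%:R * b ord0 i) i)).

Lemma bumpE a b k x : peval (bump a b k) x =
  \prod_i (flat 0 (k%:R * (x ord0 i - a ord0 i)) * flat 0 (k%:R * (b ord0 i - x ord0 i))).
Proof.
rewrite peval_pprod; apply: eq_bigr => i _ /=.
by congr (flat _ _ * flat _ _); ring.
Qed.

Lemma flat0_le1 (t : R) : 0 <= flat 0 t <= 1.
Proof.
rewrite flat_ge0 /= /flat; case: ifP => // t0.
by rewrite expr0 mul1r -expR0 ler_expR oppr_le0 invr_ge0 ltW.
Qed.

Lemma flat_neg k (t : R) : t <= 0 -> flat k t = 0.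
Proof. by rewrite /flat ltNge => ->. Qed.

Lemma bump_bound a b k x : 0 <= peval (bump a b k) x <= 1.
Proof.
rewrite bumpE; elim/big_ind: _ => [|p q|i _].
- by rewrite ler01 lexx.
- move=> /andP[p0 p1] /andP[q0 q1]; rewrite mulr_ge0//= -[leRHS]mulr1.
  exact: ler_pM.
have /andP[p0 p1] := flat0_le1 (k%:R * (x ord0 i - a ord0 i)).
have /andP[q0 q1] := flat0_le1 (k%:R * (b ord0 i - x ord0 i)).
rewrite mulr_ge0//= -[leRHS]mulr1; exact: ler_pM.
Qed.

Lemma bump_out a b k x : ~ obox a b x -> peval (bump a b k) x = 0.
Proof.
move=> hx; have /existsNP[i hi] : ~ forall i, a ord0 i < x ord0 i < b ord0 i by [].
rewrite bumpE (bigD1 i) //=.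
move/negP : hi; rewrite negb_and -!leNgt => /orP[h|h].
  by rewrite flat_neg ?mul0r// mulr_ge0_le0// subr_le0.
by rewrite [X in _ * X * _]flat_neg ?mulr0 ?mul0r// mulr_ge0_le0// subr_le0.
Qed.

Lemma flat0_cvg (t : R) : 0 < t -> flat 0 (k%:R * t) @[k --> \oo] --> (1 : R).
Proof.
move=> t0.
have h : expR (- ((k.+1%:R)^-1 * t^-1)) @[k --> \oo] --> (1 : R).
  have h0 : (k.+1%:R)^-1 * t^-1 @[k --> \oo] --> (0 * t^-1 : R).
    by apply: cvgMl; exact: cvg_harmonic.
  have h1 : - ((k.+1%:R)^-1 * t^-1) @[k --> \oo] --> (- (0 * t^-1) : R) by exact: cvgN h0.
  have h2 : expR (- ((k.+1%:R)^-1 * t^-1)) @[k --> \oo] --> expR (- (0 * t^-1) : R).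
    by apply: continuous_cvg h1; exact: continuous_expR.
  by rewrite mul0r oppr0 expR0 in h2.
rewrite -(cvg_shiftn 1); apply: cvg_trans h; apply: near_eq_cvg; near=> k.
by rewrite /= /flat addn1 mulr_gt0 ?ltr0n// expr0 mul1r invfM.
Unshelve. all: by end_near.
Qed.

Lemma prod_cvg1 (I : Type) (s : seq I) (u : I -> nat -> R) :
  (forall i, u i k @[k --> \oo] --> (1 : R)) -> \prod_(i <- s) u i k @[k --> \oo] --> (1 : R).
Proof.
move=> h; elim: s => [|i s IH].
  by under eq_fun do rewrite big_nil; exact: cvg_cst.
under eq_fun do rewrite big_cons.
have : u i k * \prod_(j <- s) u j k @[k --> \oo] --> (1 * 1 : R) by exact: cvgM (h i) IH.
by rewrite mulr1.
Qed.

Lemma bump_cvg a b x : obox a b x -> peval (bump a b k) x @[k --> \oo] --> (1 : R).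
Proof.
move=> hx; under eq_fun do rewrite bumpE.
apply: prod_cvg1 => i; have /andP[] := hx i.
rewrite -subr_gt0 => /flat0_cvg h1; rewrite -subr_gt0 => /flat0_cvg h2.
have : flat 0 (k%:R * (x ord0 i - a ord0 i)) * flat 0 (k%:R * (b ord0 i - x ord0 i))
    @[k --> \oo] --> (1 * 1 : R) by exact: cvgM h1 h2.
by rewrite mulr1.
Qed.

End bumps.

Section classical_weak_derivative.
Context {R : realType} {n : nat}.
Local Notation leb := (lebesgue_rV R n).
Implicit Types (x a b : 'rV[R]_n) (f g : 'rV[R]_n -> R).

Lemma bump_supported (rho : R) a b k : (forall x, obox a b x -> enorm x <= rho) ->
  supported rho (peval (bump a b k)).
Proof.
by move=> h x rx; apply: bump_out => /h; rewrite leNgt rx.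
Qed.

Lemma bump_test (rho : R) a b k : rho < 1 -> (forall x, obox a b x -> enorm x <= rho) ->
  test_function (eball n) (peval (bump a b k)).
Proof.
move=> r1 h; split; first by move=> m; exact: peval_Cn.
exists [set x | enorm x <= rho].
  by split; [exact: compact_enorm_ball|move=> x /= /le_lt_trans; apply].
by move=> x /negP; rewrite -ltNge; exact: bump_supported.
Qed.

(* The bumps converge boundedly to the indicator of the box. *)
Lemma integral_bump_limit (rho : R) a b (v : 'rV[R]_n -> R) :
  (forall x, obox a b x -> enorm x <= rho) ->
  leb.-integrable setT (EFin \o (v \_ [set x : 'rV[R]_n | enorm x <= rho])) ->
  (\int[leb]_x (v x * peval (bump a b k) x)%:E)%E @[k --> \oo] -->
  (\int[leb]_(x in obox a b) (v x)%:E)%E.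
Proof.
move=> hr iv; pose w : 'rV[R]_n -> R := v \_ [set x | enorm x <= rho].
rewrite -/w in iv.
have wE x k : v x * peval (bump a b k) x = w x * peval (bump a b k) x.
  rewrite /w /patch; case: ifPn => // /negP xr.
  have -> : peval (bump a b k) x = 0.
    apply: (bump_supported k hr); rewrite ltNge; apply/negP => h; apply: xr; exact/mem_set.
  by rewrite !mulr0.
have wb x : obox a b x -> w x = v x.
  by move=> /hr xr; rewrite /w /patch ifT//; exact/mem_set.
have mw : measurable_fun setT w by apply/measurable_EFinP; exact: measurable_int iv.
have mk k : measurable_fun setT (fun x => (w x * peval (bump a b k) x)%:E).
  apply/measurable_EFinP; apply: measurable_funM => //; exact: measurable_peval.
have mi : measurable_fun setT (fun x => ((w \_ (obox a b)) x)%:E).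
  apply/measurable_EFinP/(measurable_restrictT w (measurable_obox a b)).
  exact: measurable_funTS.
have ae_cvg : {ae leb, forall x, [set: 'rV[R]_n] x ->
    (w x * peval (bump a b k) x)%:E @[k --> \oo] --> ((w \_ (obox a b)) x)%:E}.
  apply: aeW => x _; apply: cvg_EFin; first exact: nearW.
  rewrite /patch; case: ifPn => [|/negP]; rewrite inE => hx.
    have E : w x * peval (bump a b k) x @[k --> \oo] --> (w x * 1 : R).
      by apply: cvgMr; exact: bump_cvg.
    by rewrite mulr1 in E.
  have -> : fine \o (fun k => (w x * peval (bump a b k) x)%:E) = (fun=> 0).
    by apply/funext => k /=; rewrite bump_out ?mulr0.
  exact: cvg_cst.
have dom : {ae leb, forall x k, [set: 'rV[R]_n] x ->
    (`|(w x * peval (bump a b k) x)%:E| <= (abse \o (EFin \o w)) x)%E}.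
  apply: aeW => x k _ /=; rewrite lee_fin normrM.
  have /andP[p0 p1] := bump_bound a b k x.
  by rewrite ler_piMr// ger0_norm.
have [_ _ lim] := dominated_convergence measurableT mk mi ae_cvg (integrable_abse iv) dom.
have -> : (fun k => \int[leb]_x (v x * peval (bump a b k) x)%:E)%E =
    (fun k => \int[leb]_x (w x * peval (bump a b k) x)%:E)%E.
  by apply/funext => k; apply: eq_integral => x _; rewrite wE.
have -> : (\int[leb]_(x in obox a b) (v x)%:E = \int[leb]_x ((w \_ (obox a b)) x)%:E)%E.
  rewrite integral_mkcond; apply: eq_integral => x _; rewrite /patch /=.
  by case: ifPn => //; rewrite inE => /wb ->.
exact: lim.
Qed.

(** On a bounded set [|f| <= 1 + f^2] suffices. *)
Lemma ball_integrable (rho : R) f : rho < 1 -> L2_on (eball n) f ->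
  leb.-integrable setT (EFin \o (f \_ [set x : 'rV[R]_n | enorm x <= rho])).
Proof.
move=> r1 [mf if2]; have mB := @measurable_eball R n.
have sub : [set x : 'rV[R]_n | enorm x <= rho] `<=` eball n.
  by move=> x /= /le_lt_trans; apply.
have mr := @measurable_enorm_le R n rho.
have i2 : leb.-integrable setT (EFin \o ((fun x => f x ^+ 2) \_ (eball n))).
  have -> : EFin \o ((fun x => f x ^+ 2) \_ (eball n)) = (EFin \o (fun x => f x ^+ 2)) \_ (eball n).
    by rewrite restrict_EFin.
  apply: (iffLR (integrable_mkcond _ mB)); apply/integrableP; split.
    by apply/measurable_EFinP; exact: measurable_funX.
  rewrite (eq_integral (fun x => (f x ^+ 2)%:E)) // => x _ /=.
  by rewrite ger0_norm// sqr_ge0.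
apply: (le_integrable measurableT _ _ (integrableD measurableT (plateau_integrable rho 1) i2)).
  apply/measurable_EFinP/(measurable_restrictT f mr); exact: measurable_funS mf.
move=> x _ /=; rewrite lee_fin /plateau /patch.
case: ifPn => [|_]; last first.
  by rewrite [X in X <= _](_ : _ = 0); [exact: normr_ge0|exact: normr0].
rewrite inE /= => xr; rewrite ifT; last by apply/mem_set; exact: sub.
rewrite [leRHS]ger0_norm ?addr_ge0 ?sqr_ge0//.
have := sqr_ge0 (`|f x| - 1); rewrite -[f x ^+ 2]real_normK ?num_real//.
by have := normr_ge0 (f x); rewrite !expr2; lra.
Qed.

Lemma dpart_ball_integrable (rho : R) f s : (0 < n)%N -> 0 < rho < 1 -> harm_lim f ->
  leb.-integrable setT (EFin \o (dpart s f \_ [set x : 'rV[R]_n | enorm x <= rho])).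
Proof.
move=> n0 rho1 hf; have mv := dpart_measurable n0 s hf; case: hf => F hF Ff.
have [N hN] := dpart_uniform (Ordinal n0) s hF Ff rho1 (@ltr01 R).
have [M M0 hM] := peval_bounded (foldr pderiv (F N) s) rho.
have sub : [set x : 'rV[R]_n | enorm x <= rho] `<=` eball n.
  by move=> x /= xr; case/andP: rho1 => _; exact: le_lt_trans.
apply: (@bounded_supported_integrable _ _ rho (M + 1)).
- apply/(measurable_restrictT _ (@measurable_enorm_le R n rho)); exact: (measurable_funS (@measurable_eball R n) sub mv).
- move=> x rx; rewrite /patch ifN//; apply/negP; rewrite inE /= => h.
  by move: rx; rewrite ltNge h.
move=> x xr; rewrite /patch ifT; last exact/mem_set.
have := hN N (leqnn _) x xr; have := hM x xr.
by rewrite !ler_norml => /andP[? ?] /andP[? ?]; apply/andP; split; lra.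
Qed.

Lemma integral_supported (rho : R) (u : 'rV[R]_n -> R) : rho < 1 -> supported rho u ->
  (\int[leb]_(x in eball n) (u x)%:E = \int[leb]_x (u x)%:E)%E.
Proof.
move=> r1 su; rewrite integral_mkcond; apply: eq_integral => x _; rewrite /patch.
case: ifPn => // /negP xB; rewrite su//; apply: lt_le_trans r1 _.
by rewrite leNgt; apply/negP => h; apply: xB; exact/mem_set.
Qed.

(** Tested against bumps, the weak derivative and integration by parts give equal integrals; the
    bumps then tend to the indicator of the box. *)
Lemma weak_derivative_box (rho : R) f g s a b : (0 < n)%N -> 0 < rho < 1 -> harm_lim f ->
  L2_on (eball n) g -> weak_derivative (eball n) s f g ->
  (forall x, obox a b x -> enorm x <= rho) ->
  (\int[leb]_(x in obox a b) (g x)%:E = \int[leb]_(x in obox a b) (dpart (rev s) f x)%:E)%E.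
Proof.
move=> n0 rho01 hf gL wd hbox; have /andP[rho0 rho1] := rho01.
have ig := ball_integrable rho1 gL.
have iv := dpart_ball_integrable (rev s) n0 rho01 hf.
have lg := integral_bump_limit hbox ig; have lv := integral_bump_limit hbox iv.
suff E k : (\int[leb]_x (g x * peval (bump a b k) x)%:E =
    \int[leb]_x (dpart (rev s) f x * peval (bump a b k) x)%:E)%E.
  have -> : (\int[leb]_(x in obox a b) (g x)%:E)%E =
      limn (fun k => \int[leb]_x (g x * peval (bump a b k) x)%:E)%E by apply/esym/cvg_lim.
  by under eq_fun do rewrite E; apply/cvg_lim.
have sb := bump_supported k hbox.
have [i1 i2 parts] := harm_lim_by_parts s n0 hf rho01 sb.
have := wd _ (bump_test k rho1 hbox).
rewrite peval_dpart /Rintegral (integral_supported rho1 (supportedM f (supported_pderivs s sb))).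
rewrite (integral_supported rho1 (supportedM g sb)) parts.
(* Weak derivatives are stated with real-valued integrals, so both integrals must be known finite
   before the extended equality can be recovered. *)
have f2 := integrable_fin_num measurableT i2.
have fg : (\int[leb]_x (g x * peval (bump a b k) x)%:E)%E \is a fin_num.
  apply: integrable_fin_num => //; apply: (le_integrable measurableT _ _ ig).
    have -> : (fun x => (g x * peval (bump a b k) x)%:E) = EFin \o (fun x =>
        (g \_ [set x : 'rV[R]_n | enorm x <= rho]) x * peval (bump a b k) x).
      apply/funext => x /=; rewrite /patch; case: ifPn => // /negP xr.
      by rewrite sb ?mulr0// ltNge; apply/negP => h; apply: xr; exact/mem_set.
    apply/measurable_EFinP; apply: measurable_funM; last exact: measurable_peval.
    by apply/measurable_EFinP; exact: measurable_int ig.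
  move=> x _ /=; rewrite lee_fin /patch; case: ifPn => [_|/negP xr].
    rewrite normrM; have /andP[p0 p1] := bump_bound a b k x.
    by rewrite ler_piMr// ger0_norm.
  by rewrite sb ?mulr0 ?normr0// ltNge; apply/negP => h; apply: xr; exact/mem_set.
have s0 : (-1) ^+ size s != 0 :> R by rewrite expf_neq0// oppr_eq0 oner_eq0.
move: fg f2; move: (integral _ _ _) (integral _ _ _) => [p| |] // [q| |] //= _ _.
by move=> /(mulfI s0) ->.
Qed.

(** The intersection of two boxes is a box, so the difference, restricted to the given box, has zero
    integral over every box. *)
Lemma weak_derivative_ae_box (rho : R) f g s a b : (0 < n)%N -> 0 < rho < 1 -> harm_lim f ->
  L2_on (eball n) g -> weak_derivative (eball n) s f g ->
  (forall x, obox a b x -> enorm x <= rho) ->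
  {ae leb, forall x, obox a b x -> g x = dpart (rev s) f x}.
Proof.
move=> n0 rho01 hf gL wd hbox; have /andP[rho0 rho1] := rho01.
have mb := measurable_obox a b.
have on_box (u : 'rV[R]_n -> R) c d :
    leb.-integrable setT (EFin \o (u \_ [set x : 'rV[R]_n | enorm x <= rho])) ->
    (forall x, obox c d x -> enorm x <= rho) -> leb.-integrable (obox c d) (EFin \o u).
  move=> iu hcd; have mcd := measurable_obox c d.
  have := integrableS measurableT mcd (@subsetT _ _) iu.
  apply: eq_integrable => // x; rewrite inE => /hcd xr /=.
  by rewrite /patch ifT//; exact/mem_set.
have ig := on_box _ _ _ (ball_integrable rho1 gL).
have iv := on_box _ _ _ (dpart_ball_integrable (rev s) n0 rho01 hf).
pose h : 'rV[R]_n -> R := (fun x => g x - dpart (rev s) f x) \_ (obox a b).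
have ih : leb.-integrable setT (EFin \o h).
  have -> : EFin \o h = (EFin \o (fun x => g x - dpart (rev s) f x)) \_ (obox a b).
    by rewrite /h restrict_EFin.
  apply: (iffLR (integrable_mkcond _ mb)).
  have := integrableB mb (ig _ _ hbox) (iv _ _ hbox).
  by apply: eq_integrable => // x _ /=; rewrite EFinB.
have hz c d : (\int[leb]_(x in obox c d) (h x)%:E = 0)%E.
  have -> : (fun x => (h x)%:E) = (EFin \o (fun x => g x - dpart (rev s) f x)) \_ (obox a b).
    by apply/funext => x; rewrite /h /patch /=; case: ifP.
  rewrite -integral_mkcondr.
  have [c' [d' E]] := oboxes_setI (ex_intro _ c (ex_intro _ d erefl))
    (ex_intro _ a (ex_intro _ b erefl)).
  rewrite E; have hcd x : obox c' d' x -> enorm x <= rho by rewrite -E => -[_ /hbox].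
  have mcd := measurable_obox c' d'.
  rewrite (eq_integral (fun x => (g x)%:E - (dpart (rev s) f x)%:E)%E) //.
  rewrite (integralB mcd (ig _ _ hcd) (iv _ _ hcd)).
  rewrite (weak_derivative_box n0 rho01 hf gL wd hcd) subee//.
  exact: integrable_fin_num (iv _ _ hcd).
have := zero_on_boxes ih hz; apply: filterS => x /= E xb.
have := E I; rewrite /h /patch ifT; last exact/mem_set.
by move=> [] /eqP; rewrite subr_eq0 => /eqP.
Qed.

Lemma rational_box x : enorm x < 1 -> exists (q : 'rV[rat]_n * 'rV[rat]_n) (rho : R),
  [/\ 0 < rho < 1, obox (map_mx ratr q.1) (map_mx ratr q.2) x &
      forall y, obox (map_mx ratr q.1) (map_mx ratr q.2) y -> enorm y <= rho].
Proof.
move=> x1; pose d : R := (1 - enorm x) / 2 / n.+1%:R.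
have d0 : 0 < d by rewrite !divr_gt0// subr_gt0.
have /choice[q hq] : forall i, exists q : rat * rat,
    x ord0 i - d < ratr q.1 < x ord0 i /\ x ord0 i < ratr q.2 < x ord0 i + d.
  move=> i.
  have [p1 +] := @rat_in_itvoo R (x ord0 i - d) (x ord0 i) ltac:(by rewrite ltrBlDr ltrDl).
  rewrite in_itv /= => h1.
  have [p2 +] := @rat_in_itvoo R (x ord0 i) (x ord0 i + d) ltac:(by rewrite ltrDl).
  by rewrite in_itv /= => h2; exists (p1, p2).
exists (\row_i (q i).1, \row_i (q i).2), ((1 + enorm x) / 2); split.
- by have := enorm_ge0 x => h; apply/andP; split; lra.
- move=> i; rewrite !mxE; have [/andP[_ ->] /andP[-> _]] := hq i; exact.
move=> y hy; have yx : enorm (y - x) <= (1 - enorm x) / 2.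
  apply: le_trans (enorm_le_sum _) _.
  apply: (@le_trans _ _ (\sum_(i < n) d)).
    apply: ler_sum => i _; have := hy i; rewrite !mxE => /andP[y1 y2].
    have [/andP[h1 h2] /andP[h3 h4]] := hq i; rewrite ler_norml; apply/andP; split; lra.
  rewrite sumr_const card_ord; apply: (@le_trans _ _ (d * n.+1%:R)).
    rewrite -[leLHS]mulr_natr; by rewrite ler_wpM2l ?ler_nat// ltW.
  by rewrite /d divfK// pnatr_eq0.
have := enorm_triangle (y - x) x; rewrite subrK; lra.
Qed.

(** The ball is a countable union of boxes with rational corners, each inside a smaller ball; [good]
    selects these boxes and [unpickle] enumerates them. *)
Lemma weak_derivative_ae f g s : (0 < n)%N -> harm_lim f ->
  L2_on (eball n) g -> weak_derivative (eball n) s f g ->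
  {ae leb, forall x, eball n x -> g x = dpart (rev s) f x}.
Proof.
move=> n0 hf gL wd.
pose good (q : 'rV[rat]_n * 'rV[rat]_n) := exists rho : R, 0 < rho < 1 /\
  forall y, obox (map_mx ratr q.1) (map_mx ratr q.2) y -> enorm y <= rho.
pose N (k : nat) : set 'rV[R]_n := if unpickle k is Some q then
  [set x | good q /\ ~ (obox (map_mx ratr q.1) (map_mx ratr q.2) x -> g x = dpart (rev s) f x)]
  else set0.
have hN k : leb.-negligible (N k).
  rewrite /N; case: unpickle => [q|]; last exact: negligible_set0.
  have [[rho [rho01 hq]]|nq] := pselect (good q).
    have := weak_derivative_ae_box n0 rho01 hf gL wd hq.
    by apply: negligibleS => x [].
  by apply: negligibleS (negligible_set0 leb) => x [].
have := negligible_bigcup hN; apply: negligibleS => x /= hx.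
have xB : eball n x by apply: contrapT => h; apply: hx => /h.
have [q [rho [rho01 xq hq]]] := rational_box xB.
exists (pickle q) => //; rewrite /N pickleK; split; first by exists rho.
by move=> h; apply: hx => _; exact: h.
Qed.

End classical_weak_derivative.

(** * Energies of pairs of points near the sphere *)

Section pair_energy.
Context {R : realType} {n : nat}.
Variables (i0 i1 : 'I_n).
Hypotheses (i0E : i0 = 0%N :> nat) (i1E : i1 = 1%N :> nat).
Local Notation leb := (lebesgue_rV R n).
Local Notation ssq := (@ssq R n i0 i1).
Local Notation rot := (@rot R n i0 i1).
Implicit Types (x y : 'rV[R]_n) (G H : 'rV[R]_n -> R).

Let i01 : i0 != i1. Proof. by rewrite -val_eqE /= i0E i1E. Qed.

Definition shell (e : R) : set 'rV[R]_n := [set x | 1 - e <= enorm x < 1].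

(** Only norms and [ssq] occur, so the set is stable under the simultaneous rotation of both points.
    The condition on [1 - |y|^2] puts [y] at a depth of order at least [s]. *)
Definition close_pairs (q s e : R) : set ('rV[R]_n * 'rV[R]_n) :=
  [set z | [/\ 1 - e <= enorm z.1 < 1, q <= ssq z.1, enorm (z.1 - z.2) <= 2 * s,
               s / 2 <= 1 - enorm z.2 ^+ 2 & enorm z.2 < 1]].

Lemma measurable_le_set d (T : measurableType d) (u v : T -> R) :
  measurable_fun setT u -> measurable_fun setT v -> measurable [set x | u x <= v x].
Proof.
move=> mu mv; have := measurable_fun_le measurableT mu mv.
by rewrite setTI.
Qed.

Lemma measurable_lt_set d (T : measurableType d) (u v : T -> R) :
  measurable_fun setT u -> measurable_fun setT v -> measurable [set x | u x < v x].
Proof.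
move=> mu mv; rewrite (_ : [set x | _] = ~` [set x | v x <= u x]).
  by apply: measurableC; exact: measurable_le_set.
by apply/seteqP; split => x /=; rewrite ltNge => /negP.
Qed.

Lemma measurable_shell (e : R) : measurable (shell e).
Proof.
rewrite (_ : shell e = [set x | 1 - e <= enorm x] `&` [set x | enorm x < 1]).
  apply: measurableI; last exact: measurable_eball.
  by apply: measurable_le_set; [exact: measurable_cst|exact: measurable_enorm].
by apply/seteqP; split => x; [move=> /andP[]|move=> [h1 h2]; apply/andP].
Qed.

Lemma measurable_enorm_sub : measurable_fun [set: 'rV[R]_n * 'rV[R]_n] (fun z => enorm (z.1 - z.2)).
Proof.
apply: (measurableT_comp measurable_enorm); apply: measurable_fun_to_rV => i.
under eq_fun do rewrite !mxE.
apply: measurable_funB; first exact: measurableT_comp (measurable_coord i) measurable_fst.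
exact: measurableT_comp (measurable_coord i) measurable_snd.
Qed.

Lemma measurable_close_pairs (q s e : R) : measurable (close_pairs q s e).
Proof.
have m1 : measurable_fun [set: 'rV[R]_n * 'rV[R]_n] (fun z => enorm z.1).
  exact: measurableT_comp measurable_enorm measurable_fst.
have m2 : measurable_fun [set: 'rV[R]_n * 'rV[R]_n] (fun z => enorm z.2).
  exact: measurableT_comp measurable_enorm measurable_snd.
have m3 : measurable_fun [set: 'rV[R]_n * 'rV[R]_n] (fun z => ssq z.1).
  have -> : (fun z : 'rV[R]_n * 'rV[R]_n => ssq z.1) = peval (pss i0 i1) \o fst.
    by apply/funext => z; exact/esym/pssE.
  exact: measurableT_comp (measurable_peval _) measurable_fst.
have m4 := measurable_enorm_sub.
have m5 : measurable_fun [set: 'rV[R]_n * 'rV[R]_n] (fun z => 1 - enorm z.2 ^+ 2).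
  by apply: measurable_funB; [exact: measurable_cst|exact: measurable_funX].
have mc c : measurable_fun [set: 'rV[R]_n * 'rV[R]_n] (fun=> c : R) by exact: measurable_cst.
have -> : close_pairs q s e = [set z | 1 - e <= enorm z.1] `&` [set z | enorm z.1 < 1] `&`
    [set z | q <= ssq z.1] `&` [set z | enorm (z.1 - z.2) <= 2 * s] `&`
    [set z | s / 2 <= 1 - enorm z.2 ^+ 2] `&` [set z | enorm z.2 < 1].
  apply/seteqP; split => z /= => [[/andP[-> ->] -> -> -> ->]//|].
  by move=> [[[[[h1 h2] h3] h4] h5] h6]; split => //; apply/andP.
by repeat apply: measurableI; (apply: measurable_le_set || apply: measurable_lt_set).
Qed.

Section fixed_pairs.
Variables (q s e : R).
Local Notation P := (close_pairs q s e).

Definition pair_sqr (l : R) G : 'rV[R]_n * 'rV[R]_n -> R :=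
  (fun z => (G z.1 - l * G z.2) ^+ 2) \_ P.

Definition energy (l : R) G : \bar R := (\int[leb \x leb]_z (pair_sqr l G z)%:E)%E.

Lemma pair_sqr_ge0 l G z : 0 <= pair_sqr l G z.
Proof. by rewrite /pair_sqr /patch; case: ifP => // _; exact: sqr_ge0. Qed.

Lemma measurable_pair_sqr l G : measurable_fun (eball n) G -> measurable_fun setT (pair_sqr l G).
Proof.
move=> mG; have mP := measurable_close_pairs q s e.
apply/(measurable_restrictT _ mP); apply: measurable_funX; apply: measurable_funB.
  apply: (measurable_comp (F := eball n) _ _ mG); first exact: measurable_eball.
    by move=> _ [z [/andP[_ ? ] _ _ _ _] <-].
  exact: measurable_funTS measurable_fst.
apply: measurable_funM; first exact: measurable_cst.
apply: (measurable_comp (F := eball n) _ _ mG); first exact: measurable_eball.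
  by move=> _ [z [_ _ _ _ ?] <-].
exact: measurable_funTS measurable_snd.
Qed.

Lemma energy_ext l G H : (forall x, enorm x < 1 -> G x = H x) -> energy l G = energy l H.
Proof.
move=> GH; apply: eq_integral => z _; rewrite /pair_sqr /patch; case: ifP => //.
by rewrite inE => -[/andP[_ z1] _ _ _ z2]; rewrite !GH.
Qed.

Lemma energyZ l (c : R) G : measurable_fun (eball n) G ->
  (energy l (fun x => (c * G x)%R) = (c ^+ 2)%:E * energy l G)%E.
Proof.
move=> mG; rewrite /energy -ge0_integralZl//.
- apply: eq_integral => z _; rewrite -EFinM /pair_sqr /patch; congr (_%:E).
  by case: ifP => _; [ring|rewrite mulr0].
- by apply/measurable_EFinP; exact: measurable_pair_sqr.
- by move=> z _; rewrite lee_fin pair_sqr_ge0.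
by rewrite lee_fin sqr_ge0.
Qed.

Lemma close_pairs_rot t z : P z -> P (rot t z.1, rot t z.2).
Proof.
move=> [h1 h2 h3 h4 h5]; split => /=; rewrite ?(rot_enorm i01) ?(rot_ssq i01)//.
by rewrite -(rotB i0 i1) (rot_enorm i01).
Qed.

Lemma pair_sqr_rot l G t z :
  pair_sqr l (fun x => G (rot t x)) z = pair_sqr l G (rot t z.1, rot t z.2).
Proof.
rewrite /pair_sqr /patch /=; congr (if _ then _ else _); apply/idP/idP; rewrite !inE.
  exact: close_pairs_rot.
move=> /(close_pairs_rot (- t)) /=; rewrite !(rotK i01).
by case: z.
Qed.

(** Tonelli's theorem reduces the claim to rotating one variable at a time; [sin t != 0] comes from
    the factorisation of the rotation into shears. *)
Lemma energy_rot l G t : sin t != 0 -> measurable_fun (eball n) G ->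
  energy l (fun x => G (rot t x)) = energy l G.
Proof.
move=> st mG; have pr := preserving_rot i0E i1E st.
have mH : measurable_fun setT (fun z => (pair_sqr l G z)%:E).
  by apply/measurable_EFinP; exact: measurable_pair_sqr.
have H0 z : (0 <= (pair_sqr l G z)%:E)%E by rewrite lee_fin pair_sqr_ge0.
have mrot : measurable_fun setT (fun z : 'rV[R]_n * 'rV[R]_n => (rot t z.1, rot t z.2)).
  apply/measurable_fun_pair; first exact: measurableT_comp pr.1 measurable_fst.
  exact: measurableT_comp pr.1 measurable_snd.
have mH' : measurable_fun setT (fun z => (pair_sqr l (fun x => G (rot t x)) z)%:E).
  have -> : (fun z => (pair_sqr l (fun x => G (rot t x)) z)%:E) =
      (fun z => (pair_sqr l G z)%:E) \o (fun z => (rot t z.1, rot t z.2)).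
    by apply/funext => z /=; rewrite pair_sqr_rot.
  exact: measurableT_comp.
rewrite /energy (fubini_tonelli1 _ mH'); last first.
  by move=> z; rewrite lee_fin pair_sqr_ge0.
rewrite (fubini_tonelli1 _ mH H0) /fubini_F.
rewrite -[RHS](preserving_integral pr (G := fun x => \int[leb]_y (pair_sqr l G (x, y))%:E)%E).
- apply: eq_integral => x _.
  rewrite -[RHS](preserving_integral pr (G := fun y => (pair_sqr l G (rot t x, y))%:E)).
  + by apply: eq_integral => y _; rewrite pair_sqr_rot.
  + exact: measurableT_comp mH (measurable_pair1 _).
  + by move=> y; exact: H0.
- exact: (@measurable_fun_fubini_tonelli_F _ _ _ _ R leb _ mH).
- by move=> x; apply: integral_ge0 => y _; exact: H0.
Qed.

(** By [(a p + b r)^2 <= 2 (a^2 p^2 + b^2 r^2)] and the invariance of the energy. Prescribing only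
    the squares of [a] and [b] treats averages and half differences together. *)
Lemma energy_average l G H t (a b : R) : sin t != 0 -> measurable_fun (eball n) G ->
  measurable_fun (eball n) H -> measurable_fun (eball n) (fun x => G (rot t x)) ->
  a ^+ 2 = 4^-1 -> b ^+ 2 = 4^-1 ->
  (forall x, enorm x < 1 -> H x = a * G x + b * G (rot t x)) ->
  (energy l H <= energy l G)%E.
Proof.
move=> st mG mH mGr a2 b2 E.
have mA : measurable_fun setT (fun z => (2^-1)%:E * (pair_sqr l G z)%:E)%E.
  apply/measurable_EFinP; apply: measurable_funM; first exact: measurable_cst.
  exact: measurable_pair_sqr.
have mB : measurable_fun setT (fun z => (2^-1)%:E * (pair_sqr l (fun x => G (rot t x)) z)%:E)%E.
  apply/measurable_EFinP; apply: measurable_funM; first exact: measurable_cst.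
  exact: measurable_pair_sqr.
have A0 z : (0 <= (2^-1)%:E * (pair_sqr l G z)%:E)%E.
  by rewrite -EFinM lee_fin mulr_ge0 ?pair_sqr_ge0.
have B0 z : (0 <= (2^-1)%:E * (pair_sqr l (fun x => G (rot t x)) z)%:E)%E.
  by rewrite -EFinM lee_fin mulr_ge0 ?pair_sqr_ge0.
apply: (@le_trans _ _ (\int[leb \x leb]_z ((2^-1)%:E * (pair_sqr l G z)%:E +
   (2^-1)%:E * (pair_sqr l (fun x => G (rot t x)) z)%:E))%E).
  apply: ge0_le_integral => //.
  - by move=> z _; rewrite lee_fin pair_sqr_ge0.
  - by apply/measurable_EFinP; exact: measurable_pair_sqr.
  - exact: emeasurable_funD.
  move=> z _; rewrite -!EFinM -EFinD lee_fin /pair_sqr /patch; case: ifP => [|_]; last first.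
    by rewrite !mulr0 addr0.
  rewrite inE => -[/andP[_ z1] _ _ _ z2]; rewrite !E//.
  set p := G z.1 - l * G z.2; set r' := G (rot t z.1) - l * G (rot t z.2).
  have -> : a * G z.1 + b * G (rot t z.1) - l * (a * G z.2 + b * G (rot t z.2)) = a * p + b * r'.
    by rewrite /p /r'; ring.
  clearbody p r'.
  have : 0 <= (a * p - b * r') ^+ 2 by exact: sqr_ge0.
  have -> : (a * p - b * r') ^+ 2 = a ^+ 2 * p ^+ 2 + b ^+ 2 * r' ^+ 2 - 2 * (a * p * (b * r')) by ring.
  have -> : (a * p + b * r') ^+ 2 = a ^+ 2 * p ^+ 2 + b ^+ 2 * r' ^+ 2 + 2 * (a * p * (b * r')) by ring.
  by rewrite a2 b2; lra.
have Zl (u : 'rV[R]_n * 'rV[R]_n -> R) : measurable_fun setT u -> (forall z, 0 <= u z) ->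
    (\int[leb \x leb]_z ((2^-1)%:E * (u z)%:E) = (2^-1)%:E * \int[leb \x leb]_z (u z)%:E)%E.
  move=> mu u0; apply: ge0_integralZl => //.
  - exact/measurable_EFinP.
  - by move=> z _; rewrite lee_fin.
rewrite ge0_integralD// !Zl; [|by move=> *; exact: pair_sqr_ge0 || exact: measurable_pair_sqr..].
rewrite -/(energy l G) -/(energy l (fun x => G (rot t x))) energy_rot//.
have e0 : (0 <= energy l G)%E by apply: integral_ge0 => z _; rewrite lee_fin pair_sqr_ge0.
rewrite -ge0_muleDl ?lee_fin// -EFinD.
have -> : 2^-1 + 2^-1 = 1 :> R by lra.
by rewrite mul1e.
Qed.

(** The two energies are equal and their sum is at least a quarter of the volume, so each is at
    least an eighth. *)
Lemma energy_pair_lower l A B : measurable_fun (eball n) A -> measurable_fun (eball n) B ->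
  energy l A = energy l B ->
  (forall z, P z -> 4^-1 <= (A z.1 - l * A z.2) ^+ 2 + (B z.1 - l * B z.2) ^+ 2) ->
  ((8^-1)%:E * (leb \x leb)%E P <= energy l A)%E.
Proof.
move=> mA mB EAB h; have mP := measurable_close_pairs q s e.
have e0 : (0 <= energy l A)%E by apply: integral_ge0 => z _; rewrite lee_fin pair_sqr_ge0.
have : ((4^-1)%:E * (leb \x leb)%E P <= energy l A + energy l B)%E.
  rewrite /energy -ge0_integralD//; last 4 first.
  - by move=> z _; rewrite lee_fin pair_sqr_ge0.
  - by apply/measurable_EFinP; exact: measurable_pair_sqr.
  - by move=> z _; rewrite lee_fin pair_sqr_ge0.
  - by apply/measurable_EFinP; exact: measurable_pair_sqr.
  rewrite -(integral_cst _ mP) integral_mkcond; apply: ge0_le_integral => //.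
  - by move=> z _; rewrite /patch; case: ifP => //; rewrite lee_fin.
  - by apply/(measurable_restrictT _ mP); exact: measurable_cst.
  - apply: emeasurable_funD; apply/measurable_EFinP; exact: measurable_pair_sqr.
  move=> z _; rewrite /pair_sqr /patch; case: ifP => [|_]; last by rewrite -EFinD addr0.
  by rewrite inE => /h; rewrite -EFinD lee_fin.
rewrite -EAB => hh.
have -> : 8^-1 = 2^-1 * 4^-1 :> R by lra.
rewrite EFinM -muleA; apply: (@le_trans _ _ ((2^-1)%:E * (energy l A + energy l A))%E).
  by rewrite lee_wpmul2l// lee_fin.
rewrite muleC ge0_muleDl// -ge0_muleDr ?lee_fin// -EFinD.
have -> : 2^-1 + 2^-1 = 1 :> R by lra.
by rewrite mule1.
Qed.

End fixed_pairs.

End pair_energy.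

Section pair_volume.
Context {R : realType} {m : nat}.
Variables (i0 i1 : 'I_m.+1).
Hypothesis i0E : i0 = 0%N :> nat.
Local Notation leb := (lebesgue_rV R m.+1).
Local Notation ssq := (@ssq R m.+1 i0 i1).

(** Every [y] within [s / 2] of [(1 - s) x] is a partner of [x]: then [|y| <= 1 - s / 2] and
    [|x - y| <= 3 s / 2]. A cube of side [s / (m + 1)] fits in that ball. *)
Lemma close_pairs_volume (q : R) : 0 < q < 1 -> exists c e0 : R, [/\ 0 < c, 0 < e0 &
  forall s e : R, 0 < s <= 1 -> 0 < e <= e0 ->
  ((c * e * s ^+ m.+1)%:E <= (leb \x leb)%E (close_pairs i0 i1 q s e))%E].
Proof.
move=> hq; have [c [e0 [c0 e00 hv]]] := shell_volume m hq.
pose K : R := m.+1%:R ^- m.+1.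
have n0 : 0 < m.+1%:R :> R by rewrite ltr0n.
have K0 : 0 < K by rewrite invr_gt0 exprn_gt0.
exists (c * K), e0; split => //; first exact: mulr_gt0.
move=> s e /andP[s0 s1] he.
pose E : set 'rV[R]_m.+1 := shell e `&` [set x | q <= ssq x].
have mE : measurable E.
  apply: measurableI; first exact: measurable_shell.
  have -> : [set x : 'rV[R]_m.+1 | q <= ssq x] = [set x | q <= peval (pss i0 i1) x].
    by apply/funext => x; rewrite /mkset pssE.
  by apply: measurable_le_set; [exact: measurable_cst|exact: measurable_peval].
have hE : ((c * e)%:E <= leb E)%E.
  apply: hv => // x x1 x2 x3; split; first exact/andP.
  apply: le_trans x3 _; rewrite /ssq.
  have -> : ord0 = i0 by apply/val_inj.
  by rewrite ler_wpDr// sqr_ge0.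
have mP := @measurable_close_pairs R m.+1 i0 i1 q s e.
pose a : R := (s / m.+1%:R) ^+ m.+1.
have a0 : 0 <= a by rewrite exprn_ge0// divr_ge0// ltW.
apply: (@le_trans _ _ (a%:E * leb E)%E).
  have -> : c * K * e * s ^+ m.+1 = a * (c * e) by rewrite /a /K expr_div_n; ring.
  by rewrite EFinM lee_wpmul2l// lee_fin.
rewrite -(integral_cst _ mE) integral_mkcond; apply: ge0_le_integral => //.
- by move=> x _; rewrite /patch; case: ifP => // _; rewrite lee_fin.
- by apply/(measurable_restrictT _ mE); exact: measurable_cst.
- exact: measurable_fun_xsection.
move=> x _; rewrite /patch; case: ifP => [/set_mem[/andP[xe x1] xq]|_]; last exact: measure_ge0.
have -> : a = (2 * (s / 2 / m.+1%:R)) ^+ m.+1 by rewrite /a; congr (_ ^+ _); field.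
apply: (lebesgue_near_ge (z := (1 - s) *: x)).
- by rewrite !divr_ge0// ltW.
- exact: measurable_xsection.
move=> y; have -> : m.+1%:R * (s / 2 / m.+1%:R) = s / 2 by rewrite mulrC divfK// gt_eqF.
move=> hy; rewrite /xsection /= inE.
have hZ (b : R) : 0 <= b -> enorm (b *: x) <= b.
  by move=> b0; rewrite enormZ ger0_norm// ler_piMr// ltW.
have hx := hZ _ (ltW s0); have h1 : enorm ((1 - s) *: x) <= 1 - s.
  by apply: hZ; rewrite subr_ge0.
have y1 : enorm y <= 1 - s / 2.
  have -> : y = (y - (1 - s) *: x) + (1 - s) *: x by rewrite subrK.
  apply: le_trans (enorm_triangle _ _) _; lra.
have y0 : 0 <= enorm y by exact: enorm_ge0.
split => //=.
- exact/andP.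
- have -> : x - y = s *: x - (y - (1 - s) *: x).
    by apply/rowP => i; rewrite !mxE; ring.
  apply: le_trans (enorm_triangle _ _) _; rewrite enormN; lra.
- nra.
- lra.
Qed.

End pair_volume.

(** * Sobolev norms as upper bounds for energies *)

Section gagliardo_inner.
Context {R : realType} {n : nat}.
Local Notation leb := (lebesgue_rV R n).
Implicit Types (g h : 'rV[R]_n -> R).

Definition gag_kernel (theta : R) g (x y : 'rV[R]_n) : R :=
  (g x - g y) ^+ 2 / enorm (x - y) `^ (n%:R + 2 * theta).

Definition gag_inner (theta : R) g (x : 'rV[R]_n) : \bar R :=
  (\int[leb]_(y in eball n) (gag_kernel theta g x y)%:E)%E.

Lemma gag_kernel_ge0 theta g x y : 0 <= gag_kernel theta g x y.
Proof. by rewrite divr_ge0 ?sqr_ge0 ?powR_ge0. Qed.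

Lemma gag_inner_ge0 theta g x : (0 <= gag_inner theta g x)%E.
Proof. by apply: integral_ge0 => y _; rewrite lee_fin gag_kernel_ge0. Qed.

Let B2 : set ('rV[R]_n * 'rV[R]_n) := eball n `*` eball n.

Let mB2 : measurable B2.
Proof. by apply: measurableX; exact: measurable_eball. Qed.

Lemma measurable_gag_kernel theta g : measurable_fun (eball n) g ->
  measurable_fun (eball n `*` eball n) (fun z => gag_kernel theta g z.1 z.2).
Proof.
move=> mg; rewrite -/B2; apply: measurable_funM.
  apply: measurable_funX; apply: measurable_funB.
    apply: (measurable_comp (F := eball n) _ _ mg); first exact: measurable_eball.
      by move=> _ [z [? _] <-].
    exact: measurable_funTS measurable_fst.
  apply: (measurable_comp (F := eball n) _ _ mg); first exact: measurable_eball.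
    by move=> _ [z [_ ?] <-].
  exact: measurable_funTS measurable_snd.
under eq_fun do rewrite -powRN.
apply: measurable_funTS; apply: (measurableT_comp (measurable_powR _)).
exact: measurable_enorm_sub.
Qed.

Lemma measurable_gag_kernel_pair theta g x : measurable_fun (eball n) g -> eball n x ->
  measurable_fun (eball n) (gag_kernel theta g x).
Proof.
move=> mg x1; apply: (measurable_comp (F := eball n `*` eball n) (g := fun y : 'rV[R]_n => (x, y))
  _ _ (measurable_gag_kernel theta mg)) => //.
- by move=> _ [y y1 <-].
- by apply: measurable_funTS; exact: measurable_pair1.
Qed.

Lemma measurable_gag_inner theta g : measurable_fun (eball n) g ->
  measurable_fun (eball n) (gag_inner theta g).
Proof.
move=> mg; have mk := measurable_gag_kernel theta mg.
pose k z := ((fun z => gag_kernel theta g z.1 z.2) \_ B2) z.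
have mk' : measurable_fun setT (fun z => (k z)%:E).
  by apply/measurable_EFinP; apply/(measurable_restrictT _ mB2).
have k0 z : (0 <= (k z)%:E)%E.
  by rewrite lee_fin /k /patch; case: ifP => // _; exact: gag_kernel_ge0.
have mF := measurable_fun_fubini_tonelli_F (m2 := leb) _ mk' k0.
apply: (eq_measurable_fun (fubini_F leb (fun z => (k z)%:E))); last exact: measurable_funTS.
move=> x; rewrite inE => x1; rewrite /fubini_F /gag_inner [RHS]integral_mkcond.
apply: eq_integral => y _; rewrite /k /patch.
have -> : (y \in (eball n : set 'rV[R]_n)) = ((x, y) \in B2).
  by apply/idP/idP; rewrite !inE; [split|case].
by case: ifP.
Qed.

(** The kernels agree for almost every [x] and, given such an [x], for almost every [y]. *)
Lemma gagliardo_ae theta g h : measurable_fun (eball n) g -> measurable_fun (eball n) h ->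
  {ae leb, forall x, eball n x -> g x = h x} -> gagliardo (eball n) theta g = gagliardo (eball n) theta h.
Proof.
move=> mg mh E; have mB := @measurable_eball R n.
apply: (@ae_eq_integral _ _ _ _ _ (gag_inner theta h) (gag_inner theta g)) => //.
- exact: measurable_gag_inner.
- exact: measurable_gag_inner.
apply: filterS (E) => x gx x1; have {}gx := gx x1.
have mk f : measurable_fun (eball n) f -> measurable_fun (eball n) (fun y => (gag_kernel theta f x y)%:E).
  by move=> mf; apply/measurable_EFinP; exact: measurable_gag_kernel_pair.
apply: ae_eq_integral => //; [exact: mk|exact: mk|].
apply: filterS E => y hy y1; by rewrite /gag_kernel gx hy.
Qed.

End gagliardo_inner.

Section sobolev_energy.
Context {R : realType} {n : nat}.
Variables (i0 i1 : 'I_n).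
Hypotheses (i0E : i0 = 0%N :> nat) (i1E : i1 = 1%N :> nat).
Local Notation leb := (lebesgue_rV R n).
Local Notation energy := (@energy R n i0 i1).
Local Notation pair_sqr := (@pair_sqr R n i0 i1).
Local Notation aderiv := (@aderiv R n i0 i1).
Implicit Types (x y : 'rV[R]_n) (f G : 'rV[R]_n -> R).

Let i01 : i0 != i1. Proof. by rewrite -val_eqE /= i0E i1E. Qed.
Let n0 : (0 < n)%N. Proof. by rewrite -i0E (leq_ltn_trans _ (ltn_ord i0)). Qed.

(** The partial derivatives that occur in [iter m aderiv]. For [m = 2] those of first order arise
    from differentiating the coefficients [x_0] and [x_1]. *)
Definition words (m : nat) : seq (seq 'I_n) :=
  match m with
  | 0 => [:: [::]]
  | 1 => [:: [:: i1]; [:: i0]]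
  | _ => [:: [:: i1; i1]; [:: i0; i1]; [:: i1; i0]; [:: i0; i0]; [:: i1]; [:: i0]]
  end.

Lemma words1_sum (F : seq 'I_n -> R) : \sum_(w <- words 1) F w = F [:: i1] + F [:: i0].
Proof. by rewrite big_cons big_seq1. Qed.

Lemma words2_sum (F : seq 'I_n -> R) : \sum_(w <- words 2) F w =
  F [:: i1; i1] + (F [:: i0; i1] + (F [:: i1; i0] + (F [:: i0; i0] + (F [:: i1] + F [:: i0])))).
Proof. by rewrite !big_cons big_nil addr0. Qed.

Definition sqsum f m x : R := \sum_(w <- words m) dpart w f x ^+ 2.

Lemma sqsum_ge0 f m x : 0 <= sqsum f m x.
Proof. by apply: sumr_ge0 => w _; exact: sqr_ge0. Qed.

Lemma sqr_add2_le (a b : R) : (a + b) ^+ 2 <= 2 * (a ^+ 2 + b ^+ 2).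
Proof. by have := sqr_ge0 (a - b); rewrite sqrrB sqrrD; lra. Qed.

Lemma sqr_add3_le (a b c : R) : (a + b + c) ^+ 2 <= 3 * (a ^+ 2 + b ^+ 2 + c ^+ 2).
Proof.
have := sqr_ge0 (a - b); have := sqr_ge0 (a - c); have := sqr_ge0 (b - c).
by rewrite !expr2; nra.
Qed.

Lemma coord_sqr_le1 x i : enorm x < 1 -> x ord0 i ^+ 2 <= 1.
Proof.
move=> x1; rewrite -(real_normK (num_real _)) expr_le1//.
by apply: le_trans (coord_le_enorm _ _) (ltW x1).
Qed.

(** In the unit ball the coefficients are at most 1 in absolute value, and the expansion has at most
    six terms. *)
Lemma iter_aderiv_sqr f m x : harm_lim f -> enorm x < 1 -> (m <= 2)%N ->
  iter m aderiv f x ^+ 2 <= 6 * sqsum f m x.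
Proof.
move=> hf x1 m2.
have a1 := coord_sqr_le1 i0 x1; have b1 := coord_sqr_le1 i1 x1.
have cut (c p : R) : c ^+ 2 <= 1 -> (c * p) ^+ 2 <= p ^+ 2.
  by move=> c1; rewrite exprMn ler_piMl// sqr_ge0.
have ab1 : (x ord0 i0 * x ord0 i1) ^+ 2 <= 1 by rewrite exprMn mulr_ile1 ?sqr_ge0.
have aa1 : (x ord0 i0 * x ord0 i0) ^+ 2 <= 1 by rewrite exprMn mulr_ile1 ?sqr_ge0.
have bb1 : (x ord0 i1 * x ord0 i1) ^+ 2 <= 1 by rewrite exprMn mulr_ile1 ?sqr_ge0.
have s0 := sqsum_ge0 f m x.
case: m m2 s0 => [|[|[|//]]] _.
- rewrite /sqsum /= big_seq1 /= => s0; lra.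
- rewrite /iter aderivE// /sqsum words1_sum => s0.
  have := sqr_add2_le (x ord0 i0 * dpart [:: i1] f x) (- (x ord0 i1 * dpart [:: i0] f x)).
  rewrite sqrrN; move: (dpart [:: i1] f x) (dpart [:: i0] f x) s0 => p q s0.
  move: (x ord0 i0) (x ord0 i1) a1 b1 {ab1 aa1 bb1} => a b a1 b1.
  by move: (cut _ p a1) (cut _ q b1); lra.
rewrite /iter aderiv2E// /sqsum words2_sum => _.
move: (dpart [:: i1; i1] f x) (dpart [:: i0; i1] f x) (dpart [:: i1; i0] f x)
  (dpart [:: i0; i0] f x) (dpart [:: i1] f x) (dpart [:: i0] f x) => p q u v r s.
move: (x ord0 i0) (x ord0 i1) a1 b1 ab1 aa1 bb1 => a b a1 b1 ab1 aa1 bb1.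
have -> : a * (a * p - b * q) - b * r - (b * (a * u - b * v) + a * s) =
  (a * a * p + - (a * b * q)) + (- (b * r) + - (a * b * u)) + (b * b * v + - (a * s)) by ring.
apply: le_trans (sqr_add3_le _ _ _) _.
have := sqr_add2_le (a * a * p) (- (a * b * q)).
have := sqr_add2_le (- (b * r)) (- (a * b * u)).
have := sqr_add2_le (b * b * v) (- (a * s)).
rewrite !sqrrN.
move: (cut _ p aa1) (cut _ q ab1) (cut _ u ab1) (cut _ v bb1) (cut _ r b1) (cut _ s a1).
lra.
Qed.

(** Differences of products are split into differences of derivatives and differences of the
    coordinates that multiply them; the latter are at most [|x - y|]. *)
Lemma iter_aderiv_sub_sqr f m x y : harm_lim f -> enorm x < 1 -> enorm y < 1 -> (m <= 1)%N ->
  (iter m aderiv f x - iter m aderiv f y) ^+ 2 <=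
  4 * (\sum_(w <- words m) (dpart w f x - dpart w f y) ^+ 2 + enorm (x - y) ^+ 2 * sqsum f m x).
Proof.
move=> hf x1 y1.
case: m => [|[|//]] _.
  rewrite /sqsum /words !big_seq1 /=.
  have := sqr_ge0 (f x - f y); have := mulr_ge0 (sqr_ge0 (enorm (x - y))) (sqr_ge0 (f x)).
  lra.
have a1 := coord_sqr_le1 i0 y1; have b1 := coord_sqr_le1 i1 y1.
have d i : (x ord0 i - y ord0 i) ^+ 2 <= enorm (x - y) ^+ 2.
  rewrite -(real_normK (num_real (_ - _))) ler_pXn2r ?nnegrE ?enorm_ge0 ?normr_ge0//.
  by have := coord_le_enorm (x - y) i; rewrite !mxE.
have d0 := d i0; have d1 := d i1 => {d}.
rewrite /iter (aderivE i01 hf x1) (aderivE i01 hf y1) /sqsum !words1_sum.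
move: (dpart [:: i1] f x) (dpart [:: i0] f x) (dpart [:: i1] f y) (dpart [:: i0] f y) => p q u v.
move: (enorm (x - y) ^+ 2) (x ord0 i0) (x ord0 i1) (y ord0 i0) (y ord0 i1) a1 b1 d0 d1
  => N a b c d a1 b1 d0 d1.
have cut (k l M : R) : k ^+ 2 <= M -> (k * l) ^+ 2 <= M * l ^+ 2.
  by move=> c1; rewrite exprMn ler_wpM2r// sqr_ge0.
have -> : a * p - b * q - (c * u - d * v) =
  (c * (p - u) + (a - c) * p) + (- (d * (q - v)) + - ((b - d) * q)) by ring.
have := sqr_add2_le (c * (p - u) + (a - c) * p) (- (d * (q - v)) + - ((b - d) * q)).
have := sqr_add2_le (c * (p - u)) ((a - c) * p).
have := sqr_add2_le (- (d * (q - v))) (- ((b - d) * q)).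
rewrite !sqrrN.
move: (cut _ (p - u) _ a1) (cut _ (q - v) _ b1) (cut _ p _ d0) (cut _ q _ d1).
lra.
Qed.

Lemma measurable_iter_aderiv f m : harm_lim f -> (m <= 2)%N ->
  measurable_fun (eball n) (iter m aderiv f).
Proof.
move=> hf m2.
have mc i : measurable_fun (eball n) (fun x : 'rV[R]_n => x ord0 i).
  by apply: measurable_funTS; exact: measurable_coord.
have md s := dpart_measurable n0 s hf.
case: m m2 => [|[|[|//]]] _; first exact: (md [::]).
  apply: (eq_measurable_fun (fun x => x ord0 i0 * dpart [:: i1] f x - x ord0 i1 * dpart [:: i0] f x)).
    by move=> x; rewrite inE => x1; rewrite /iter aderivE.
  by apply: measurable_funB; apply: measurable_funM.
apply: (eq_measurable_fun (fun x =>
   x ord0 i0 * (x ord0 i0 * dpart [:: i1; i1] f x - x ord0 i1 * dpart [:: i0; i1] f x)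
    - x ord0 i1 * dpart [:: i1] f x
    - (x ord0 i1 * (x ord0 i0 * dpart [:: i1; i0] f x - x ord0 i1 * dpart [:: i0; i0] f x)
       + x ord0 i0 * dpart [:: i0] f x))).
  by move=> x; rewrite inE => x1; rewrite /iter aderiv2E.
by repeat (apply: measurable_funB || apply: measurable_funD || apply: measurable_funM ||
  exact: mc || exact: md).
Qed.

Lemma measurable_sqsum f m : harm_lim f -> measurable_fun (eball n) (sqsum f m).
Proof.
move=> hf; apply: measurable_sum => w; apply: measurable_funX.
exact: dpart_measurable.
Qed.

Lemma energy_le_shell q s e l G (F : 'rV[R]_n -> \bar R) :
  measurable_fun (eball n) G -> measurable_fun (eball n) F -> (forall x, (0 <= F x)%E) ->
  (forall x, shell e x -> (\int[leb]_y (pair_sqr q s e l G (x, y))%:E <= F x)%E) ->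
  (energy q s e l G <= \int[leb]_(x in shell e) F x)%E.
Proof.
move=> mG mF F0 h; have mS := @measurable_shell R n e.
have SB : shell e `<=` (eball n : set 'rV[R]_n) by move=> x /andP[].
have mH : measurable_fun setT (fun z => (pair_sqr q s e l G z)%:E).
  by apply/measurable_EFinP; exact: measurable_pair_sqr.
have H0 z : (0 <= (pair_sqr q s e l G z)%:E)%E by rewrite lee_fin pair_sqr_ge0.
rewrite /energy fubini_tonelli1// [leRHS]integral_mkcond; apply: ge0_le_integral => //.
- by move=> x _; apply: integral_ge0 => y _.
- exact: measurable_fun_fubini_tonelli_F.
- by apply/(measurable_restrictT _ mS); apply: measurable_funS SB mF; exact: measurable_eball.
move=> x _; rewrite /patch; case: ifPn => [/set_mem|/negP] xS; first exact: h.
rewrite /fubini_F integral0_eq// => y _.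
rewrite /pair_sqr /patch; case: ifPn => // /set_mem[/= x1 _ _ _ _].
by case: xS; apply/mem_set.
Qed.

Definition partners (s : R) x : set 'rV[R]_n := eball n `&` [set y | enorm (x - y) <= 2 * s].

Lemma measurable_partners s x : measurable (partners s x).
Proof.
apply: measurableI; first exact: measurable_eball.
apply: measurable_le_set; last exact: measurable_cst.
exact: measurableT_comp measurable_enorm_sub (measurable_pair1 x).
Qed.

Lemma partners_le s x : 0 <= s -> (leb (partners s x) <= ((4 * s) ^+ n)%:E)%E.
Proof.
move=> s0; have -> : 4 * s = 2 * (2 * s) by ring.
apply: (lebesgue_near_le (z := x)).
- exact: mulr_ge0.
- exact: measurable_partners.
- by move=> y [_]; rewrite /mkset enormB.
Qed.

Lemma pair_integral_le q s e l G x (k : 'rV[R]_n -> R) : measurable_fun (eball n) G ->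
  measurable_fun (partners s x) k -> (forall y, 0 <= k y) ->
  (forall y, partners s x y -> (G x - l * G y) ^+ 2 <= k y) ->
  (\int[leb]_y (pair_sqr q s e l G (x, y))%:E <= \int[leb]_(y in partners s x) (k y)%:E)%E.
Proof.
move=> mG mk k0 h; have mD := measurable_partners s x.
rewrite [leRHS]integral_mkcond; apply: ge0_le_integral => //.
- by move=> y _; rewrite lee_fin pair_sqr_ge0.
- apply/measurable_EFinP; apply: measurableT_comp (measurable_pair1 x).
  exact: measurable_pair_sqr.
- by apply/(measurable_restrictT _ mD); exact/measurable_EFinP.
move=> y _; rewrite /pair_sqr /patch; case: ifPn => [/set_mem[/= h1 h2 h3 h4 h5]|_].
  by rewrite mem_set// lee_fin; apply: h.
by case: ifP => // _; rewrite lee_fin.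
Qed.

Lemma pair_integral_le0 q s e G x : measurable_fun (eball n) G -> 0 <= s ->
  (\int[leb]_y (pair_sqr q s e 0 G (x, y))%:E <= ((4 * s) ^+ n * G x ^+ 2)%:E)%E.
Proof.
move=> mG s0; apply: (@le_trans _ _ (\int[leb]_(y in partners s x) (G x ^+ 2)%:E)%E).
  apply: pair_integral_le => //.
  - by move=> y; exact: sqr_ge0.
  - by move=> y _; rewrite mul0r subr0.
rewrite (integral_cst leb (measurable_partners s x)) [(4 * s) ^+ n * _]mulrC [leRHS]EFinM lee_wpmul2l ?lee_fin ?sqr_ge0//.
exact: partners_le.
Qed.

(** On partners [|x - y| <= 2 s], so a squared difference is at most [(2 s)^(n + 2 theta)] times the
    Gagliardo kernel. The coordinate terms contribute [s^(n + 2) <= s^(n + 2 theta)]; the constant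
    comes from [2^(n + 2 theta) <= 4^(n + 1)]. *)
Lemma pair_integral_le1 q s e theta f m x : harm_lim f -> (m <= 1)%N -> 0 < theta < 1 ->
  0 < s <= 1 -> enorm x < 1 ->
  (\int[leb]_y (pair_sqr q s e 1 (iter m aderiv f) (x, y))%:E <=
   (16 * 4 ^+ n * s `^ (n%:R + 2 * theta))%:E *
   (\sum_(w <- words m) gag_inner theta (dpart w f) x + (sqsum f m x)%:E))%E.
Proof.
move=> hf m1 /andP[th0 th1] /andP[s0 s1] x1.
set p : R := n%:R + 2 * theta.
have mB := @measurable_eball R n; have mD := measurable_partners s x.
have DB : partners s x `<=` (eball n : set 'rV[R]_n) by move=> y [].
have mgk w : measurable_fun (partners s x) (gag_kernel theta (dpart w f) x).
  apply: measurable_funS DB _ => //; apply: measurable_gag_kernel_pair => //.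
  exact: dpart_measurable.
have p0 : 0 < p by rewrite /p ltr_wpDl// mulr_gt0.
pose A : R := 4 * (2 * s) `^ p; pose B : R := 4 * (2 * s) ^+ 2 * sqsum f m x.
have A0 : 0 <= A by rewrite mulr_ge0// powR_ge0.
have B0 : 0 <= B by rewrite /B mulr_ge0 ?sqsum_ge0// mulr_ge0 ?sqr_ge0.
pose k y : R := A * (\sum_(w <- words m) gag_kernel theta (dpart w f) x y) + B.
have S0 y : 0 <= \sum_(w <- words m) gag_kernel theta (dpart w f) x y.
  by apply: sumr_ge0 => w _; exact: gag_kernel_ge0.
apply: (@le_trans _ _ (\int[leb]_(y in partners s x) (k y)%:E)%E).
  apply: pair_integral_le.
  - by apply: measurable_iter_aderiv => //; exact: leq_trans m1 _.
  - apply: measurable_funD; last exact: measurable_cst.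
    apply: measurable_funM; first exact: measurable_cst.
    by apply: measurable_sum => w; exact: mgk.
  - by move=> y; rewrite /k addr_ge0// mulr_ge0.
  move=> y [y1 xy]; rewrite mul1r; apply: le_trans (iter_aderiv_sub_sqr hf x1 y1 m1) _.
  rewrite mulrDr /k lerD//; last first.
    rewrite /B -mulrA ler_wpM2l// ler_wpM2r ?sqsum_ge0// ler_pXn2r// nnegrE ?enorm_ge0//.
    exact: le_trans (enorm_ge0 _) xy.
  rewrite /A -mulrA ler_wpM2l// mulr_sumr; apply: ler_sum => w _.
  rewrite /gag_kernel -/p.
  have [->|xy0] := eqVneq x y.
    by rewrite !subrr expr0n /= mul0r mulr0.
  have d0 : 0 < enorm (x - y).
    rewrite lt_neqAle enorm_ge0 andbT eq_sym; apply: contra_neq xy0 => /enorm_eq0/eqP.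
    by rewrite subr_eq0 => /eqP.
  rewrite mulrCA ler_peMr ?sqr_ge0// ler_pdivlMr ?powR_gt0// mul1r.
  by apply: ge0_ler_powR; rewrite ?nnegrE ?enorm_ge0 ?(ltW p0)//; exact: le_trans (enorm_ge0 _) xy.
have kE y : (k y)%:E = (A%:E * (\sum_(w <- words m) (gag_kernel theta (dpart w f) x y)%:E) + B%:E)%E.
  by rewrite /k EFinD EFinM -sumEFin.
under eq_integral do rewrite kE.
have mg w : measurable_fun (partners s x) (fun y => (gag_kernel theta (dpart w f) x y)%:E).
  exact/measurable_EFinP.
have ms : measurable_fun (partners s x) (fun y => \sum_(w <- words m) (gag_kernel theta (dpart w f) x y)%:E)%E.
  by apply: emeasurable_sum => w; exact: mg.
have s0' y : (0 <= \sum_(w <- words m) (gag_kernel theta (dpart w f) x y)%:E)%E.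
  by apply: sume_ge0 => w _; rewrite lee_fin gag_kernel_ge0.
rewrite ge0_integralD//; last 2 first.
- by move=> y _; rewrite mule_ge0 ?lee_fin.
- exact: measurable_funeM.
rewrite ge0_integralZl ?lee_fin// ge0_integral_sum//; last first.
  by move=> w y _; rewrite lee_fin gag_kernel_ge0.
rewrite (integral_cst leb mD).
have sp : s ^+ n * s ^+ 2 <= s `^ p.
  rewrite -exprD -powR_mulrn ?(ltW s0)//.
  by apply: ger_powR; rewrite ?s0// /p natrD lerD2l; lra.
have sp0 : 0 <= s `^ p by exact: powR_ge0.
have g0 : (0 <= \sum_(w <- words m) gag_inner theta (dpart w f) x)%E.
  by apply: sume_ge0 => w _; exact: gag_inner_ge0.
have q0 := sqsum_ge0 f m x.
rewrite ge0_muleDr ?lee_fin//; apply: leeD.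
  apply: (@le_trans _ _ (A%:E * \sum_(w <- words m) gag_inner theta (dpart w f) x)%E).
    rewrite lee_wpmul2l ?lee_fin//; apply: lee_sum => w _.
    apply: ge0_subset_integral => //.
    - apply/measurable_EFinP; apply: measurable_gag_kernel_pair => //; exact: dpart_measurable.
    - by move=> y _; rewrite lee_fin gag_kernel_ge0.
  rewrite lee_wpmul2r// lee_fin /A powRM ?(ltW s0)//.
  have h2 : (2 : R) `^ p <= 4 * 4 ^+ n.
    have -> : 4 * 4 ^+ n = 4 `^ (n.+1%:R) :> R by rewrite powR_mulrn// exprS.
    have -> : (4 : R) = 2 `^ 2 by rewrite (powR_mulrn 2)//; lra.
    rewrite -powRrM ler_powR//; first by lra.
    by rewrite -natr1 /p; have : (0 : R) <= n%:R by []; lra.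
  by move: (2 `^ p) (s `^ p) (4 ^+ n) sp0 h2 => a b c b0 ac; nra.
apply: (@le_trans _ _ (B%:E * ((4 * s) ^+ n)%:E)%E).
  by rewrite lee_wpmul2l ?lee_fin//; exact: partners_le (ltW s0).
rewrite -!EFinM lee_fin /B [(4 * s) ^+ n]exprMn.
have -> : 4 * (2 * s) ^+ 2 * sqsum f m x * (4 ^+ n * s ^+ n) =
  16 * 4 ^+ n * (s ^+ n * s ^+ 2) * sqsum f m x by ring.
by rewrite ler_wpM2r// ler_wpM2l// mulr_ge0// exprn_ge0.
Qed.

End sobolev_energy.

Section sobolev_control.
Context {R : realType} {n : nat}.
Variables (i0 i1 : 'I_n).
Hypotheses (i0E : i0 = 0%N :> nat) (i1E : i1 = 1%N :> nat).
Local Notation leb := (lebesgue_rV R n).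
Local Notation energy := (@energy R n i0 i1).
Local Notation aderiv := (@aderiv R n i0 i1).
Local Notation words := (@words n i0 i1).
Local Notation sqsum := (@sqsum R n i0 i1).
Implicit Types (x y : 'rV[R]_n) (f G : 'rV[R]_n -> R).

Let i01 : i0 != i1. Proof. by rewrite -val_eqE /= i0E i1E. Qed.
Let n0 : (0 < n)%N. Proof. by rewrite -i0E (leq_ltn_trans _ (ltn_ord i0)). Qed.

(** Each point of the open ball is eventually outside the shells, and [F] itself dominates. *)
Lemma shell_vanish (F : 'rV[R]_n -> \bar R) (e : nat -> R) : measurable_fun (eball n) F ->
  (forall x, (0 <= F x)%E) -> (\int[leb]_(x in eball n) F x < +oo)%E ->
  e @ \oo --> (0 : R) ->
  ((fun J => \int[leb]_(x in shell (e J)) F x)%E @ \oo --> 0%E).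
Proof.
move=> mF F0 Foo e0; have mB := @measurable_eball R n.
have mS a := @measurable_shell R n a.
have SB a : shell a `<=` (eball n : set 'rV[R]_n) by move=> x /andP[].
pose h J x : \bar R := (F \_ (shell (e J))) x.
have mh J : measurable_fun (eball n) (h J).
  apply/(measurable_restrict _ (mS (e J)) mB).
  by apply: measurable_funS mF => // x [].
have h0 : {ae leb, forall x, eball n x -> h ^~ x @ \oo --> 0%E}.
  apply: aeW => x x1; apply: cvg_near_cst.
  have d0 : 0 < 1 - enorm x by rewrite subr_gt0.
  move/cvgrPdist_lt : e0 => /(_ _ d0); apply: filterS => J; rewrite sub0r normrN => eJ.
  rewrite /h /patch; case: ifPn => // /set_mem/andP[h1 _].
  by exfalso; have := ler_norm (e J); lra.
have iF : leb.-integrable (eball n) F.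
  apply/integrableP; split => //.
  by under eq_integral do rewrite gee0_abs//.
have dom : {ae leb, forall x, forall J, eball n x -> (`|h J x| <= F x)%E}.
  apply: aeW => x J x1; rewrite /h /patch; case: ifP => _; first by rewrite gee0_abs.
  by rewrite abse0.
have [_ _] := dominated_convergence mB mh (measurable_cst 0%E) h0 iF dom.
rewrite integral0; apply: cvg_trans; apply: near_eq_cvg; near=> J.
transitivity (\int[leb]_(x in eball n `&` shell (e J)) F x)%E; first by rewrite integral_mkcondr.
congr (integral _ _ _).
by apply/seteqP; split => x; [case|move=> xS; split => //; exact: SB xS].
Unshelve. all: by end_near. Qed.

(** The weak derivative along a word is identified with the classical one along the reversed word,
    hence the use of [rev w]. *)
Lemma sobolev_dpart f t (w : seq 'I_n) : harm_lim f -> sobolev_space t (eball n) f ->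
  (size w <= Num.truncn t)%N ->
  (\int[leb]_(x in eball n) (dpart w f x ^+ 2)%:E < +oo)%E /\
  (size w = Num.truncn t -> 0 < t - (Num.truncn t)%:R ->
   (gagliardo (eball n) (t - (Num.truncn t)%:R) (dpart w f) < +oo)%E).
Proof.
move=> hf [_ /= hs] sw; have [|g [[mg g2] wd gg]] := hs (rev w); first by rewrite size_rev.
have mB := @measurable_eball R n; have md := dpart_measurable n0 w hf.
have E : {ae leb, forall x, eball n x -> g x = dpart w f x}.
  have := weak_derivative_ae n0 hf (conj mg g2) wd; by rewrite revK.
split.
  rewrite -(_ : \int[leb]_(x in eball n) (g x ^+ 2)%:E = \int[leb]_(x in eball n) (dpart w f x ^+ 2)%:E)%E//.
  apply: ae_eq_integral => //.
  - by apply/measurable_EFinP; exact: measurable_funX.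
  - by apply/measurable_EFinP; exact: measurable_funX.
  by apply: filterS E => x hx x1; rewrite hx.
move=> sE th0; rewrite -(gagliardo_ae _ mg md E); apply: gg => //.
by rewrite size_rev.
Qed.

Lemma integral_sqsum_lty f t m : harm_lim f -> sobolev_space t (eball n) f ->
  (m <= Num.truncn t)%N -> (\int[leb]_(x in eball n) (sqsum f m x)%:E < +oo)%E.
Proof.
move=> hf hs mt; have mB := @measurable_eball R n.
rewrite /sqsum; under eq_integral do rewrite -sumEFin.
rewrite ge0_integral_sum//; last 2 first.
- move=> w; apply/measurable_EFinP; apply: measurable_funX; exact: dpart_measurable.
- by move=> w x _; rewrite lee_fin sqr_ge0.
rewrite big_seq; apply: lte_sum_pinfty => w ww.
have sw : (size w <= Num.truncn t)%N.
  apply: leq_trans mt; move: ww.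
  suff /allP/(_ w) : all (fun w => size w <= m)%N (words m) by exact.
  by case: m => [|[|m]].
by have [] := sobolev_dpart hf hs sw.
Qed.

(** For [t >= 2], or [t] an integer, whole derivatives are used, with [l = 0] and [theta = 0];
    otherwise [l = 1], and [m] and [theta] are the integer and fractional parts of [t]. The function
    [F] gathers the densities of the norms involved. *)
Lemma sobolev_energy f (t : R) : harm_lim f -> 0 <= t -> sobolev_space t (eball n) f ->
  exists (m : nat) (l theta C : R) (F : 'rV[R]_n -> \bar R),
  [/\ (m <= 2)%N, l = 0 \/ l = 1, m%:R + theta = Num.min t 2 & 0 <= C] /\
  [/\ measurable_fun (eball n) F, forall x, (0 <= F x)%E,
      (\int[leb]_(x in eball n) F x < +oo)%E &
      forall q s e : R, 0 < s <= 1 -> (energy q s e l (iter m aderiv f) <=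
        (C * s `^ (n%:R + 2 * theta))%:E * \int[leb]_(x in shell e) F x)%E].
Proof.
move=> hf t0 hs; have mB := @measurable_eball R n.
have mS a := @measurable_shell R n a.
have SB a : shell a `<=` (eball n : set 'rV[R]_n) by move=> x /andP[].
have /andP[tt1 tt2] := truncn_itv t0.
have whole m : (m <= 2)%N -> (m <= Num.truncn t)%N -> m%:R = Num.min t 2 :> R ->
    exists (m : nat) (l theta C : R) (F : 'rV[R]_n -> \bar R),
    [/\ (m <= 2)%N, l = 0 \/ l = 1, m%:R + theta = Num.min t 2 & 0 <= C] /\
    [/\ measurable_fun (eball n) F, forall x, (0 <= F x)%E,
      (\int[leb]_(x in eball n) F x < +oo)%E &
      forall q s e : R, 0 < s <= 1 -> (energy q s e l (iter m aderiv f) <=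
        (C * s `^ (n%:R + 2 * theta))%:E * \int[leb]_(x in shell e) F x)%E].
  move=> m2 mt mE; pose F x := (sqsum f m x)%:E.
  have F0 x : (0 <= F x)%E by rewrite lee_fin; exact: sqsum_ge0.
  have mF : measurable_fun (eball n) F by apply/measurable_EFinP; exact: measurable_sqsum.
  exists m, 0, 0, (6 * 4 ^+ n), F; split; first by split; [|left|rewrite addr0|].
  split => //; first exact: integral_sqsum_lty hs mt.
  move=> q s e /andP[s0 s1]; rewrite mulr0 addr0 powR_mulrn ?(ltW s0)//.
  have c0 : 0 <= 6 * 4 ^+ n * s ^+ n by rewrite !mulr_ge0// exprn_ge0// ltW.
  rewrite -ge0_integralZl//; last by apply: measurable_funS (SB e) mF.
  apply: energy_le_shell => //.
  - exact: measurable_iter_aderiv.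
  - exact: measurable_funeM.
  - by move=> x; rewrite mule_ge0// lee_fin.
  move=> x /SB x1; apply: le_trans.
    by apply: pair_integral_le0; [exact: measurable_iter_aderiv|exact: ltW].
  rewrite -EFinM lee_fin [(4 * s) ^+ n]exprMn.
  have h := iter_aderiv_sqr i0E i1E hf x1 m2.
  have -> : 6 * 4 ^+ n * s ^+ n * sqsum f m x = (4 ^+ n * s ^+ n) * (6 * sqsum f m x) by ring.
  by rewrite ler_wpM2l// mulr_ge0// exprn_ge0// ltW.
have /orP[t2|t2] : (2 <= t) || (t < 2) by rewrite leNgt orNb.
  apply: (whole 2%N) => //; last by rewrite min_r.
  by rewrite truncn_ge_nat.
have tm : Num.min t 2 = t by rewrite min_l// ltW.
have m1 : (Num.truncn t <= 1)%N.
  by rewrite -ltnS -(ltr_nat R); exact: le_lt_trans tt1 t2.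
set m := Num.truncn t in tt1 tt2 m1 *.
have [tE|tE] := eqVneq t m%:R.
  by apply: (whole m) => //; [exact: leq_trans m1 _|rewrite tm].
have th0 : 0 < t - m%:R by rewrite subr_gt0 lt_neqAle eq_sym tE.
have th1 : 0 < t - m%:R < 1 by rewrite th0 ltrBlDr addrC natr1.
pose F x := (\sum_(w <- words m) gag_inner (t - m%:R) (dpart w f) x + (sqsum f m x)%:E)%E.
have S0 x : (0 <= \sum_(w <- words m) gag_inner (t - m%:R) (dpart w f) x)%E.
  by apply: sume_ge0 => w _; exact: gag_inner_ge0.
have F0 x : (0 <= F x)%E by rewrite adde_ge0// lee_fin; exact: sqsum_ge0.
have mgi w := measurable_gag_inner (t - m%:R) (dpart_measurable n0 w hf).
have mS1 : measurable_fun (eball n) (fun x => \sum_(w <- words m) gag_inner (t - m%:R) (dpart w f) x)%E.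
  exact: emeasurable_sum.
have mS2 : measurable_fun (eball n) (fun x => (sqsum f m x)%:E).
  by apply/measurable_EFinP; exact: measurable_sqsum.
have mF : measurable_fun (eball n) F by exact: emeasurable_funD.
exists m, 1, (t - m%:R), (16 * 4 ^+ n), F; split.
  by split; [exact: leq_trans m1 _|right|rewrite tm addrC subrK|].
split => //.
  rewrite /F ge0_integralD//; last by move=> x _; rewrite lee_fin; exact: sqsum_ge0.
  apply: lte_add_pinfty; last exact: integral_sqsum_lty hs _.
  rewrite ge0_integral_sum//; last by move=> w x _; exact: gag_inner_ge0.
  rewrite big_seq; apply: lte_sum_pinfty => w ww.
  have sw : size w = m.
    suff /allP/(_ w ww)/eqP : all (fun w => size w == m) (words m) by [].
    by move: m1; case: (m) => [|[|]].
  have [|_] := sobolev_dpart (w := w) hf hs; first by rewrite sw.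
  by apply.
move=> q s e /andP[s0 s1].
have c0 : 0 <= 16 * 4 ^+ n * s `^ (n%:R + 2 * (t - m%:R)) by rewrite mulr_ge0 ?powR_ge0.
rewrite -ge0_integralZl//; last by apply: measurable_funS (SB e) mF.
apply: energy_le_shell => //.
- by apply: measurable_iter_aderiv => //; exact: leq_trans m1 _.
- exact: measurable_funeM.
- by move=> x; rewrite mule_ge0// lee_fin.
by move=> x /SB x1; apply: pair_integral_le1 => //; rewrite s0 s1.
Qed.

End sobolev_control.

(** With [z = P - p - l w], of size at most 1/4, use [(p + z)^2 >= p^2 / 2 - z^2]. *)
Lemma sqr_perturb (R : realFieldType) (l p P w : R) : l = 0 \/ l = 1 ->
  - 8^-1 <= P - p -> P - p <= 8^-1 -> - 8^-1 <= w -> w <= 8^-1 ->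
  p ^+ 2 / 2 - 16^-1 <= (P - l * w) ^+ 2.
Proof.
move=> hl h1 h2 h3 h4; pose z : R := P - p - l * w.
have [z1 z2] : - 4^-1 <= z /\ z <= 4^-1 by rewrite /z; case: hl => ->; split; lra.
have -> : P - l * w = p + z by rewrite /z; ring.
clearbody z; have := sqr_ge0 (p + 2 * z); have : z ^+ 2 <= 16^-1 by nra.
by rewrite !expr2; lra.
Qed.

(** * Lower bounds for the energy of a wave *)

Section wave_energy.
Context {R : realType} {n : nat}.
Variables (i0 i1 : 'I_n).
Hypotheses (n3 : (3 <= n)%N) (i0E : i0 = 0%N :> nat) (i1E : i1 = 1%N :> nat).
Local Notation leb := (lebesgue_rV R n).
Local Notation ssq := (@ssq R n i0 i1).
Local Notation rot := (@rot R n i0 i1).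
Local Notation zang := (@zang R n i0 i1).
Local Notation aderiv := (@aderiv R n i0 i1).
Local Notation energy := (@energy R n i0 i1).
Variables (g : R -> R) (Lam : R) (W : nat -> 'rV[R]_n -> R).
Local Notation wave := (@wave R n i0 i1 W).
Implicit Types (x y xi : 'rV[R]_n).

Hypotheses (Lam0 : 0 <= Lam)
  (g_le1 : forall xi, enorm xi = 1 -> g (ssq xi) ^+ 2 * ssq xi <= 1)
  (g_lip : forall xi eta : 'rV[R]_n, enorm xi = 1 -> enorm eta = 1 ->
    `|g (ssq xi) * xi ord0 i0 - g (ssq eta) * eta ord0 i0| +
    `|g (ssq xi) * xi ord0 i1 - g (ssq eta) * eta ord0 i1| <= Lam * enorm (xi - eta))
  (W_inv : forall j, rotation_invariant i0 i1 (W j))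
  (W_lim : forall j c d, harm_lim (wave c d j))
  (W_sphere : forall j c d xi, enorm xi = 1 ->
    wave c d j xi = peval (zang c d (2 ^ j)) xi * g (ssq xi) ^+ (2 ^ j)).
Variable q : R.
Hypotheses (hq : 0 < q < 1)
  (g_patch : forall xi, enorm xi = 1 -> q <= ssq xi -> g (ssq xi) ^+ 2 * ssq xi = 1).

Let i01 : i0 != i1. Proof. by rewrite -val_eqE /= i0E i1E. Qed.
Let n0 : (0 < n)%N. Proof. exact: leq_trans n3. Qed.

Let pow2_gt0 j : 0 < (2 ^ j)%:R :> R. Proof. by rewrite ltr0n expn_gt0. Qed.

Lemma pairs_volume : exists c e0 : R, [/\ 0 < c, 0 < e0 &
  forall s e : R, 0 < s <= 1 -> 0 < e <= e0 ->
  ((c * e * s ^+ n)%:E <= (leb \x leb)%E (close_pairs i0 i1 q s e))%E].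
Proof.
move: i0 i1 i0E; case: n n0 => [//|m] _ j0 j1 j0E.
have [c [e0 [c0 e00 h]]] := close_pairs_volume j1 j0E hq.
exists c, e0; split => // s e hs he; exact: h.
Qed.

Lemma sin_pos_neq0 (t : R) : 0 < t < pi -> sin t != 0.
Proof. by move=> h; rewrite gt_eqF// sin_gt0_pi. Qed.

(** This rotation carries the phase [(1, 0)] of the wave of index [j] to [(0, 1)]; an angular
    derivative of that wave is this rotation with a factor [2^j]. *)
Let quarter (j : nat) : R := pi / 2 / (2 ^ j)%:R.

Let quarterE j : (2 ^ j)%:R * quarter j = pi / 2.
Proof. by rewrite /quarter mulrC divfK// gt_eqF. Qed.

Let quarter_itv j : 0 < quarter j < pi.
Proof.
have p0 := pi_gt0 R; rewrite /quarter divr_gt0 ?divr_gt0//=.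
rewrite ltr_pdivrMr//; have : 1 <= (2 ^ j)%:R :> R by rewrite ler1n expn_gt0.
by move: (2 ^ j)%:R => k k1; nra.
Qed.

Lemma wave_rot10 j t x : wave 1 0 j (rot t x) =
  cos ((2 ^ j)%:R * t) * wave 1 0 j x + sin ((2 ^ j)%:R * t) * wave 0 1 j x.
Proof. by rewrite (wave_rot i01 W_inv) wave_lin !mul0r !mul1r subr0 addr0. Qed.

Lemma wave_quarter j x : wave 1 0 j (rot (quarter j) x) = wave 0 1 j x.
Proof. by rewrite wave_rot10 quarterE cos_pihalf sin_pihalf mul0r mul1r add0r. Qed.

Lemma aderiv_wave j (c s : R) x : aderiv (fun y => c * wave 1 0 j (rot s y)) x =
  c * (2 ^ j)%:R * wave 1 0 j (rot (s + quarter j) x).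
Proof.
set k : R := (2 ^ j)%:R; have kt : k * quarter j = pi / 2 := quarterE j.
rewrite wave_rot10 -/k (mulrDr k s) kt.
rewrite cosD sinD cos_pihalf sin_pihalf !mulr0 !mulr1 sub0r add0r.
rewrite /aderiv.
have -> : (fun t => c * wave 1 0 j (rot s (rot t x))) =
    (fun t => c * (cos (k * (s + t)) * wave 1 0 j x + sin (k * (s + t)) * wave 0 1 j x)).
  by apply/funext => t; rewrite (rotD i01) wave_rot10.
move: (wave 1 0 j x) (wave 0 1 j x) => A B.
have hl (t : R) : is_derive t (1 : R) (fun u => k * (s + u)) k.
  apply: is_derive_eq; by rewrite add0r scaler1.
have hc : is_derive (0 : R) (1 : R) (fun t => cos (k * (s + t))) (- sin (k * s) * k).
  have := is_derive1_comp (f := cos) (g := fun t => k * (s + t)) (is_derive_cos (k * (s + 0))) (hl 0); rewrite addr0; exact.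
have hs : is_derive (0 : R) (1 : R) (fun t => sin (k * (s + t))) (cos (k * s) * k).
  have := is_derive1_comp (f := sin) (g := fun t => k * (s + t)) (is_derive_sin (k * (s + 0))) (hl 0); rewrite addr0; exact.
transitivity (c * ((- sin (k * s) * k) * A + (cos (k * s) * k) * B)); last by ring.
have h : is_derive (0 : R) (1 : R)
   (fun t => c * (cos (k * (s + t)) * A + sin (k * (s + t)) * B))
   (c * ((- sin (k * s) * k) * A + (cos (k * s) * k) * B)).
  apply: is_derive_eq.
  by rewrite /GRing.scale /=; ring.
exact: derive_val.
Qed.

Lemma iter_aderiv_wave j m x : iter m aderiv (wave 1 0 j) x =
  (2 ^ j)%:R ^+ m * wave 1 0 j (rot (m%:R * quarter j) x).
Proof.
elim: m x => [|m IH] x; first by rewrite mul0r rot0 expr0 mul1r.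
rewrite iterS; have -> : iter m aderiv (wave 1 0 j) =
    (fun y => (2 ^ j)%:R ^+ m * wave 1 0 j (rot (m%:R * quarter j) y)) by exact/funext.
by rewrite aderiv_wave -exprSr -natr1 mulrDl mul1r.
Qed.

Lemma energy_iter_wave l s e j m : (0 < j)%N -> (m <= 2)%N ->
  energy q s e l (iter m aderiv (wave 1 0 j)) =
  (((2 ^ j)%:R ^+ (2 * m))%:E * energy q s e l (wave 1 0 j))%E.
Proof.
move=> j0 m2; have mw := harm_lim_measurable (W_lim j 1 0).
have -> : iter m aderiv (wave 1 0 j) =
    (fun y => (2 ^ j)%:R ^+ m * wave 1 0 j (rot (m%:R * quarter j) y)).
  by apply/funext => x; exact: iter_aderiv_wave.
have mr : measurable_fun (eball n) (fun y => wave 1 0 j (rot (m%:R * quarter j) y)).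
  apply: (eq_measurable_fun (wave (cos ((2 ^ j)%:R * (m%:R * quarter j))) (sin ((2 ^ j)%:R * (m%:R * quarter j))) j)).
    by move=> x _; rewrite wave_rot10 wave_lin.
  exact: harm_lim_measurable.
rewrite energyZ// -exprM mulnC; congr (_ * _)%E.
(* [energy_rot] needs an angle of nonzero sine: [m = 0] is treated apart, and for [m] equal to 1 or
   2 the angle is at most [pi / 2^j < pi], as [j > 0]. *)
case: m m2 mr => [|m] m2 mr.
  by congr energy; apply/funext => x; rewrite mul0r rot0.
apply: energy_rot => //; apply: sin_pos_neq0.
have /andP[t0 t1] := quarter_itv j.
rewrite mulr_gt0//=; apply: (@le_lt_trans _ _ (2 * quarter j)).
  by rewrite ler_wpM2r ?(ltW t0)// ler_nat.
have -> : 2 * quarter j = pi / (2 ^ j)%:R by rewrite /quarter; field; rewrite gt_eqF.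
rewrite ltr_pdivrMr// ltr_pMr ?pi_gt0// ltr1n -{1}(expn0 2) ltn_exp2l//.
Qed.

Lemma wave_patch j xi : enorm xi = 1 -> q <= ssq xi ->
  wave 1 0 j xi ^+ 2 + wave 0 1 j xi ^+ 2 = 1.
Proof.
move=> x1 xq; rewrite !W_sphere// !zangE !exprMn.
have -> : 1 * zre i0 i1 (2 ^ j) xi - 0 * zim i0 i1 (2 ^ j) xi = zre i0 i1 (2 ^ j) xi by ring.
have -> : 0 * zre i0 i1 (2 ^ j) xi - 1 * zim i0 i1 (2 ^ j) xi = - zim i0 i1 (2 ^ j) xi by ring.
rewrite sqrrN -mulrDl zre_zim -exprM mulnC exprM -exprMn mulrC g_patch//.
by rewrite expr1n.
Qed.

(** The thickness [c1 / k] keeps the wave at [x] within 1/8 of its value at the radial projection of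
    [x], and the depth [c2 / k] keeps the wave at [y] below 1/8. Then [sqr_perturb] for both phases
    leaves [1/2 - 1/8], more than the 1/4 required. *)
Lemma wave_energy_lower : exists (c c1 c2 : R) (J0 : nat),
  [/\ 0 < c, 0 < c1, 0 < c2 & forall (J : nat) (l : R), (J0 <= J)%N -> l = 0 \/ l = 1 ->
    c2 / (2 ^ J)%:R <= 1 /\
    ((c / (2 ^ J)%:R * (c2 / (2 ^ J)%:R) ^+ n)%:E <=
      energy q (c2 / (2 ^ J)%:R) (c1 / (2 ^ J)%:R) l (wave 1 0 J))%E].
Proof.
have [cv [e0 [cv0 e00 hv]]] := pairs_volume.
(* At thickness [c1 / k], [wave_near] bounds the radial variation by [(2 n + 1) sqrt (2 Lam c1)];
   [N] and [c1] make it at most 1/8, and [Lam + 1] avoids a zero denominator. *)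
pose N : R := 8 * (2 * n%:R + 1).
have N0 : 0 < N by rewrite mulr_gt0// ltr_wpDl.
pose c1 : R := (2 * (Lam + 1) * N ^+ 2)^-1.
have L0 : 0 < 2 * (Lam + 1) * N ^+ 2 by rewrite mulr_gt0 ?exprn_gt0// mulr_gt0// ltr_wpDl.
have c10 : 0 < c1 by rewrite invr_gt0.
have g1 := @grad_cst_ge1 R n; have p0 := pi_gt0 R.
(* As [1 - |y|^2 >= c2 / (2 k)], [wave_deep] bounds the wave at [y] by [4 n grad_cst pi / c2], which
   is 1/8. *)
pose c2 : R := 32 * n%:R * @grad_cst R n * pi.
have c20 : 0 < c2 by rewrite !mulr_gt0 ?ltr0n// (lt_le_trans ltr01 g1).
(* By [2^J > J], from some index on the depth parameter is at most 1 and the thickness at most [e0]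
   and 1/2. *)
have [J0 hJ0] : exists J0 : nat, forall J, (J0 <= J)%N ->
    [/\ c2 <= (2 ^ J)%:R :> R, c1 <= e0 * (2 ^ J)%:R & c1 <= 2^-1 * (2 ^ J)%:R].
  exists (Num.truncn (c2 + c1 / e0 + 2 * c1)).+1 => J hJ.
  have h : c2 + c1 / e0 + 2 * c1 <= (2 ^ J)%:R.
    apply: le_trans (ltW (truncnS_gt _)) _; rewrite ler_nat.
    by apply: leq_trans hJ _; apply: ltnW; exact: ltn_expl.
  have h1 : 0 < c1 / e0 by rewrite divr_gt0.
  split; [lra| |lra].
  by rewrite mulrC -ler_pdivrMr//; lra.
exists (8^-1 * (cv * c1)), c1, c2, J0; split => //; first by rewrite !mulr_gt0// invr_gt0.
move=> J l /hJ0[hs he he'] hl; have := pow2_gt0 J.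
set k : R := (2 ^ J)%:R in hs he he' * => k0.
have s1 : 0 < c2 / k <= 1 by rewrite divr_gt0//= ler_pdivrMr// mul1r.
have e1 : 0 < c1 / k <= e0 by rewrite divr_gt0//= ler_pdivrMr.
split; first by case/andP: s1.
have mw c d := harm_lim_measurable (W_lim J c d).
have EAB : energy q (c2 / k) (c1 / k) l (wave 1 0 J) = energy q (c2 / k) (c1 / k) l (wave 0 1 J).
  rewrite -(energy_rot i0E i1E _ _ _ _ (sin_pos_neq0 (quarter_itv J)) (mw 1 0)).
  by apply: energy_ext => x _; exact: wave_quarter.
apply: le_trans (energy_pair_lower (mw 1 0) (mw 0 1) EAB _).
  have -> : 8^-1 * (cv * c1) / k * (c2 / k) ^+ n = 8^-1 * (cv * (c1 / k) * (c2 / k) ^+ n) by ring.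
  by rewrite EFinM lee_wpmul2l ?hv// lee_fin invr_ge0.
move=> [x y] [/= /andP[xe x1] xq _ ys y1].
have kc1 : 0 < c1 / k <= 2^-1.
  by case/andP: e1 => -> _ /=; rewrite ler_pdivrMr.
have x0 : 0 < enorm x by lra.
pose xi := (enorm x)^-1 *: x.
have xi1 : enorm xi = 1 by rewrite enormZ ger0_norm ?invr_ge0 ?(ltW x0)// mulVf// gt_eqF.
have xiq : q <= ssq xi.
  apply: le_trans xq _; rewrite ssqZ ler_peMl ?ssq_ge0//.
  by rewrite exprVn invf_ge1 ?exprn_gt0// expr_le1// ltW.
have dx : enorm (x - xi) <= c1 / k.
  have -> : x - xi = (1 - (enorm x)^-1) *: x by rewrite scalerBl scale1r.
  rewrite enormZ distrC ger0_norm; last by rewrite subr_ge0 invf_ge1// ltW.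
  by rewrite mulrBl mulVf ?gt_eqF// mul1r; lra.
have near c d : `|c| + `|d| = 1 -> `|wave c d J x - wave c d J xi| <= 8^-1.
  move=> cd; apply: le_trans (wave_near i01 n3 Lam0 g_le1 g_lip W_lim W_sphere c d J xi1 (ltW x1)) _.
  rewrite cd mul1r -/k.
  have -> : 8^-1 = (2 * n%:R + 1) * N^-1 :> R.
    by rewrite /N; field; rewrite gt_eqF// ltr_wpDl.
  rewrite ler_wpM2l ?addr_ge0 ?mulr_ge0//.
  have -> : N^-1 = Num.sqrt (N^-1 ^+ 2) by rewrite sqrtr_sqr ger0_norm// invr_ge0 ltW.
  apply: ler_wsqrtr; apply: (@le_trans _ _ (2 * Lam * k * (c1 / k))).
    by rewrite ler_wpM2l// !mulr_ge0// ltW.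
  have -> : 2 * Lam * k * (c1 / k) = 2 * Lam * c1 by field; rewrite gt_eqF.
  have M0 : 0 < N ^+ 2 by rewrite exprn_gt0.
  have cM : c1 * (2 * (Lam + 1) * N ^+ 2) = 1 by rewrite mulVf// gt_eqF.
  rewrite exprVn -[leRHS]mul1r ler_pdivlMr//.
  by have := mulr_gt0 c10 M0; move: (N ^+ 2) (c1) cM => M e; lra.
have deep c d : `|c| + `|d| = 1 -> `|wave c d J y| <= 8^-1.
  move=> cd; apply: le_trans (wave_deep i01 n3 g_le1 W_inv W_lim W_sphere c d J y1) _.
  rewrite cd mulr1 -/k; have y2 : 0 < 1 - enorm y ^+ 2.
    by apply: lt_le_trans ys; rewrite !divr_gt0.
  rewrite ler_pdivrMr ?mulr_gt0//.
  have : c2 / 2 <= k * (1 - enorm y ^+ 2).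
    rewrite -ler_pdivrMl// mulrC; apply: le_trans ys.
    by rewrite le_eqVlt; apply/orP; left; apply/eqP; ring.
  rewrite /c2; pose G : R := n%:R * @grad_cst R n * pi.
  have -> : 32 * n%:R * @grad_cst R n * pi = 32 * G by rewrite /G; ring.
  have -> : 2 * n%:R * @grad_cst R n * pi = 2 * G by rewrite /G; ring.
  lra.
have cd1 : `|1 : R| + `|0 : R| = 1 by rewrite normr1 normr0 addr0.
have cd2 : `|0 : R| + `|1 : R| = 1 by rewrite normr1 normr0 add0r.
have := near _ _ cd1; have := near _ _ cd2; have := deep _ _ cd1; have := deep _ _ cd2.
have := wave_patch J xi1 xiq.
move: (wave 1 0 J xi) (wave 0 1 J xi) (wave 1 0 J x) (wave 0 1 J x) (wave 1 0 J y) (wave 0 1 J y).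
move=> a b A B u v ab; rewrite !ler_norml => /andP[v1 v2] /andP[u1 u2] /andP[B1 B2] /andP[A1 A2].
have := sqr_perturb hl A1 A2 u1 u2; have := sqr_perturb hl B1 B2 v1 v2; lra.
Qed.

End wave_energy.

Section wave_sum_sobolev.
Context {R : realType} {n : nat}.
Variables (i0 i1 : 'I_n).
Hypotheses (n3 : (3 <= n)%N) (i0E : i0 = 0%N :> nat) (i1E : i1 = 1%N :> nat).
Local Notation leb := (lebesgue_rV R n).
Local Notation ssq := (@ssq R n i0 i1).
Local Notation rot := (@rot R n i0 i1).
Local Notation zang := (@zang R n i0 i1).
Local Notation aderiv := (@aderiv R n i0 i1).
Local Notation energy := (@energy R n i0 i1).
Variables (g : R -> R) (Lam : R) (W : nat -> 'rV[R]_n -> R) (alpha : R).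
Local Notation wave := (@wave R n i0 i1 W).
Implicit Types (x y xi : 'rV[R]_n).

Hypotheses (Lam0 : 0 <= Lam)
  (g_le1 : forall xi, enorm xi = 1 -> g (ssq xi) ^+ 2 * ssq xi <= 1)
  (g_lip : forall xi eta : 'rV[R]_n, enorm xi = 1 -> enorm eta = 1 ->
    `|g (ssq xi) * xi ord0 i0 - g (ssq eta) * eta ord0 i0| +
    `|g (ssq xi) * xi ord0 i1 - g (ssq eta) * eta ord0 i1| <= Lam * enorm (xi - eta))
  (W_inv : forall j, rotation_invariant i0 i1 (W j))
  (W_lim : forall j c d, harm_lim (wave c d j))
  (W_sphere : forall j c d xi, enorm xi = 1 ->
    wave c d j xi = peval (zang c d (2 ^ j)) xi * g (ssq xi) ^+ (2 ^ j))
  (halpha : 0 <= alpha < 1).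
Local Notation phased := (@phased R n i0 i1 W alpha).
Local Notation wave_sum := (@wave_sum R n i0 i1 W alpha).

Let i01 : i0 != i1. Proof. by rewrite -val_eqE /= i0E i1E. Qed.
Let n0 : (0 < n)%N. Proof. exact: leq_trans n3. Qed.

Let from_lim i : harm_lim (phased (from i)).
Proof. by apply: (phased_harm_lim n3 g_le1 W_lim W_sphere halpha) => j; exact: from_le. Qed.

(** Combinations of a sum with its rotation pass through angular derivatives, which are linear and
    commute with rotations; [pi / 2^i] has nonzero sine because [i > 0]. *)
Lemma energy_step q s e l m i (a b : R) (G : 'rV[R]_n -> R) : (0 < i)%N -> (m <= 2)%N ->
  harm_lim G -> a ^+ 2 = 4^-1 -> b ^+ 2 = 4^-1 ->
  (forall x, enorm x <= 1 ->
    G x = a * phased (from i) x + b * phased (from i) (rot (pi / (2 ^ i)%:R) x)) ->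
  (energy q s e l (iter m aderiv G) <= energy q s e l (iter m aderiv (phased (from i))))%E.
Proof.
move=> hi m2 hG a2 b2 E; set t := pi / (2 ^ i)%:R in E.
have hr : harm_lim (fun x => phased (from i) (rot t x)).
  apply: harm_lim_ext (phased_harm_lim n3 g_le1 W_lim W_sphere halpha (rotated_from_le i t)).
  by move=> x _; rewrite (phased_rot i01 W_inv).
have st : sin t != 0.
  apply: sin_pos_neq0; rewrite divr_gt0 ?pi_gt0 ?ltr0n ?expn_gt0//=.
  rewrite ltr_pdivrMr ?ltr0n ?expn_gt0// ltr_pMr ?pi_gt0// ltr1n.
  by rewrite -{1}(expn0 2) ltn_exp2l.
have mr : measurable_fun (eball n) (fun x => iter m aderiv (phased (from i)) (rot t x)).
  apply: (eq_measurable_fun (iter m aderiv (fun x => phased (from i) (rot t x)))).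
    by move=> x _; rewrite (iter_aderiv_rot i01).
  exact: measurable_iter_aderiv.
apply: (energy_average i0E i1E _ _ _ _ st _ _ mr a2 b2).
- exact: (measurable_iter_aderiv i0E i1E (from_lim i) m2).
- exact: measurable_iter_aderiv.
move=> x x1; rewrite -(iter_aderiv_rot i01).
by apply: (iter_aderiv_lin i01 (from_lim i) hr m2 x1) => y y1; exact: E (ltW y1).
Qed.

Lemma energy_from q s e l m J : (m <= 2)%N ->
  (energy q s e l (iter m aderiv (phased (from J.+1))) <=
   energy q s e l (iter m aderiv wave_sum))%E.
Proof.
move=> m2; elim: J => [|J IH]; first by rewrite phased_from1.
have h4 : 2^-1 ^+ 2 = 4^-1 :> R by lra.
apply: le_trans IH; apply: (energy_step q s e l (ltn0Sn J) m2 (from_lim _) h4 h4).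
by move=> x x1; rewrite (phased_average i01 n3 g_le1 W_inv W_lim W_sphere halpha).
Qed.

Lemma energy_wave_le q s e l m J : (0 < J)%N -> (m <= 2)%N ->
  ((lcoef alpha J ^+ 2 * (2 ^ J)%:R ^+ (2 * m))%:E * energy q s e l (wave 1 0 J) <=
   energy q s e l (iter m aderiv wave_sum))%E.
Proof.
move=> J0 m2; set G := fun x => lcoef alpha J * wave 1 0 J x.
have hG : harm_lim G.
  apply: harm_lim_ext (harm_lim_lin (lcoef alpha J) harm_lim0 (W_lim J 1 0)) => x _.
  by rewrite add0r.
have GE x : enorm x < 1 -> iter m aderiv G x = lcoef alpha J * iter m aderiv (wave 1 0 J) x.
  move=> x1; rewrite (iter_aderiv_lin i01 (W_lim J 1 0) (W_lim J 1 0) (a := lcoef alpha J) (b := 0) m2 x1).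
    by rewrite mul0r addr0.
  by move=> y _; rewrite mul0r addr0.
case: J J0 @G hG GE => // J _ G hG GE.
apply: le_trans (energy_from q s e l J m2).
have h4 : 2^-1 ^+ 2 = 4^-1 :> R by lra.
have h4' : (- 2^-1) ^+ 2 = 4^-1 :> R by lra.
apply: le_trans (energy_step q s e l (ltn0Sn J) m2 hG h4 h4' _).
  rewrite (energy_ext _ _ _ _ _ _ GE) energyZ; last exact: measurable_iter_aderiv.
  by rewrite (energy_iter_wave i0E i1E W_inv W_lim)// EFinM muleA.
move=> x x1; exact: (phased_difference i01 n3 g_le1 W_inv W_lim W_sphere halpha).
Qed.

Variable q : R.
Hypotheses (hq : 0 < q < 1)
  (g_patch : forall xi, enorm xi = 1 -> q <= ssq xi -> g (ssq xi) ^+ 2 * ssq xi = 1).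

Lemma wave_sum_not_sobolev (sigma : R) : 0 < sigma -> alpha <= sigma ->
  ~ sobolev_space (sigma + 2^-1) (eball n) wave_sum.
Proof.
move=> s0 sa hs.
have hw : harm_lim wave_sum := wave_sum_harm_lim n3 g_le1 W_lim W_sphere halpha.
have t0 : 0 <= sigma + 2^-1 by lra.
have [m [l [th [C [F [[m2 hl mth C0] [mF F0 Foo hE]]]]]]] := sobolev_energy i0E i1E hw t0 hs.
have [c [c1 [c2 [J0 [c_gt0 c1_gt0 c2_gt0 hlow]]]]] :=
  wave_energy_lower n3 i0E i1E Lam0 g_le1 g_lip W_inv W_lim W_sphere hq g_patch.
(* Since [m + th] is the minimum of [sigma + 1/2] and 2, this is the minimum of [sigma] and 3/2,
   still positive and at least [alpha] because [alpha < 1]. *)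
pose sg : R := m%:R + th - 2^-1.
have [sg0 sga] : 0 < sg /\ alpha <= sg.
  rewrite /sg mth; case/andP: halpha => _ a1.
  by case: (leP (sigma + 2^-1) 2) => h; split; lra.
have [c3 c30 hc3] := lcoef_lower sg0 sga.
pose D : R := C * c2 `^ (2 * th).
have D0 : 0 <= D by rewrite mulr_ge0 ?powR_ge0.
(* Chosen so that [D del < c3^2 c / 2], which contradicts the final inequality [c3^2 c <= D del]. *)
pose del : R := c3 ^+ 2 * c / (2 * (D + 1)).
have num0 : 0 < c3 ^+ 2 * c by rewrite mulr_gt0 ?exprn_gt0.
have del0 : 0 < del by rewrite divr_gt0// mulr_gt0// ltr_wpDl.
have e0 : (fun J => c1 / (2 ^ J)%:R : R) @ \oo --> (0 : R).
  rewrite -(mulr0 c1); apply: cvgMr.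
  have : (fun J => (2^-1 : R) ^+ J) @ \oo --> (0 : R).
    by apply: cvg_expr; rewrite ger0_norm//; lra.
  suff -> : (fun J => (2 ^ J)%:R^-1 : R) = (fun J => (2^-1 : R) ^+ J) by [].
  by apply/funext => J; rewrite natrX exprVn.
have tv := shell_vanish mF F0 Foo e0.
have : \forall J \near \oo, ((\int[leb]_(x in shell (c1 / (2 ^ J)%:R)) F x) < del%:E)%E.
  have : nbhs (0%E : \bar R) [set x | (x < del%:E)%E].
    by apply: open_nbhs_nbhs; split; [exact: open_ereal_lt_ereal|rewrite /= lte_fin].
  exact: tv.
move=> [J1 _ hJ1].
pose J := (J0 + J1).+1.
have /hJ1 tJ : (J1 <= J)%N by rewrite /J -addnS (leq_trans (leq_addl J0 J1))// addnS.
have JJ0 : (J0 <= J)%N by rewrite /J (leq_trans (leq_addr J1 J0)).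
have [hs1 low] := hlow J l JJ0 hl.
have k0 : 0 < (2 ^ J)%:R :> R by rewrite ltr0n expn_gt0.
have s01 : 0 < c2 / (2 ^ J)%:R <= 1 by rewrite divr_gt0.
have up := hE q _ (c1 / (2 ^ J)%:R) s01.
have lc0 : 0 <= lcoef alpha J ^+ 2 by exact: sqr_ge0.
have := le_trans (energy_wave_le q (c2 / (2 ^ J)%:R) (c1 / (2 ^ J)%:R) l (ltn0Sn _ : 0 < J)%N m2) up.
have c3J := hc3 J (ltn0Sn _).
have kE : (2 : R) `^ (sg * J%:R) = (2 ^ J)%:R `^ sg.
  by rewrite mulrC powRrM powR_mulrn// natrX.
move: c3J kE low tJ s01 k0 lc0; set k : R := (2 ^ J)%:R; move: (lcoef alpha J) => a c3J kE low tJ s01 k0 a0 up2.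
have {}up2 : a ^+ 2 * k ^+ (2 * m) * (c / k * (c2 / k) ^+ n) <=
    C * (c2 / k) `^ (n%:R + 2 * th) * del.
  rewrite -lee_fin EFinM; apply: (@le_trans _ _ ((a ^+ 2 * k ^+ (2 * m))%:E *
      energy q (c2 / k) (c1 / k) l (wave 1 0 J))%E).
    by rewrite lee_wpmul2l// lee_fin mulr_ge0// exprn_ge0// ltW.
  apply: le_trans up2 _; rewrite [leRHS]EFinM lee_wpmul2l ?(ltW tJ)//.
  by rewrite lee_fin mulr_ge0 ?powR_ge0.
have spl (x u v : R) : 0 < x -> x `^ (u + v) = x `^ u * x `^ v.
  by move=> x0; apply: powRD; rewrite (gt_eqF x0) implybT.
have s_gt0 : 0 < c2 / k by case/andP: s01.
(* With [s = c2 / k] the factor [s^n] cancels: it is the order of the volume of the partners on one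
   side, and part of [s^(n + 2 th)] on the other. *)
have {}up2 : a ^+ 2 * k ^+ (2 * m) * (c / k) <= C * (c2 / k) `^ (2 * th) * del.
  rewrite -(ler_pM2r (exprn_gt0 n s_gt0)).
  apply: le_trans (_ : _ <= C * (c2 / k) `^ (n%:R + 2 * th) * del) _.
    by apply: le_trans up2; rewrite le_eqVlt; apply/orP; left; apply/eqP; ring.
  rewrite spl// powR_mulrn ?(ltW s_gt0)//.
  by rewrite le_eqVlt; apply/orP; left; apply/eqP; ring.
(* Multiplying by [k^(2 th)] collects all powers of [k] into [k^(2 sg)], because
   [2 m - 1 + 2 th = 2 sg]. *)
have {}up2 : (a * k `^ sg) ^+ 2 * c <= D * del.
  have kt0 : 0 < k `^ (2 * th) by rewrite powR_gt0.
  have -> : D * del = C * (c2 / k) `^ (2 * th) * del * k `^ (2 * th).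
    rewrite powRM ?(ltW c2_gt0) ?invr_ge0 ?(ltW k0)// /D.
    have -> : k^-1 `^ (2 * th) = (k `^ (2 * th))^-1.
      by rewrite -(powR_inv1 (ltW k0)) -powRrM mulN1r powRN.
    by field; rewrite gt_eqF.
  apply: le_trans (_ : _ <= a ^+ 2 * k ^+ (2 * m) * (c / k) * k `^ (2 * th)) _; last first.
    by rewrite ler_pM2r.
  have -> : (a * k `^ sg) ^+ 2 = a ^+ 2 * (k ^+ (2 * m) * k^-1 * k `^ (2 * th)).
    rewrite exprMn; congr (_ * _).
    rewrite -(powR_mulrn _ (powR_ge0 _ _)) -powRrM -(powR_inv1 (ltW k0)) -(powR_mulrn _ (ltW k0)).
    rewrite -!spl//; congr (_ `^ _).
    by rewrite /sg natrM; lra.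
  by rewrite le_eqVlt; apply/orP; left; apply/eqP; ring.
have : c3 ^+ 2 * c <= D * del.
  apply: le_trans up2; rewrite ler_wpM2r ?(ltW c_gt0)// -kE.
  by rewrite ler_pXn2r// nnegrE ?(ltW c30)// (le_trans (ltW c30)).
have : del * (2 * (D + 1)) = c3 ^+ 2 * c by rewrite divfK// gt_eqF// mulr_gt0// ltr_wpDl.
move: (c3 ^+ 2 * c) num0 => N N0; clearbody del D.
by move=> h1 h2; nra.
Qed.

End wave_sum_sobolev.

Section profile.
Context {R : realType} {n : nat}.
Variables (i0 i1 : 'I_n).
Local Notation ssq := (@ssq R n i0 i1).

(** Products of bounded Lipschitz functions on the sphere, where [ssq] is Lipschitz with constant
    4. *)
Lemma profile_lipschitz (f : R -> R) (L : R) : 0 <= L ->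
  (forall p p' : R, 0 <= p <= 1 -> 0 <= p' <= 1 -> `|f p - f p'| <= L * `|p - p'|) ->
  (forall xi : 'rV[R]_n, enorm xi = 1 -> 0 <= ssq xi <= 1) ->
  exists2 Lam : R, 0 <= Lam & forall xi eta : 'rV[R]_n, enorm xi = 1 -> enorm eta = 1 ->
    `|f (ssq xi) * xi ord0 i0 - f (ssq eta) * eta ord0 i0| +
    `|f (ssq xi) * xi ord0 i1 - f (ssq eta) * eta ord0 i1| <= Lam * enorm (xi - eta).
Proof.
move=> L0 fL s01; pose M : R := `|f 0| + L.
have M0 : 0 <= M by rewrite addr_ge0.
exists (2 * (L * 4 + M)); first by rewrite mulr_ge0// addr_ge0// mulr_ge0.
move=> xi eta x1 y1; set d := enorm (xi - eta).
have c1 (z : 'rV[R]_n) i : enorm z = 1 -> `|z ord0 i| <= 1.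
  by move=> <-; exact: coord_le_enorm.
have dc i : `|xi ord0 i - eta ord0 i| <= d.
  by have := coord_le_enorm (xi - eta) i; rewrite !mxE.
have sq i : `|xi ord0 i ^+ 2 - eta ord0 i ^+ 2| <= 2 * d.
  rewrite subr_sqr normrM mulrC; apply: ler_pM => //; apply: le_trans (ler_normD _ _) _.
  by have := c1 xi i x1; have := c1 eta i y1; lra.
have ds : `|ssq xi - ssq eta| <= 4 * d.
  rewrite /ssq; have -> : xi ord0 i0 ^+ 2 + xi ord0 i1 ^+ 2 - (eta ord0 i0 ^+ 2 + eta ord0 i1 ^+ 2) =
    (xi ord0 i0 ^+ 2 - eta ord0 i0 ^+ 2) + (xi ord0 i1 ^+ 2 - eta ord0 i1 ^+ 2) by ring.
  apply: le_trans (ler_normD _ _) _.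
  by have := sq i0; have := sq i1; lra.
have fM : `|f (ssq eta)| <= M.
  have s := s01 _ y1; have z01 : 0 <= (0 : R) <= 1 by rewrite lexx ler01.
  have := ler_normD (f (ssq eta) - f 0) (f 0); rewrite subrK => /le_trans; apply.
  rewrite addrC /M lerD2l; apply: le_trans (fL _ _ s z01) _.
  by rewrite subr0 ger0_norm ?ler_piMr//; case/andP: s.
have fd : `|f (ssq xi) - f (ssq eta)| <= L * (4 * d).
  by apply: le_trans (fL _ _ (s01 _ x1) (s01 _ y1)) _; rewrite ler_wpM2l.
have d0 : 0 <= d by exact: enorm_ge0.
have term i : `|f (ssq xi) * xi ord0 i - f (ssq eta) * eta ord0 i| <= (L * 4 + M) * d.
  have -> : f (ssq xi) * xi ord0 i - f (ssq eta) * eta ord0 i =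
    (f (ssq xi) - f (ssq eta)) * xi ord0 i + f (ssq eta) * (xi ord0 i - eta ord0 i) by ring.
  apply: le_trans (ler_normD _ _) _; rewrite !normrM mulrDl; apply: lerD.
    rewrite -mulrA -[leRHS]mulr1; apply: ler_pM => //; exact: c1.
  exact: ler_pM.
by have := term i0; have := term i1; lra.
Qed.

End profile.

Theorem theorem16 (R : realType) (n : nat) (hn : (3 <= n)%N)
    (r : R) (hr : 0 < r)
    (mu : R -> R)
    (mu_smooth : smooth_halfline mu)
    (mu_decr : forall s t : R, 0 <= s -> s <= t -> mu t <= mu s)
    (mu_one : forall t : R, 0 <= t <= r -> mu t = 1)
    (mu_pos : forall t : R, 0 < t < 2 * r -> 0 < mu t)
    (mu_neg : forall t : R, 2 * r < t -> mu t < 0)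
    (mu_deriv : derive1 mu (2 * r) < 0)
    (alpha : R) (halpha : 0 <= alpha < 1) :
  exists w : 'rV[R]_n -> R,
    [/\ dirichlet_solution mu alpha w,
        (forall w' : 'rV[R]_n -> R, dirichlet_solution mu alpha w' ->
           forall x, closure (eball n) x -> w' x = w x),
        (forall eps : R, 0 < eps ->
           ~ holder_space (alpha + eps) (closure (eball n)) w),
        (alpha = 0 -> forall sigma : R, 0 < sigma ->
           ~ sobolev_space (sigma + 2^-1) (eball n) w) &
        (0 < alpha -> forall sigma : R, alpha <= sigma ->
           ~ sobolev_space (sigma + 2^-1) (eball n) w)].
Proof.
have n0 : (0 < n)%N by exact: leq_trans hn.
have n1 : (1 < n)%N by exact: leq_trans hn.
pose i0 : 'I_n := Ordinal n0; pose i1 : 'I_n := Ordinal n1.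
have i0E : i0 = 0%N :> nat by [].
have i1E : i1 = 1%N :> nat by [].
have i01 : i0 != i1 by [].
have a0 : 0 <= alpha by case/andP: halpha.
pose g := rho hr mu_smooth mu_decr mu_one mu_neg.
have [L L0 gL] := rho_lipschitz hr mu_smooth mu_decr mu_one mu_pos mu_neg mu_deriv.
have s01 (xi : 'rV[R]_n) (h : enorm xi = 1) := ssq01 i0E i1E h.
have [Lam Lam0 g_lip] := profile_lipschitz L0 gL s01.
have g_le1 (xi : 'rV[R]_n) : enorm xi = 1 -> g (ssq i0 i1 xi) ^+ 2 * ssq i0 i1 xi <= 1.
  exact: rho_ssq_le1.
have hW j : exists W : 'rV[R]_n -> R, rotation_invariant i0 i1 W /\ forall c d,
    harm_lim (fun x => peval (zang i0 i1 c d (2 ^ j)) x * W x) /\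
    forall x, enorm x = 1 -> peval (zang i0 i1 c d (2 ^ j)) x * W x =
      peval (zang i0 i1 c d (2 ^ j)) x * g (ssq i0 i1 x) ^+ (2 ^ j).
  have [L' gL'] := rho_pow_lipschitz hr mu_smooth mu_decr mu_one mu_pos mu_neg mu_deriv (2 ^ j).
  apply: (angular_extension i01 hn (L := L') (f := fun s => g s ^+ (2 ^ j))) => //.
  by rewrite expn_gt0.
have [W WP] := choice hW.
have W_inv j : rotation_invariant i0 i1 (W j) by have [] := WP j.
have W_lim j c d : harm_lim (wave i0 i1 W c d j) by have [_ /(_ c d)[]] := WP j.
have W_sphere j c d (xi : 'rV[R]_n) : enorm xi = 1 -> wave i0 i1 W c d j xi =
    peval (zang i0 i1 c d (2 ^ j)) xi * g (ssq i0 i1 xi) ^+ (2 ^ j).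
  by have [_ /(_ c d)[_ h]] := WP j; exact: h.
(* The threshold of [rho_ssq_eq1]: in directions with [q <= |z|^2] the boundary of the domain is
   cylindrical. *)
pose q : R := (1 + r)^-1.
have hq : 0 < q < 1 by rewrite /q invr_gt0 invf_lt1 ?addr_gt0// ltrDl hr.
have g_patch (xi : 'rV[R]_n) : enorm xi = 1 -> q <= ssq i0 i1 xi ->
    g (ssq i0 i1 xi) ^+ 2 * ssq i0 i1 xi = 1.
  move=> x1 xq; apply: rho_ssq_eq1 => //.
  by rewrite mulrC -ler_pdivrMr ?addr_gt0// mul1r.
have g1 : g 1 ^+ 2 = 1.
  have e1 : ssq i0 i1 (delta_mx ord0 i0 : 'rV[R]_n) = 1.
    by rewrite /ssq !mxE /= mulr1n expr1n expr0n addr0.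
  have := g_patch _ (enorm_delta i0); rewrite e1 mulr1; apply.
  by rewrite ltW//; case/andP: hq.
have hw : harm_lim (wave_sum i0 i1 W alpha) := wave_sum_harm_lim hn g_le1 W_lim W_sphere halpha.
have bd (xi : 'rV[R]_n) : enorm xi = 1 ->
    wave_sum i0 i1 W alpha xi = lacunary_sum alpha (zeta_inv mu xi).
  move=> x1; rewrite (zeta_invE hn hr mu_smooth mu_decr mu_one mu_pos mu_neg i0E i1E x1).
  exact: (wave_sum_boundary g_le1 W_sphere halpha (coord_nat0 hn i0E xi) (coord_nat1 hn i1E xi) x1).
have nS := wave_sum_not_sobolev hn i0E i1E Lam0 g_le1 g_lip W_inv W_lim W_sphere halpha hq g_patch.
exists (wave_sum i0 i1 W alpha); split.
- split.
  + by rewrite closure_eball; exact (wave_sum_holder i01 hn Lam0 g_le1 g_lip W_lim W_sphere halpha).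
  + exact: harm_lim_harmonic.
  + by move=> xi; rewrite boundary_eball; exact: bd.
- move=> w' [hw' harm' bd'] x; rewrite closure_eball => x1.
  apply: (harmonic_unique n0) x1.
  + by rewrite closure_eball in hw'; exact: holder_within hw'.
  + exact: harm_lim_within.
  + exact: harm'.
  + exact: harm_lim_harmonic.
  + by move=> xi xi1; rewrite bd// bd'// boundary_eball.
- move=> eps e0; rewrite closure_eball.
  exact (wave_sum_not_holder i01 hn g_le1 W_lim W_sphere halpha g1 e0).
- by move=> aE sigma s0; apply: nS => //; rewrite aE ltW.
- by move=> a_gt0 sigma sa; apply: nS => //; exact: lt_le_trans sa.
Qed.
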